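(* Let $\gamma>0$, let $$X=\Big\{u:\mathbb{R}^2\to\mathbb{C}:\ \int_{\mathbb{R}^2}\big(|\nabla u|^2+|u|^2+\ln(1+|x|)\,|u|^2\big)\,dx<\infty\Big\},$$ and for $u\in X$ let $$E(u)=\int_{\mathbb{R}^2}|\nabla u|^2\,dx+\frac{\gamma}{4\pi}\int_{\mathbb{R}^2}\int_{\mathbb{R}^2}\ln(|x-y|)\,|u(x)|^2|u(y)|^2\,dx\,dy,\qquad N(u)=\int_{\mathbb{R}^2}|u|^2\,dx,$$ and $e_0(\lambda)=\inf\{E(u):u\in X,\ N(u)=\lambda\}$. Then for every $\lambda>0$ there exists a spherically symmetric decreasing function $u_\lambda\in X$ such that $N(u_\lambda)=\lambda$ and $E(u_\lambda)=e_0(\lambda)$.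
   Context: $\gamma>0$ is a fixed coupling constant. *)

(* Defs.v *)
From HB Require Import structures.
From mathcomp Require Import all_boot all_order all_algebra.
From mathcomp Require Import all_classical all_reals all_analysis.
From mathcomp Require Import complex.
Set Implicit Arguments. Unset Strict Implicit. Unset Printing Implicit Defensive.
Import Order.TTheory GRing.Theory Num.Theory.
Import numFieldNormedType.Exports.
Local Open Scope classical_set_scope.
Local Open Scope ring_scope.

Definition leb2 (R : realType) : set (R * R) -> \bar R :=
  (@lebesgue_measure R \x @lebesgue_measure R)%E.

(* Euclidean norm |x| of x in R^2 (NB: the library norm on R*R is the max norm). *)
Arguments leb2 R : clear implicits.

Definition enorm (R : realType) (x : R * R) : R := Num.sqrt (x.1 ^+ 2 + x.2 ^+ 2).

Definition cabs2 (R : realType) (z : R[i]) : R := (complex.Re z) ^+ 2 + (complex.Im z) ^+ 2.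

Definition e1 (R : realType) : R * R := (1, 0).
Definition e2 (R : realType) : R * R := (0, 1).

Arguments e1 R : clear implicits.
Arguments e2 R : clear implicits.

Fixpoint Ck (R : realType) (k : nat) (f : R * R -> R) : Prop :=
  continuous f /\
  match k with
  | 0 => True
  | k'.+1 => (forall x, derivable f x (e1 R) /\ derivable f x (e2 R)) /\
             Ck k' (fun x => 'D_(e1 R) f x) /\ Ck k' (fun x => 'D_(e2 R) f x)
  end.

Definition test_fun (R : realType) (phi : R * R -> R) : Prop :=
  (forall k, Ck k phi) /\ compact (closure [set x | phi x != 0]).

Definition loc_int (R : realType) (f : R * R -> R) : Prop :=
  measurable_fun setT f /\
  forall K : set (R * R), compact K -> integrable (leb2 R) K (EFin \o f).

Definition weak_partial (R : realType) (v : R * R) (f g : R * R -> R) : Prop :=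
  loc_int f /\ loc_int g /\
  forall phi, test_fun phi ->
    (\int[leb2 R]_x (f x * 'D_v phi x)%:E = - \int[leb2 R]_x (g x * phi x)%:E)%E.

Definition weak_grad (R : realType) (u g1 g2 : R * R -> R[i]) : Prop :=
  weak_partial (e1 R) (fun x => complex.Re (u x)) (fun x => complex.Re (g1 x)) /\
  weak_partial (e1 R) (fun x => complex.Im (u x)) (fun x => complex.Im (g1 x)) /\
  weak_partial (e2 R) (fun x => complex.Re (u x)) (fun x => complex.Re (g2 x)) /\
  weak_partial (e2 R) (fun x => complex.Im (u x)) (fun x => complex.Im (g2 x)).

Definition X_grad (R : realType) (u g1 g2 : R * R -> R[i]) : Prop :=
  weak_grad u g1 g2 /\
  (\int[leb2 R]_x ((cabs2 (g1 x) + cabs2 (g2 x) + cabs2 (u x)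
                     + ln (1 + enorm x) * cabs2 (u x))%:E) < +oo)%E.

Definition in_X (R : realType) (u : R * R -> R[i]) : Prop :=
  exists g1 g2, X_grad u g1 g2.

Definition Nmass (R : realType) (u : R * R -> R[i]) : \bar R :=
  (\int[leb2 R]_x (cabs2 (u x))%:E)%E.

(* E(u) computed with the weak gradient (g1, g2) of u (which is unique a.e.,
   so the value does not depend on the choice) *)
Definition energy (R : realType) (gamma : R) (u g1 g2 : R * R -> R[i]) : \bar R :=
  (\int[leb2 R]_x ((cabs2 (g1 x) + cabs2 (g2 x))%:E)
   + (gamma / (4 * pi))%:E *
     \int[leb2 R]_x \int[leb2 R]_y
        (ln (enorm (x - y)) * cabs2 (u x) * cabs2 (u y))%:E)%E.

Definition e0 (R : realType) (gamma lambda : R) : \bar R :=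
  ereal_inf [set E | exists u g1 g2, [/\ X_grad u g1 g2,
                        Nmass u = lambda%:E & E = energy gamma u g1 g2]].

Definition sym_decreasing (R : realType) (u : R * R -> R[i]) : Prop :=
  exists f : R -> R,
    (forall r s, 0 <= r -> r <= s -> f s <= f r) /\
    (forall x, u x = Complex (f (enorm x)) 0).

(* Main.v *)
(** The kernel splits as [ln r = k1 r - k2 r] with [k1 r = ln (1 + r)] increasing
    and [k2 r = ln (1 + 1/r)] decreasing, both nonnegative, and the Dirichlet
    integral is read off the L2 moduli [dq f h = ||f (. + h) - f||^2]: [f] has a weak
    gradient of square norm at most [M] iff the integral of [dq f] over each small
    disc is at most [M] times that of [h1^2].  So [|u|] has no larger Dirichlet integral than [u].

    Existence: the [k2] part is controlled by mass and a small multiple of the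
    Dirichlet integral, so minimizing sequences are bounded; the [k1] part gives,
    after a translation, a bound on the logarithmic moment, hence compactness in L2.

    Symmetry: exchanging the values of [f] at two mirror points so that the larger
    one lies on a fixed side of the mirror does not increase the energy, and strict
    monotonicity of [k1] forces [f - f o sigma] to have a constant sign on each side
    for every minimizer.  Placing the origin at the medians of [f^2] makes [f] even,
    which decides the sign for all mirrors at once; hence the means of [f] over discs
    of fixed radius are radially nonincreasing.  A De Giorgi iteration bounds [f], so
    that the radial profile is finite at the origin. *)
From HB Require Import structures.
From mathcomp Require Import all_boot all_order all_algebra.
From mathcomp Require Import all_classical all_reals all_analysis.
From mathcomp Require Import measurable_realfun ring lra.
From mathcomp Require Import complex.
Require Import Defs.
Set Implicit Arguments. Unset Strict Implicit. Unset Printing Implicit Defensive.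
Import Order.TTheory GRing.Theory Num.Theory.
Import numFieldNormedType.Exports.
Local Open Scope classical_set_scope.
Local Open Scope ring_scope.

(** * Lebesgue measure on the plane *)

(** Modulus, truncation, polarization and L2 limits act simply on differences f(x + h) - f(x),
    whereas on weak gradients each would need its own chain rule; this is why the Dirichlet integral
    is read off moduli. Discs are used for two reasons. A quadratic form in h averages over a disc
    to a multiple of its trace, so passing from gradients to moduli and back loses no constant; and
    polarization compares only kernels that depend on the distance. Every function travels with a
    bound D for its Dirichlet integral, so that the uniqueness of weak gradients is faced once, at
    the end. Polarization is preferred to a symmetric rearrangement because it permutes two values
    at a time: every comparison reduces to four values and the sign of a difference of kernels, and
    its equality case is visible on pairs of points. The price is one almost everywhere statement
    for each of uncountably many mirrors; disc means convert them into inequalities that hold at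
    every point, as they must, since the theorem prescribes the symmetric function everywhere and
    not up to a null set. *)

Definition leb1 (R : realType) : set R -> \bar R := @lebesgue_measure R.
Arguments leb1 R : clear implicits.

Section LebesgueInstances.
Context (R : realType).

Let leb1_0 : leb1 R set0 = 0%E.
Proof. exact: (measure0 (@lebesgue_measure R)). Qed.

Let leb1_ge0 A : (0 <= leb1 R A)%E.
Proof. exact: (measure_ge0 (@lebesgue_measure R)). Qed.

Let leb1_additive : semi_sigma_additive (leb1 R).
Proof. exact: (@measure_semi_sigma_additive _ _ _ (@lebesgue_measure R)). Qed.

HB.instance Definition _ :=
  isMeasure.Build _ _ _ (leb1 R) leb1_0 leb1_ge0 leb1_additive.

Let leb1_sigma_finite : sigma_finite setT (leb1 R).
Proof.
have [F FT Foo] := sigma_finiteT (@lebesgue_measure R).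
exists F; first exact: FT. 
exact: Foo.
Qed.
HB.instance Definition _ :=
  @Measure_isSigmaFinite.Build _ _ _ (leb1 R) leb1_sigma_finite.
 
Let mu2 := (@lebesgue_measure R \x @lebesgue_measure R)%E.

Let leb2_0 : leb2 R set0 = 0%E.
Proof. exact: (measure0 mu2). Qed.

Let leb2_ge0 A : (0 <= leb2 R A)%E.
Proof. exact: (measure_ge0 mu2). Qed.

Let leb2_additive : semi_sigma_additive (leb2 R).
Proof. exact: (@measure_semi_sigma_additive _ _ _ mu2). Qed.

HB.instance Definition _ :=
  isMeasure.Build _ _ _ (leb2 R) leb2_0 leb2_ge0 leb2_additive.

Lemma leb2X (A B : set R) : measurable A -> measurable B ->
  leb2 R (A `*` B) = (leb1 R A * leb1 R B)%E.
Proof.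
move=> mA mB.
exact: (@product_measure1E _ _ _ _ _ (@lebesgue_measure R) (@lebesgue_measure R)).
Qed.

Let leb2_sigma_finite : sigma_finite setT (leb2 R).
Proof.
have /sigma_finiteP[F [TF ndF Foo]] := sigma_finiteT (leb1 R).
exists (fun n => F n `*` F n).
  rewrite -setXTT TF predeqE => -[x y]; split.
    move=> [/= [n _ Fnx] [k _ Gky]]; exists (maxn n k) => //; split.
    - by move: x Fnx; exact/subsetPset/ndF/leq_maxl.
    - by move: y Gky; exact/subsetPset/ndF/leq_maxr.
  by move=> [n _ []/= ? ?]; split; exists n.
move=> k; have [? ?] := Foo k.
split; first exact: measurableX.
by rewrite leb2X// lte_mul_pinfty// ge0_fin_numE.
Qed.

HB.instance Definition _ :=
  @Measure_isSigmaFinite.Build _ _ _ (leb2 R) leb2_sigma_finite.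


(** Two measures that agree on rectangles are equal. Through this identity Fubini-Tonelli, which
    speaks of the product of [leb1 R] with itself, becomes available for [leb2]. *)
Lemma leb2E (A : set (R * R)) : measurable A -> leb2 R A = (leb1 R \x leb1 R)%E A.
Proof.
move=> mA; apply/esym; apply: (@product_measure_unique _ _ _ _ _ (leb1 R) (leb1 R) (leb2 R)) => //.
exact: leb2X.
Qed.

Local Open Scope ereal_scope.

Lemma integral_leb2 (f : R * R -> \bar R) : measurable_fun setT f ->
  (forall x, 0 <= f x) ->
  \int[leb2 R]_x f x = \int[leb1 R]_x \int[leb1 R]_y f (x, y).
Proof.
move=> mf f0; rewrite -(fubini_tonelli1 f)//.
by apply: eq_measure_integral => A mA _; exact: leb2E.
Qed.

Lemma integral_leb2' (f : R * R -> \bar R) : measurable_fun setT f ->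
  (forall x, 0 <= f x) ->
  \int[leb2 R]_x f x = \int[leb1 R]_y \int[leb1 R]_x f (x, y).
Proof. by move=> mf f0; rewrite integral_leb2// (fubini_tonelli f). Qed.

End LebesgueInstances.


(** * Measure-preserving maps of the plane *)

Section Invariance.
Context (R : realType).
Local Open Scope ereal_scope.

(** Stated on integrals rather than on measures of sets, so that closure under composition is a
    substitution and a shear reduces by Tonelli to a shift of the line. *)
Definition preserves (s : R * R -> R * R) :=
  measurable_fun setT s /\
  forall f : R * R -> \bar R, measurable_fun setT f -> (forall x, 0 <= f x) ->
    \int[leb2 R]_x f (s x) = \int[leb2 R]_x f x.

(** The pushforward has the right value on half-open intervals, which characterizes Lebesgue
    measure. *)
Lemma integral_leb1_shift (a : R) (f : R -> \bar R) : measurable_fun setT f ->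
  (forall x, 0 <= f x) -> \int[leb1 R]_x f (x + a)%R = \int[leb1 R]_x f x.
Proof.
move=> mf f0.
have ms : measurable_fun setT (fun x : R => x + a)%R.
  by apply: measurable_funD => //; exact: measurable_cst.
pose nu := pushforward (@lebesgue_measure R)
  ((fun x => x + a)%R : measurableTypeR R -> measurableTypeR R).
have nuE A : measurable A -> leb1 R A = nu A.
  move=> mA; apply: (@lebesgue_measure_unique R nu) => // _ [[b c]] _ <-.
  rewrite /nu/= /pushforward /=.
  have -> : (fun x : R => x + a)%R @^-1` `]b, c] = `](b - a)%R, (c - a)%R]%classic.
    by apply/seteqP; split => x /=; rewrite !in_itv /= ltrBlDr lerBrDr.
  rewrite !lebesgue_measure_itv/= !lte_fin ltrD2r.
  by case: ifP => // _; rewrite -!EFinB; congr EFin; ring.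
transitivity (\int[pushforward (leb1 R) (fun x => x + a)%R]_x f x).
  by rewrite ge0_integral_pushforward.
by apply: eq_measure_integral => A mA _; exact/esym/nuE.
Qed.

Lemma integral_leb1_opp (f : R -> \bar R) : measurable_fun setT f ->
  (forall x, 0 <= f x) -> \int[leb1 R]_x f (- x)%R = \int[leb1 R]_x f x.
Proof.
move=> mf f0.
have ms : measurable_fun setT (fun x : R => - x)%R by exact: oppr_measurable.
transitivity (\int[pushforward (leb1 R) (fun x => - x)%R]_x f x).
  by rewrite ge0_integral_pushforward.
by apply: eq_measure_integral => A mA _; exact: lebesgue_measureN.
Qed.

Lemma preserves_comp s1 s2 : preserves s1 -> preserves s2 ->
  preserves (s1 \o s2).
Proof.
move=> [ms1 h1] [ms2 h2]; split; first exact: measurableT_comp.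
move=> f mf f0; rewrite -(h1 f)// -(h2 (f \o s1))//; first exact: measurableT_comp.
by move=> x; exact: f0.
Qed.

Lemma eq_preserves s1 s2 : s1 =1 s2 -> preserves s1 -> preserves s2.
Proof. by move=> /funext ->. Qed.

Lemma preserves_swap : preserves (fun x => (x.2, x.1)).
Proof.
have ms : measurable_fun setT (fun x : R * R => (x.2, x.1)).
  by apply: measurable_fun_pair; [exact: measurable_snd|exact: measurable_fst].
split => // f mf f0.
by rewrite integral_leb2//= ?integral_leb2'//; exact: measurableT_comp.
Qed.

Lemma preserves_shear (k : R) : preserves (fun x => (x.1 + k * x.2, x.2)%R).
Proof.
have ms : measurable_fun setT (fun x : R * R => (x.1 + k * x.2, x.2)%R).
  apply: measurable_fun_pair; last exact: measurable_snd.
  apply: measurable_funD; first exact: measurable_fst.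
  by apply: measurable_funM; [exact: measurable_cst|exact: measurable_snd].
split => // f mf f0.
rewrite !integral_leb2'//=; last exact: measurableT_comp.
apply: eq_integral => y _; rewrite (integral_leb1_shift (k * y) (f := fun x => f (x, y)))//.
exact: measurableT_comp.
Qed.

Lemma preserves_shift1 (a : R) : preserves (fun x => (x.1 + a, x.2)%R).
Proof.
have ms : measurable_fun setT (fun x : R * R => (x.1 + a, x.2)%R).
  apply: measurable_fun_pair; last exact: measurable_snd.
  by apply: measurable_funD; [exact: measurable_fst|exact: measurable_cst].
split => // f mf f0.
rewrite !integral_leb2'//=; last exact: measurableT_comp.
apply: eq_integral => y _; rewrite (integral_leb1_shift a (f := fun x => f (x, y)))//.
exact: measurableT_comp.
Qed.

Lemma preserves_opp1 : preserves (fun x => (- x.1, x.2)%R).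
Proof.
have ms : measurable_fun setT (fun x : R * R => (- x.1, x.2)%R).
  apply: measurable_fun_pair; last exact: measurable_snd.
  by apply: measurableT_comp => //; exact: measurable_fst.
split => // f mf f0.
rewrite !integral_leb2'//=; last exact: measurableT_comp.
apply: eq_integral => y _; rewrite (integral_leb1_opp (f := fun x => f (x, y)))//.
exact: measurableT_comp.
Qed.

Lemma preserves_shift (h : R * R) : preserves (fun x => x + h)%R.
Proof.
have := preserves_comp (preserves_shift1 h.1) (preserves_comp preserves_swap
  (preserves_comp (preserves_shift1 h.2) preserves_swap)).
by apply: eq_preserves => x.
Qed.

Lemma preserves_opp2 : preserves (fun x => (x.1, - x.2)%R).
Proof.
have := preserves_comp preserves_swap (preserves_comp preserves_opp1 preserves_swap).
by apply: eq_preserves => x.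
Qed.

Lemma preserves_opp : preserves (fun x => - x)%R.
Proof. by apply: eq_preserves (preserves_comp preserves_opp1 preserves_opp2) => x. Qed.

Lemma preserves_shear2 (k : R) : preserves (fun x => (x.1, x.2 + k * x.1)%R).
Proof.
have := preserves_comp preserves_swap (preserves_comp (preserves_shear k) preserves_swap).
by apply: eq_preserves => x.
Qed.

(* Composed with a flip, the reflection is a rotation, a product of three shears. *)
Lemma preserves_orthogonal_reflection (c s : R) : (c ^+ 2 + s ^+ 2 = 1)%R ->
  preserves (fun x => (c * x.1 + s * x.2, s * x.1 - c * x.2)%R).
Proof.
move=> cs1; have [s0|s0] := eqVneq s 0%R.
  have : (c = 1 \/ c = -1)%R.
    have : (c ^+ 2 == 1)%R by apply/eqP; rewrite -cs1 s0; ring.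
    by rewrite sqrf_eq1 => /orP[] /eqP; [left|right].
  case=> ->; rewrite s0.
    by apply: eq_preserves preserves_opp2 => x /=; congr pair; ring.
  by apply: eq_preserves preserves_opp1 => x /=; congr pair; ring.
have := preserves_comp (preserves_shear ((c - 1) / s)%R)
  (preserves_comp (preserves_shear2 s)
  (preserves_comp (preserves_shear ((c - 1) / s)%R) preserves_opp2)).
have c2 : (c ^+ 2 = 1 - s ^+ 2)%R by lra.
apply: eq_preserves => x /=; congr pair; last by field.
transitivity (c * x.1 - (c ^+ 2 - 1) / s * x.2)%R; first by field.
by rewrite c2; field.
Qed.

End Invariance.

(** * Square-integrable functions *)

Ltac mfun := repeat first
  [ assumption
  | match goal with |- measurable_fun _ (fun x => EFin _) => apply/measurable_EFinP end
  | match goal with |- measurable_fun _ (fun x => ?c) => exact: measurable_cst end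
  | match goal with |- measurable_fun _ (fun x => (?f x + ?g x)%R) => apply: measurable_funD end
  | match goal with |- measurable_fun _ (fun x => _ + _)%R => apply: measurable_funD end
  | match goal with |- measurable_fun _ (fun x => - _)%R => apply: measurable_funN end
  | match goal with |- measurable_fun _ (fun x => _ * _)%R => apply: measurable_funM end
  | match goal with |- measurable_fun _ (fun x => _ ^+ _)%R => apply: measurable_funX end
  | match goal with |- measurable_fun _ (fun x => `| _ |)%R => apply: measurableT_comp end
  | match goal with |- measurable_fun _ (fun x => (_, _)) => apply: measurable_fun_pair end
  | exact: measurable_fst | exact: measurable_snd | exact: measurable_id
  ].

Section NonnegIntegrals.
Context d (T : measurableType d) (R : realType) (mu : {measure set T -> \bar R}).
Implicit Types f g : T -> R.
Local Open Scope ereal_scope.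

Lemma le_integral_EFin f g : measurable_fun setT f -> measurable_fun setT g ->
  (forall x, 0 <= f x)%R -> (forall x, f x <= g x)%R ->
  \int[mu]_x (f x)%:E <= \int[mu]_x (g x)%:E.
Proof.
move=> mf mg f0 fg; apply: ge0_le_integral => //.
- by move=> x _; rewrite lee_fin.
- exact/measurable_EFinP.
- exact/measurable_EFinP.
- by move=> x _; rewrite lee_fin.
Qed.

Lemma integralD_ge0 f g : measurable_fun setT f -> measurable_fun setT g ->
  (forall x, 0 <= f x)%R -> (forall x, 0 <= g x)%R ->
  \int[mu]_x (f x + g x)%:E = \int[mu]_x (f x)%:E + \int[mu]_x (g x)%:E.
Proof.
move=> mf mg f0 g0; under eq_integral do rewrite EFinD.
rewrite ge0_integralD//.
- by move=> x _; rewrite lee_fin.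
- exact/measurable_EFinP.
- by move=> x _; rewrite lee_fin.
- exact/measurable_EFinP.
Qed.

Lemma integralZ_ge0 (c : R) f : measurable_fun setT f -> (0 <= c)%R ->
  (forall x, 0 <= f x)%R ->
  \int[mu]_x (c * f x)%:E = c%:E * \int[mu]_x (f x)%:E.
Proof.
move=> mf c0 f0; under eq_integral do rewrite EFinM.
rewrite ge0_integralZl_EFin//.
- by move=> x _; rewrite lee_fin.
- exact/measurable_EFinP.
Qed.

Lemma integral_EFin_ge0 f : (forall x, 0 <= f x)%R -> 0 <= \int[mu]_x (f x)%:E.
Proof. by move=> f0; apply: integral_ge0 => x _; rewrite lee_fin. Qed.

Lemma integrable_EFin_ge0 f : measurable_fun setT f -> (forall x, 0 <= f x)%R ->
  \int[mu]_x (f x)%:E < +oo -> mu.-integrable setT (EFin \o f).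
Proof.
move=> mf f0 foo; apply/integrableP; split; first exact/measurable_EFinP.
by under eq_integral do rewrite /= ger0_norm//.
Qed.

Lemma integral_eq0_ae f : measurable_fun setT f -> (forall x, 0 <= f x)%R ->
  \int[mu]_x (f x)%:E = 0 -> {ae mu, forall x, f x = 0%R}.
Proof.
move=> mf f0 I0.
have : ae_eq mu setT (EFin \o f) (cst 0).
  apply/ae_eq_integral_abs => //; first exact/measurable_EFinP.
  by under eq_integral do rewrite /= ger0_norm//.
by move=> h; apply: filterS h => x /(_ I) [].
Qed.

End NonnegIntegrals.

Section SquareIntegrable.
Context d (T : measurableType d) (R : realType) (mu : {measure set T -> \bar R}).
Implicit Types f g h : T -> R.

(** Functions, not classes: symmetry and monotonicity are claimed at every point, so almost
    everywhere equality is always handled explicitly. *)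
Definition L2 f := measurable_fun setT f /\ (\int[mu]_x (f x ^+ 2)%:E < +oo)%E.

Definition ip f g : R := fine (\int[mu]_x (f x * g x)%:E)%E.

Lemma L2_meas f : L2 f -> measurable_fun setT f. Proof. by case. Qed.

Lemma L2_integrable f g : L2 f -> L2 g ->
  mu.-integrable setT (EFin \o (fun x => f x * g x)).
Proof.
move=> [mf foo] [mg goo].
have hi : mu.-integrable setT (EFin \o (fun x => f x ^+ 2 + g x ^+ 2)).
  apply: integrable_EFin_ge0; first by mfun.
    by move=> x; rewrite addr_ge0 ?sqr_ge0.
  rewrite integralD_ge0//; [|by mfun|by mfun|by move=> x; exact: sqr_ge0|by move=> x; exact: sqr_ge0].
  by rewrite lte_add_pinfty.
apply: (le_integrable measurableT _ _ hi).
- by apply/measurable_EFinP; mfun.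
- move=> x _ /=; rewrite lee_fin normrM [leRHS]ger0_norm ?addr_ge0 ?sqr_ge0//.
  rewrite -(real_normK (num_real (f x))) -(real_normK (num_real (g x))).
  by have := normr_ge0 (f x); have := normr_ge0 (g x); nra.
Qed.

Lemma ipE f g : L2 f -> L2 g -> ((ip f g)%:E = \int[mu]_x (f x * g x)%:E)%E.
Proof.
move=> lf lg; rewrite /ip fineK//.
exact: integrable_fin_num (L2_integrable lf lg).
Qed.

Lemma ip_sqr f : L2 f -> ((ip f f)%:E = \int[mu]_x (f x ^+ 2)%:E)%E.
Proof. by move=> lf; rewrite ipE. Qed.

Lemma ipC f g : ip f g = ip g f.
Proof. by congr fine; apply: eq_integral => x _; rewrite mulrC. Qed.

Lemma ip_ge0 f : 0 <= ip f f.
Proof.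
by apply: fine_ge0; apply: integral_EFin_ge0 => x; rewrite -expr2 sqr_ge0.
Qed.

Lemma L2D f g : L2 f -> L2 g -> L2 (fun x => f x + g x).
Proof.
move=> lf lg; have [mf foo] := lf; have [mg goo] := lg; split; first by mfun.
apply: (@le_lt_trans _ _ (\int[mu]_x (2 * f x ^+ 2 + 2 * g x ^+ 2)%:E)%E).
  apply: le_integral_EFin; [by mfun|by mfun|by move=> x; exact: sqr_ge0|].
  by move=> x; have := sqr_ge0 (f x - g x); nra.
rewrite integralD_ge0; [|by mfun|by mfun| |]; last 2 first.
- by move=> x; rewrite mulr_ge0 ?sqr_ge0.
- by move=> x; rewrite mulr_ge0 ?sqr_ge0.
rewrite !integralZ_ge0//; [|by mfun|by move=> x; exact: sqr_ge0|by mfun|by move=> x; exact: sqr_ge0].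
by rewrite lte_add_pinfty// lte_mul_pinfty.
Qed.

Lemma L2Z c f : L2 f -> L2 (fun x => c * f x).
Proof.
move=> [mf foo]; split; first by mfun.
under eq_integral do rewrite exprMn.
rewrite integralZ_ge0; [|by mfun|exact: sqr_ge0|by move=> x; exact: sqr_ge0].
by rewrite lte_mul_pinfty// lee_fin sqr_ge0.
Qed.

Lemma L2N f : L2 f -> L2 (fun x => - f x).
Proof. by move=> /(L2Z (-1)); congr L2; apply/funext => x; rewrite mulN1r. Qed.

Lemma L2B f g : L2 f -> L2 g -> L2 (fun x => f x - g x).
Proof. by move=> lf /L2N lg; exact: (L2D lf lg). Qed.

Lemma L2_le f g : measurable_fun setT f -> (forall x, `|f x| <= `|g x|) ->
  L2 g -> L2 f.
Proof.
move=> mf fg [mg goo]; split => //; apply: le_lt_trans goo.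
apply: le_integral_EFin; [by mfun|by mfun|by move=> x; exact: sqr_ge0|].
by move=> x; rewrite -(real_normK (num_real (f x))) -(real_normK (num_real (g x))) ler_pXn2r// ?nnegrE.
Qed.

Lemma L2_0 : L2 (fun=> 0).
Proof.
by split; [mfun|under eq_integral do rewrite expr0n; rewrite integral0].
Qed.

Lemma ipDl f g h : L2 f -> L2 g -> L2 h ->
  ip (fun x => f x + g x) h = ip f h + ip g h.
Proof.
move=> lf lg lh; rewrite /ip -fineD; last 2 first.
- exact: integrable_fin_num (L2_integrable lf lh).
- exact: integrable_fin_num (L2_integrable lg lh).
congr fine; under eq_integral do rewrite mulrDl EFinD.
by rewrite -(integralD measurableT (L2_integrable lf lh) (L2_integrable lg lh)).
Qed.

Lemma ipZl c f g : L2 f -> L2 g -> ip (fun x => c * f x) g = c * ip f g.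
Proof.
move=> lf lg; rewrite /ip.
under eq_integral do rewrite -mulrA EFinM.
rewrite (integralZl measurableT (L2_integrable lf lg)).
by rewrite fineM//; exact: integrable_fin_num (L2_integrable lf lg).
Qed.

Lemma ipDr f g h : L2 f -> L2 g -> L2 h ->
  ip h (fun x => f x + g x) = ip h f + ip h g.
Proof. by move=> lf lg lh; rewrite ipC ipDl// ipC (ipC g). Qed.

Lemma ipZr c f g : L2 f -> L2 g -> ip g (fun x => c * f x) = c * ip g f.
Proof. by move=> lf lg; rewrite ipC ipZl// ipC. Qed.

Lemma ipNl f g : L2 f -> L2 g -> ip (fun x => - f x) g = - ip f g.
Proof.
move=> lf lg; rewrite -mulN1r -ipZl//.
by congr ip; apply/funext => x; rewrite mulN1r.
Qed.

Lemma ipBl f g h : L2 f -> L2 g -> L2 h ->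
  ip (fun x => f x - g x) h = ip f h - ip g h.
Proof.
by move=> lf lg lh; rewrite (ipDl lf (L2N lg))// ipNl.
Qed.

Lemma ip_lin f g c : L2 f -> L2 g ->
  ip (fun x => f x + c * g x) (fun x => f x + c * g x) =
  ip f f + 2 * c * ip f g + c ^+ 2 * ip g g.
Proof.
move=> lf lg; have lcg := L2Z c lg; have lfg := L2D lf lcg.
rewrite ipDl// ipDr// ipDr// !ipZl// !ipZr// (ipC g f); ring.
Qed.

Lemma ipD_sqr f g : L2 f -> L2 g ->
  ip (fun x => f x + g x) (fun x => f x + g x) =
  ip f f + 2 * ip f g + ip g g.
Proof.
move=> lf lg; rewrite ipDl//; last exact: L2D.
by rewrite ipDr// ipDr// (ipC g f); ring.
Qed.

Lemma ipB_sqr f g : L2 f -> L2 g ->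
  ip (fun x => f x - g x) (fun x => f x - g x) =
  ip f f - 2 * ip f g + ip g g.
Proof.
move=> lf lg; have := ip_lin (-1) lf lg.
rewrite (_ : (fun x => f x + -1 * g x) = (fun x => f x - g x)); last first.
  by apply/funext => x; rewrite mulN1r.
by move=> ->; ring.
Qed.

Lemma ip_CS f g : L2 f -> L2 g -> ip f g ^+ 2 <= ip f f * ip g g.
Proof.
move=> lf lg; have q c : 0 <= ip f f + 2 * c * ip f g + c ^+ 2 * ip g g.
  by rewrite -ip_lin// ip_ge0.
have [g0|gn0] := eqVneq (ip g g) 0.
  have [->|n0] := eqVneq (ip f g) 0; first by rewrite g0 mulr0 expr0n.
  (* When [ip g g] vanishes the quadratic in [c] is affine; this [c] gives it the value -1. *)
  have := q (- (ip f f + 1) / (2 * ip f g)).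
  rewrite g0 mulr0 addr0 [X in _ + X](_ : _ = - (ip f f + 1)); first by lra.
  by field.
have gp : 0 < ip g g by rewrite lt_neqAle eq_sym gn0 ip_ge0.
have := q (- ip f g / ip g g).
rewrite [X in 0 <= X](_ : _ = (ip f f * ip g g - ip f g ^+ 2) / ip g g); last by field.
by rewrite pmulr_lge0 ?invr_gt0// subr_ge0.
Qed.

Lemma ip_le_CS f g : L2 f -> L2 g -> `|ip f g| <= Num.sqrt (ip f f) * Num.sqrt (ip g g).
Proof.
move=> lf lg; rewrite -sqrtrM ?ip_ge0// -sqrtr_sqr.
by rewrite ler_sqrt ?ip_CS// mulr_ge0 ?ip_ge0.
Qed.

Lemma ipD_sqr_le f g : L2 f -> L2 g ->
  ip (fun x => f x + g x) (fun x => f x + g x) <= 2 * ip f f + 2 * ip g g.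
Proof.
move=> lf lg; have := ip_ge0 (fun x => f x - g x).
by rewrite ipB_sqr// ipD_sqr//; lra.
Qed.

End SquareIntegrable.

Section RealSequences.
Context (R : realType).

Lemma cvg_half_expr : ((2^-1 : R) ^+ n) @[n --> \oo] --> (0 : R).
Proof.
apply: cvg_expr; rewrite ger0_norm ?invr_ge0// invf_lt1// ?ltr1n//.
Qed.

(** With [r n] the tail of the geometric series, [u - r] increases and [u + r] decreases. The limit
    is pinned between them, which yields the rate together with the convergence. *)
Lemma geometric_cauchy (u : nat -> R) (K : R) : 0 <= K ->
  (forall n, `|u n.+1 - u n| <= K * 2^-1 ^+ n) ->
  exists l, (u n @[n --> \oo] --> l) /\
    forall n, `|u n - l| <= 2 * K * 2^-1 ^+ n.
Proof.
move=> K0 hu; pose r n : R := 2 * K * 2^-1 ^+ n.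
have rS n : r n.+1 = r n - K * 2^-1 ^+ n by rewrite /r exprS; field.
have r0 n : 0 <= r n by rewrite /r !mulr_ge0// exprn_ge0// invr_ge0.
have cr : r n @[n --> \oo] --> (0 : R).
  by rewrite -(mulr0 (2 * K)); apply: cvgM; [exact: cvg_cst|exact: cvg_half_expr].
pose a n := u n - r n; pose b n := u n + r n.
have ia : {homo a : n m / (n <= m)%N >-> n <= m}.
  apply/nondecreasing_seqP => n; rewrite /a rS.
  by have := hu n; rewrite ler_norml => /andP[]; lra.
have db : {homo b : n m / (n <= m)%N >-> m <= n}.
  apply/nonincreasing_seqP => n; rewrite /b rS.
  by have := hu n; rewrite ler_norml => /andP[]; lra.
have ub : has_ubound (range a).
  exists (b 0%N) => _ [n _ <-]; apply: le_trans (db _ _ (leq0n n)).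
  by rewrite /a /b; have := r0 n; lra.
have ca := nondecreasing_is_cvgn ia ub.
have cu : u n @[n --> \oo] --> limn a.
  rewrite (_ : u = fun n => a n + r n); last by apply/funext => n; rewrite /a; ring.
  by rewrite -[limn a]addr0; apply: cvgD.
have cb : b n @[n --> \oo] --> limn a.
  by rewrite -[limn a]addr0; apply: cvgD.
exists (limn a); split => // n.
have h1 := nondecreasing_cvgn_le ia ca n.
have h2 : limn a <= b n.
  rewrite -(cvg_lim (@Rhausdorff R) cb); apply: nonincreasing_cvgn_ge => //.
  by apply/cvg_ex; exists (limn a).
by move: h1 h2; rewrite /a /b ler_norml /r => h1 h2; apply/andP; split; lra.
Qed.

Lemma nneseries_le (u : nat -> \bar R) (B : \bar R) : (forall n, 0 <= u n)%E ->
  (forall n, \sum_(0 <= i < n) u i <= B)%E -> (\sum_(0 <= i <oo) u i <= B)%E.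
Proof.
move=> u0 h; apply: lime_le; first exact: is_cvg_nneseries.
by apply: nearW.
Qed.

End RealSequences.

(** * Completeness of L2 with a pointwise limit *)

Section Completeness.
Context d (T : measurableType d) (R : realType) (mu : {measure set T -> \bar R}).
Implicit Types f g h : T -> R.

(** The rate leaves room for the weight [4 ^+ n]: the sum [S] of the weighted squared increments has
    integral at most the sum of (4/8)^n, that is 2. Hence [S] is finite on a set [A] of full
    measure, and there the increments are at most [Num.sqrt s] times 2^-n. No subsequence is taken.
    Cutting with [\1_A] makes the convergence hold at every point, the form in which Fatou's lemma
    is applied later. *)
Lemma L2_complete (F : nat -> T -> R) : (forall n, L2 mu (F n)) ->
  (forall n, ip mu (fun x => F n.+1 x - F n x) (fun x => F n.+1 x - F n x)
     <= 8^-1 ^+ n) ->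
  exists A f, [/\ measurable A /\ {ae mu, forall x, A x}, L2 mu f,
    (forall x, F n x * \1_A x @[n --> \oo] --> f x) &
    forall n, ip mu (fun x => F n x - f x) (fun x => F n x - f x)
      <= 8 * 4^-1 ^+ n].
Proof.
move=> lF hF.
have mF n : measurable_fun setT (F n) by have [] := lF n.
pose t n x : R := 4 ^+ n * (F n.+1 x - F n x) ^+ 2.
have t0 n x : 0 <= t n x by apply: mulr_ge0; [exact: exprn_ge0|exact: sqr_ge0].
have mt n : measurable_fun setT (t n).
  by rewrite /t; apply: measurable_funM; [exact: measurable_cst|apply: measurable_funX; mfun].
pose S x := (\sum_(0 <= n <oo) (t n x)%:E)%E.
have S0 x : (0 <= S x)%E by apply: nneseries_ge0 => n _ _; rewrite lee_fin.
have mS : measurable_fun setT S.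
  apply: ge0_emeasurable_sum => //.
    by move=> n x _ _; rewrite lee_fin.
  by move=> n _; exact/measurable_EFinP.
have IS : (\int[mu]_x S x <= 2%:E)%E.
  rewrite /S integral_nneseries//; last 2 first.
  - by move=> n; exact/measurable_EFinP.
  - by move=> n x _; rewrite lee_fin.
  have It n : (\int[mu]_x (t n x)%:E <= (2^-1 ^+ n)%:E)%E.
    rewrite integralZ_ge0; [|by apply: measurable_funX; mfun|exact: exprn_ge0|by move=> x; exact: sqr_ge0].
    rewrite -ip_sqr; last exact: L2B.
    rewrite -EFinM lee_fin.
    apply: (@le_trans _ _ (4 ^+ n * 8^-1 ^+ n)).
      by rewrite ler_wpM2l// exprn_ge0.
    rewrite -exprMn.
    have -> // : 4 * 8^-1 = 2^-1 :> R by field.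
  apply: nneseries_le => n.
    by apply: integral_EFin_ge0.
  apply: (@le_trans _ _ (\sum_(0 <= i < n) (2^-1 ^+ i)%:E)%E).
    by apply: lee_sum => i _; exact: It.
  rewrite sumEFin lee_fin.
  have -> : \sum_(0 <= i < n) (2^-1 : R) ^+ i = 2 - 2 * 2^-1 ^+ n.
    elim: n => [|n IH]; first by rewrite big_nil expr0; ring.
    by rewrite big_nat_recr//= IH exprS; field.
  by rewrite gerBl mulr_ge0// exprn_ge0// invr_ge0.
pose A := [set x | (S x < +oo)%E].
have mA : measurable A.
  have := emeasurable_fun_infty_o measurableT mS +oo%E.
  by rewrite setTI.
have aeA : {ae mu, forall x, A x}.
  have iS : mu.-integrable setT S.
    apply/integrableP; split => //.
    under eq_integral do rewrite gee0_abs//.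
    by apply: le_lt_trans IS _; rewrite ltry.
  have := integrable_ae measurableT iS.
  by apply: filterS => x /(_ I); rewrite ge0_fin_numE.
have key x : A x -> exists l, (F n x @[n --> \oo] --> l) /\
    forall n, (F n x - l) ^+ 2 <= 4 * 4^-1 ^+ n * fine (S x).
  move=> Ax; set s := fine (S x).
  have s0 : 0 <= s by exact: fine_ge0.
  have sE : s%:E = S x by rewrite fineK// ge0_fin_numE.
  have ts n : t n x <= s.
    rewrite -lee_fin sE; apply: le_trans (nneseries_lim_ge n.+1 _).
      by rewrite big_nat_recr//= leeDr// sumEFin lee_fin sumr_ge0.
    by move=> i _ _; rewrite lee_fin.
  have dn n : `|F n.+1 x - F n x| <= Num.sqrt s * 2^-1 ^+ n.
    rewrite -(@ler_pXn2r _ 2)// ?nnegrE ?mulr_ge0 ?sqrtr_ge0 ?exprn_ge0 ?invr_ge0//.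
    rewrite exprMn sqr_sqrtr// real_normK ?num_real//.
    have := ts n; rewrite /t -ler_pdivlMl ?exprn_gt0//.
    move=> /le_trans; apply; rewrite mulrC -exprM mulnC exprM.
    by have -> : (2^-1 ^+ 2 : R) = 4^-1; [field|rewrite exprVn].
  have [l [cl hl]] := geometric_cauchy (sqrtr_ge0 s) dn.
  exists l; split => // n.
  have := hl n; rewrite -(@ler_pXn2r _ 2)// ?nnegrE ?mulr_ge0 ?sqrtr_ge0 ?exprn_ge0 ?invr_ge0//.
  rewrite real_normK ?num_real// => /le_trans; apply.
  rewrite !exprMn sqr_sqrtr// -exprM mulnC exprM.
  have -> : (2^-1 ^+ 2 : R) = 4^-1 by field.
  by rewrite (_ : 2 ^+ 2 = 4 :> R); [rewrite mulrAC|ring].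
have key' x : {l | (F n x * \1_A x @[n --> \oo] --> l) /\
   (A x -> forall n, (F n x - l) ^+ 2 <= 4 * 4^-1 ^+ n * fine (S x))}.
  apply: cid; have [Ax|nAx] := pselect (A x).
    have [l [cl hl]] := key x Ax; exists l; split => //.
    rewrite indicE mem_set//= (_ : (fun n => _) = F^~ x)//.
    by apply/funext => n; rewrite mulr1.
  exists 0; split => //; rewrite indicE memNset//=.
  rewrite (_ : (fun n => _) = fun=> 0); first exact: cvg_cst.
  by apply/funext => n; rewrite mulr0.
pose f x := sval (key' x).
have cf x : F n x * \1_A x @[n --> \oo] --> f x by have [] := svalP (key' x).
have bf x : A x -> forall n, (F n x - f x) ^+ 2 <= 4 * 4^-1 ^+ n * fine (S x).
  by have [] := svalP (key' x).
have mf : measurable_fun setT f.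
  apply: (@measurable_fun_cvg _ _ _ _ (fun n x => F n x * \1_A x)) => //.
  by move=> n; apply: measurable_funM => //; exact: measurable_indic.
(* The pointwise bound carries 4 * 4^-n and the integral of [S] is at most 2, whence the 8. *)
have IFf n : (\int[mu]_x ((F n x - f x) ^+ 2)%:E <= (8 * 4^-1 ^+ n)%:E)%E.
  apply: (@le_trans _ _ (\int[mu]_x ((4 * 4^-1 ^+ n)%:E * S x))%E).
    apply: ae_ge0_le_integral => //.
    - by move=> x _; rewrite lee_fin sqr_ge0.
    - by apply/measurable_EFinP; apply: measurable_funX; mfun.
    - by move=> x _; rewrite mule_ge0// lee_fin mulr_ge0// exprn_ge0// invr_ge0.
    - by apply: emeasurable_funM => //; exact: measurable_cst.
    - apply: filterS aeA => x Ax _.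
      rewrite -(@fineK _ (S x)) ?ge0_fin_numE// -EFinM lee_fin.
      exact: bf.
  rewrite ge0_integralZl_EFin ?mulr_ge0 ?exprn_ge0 ?invr_ge0//.
  apply: (@le_trans _ _ ((4 * 4^-1 ^+ n)%:E * 2%:E)%E).
    by rewrite lee_wpmul2l// lee_fin mulr_ge0// exprn_ge0// invr_ge0.
  by rewrite -EFinM lee_fin; nra.
have lFf n : L2 mu (fun x => F n x - f x).
  by split; [mfun|apply: le_lt_trans (IFf n) _; rewrite ltry].
exists A, f; split => //.
  have := L2B (lF 0%N) (lFf 0%N).
  by congr L2; apply/funext => x; ring.
by move=> n; rewrite -lee_fin ip_sqr.
Qed.

Lemma ip_cvg (F : nat -> T -> R) f h : (forall n, L2 mu (F n)) -> L2 mu f ->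
  L2 mu h -> ip mu (fun x => F n x - f x) (fun x => F n x - f x)
    @[n --> \oo] --> (0 : R) ->
  ip mu (F n) h @[n --> \oo] --> ip mu f h.
Proof.
move=> lF lf lh c0; apply/cvgrPdist_le => e e0.
pose K := ip mu h h + 1.
have K0 : 0 < K by rewrite ltr_wpDl// ip_ge0.
have e20 : 0 < e ^+ 2 / K by rewrite divr_gt0// exprn_gt0.
move/cvgrPdist_le : c0 => /(_ _ e20); apply: filterS => n.
rewrite sub0r normrN ger0_norm ?ip_ge0// => hn.
rewrite -(@ler_pXn2r _ 2)// ?nnegrE ?(ltW e0)// real_normK ?num_real//.
rewrite -sqrrN opprB -ipBl//.
apply: le_trans (ip_CS (L2B (lF n) lf) lh) _.
apply: (@le_trans _ _ (e ^+ 2 / K * K)); last by rewrite divfK ?gt_eqF.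
by apply: ler_pM; rewrite ?ip_ge0// lerDl.
Qed.

Lemma ip_sqr_cvg (F : nat -> T -> R) f : (forall n, L2 mu (F n)) -> L2 mu f ->
  ip mu (fun x => F n x - f x) (fun x => F n x - f x)
    @[n --> \oo] --> (0 : R) ->
  ip mu (F n) (F n) @[n --> \oo] --> ip mu f f.
Proof.
move=> lF lf c0.
have c1 := ip_cvg lF lf lf c0.
have -> : (fun n => ip mu (F n) (F n)) = (fun n =>
   ip mu (fun x => F n x - f x) (fun x => F n x - f x)
   + 2 * ip mu (F n) f - ip mu f f).
  by apply/funext => n; rewrite ipB_sqr//; ring.
rewrite [X in _ --> X](_ : _ = 0 + 2 * ip mu f f - ip mu f f); last by ring.
by apply: cvgB; [apply: cvgD => //; apply: cvgM; [exact: cvg_cst|exact: c1]|exact: cvg_cst].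
Qed.

End Completeness.

(** * Riesz representation *)

Section Riesz.
Context d (T : measurableType d) (R : realType) (mu : {measure set T -> \bar R}).
Local Notation ip := (ip mu).
Local Notation L2 := (L2 mu).

Lemma parallelogram (f g : T -> R) : L2 f -> L2 g ->
  ip (fun x => f x - g x) (fun x => f x - g x) =
  2 * ip f f + 2 * ip g g
  - 4 * ip (fun x => 2^-1 * f x + 2^-1 * g x) (fun x => 2^-1 * f x + 2^-1 * g x).
Proof.
move=> lf lg; have lf2 := L2Z 2^-1 lf; have lg2 := L2Z 2^-1 lg.
by rewrite ipB_sqr// ipD_sqr// !ipZl// !ipZr//; field.
Qed.

(* Riesz representation: minimise |phi|^2 - 2 l(phi); the parallelogram law makes
   a minimising sequence Cauchy. *)
Lemma riesz_pair (P : (T -> R) -> Prop) (l1 l2 : (T -> R) -> R) (M : R) :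
  (forall p, P p -> L2 p) -> P (fun=> 0) ->
  (forall c p q, P p -> P q -> P (fun x => p x + c * q x)) ->
  (forall c p q, P p -> P q -> l1 (fun x => p x + c * q x) = l1 p + c * l1 q) ->
  (forall c p q, P p -> P q -> l2 (fun x => p x + c * q x) = l2 p + c * l2 q) ->
  0 <= M ->
  (forall p q, P p -> P q -> (l1 p + l2 q) ^+ 2 <= M * (ip p p + ip q q)) ->
  exists g1 g2, [/\ L2 g1, L2 g2, ip g1 g1 + ip g2 g2 <= M &
    forall p, P p -> ip g1 p = l1 p /\ ip g2 p = l2 p].
Proof.
move=> PL P0 Pl l1l l2l M0 hM.
pose J (p q : T -> R) := ip p p + ip q q - 2 * (l1 p + l2 q).
have Jlb p q : P p -> P q -> - M <= J p q.
  move=> Pp Pq; rewrite /J.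
  have := hM _ _ Pp Pq; have := ip_ge0 mu p; have := ip_ge0 mu q.
  move: (ip p p) (ip q q) (l1 p + l2 q) => a b L b0 a0 h.
  (* By contradiction: the hypothesis gives 4 L^2 <= 4 M (a + b) <= (a + b + M)^2, against a + b + M
     < 2 L. *)
  rewrite leNgt; apply/negP => hlt.
  have h1 : 0 <= a + b + M by lra.
  have h2 : a + b + M < 2 * L by lra.
  have : (a + b + M) ^+ 2 < (2 * L) ^+ 2 by rewrite ltr_pXn2r// nnegrE; lra.
  by have := sqr_ge0 (a + b - M); nra.
pose E := [set r | exists p q, [/\ P p, P q & r = J p q]].
have infE : has_inf E.
  split; first by exists (J (fun=> 0) (fun=> 0)), (fun=> 0), (fun=> 0).
  by exists (- M) => _ [p [q [Pp Pq ->]]]; exact: Jlb.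
pose m := inf E.
have mlb p q : P p -> P q -> m <= J p q.
  by move=> Pp Pq; apply: ge_inf; [case: infE|exists p, q].
(* The slack is a quarter of 8^-n: the parallelogram law bounds a squared increment by twice the sum
   of two consecutive slacks, and [L2_complete] asks for 8^-n. *)
have seq n : {pq : (T -> R) * (T -> R) |
    [/\ P pq.1, P pq.2 & J pq.1 pq.2 < m + 4^-1 * 8^-1 ^+ n]}.
  apply: cid; have e0 : 0 < 4^-1 * 8^-1 ^+ n :> R.
    by apply: mulr_gt0; rewrite ?exprn_gt0 ?invr_gt0.
  by have [_ [p [q [Pp Pq ->]]] h] := inf_adherent e0 infE; exists (p, q).
pose p n := (sval (seq n)).1; pose q n := (sval (seq n)).2.
have Pp n : P (p n) by have [] := svalP (seq n).
have Pq n : P (q n) by have [] := svalP (seq n).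
have Jpq n : J (p n) (q n) < m + 4^-1 * 8^-1 ^+ n by have [] := svalP (seq n).
have lp n := PL _ (Pp n); have lq n := PL _ (Pq n).
have Ph r s : P r -> P s -> P (fun x => 2^-1 * r x + 2^-1 * s x).
  move=> Pr Ps; have := Pl 2^-1 _ _ (Pl 2^-1 _ _ P0 Pr) Ps.
  by congr P; apply/funext => x; rewrite add0r.
have l10 : l1 (fun=> 0) = 0.
  have := l1l 1 _ _ P0 P0; rewrite (_ : (fun x : T => 0 + 1 * 0) = (fun=> 0 : R)).
    lra.
  by apply/funext => x; ring.
have l20 : l2 (fun=> 0) = 0.
  have := l2l 1 _ _ P0 P0; rewrite (_ : (fun x : T => 0 + 1 * 0) = (fun=> 0 : R)).
    lra.
  by apply/funext => x; ring.
have l1h r s : P r -> P s ->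
    l1 (fun x => 2^-1 * r x + 2^-1 * s x) = 2^-1 * l1 r + 2^-1 * l1 s.
  move=> Pr Ps; have PP := Pl 2^-1 _ _ P0 Pr; have := l1l 2^-1 _ _ PP Ps.
  rewrite (l1l _ _ _ P0 Pr) l10 add0r => <-.
  by congr l1; apply/funext => x; rewrite add0r.
have l2h r s : P r -> P s ->
    l2 (fun x => 2^-1 * r x + 2^-1 * s x) = 2^-1 * l2 r + 2^-1 * l2 s.
  move=> Pr Ps; have PP := Pl 2^-1 _ _ P0 Pr; have := l2l 2^-1 _ _ PP Ps.
  rewrite (l2l _ _ _ P0 Pr) l20 add0r => <-.
  by congr l2; apply/funext => x; rewrite add0r.
have cau n : ip (fun x => p n.+1 x - p n x) (fun x => p n.+1 x - p n x)
   + ip (fun x => q n.+1 x - q n x) (fun x => q n.+1 x - q n x) <= 8^-1 ^+ n.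
  rewrite !parallelogram//.
  have := mlb _ _ (Ph _ _ (Pp n.+1) (Pp n)) (Ph _ _ (Pq n.+1) (Pq n)).
  have := Jpq n; have := Jpq n.+1; rewrite /J l1h// l2h//.
  rewrite exprS; have : (0 : R) <= 8^-1 ^+ n by rewrite exprn_ge0// invr_ge0.
  move: (8^-1 ^+ n) => e; lra.
have caup n : ip (fun x => p n.+1 x - p n x) (fun x => p n.+1 x - p n x) <= 8^-1 ^+ n.
  by apply: le_trans (cau n); rewrite lerDl ip_ge0.
have cauq n : ip (fun x => q n.+1 x - q n x) (fun x => q n.+1 x - q n x) <= 8^-1 ^+ n.
  by apply: le_trans (cau n); rewrite lerDr ip_ge0.
have [A [g1 [_ lg1 _ cg1]]] := L2_complete lp caup.
have [B [g2 [_ lg2 _ cg2]]] := L2_complete lq cauq.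
have c4 : 8 * (4^-1 : R) ^+ n @[n --> \oo] --> (0 : R).
  rewrite -(mulr0 8); apply: cvgM; first exact: cvg_cst.
  by apply: cvg_expr; rewrite ger0_norm ?invr_ge0// invf_lt1// ltr1n.
have c8 : 4^-1 * (8^-1 : R) ^+ n @[n --> \oo] --> (0 : R).
  rewrite -(mulr0 4^-1); apply: cvgM; first exact: cvg_cst.
  by apply: cvg_expr; rewrite ger0_norm ?invr_ge0// invf_lt1// ltr1n.
have z1 : ip (fun x => p n x - g1 x) (fun x => p n x - g1 x) @[n --> \oo] --> (0 : R).
  by apply: squeeze_cvgr (cvg_cst 0) c4; apply: nearW => n; rewrite ip_ge0 cg1.
have z2 : ip (fun x => q n x - g2 x) (fun x => q n x - g2 x) @[n --> \oo] --> (0 : R).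
  by apply: squeeze_cvgr (cvg_cst 0) c4; apply: nearW => n; rewrite ip_ge0 cg2.
have EL r s : P r -> P s -> ip g1 r + ip g2 s = l1 r + l2 s.
  move=> Pr Ps; have lr := PL _ Pr; have ls := PL _ Ps.
  have c1 := ip_cvg lp lg1 lr z1; have c2 := ip_cvg lq lg2 ls z2.
  pose N := ip r r + ip s s.
  pose D := ip g1 r + ip g2 s - (l1 r + l2 s).
  (* First variation in the limit: perturbing the minimizing sequence by [c] times (r, s) cannot go
     below the infimum. A nonnegative quadratic in [c] without constant term has no linear term
     either, so [D] vanishes. *)
  have ineq c : 0 <= 2 * c * D + c ^+ 2 * N.
    have cc : 4^-1 * 8^-1 ^+ n + (2 * c * (ip (p n) r + ip (q n) s - (l1 r + l2 s)) + c ^+ 2 * N)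
        @[n --> \oo] --> 0 + (2 * c * D + c ^+ 2 * N).
      apply: cvgD => //; apply: cvgD; last exact: cvg_cst.
      apply: cvgM; first exact: cvg_cst.
      by apply: cvgB; [exact: cvgD|exact: cvg_cst].
    rewrite -[leRHS]add0r; apply: (cvgr_to_ge cc); apply: nearW => n.
    have := mlb _ _ (Pl c _ _ (Pp n) Pr) (Pl c _ _ (Pq n) Ps).
    rewrite {1}/J !ip_lin// l1l// l2l//; have := Jpq n; rewrite /J /N.
    move: (4^-1 * 8^-1 ^+ n) => e; lra.
  apply/eqP; rewrite -subr_eq0; apply/eqP; rewrite -/D.
  have N0 : 0 <= N by rewrite addr_ge0 ?ip_ge0.
  have [NN|NN] := eqVneq N 0.
    by have := ineq (- D); rewrite NN; nra.
  have Np : 0 < N by rewrite lt_neqAle eq_sym NN.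
  have := ineq (- D / N); rewrite [X in _ <= X](_ : _ = - (D ^+ 2 / N)); last by field.
  rewrite oppr_ge0 pmulr_lle0 ?invr_gt0// => h.
  by apply/eqP; rewrite -sqrf_eq0 eq_le h sqr_ge0.
exists g1, g2; split => //.
(* The limits [g1] and [g2] need not satisfy [P], so the bound [hM] is applied to [p n] and [q n]
   and passed to the limit as G^2 <= M G. *)
- have c1 := ip_cvg lp lg1 lg1 z1; have c2 := ip_cvg lq lg2 lg2 z2.
  have s1 := ip_sqr_cvg lp lg1 z1; have s2 := ip_sqr_cvg lq lg2 z2.
  set G := ip g1 g1 + ip g2 g2.
  have cc : M * (ip (p n) (p n) + ip (q n) (q n)) - (ip (p n) g1 + ip (q n) g2) ^+ 2
       @[n --> \oo] --> M * G - G ^+ 2.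
    apply: cvgB; first by apply: cvgM; [exact: cvg_cst|exact: cvgD].
    by rewrite !expr2; apply: cvgM; exact: cvgD.
  have : 0 <= M * G - G ^+ 2.
    apply: (cvgr_to_ge cc); apply: nearW => n.
    rewrite subr_ge0 (ipC _ (p n)) (ipC _ (q n) g2) EL//; exact: hM.
  have : 0 <= G by rewrite addr_ge0 ?ip_ge0.
  move=> G0 h; rewrite leNgt; apply/negP => MG; nra.
- move=> r Pr; have e1 := EL _ _ Pr P0; have e2 := EL _ _ P0 Pr.
  have z h : ip h (fun=> 0) = 0.
    by rewrite /ip; under eq_integral do rewrite mulr0; rewrite integral0.
  by move: e1 e2; rewrite !z l10 l20 !addr0 !add0r.
Qed.

End Riesz.

(** * Test functions *)

Section SmoothFunctions.
Context (R : realType).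
Implicit Types f g : R -> R.

(** The derivative is a witness rather than ['D], so that sums, products and affine changes of
    variable follow by induction from the rules for [is_derive]. *)
Fixpoint C1k k f : Prop :=
  continuous f /\
  match k with
  | 0 => True
  | k'.+1 => exists2 f' : R -> R, (forall x : R, is_derive x (1 : R) f (f' x)) & C1k k' f'
  end.

Definition smooth f := forall k, C1k k f.

Lemma C1k_continuous k f : C1k k f -> continuous f.
Proof. by case: k => [|k] []. Qed.

Lemma C1kW k f : C1k k.+1 f -> C1k k f.
Proof.
elim: k f => [|k IH] f [cf [f' df hf']]; first by split.
by split => //; exists f' => //; exact: IH.
Qed.

Lemma C1k_cst k (c : R) : C1k k (fun=> c).
Proof.
elim: k c => [|k IH] c; split => //; try by move=> x; exact: cvg_cst.
by exists (fun=> 0) => // x; exact: is_derive_cst.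
Qed.

Lemma C1kD k f g : C1k k f -> C1k k g -> C1k k (fun x => f x + g x).
Proof.
elim: k f g => [|k IH] f g [cf hf] [cg hg].
  by split => // x; apply: cvgD; [exact: cf|exact: cg].
split; first by move=> x; apply: cvgD; [exact: cf|exact: cg].
case: hf hg => f' df hf' [g' dg hg'].
by exists (fun x => f' x + g' x); [move=> x; exact: is_deriveD|exact: IH].
Qed.

Lemma C1kM k f g : C1k k f -> C1k k g -> C1k k (fun x => f x * g x).
Proof.
elim: k f g => [|k IH] f g hf hg; have [cf _] := hf; have [cg _] := hg.
  by split => // x; apply: cvgM; [exact: cf|exact: cg].
split; first by move=> x; apply: cvgM; [exact: cf|exact: cg].
have [_ [f' df hf']] := hf; have [_ [g' dg hg']] := hg.
exists (fun x => f x * g' x + g x * f' x).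
  by move=> x; exact: is_deriveM.
by apply: C1kD; apply: IH => //; exact: C1kW.
Qed.

Lemma is_derive_affine f (a b x df : R) : is_derive (a * x + b) 1 f df ->
  is_derive x 1 (fun y => f (a * y + b)) (a * df).
Proof.
move=> hf.
have h : is_derive x 1 (fun y : R => a * y + b) a.
  have := is_deriveD (is_deriveZ a (is_derive_id x (1 : R))) (is_derive_cst b x (1 : R)).
  by rewrite addr0 /GRing.scale/= mulr1.
by rewrite mulrC; exact: (@is_derive1_comp _ f (fun y => a * y + b)).
Qed.

Lemma C1k_affine k f (a b : R) : C1k k f -> C1k k (fun x => f (a * x + b)).
Proof.
have ca : continuous (fun x : R => a * x + b).
  move=> x; apply: cvgD; last exact: cvg_cst.
  by apply: cvgM; [exact: cvg_cst|exact: cvg_id].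
elim: k f => [|k IH] f [cf hf].
  by split => // x; apply: (@continuous_comp _ _ _ (fun x => a * x + b) f); [exact: ca|exact: cf].
split; first by move=> x; apply: (@continuous_comp _ _ _ (fun x => a * x + b) f); [exact: ca|exact: cf].
have [f' df hf'] := hf.
exists (fun x => a * f' (a * x + b)).
  by move=> x; apply: is_derive_affine.
by apply: C1kM; [exact: C1k_cst|exact: IH].
Qed.

(** The functions x^-m exp(-1/x), extended by 0, span a space closed under differentiation, so a
    single derivative formula valid for all [m] proves smoothness of every order. *)
Definition flat m (x : R) : R := if 0 < x then x^-1 ^+ m * expR (- x^-1) else 0.

(** Raise y / (n+1) <= exp(y / (n+1)) to the power n+1. *)
Lemma expr_le_expR n (y : R) : 0 <= y -> y ^+ n.+1 <= n.+1%:R ^+ n.+1 * expR y.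
Proof.
move=> y0; pose z := y / n.+1%:R.
have z0 : 0 <= z by rewrite divr_ge0.
have yE : y = z * n.+1%:R by rewrite /z divfK// pnatr_eq0.
rewrite yE exprMn mulrC ler_pM2l ?exprn_gt0 ?ltr0n//.
rewrite expRM_natr.
rewrite ler_pXn2r// ?nnegrE ?expR_ge0//.
by apply: le_trans (expR_ge1Dx z); rewrite lerDr.
Qed.

Lemma flat_ge0 m x : 0 <= flat m x.
Proof.
rewrite /flat; case: ifP => // x0.
by rewrite mulr_ge0 ?expR_ge0// exprn_ge0// invr_ge0 ltW.
Qed.

Lemma flat_le m x : 0 <= x -> flat m x <= m.+1%:R ^+ m.+1 * x.
Proof.
rewrite /flat; case: ifP => [x0 _|_ x0]; last by rewrite mulr_ge0// exprn_ge0.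
have y0 : 0 <= x^-1 by rewrite invr_ge0 ltW.
rewrite expRN ler_pdivrMr ?expR_gt0//.
have := expr_le_expR m y0; rewrite exprSr ler_pdivrMr ?invr_gt0//.
by rewrite mulrAC.
Qed.

Lemma flat_div m x : x != 0 -> flat m x / x = flat m.+1 x.
Proof.
move=> x0; rewrite /flat; case: ifP => // _; last by rewrite mul0r.
by rewrite exprS; field.
Qed.

Lemma is_derive_flat m (x : R) :
  is_derive x 1 (flat m) (flat m.+2 x - m%:R * flat m.+1 x).
Proof.
have [x0|x0|<-] := ltgtP 0 x.
- pose g y : R := y^-1 ^+ m * expR (- y^-1).
  have xn0 : x != 0 by rewrite gt_eqF.
  apply: (@near_eq_is_derive _ _ _ g).
    near=> y; rewrite /flat ifT//; near: y; exact: lt_nbhsr.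
  have dV : is_derive x 1 (fun y : R => y^-1) (- (x ^- 2)).
    apply: is_derive_eq; first by apply: (@is_deriveV _ id).
    by rewrite /GRing.scale/= mulr1.
  have dX : is_derive x 1 (fun y : R => y^-1 ^+ m) ((m%:R * x^-1 ^+ m.-1) *: - (x ^- 2)).
    rewrite (_ : (fun y => _) = (fun y : R => y^-1) ^+ m); first exact: is_deriveX.
    by apply/funext => y; rewrite exprfctE.
  have dN : is_derive x 1 (fun y : R => - y^-1) (- - (x ^- 2)) by exact: is_deriveN.
  have dE : is_derive x 1 (fun y : R => expR (- y^-1)) (- - (x ^- 2) * expR (- x^-1)).
    rewrite mulrC.
    exact: (@is_derive1_comp _ expR (fun y => - y^-1) x _ _ (is_derive_expR _) dN).
  have /is_derive_eq := is_deriveM dX dE; apply.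
  rewrite /flat x0 /GRing.scale/=.
  case: m {g dX} => [|m]; first by rewrite !exprS expr0; field.
  by rewrite /= !exprS; field.
- apply: (@near_eq_is_derive _ _ _ (cst 0)).
    near=> y; rewrite /flat ifF//; apply/negbTE; rewrite -leNgt ltW//.
    by near: y; exact: lt_nbhsl.
  by rewrite /flat !ltNge (ltW x0)/= mulr0 subr0; exact: is_derive_cst.
- rewrite {2 3}/flat ltxx mulr0 subr0.
  (* At the origin the difference quotient is [flat m.+1 h], which [flat_le] bounds by a multiple of
     [h]. *)
  have c : (fun h : R => h^-1 *: ((flat m \o shift 0) (h *: 1) - flat m 0)) @ 0^' --> (0 : R).
    apply/cvgrPdist_le => e e0 /=.
    pose C : R := m.+2%:R ^+ m.+2.
    have C0 : 0 < C by rewrite exprn_gt0.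
    near=> h.
    have h0 : h != 0 by near: h; exact: nbhs_dnbhs_neq.
    rewrite addr0 /GRing.scale/= mulr1 {2}/flat ltxx subr0 sub0r normrN.
    rewrite mulrC flat_div//.
    rewrite ger0_norm ?flat_ge0//.
    have [hp|hn] := ltP 0 h; last by rewrite /flat ltNge hn/= ltW.
    apply: le_trans (flat_le _ (ltW hp)) _; rewrite -/C.
    rewrite -ler_pdivlMl//.
    rewrite -(gtr0_norm hp).
    near: h; apply: dnbhs0_le; by rewrite mulr_gt0 ?invr_gt0.
  by split; [apply/cvg_ex; exists 0|exact: cvg_lim].
Unshelve. all: by end_near. Qed.

Lemma flat_smooth m : smooth (flat m).
Proof.
move=> k; elim: k m => [|k IH] m.
  split => // x; apply: differentiable_continuous.
  by apply/derivable1_diffP; have [] := is_derive_flat m x.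
split.
  by have := IH m; exact: C1k_continuous.
exists (fun x => flat m.+2 x - m%:R * flat m.+1 x); first exact: is_derive_flat.
have -> : (fun x => flat m.+2 x - m%:R * flat m.+1 x) =
  (fun x => flat m.+2 x + (- m%:R) * flat m.+1 x).
  by apply/funext => x; rewrite mulNr.
by apply: C1kD => //; apply: C1kM => //; exact: C1k_cst.
Qed.

(** It is nonzero exactly on ]a, b[ for every [n]; only the slopes at the two ends steepen, since
    exp(-1/(n y)) tends to 1 for each y > 0. The indicator of an open interval is thus a limit of
    smooth functions that it dominates, without any convolution. *)
Definition bump (a b : R) n x :=
  flat 0 (n.+1%:R * x + - (n.+1%:R * a)) * flat 0 (- n.+1%:R * x + n.+1%:R * b).

Lemma bumpE a b n x :
  bump a b n x = flat 0 (n.+1%:R * (x - a)) * flat 0 (n.+1%:R * (b - x)).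
Proof. by rewrite /bump; congr (flat 0 _ * flat 0 _); ring. Qed.

Lemma bump_smooth a b n : smooth (bump a b n).
Proof. by move=> k; apply: C1kM; apply: C1k_affine; exact: flat_smooth. Qed.

Lemma flat0_le1 x : flat 0 x <= 1.
Proof.
rewrite /flat; case: ifP => // x0; rewrite expr0 mul1r.
by rewrite -expR0 ler_expR oppr_le0 invr_ge0 ltW.
Qed.

Lemma bump_bound a b n x : 0 <= bump a b n x <= 1.
Proof.
rewrite /bump mulr_ge0 ?flat_ge0//=.
by rewrite -[leRHS]mulr1; apply: ler_pM; rewrite ?flat_ge0 ?flat0_le1.
Qed.

Lemma bump_out a b n x : ~~ (a < x < b) -> bump a b n x = 0.
Proof.
move=> h; rewrite bumpE /flat.
rewrite !(pmulr_rgt0 _ (ltr0Sn R n)) !subr_gt0.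
by case: ltP h => ax; [case: ltP => // _; rewrite mulr0|rewrite mul0r].
Qed.

Lemma bump_cvg a b x : bump a b n x @[n --> \oo] --> (\1_(`]a, b[%classic) x : R).
Proof.
rewrite indicE; have [xab|xab] := boolP (a < x < b); last first.
  rewrite memNset; last by rewrite /= in_itv/=; exact/negP.
  by under eq_cvg do rewrite bump_out//; exact: cvg_cst.
rewrite mem_set; last by rewrite /= in_itv.
have key y : 0 < y -> flat 0 (n.+1%:R * y) @[n --> \oo] --> (1 : R).
  move=> y0.
  have -> : (fun n => flat 0 (n.+1%:R * y)) = (fun n => expR (- (n.+1%:R^-1 * y^-1))).
    apply/funext => n; rewrite /flat mulr_gt0 ?ltr0n// expr0 mul1r invfM//.
  rewrite -[X in _ --> X]expR0; apply: continuous_cvg; first exact: continuous_expR.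
  rewrite -[X in _ --> X]oppr0; apply: cvgN; rewrite -[X in _ --> X](mul0r y^-1).
  by apply: cvgM; [exact: (@cvg_harmonic R)|exact: cvg_cst].
case/andP: xab => ax xb.
have -> : (true%:R : R) = 1 * 1 by rewrite mulr1.
under eq_cvg do rewrite bumpE.
by apply: cvgM; apply: key; rewrite subr_gt0.
Qed.

End SmoothFunctions.

(** * Borel sets and bounded sets of the plane *)

Section PlaneTopology.
Context (R : realType).
Implicit Types (x h : R * R) (f g : R * R -> R).

(** The measurable sets of the plane are generated by products, not by open sets; an open set is the
    countable union of the rational squares that it contains. *)
Lemma open_measurable2 (U : set (R * R)) : open U -> measurable U.
Proof.
move=> oU.
pose B (p q r : rat) : set (R * R) := ball (ratr p : R) (ratr r) `*` ball (ratr q : R) (ratr r).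
have -> : U = \bigcup_p \bigcup_q \bigcup_r
    (if `[< B p q r `<=` U >] then B p q r else set0).
  apply/seteqP; split; last first.
    by move=> x [p _] [q _] [r _]; case: asboolP => // BU; exact: BU.
  move=> x Ux.
  have /nbhs_ballP[e/= e0 eU] : nbhs x U by exact: open_nbhs_nbhs.
  have [r re] : exists r : rat, (0 < ratr r :> R) && (ratr r < e / 2).
    have e20 : 0 < e / 2 by rewrite divr_gt0.
    by have [r] := rat_in_itvoo e20; rewrite in_itv/= => h; exists r.
  case/andP: re => r0 re.
  have [p] : exists p : rat, `|x.1 - ratr p| < ratr r.
    have h : x.1 < x.1 + ratr r by rewrite ltrDl.
    have [p] := rat_in_itvoo h; rewrite in_itv/= => /andP[h1 h2].
    by exists p; rewrite distrC ger0_norm; lra.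
  have [q] : exists q : rat, `|x.2 - ratr q| < ratr r.
    have h : x.2 < x.2 + ratr r by rewrite ltrDl.
    have [q] := rat_in_itvoo h; rewrite in_itv/= => /andP[h1 h2].
    by exists q; rewrite distrC ger0_norm; lra.
  move=> hq hp; exists p => //; exists q => //; exists r => //.
  case: asboolP => [_|].
    by split; rewrite /ball/= distrC.
  case=> y [/= h1 h2]; apply: eU; move: h1 h2; rewrite /ball/= => h1 h2.
  split; rewrite /ball/=.
    rewrite (_ : x.1 - y.1 = (x.1 - ratr p) + (ratr p - y.1)); last by ring.
    by apply: le_lt_trans (ler_normD _ _) _; lra.
  rewrite (_ : x.2 - y.2 = (x.2 - ratr q) + (ratr q - y.2)); last by ring.
  by apply: le_lt_trans (ler_normD _ _) _; lra.
apply: bigcupT_measurable_rat => p; apply: bigcupT_measurable_rat => q.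
apply: bigcupT_measurable_rat => r; case: ifP => // _.
by apply: measurableX; exact: measurable_ball.
Qed.

Lemma closed_measurable2 (U : set (R * R)) : closed U -> measurable U.
Proof. by move/closed_openC/open_measurable2/measurableC; rewrite setCK. Qed.

Lemma hausdorff2 : hausdorff_space (R * R)%type.
Proof. exact: norm_hausdorff. Qed.

Lemma compact_measurable2 (U : set (R * R)) : compact U -> measurable U.
Proof. by move/(compact_closed hausdorff2); exact: closed_measurable2. Qed.

Lemma continuous_measurable2 f : continuous f -> measurable_fun setT f.
Proof.
move=> cf; apply: (measurability _ (RGenOInfty.measurableE R)) => //.
move=> /= _ [_ [a ->] <-]; rewrite setTI; apply: open_measurable2.
by apply: open_comp; [move=> x _; exact: cf|exact: interval_open].
Qed.

Definition box (r : R) : set (R * R) := `[- r, r] `*` `[- r, r].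

Lemma boxP r x : box r x <-> (`|x.1| <= r /\ `|x.2| <= r).
Proof. by rewrite /box /= !in_itv/= !ler_norml; split => -[]. Qed.

Lemma box_measurable r : measurable (box r).
Proof. by apply: measurableX; exact: measurable_itv. Qed.

Lemma leb1_itv (a b : R) : a <= b -> leb1 R `[a, b] = (b - a)%:E.
Proof.
rewrite /leb1 lebesgue_measure_itv/= lte_fin; case: ltP => // ba ab.
by have -> : b = a; [apply/eqP; rewrite eq_le ba ab|rewrite subrr].
Qed.

Lemma leb2_box r : 0 <= r -> leb2 R (box r) = (4 * r ^+ 2)%:E.
Proof.
move=> r0; have rr : - r <= r by lra.
rewrite leb2X ?measurable_itv// (leb1_itv rr).
by rewrite -EFinM; congr EFin; ring.
Qed.

Lemma compact_box (S : set (R * R)) : compact S -> exists2 r, 0 < r & S `<=` box r.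
Proof.
move=> /compact_bounded[M [_ hM]].
exists (`|M| + 1); first by rewrite ltr_wpDl.
move=> x Sx; have := hM (`|M| + 1); rewrite (le_lt_trans (ler_norm M)) ?ltrDl//.
move=> /(_ isT _ Sx) /=; rewrite prod_normE/= ge_max => /andP[h1 h2].
exact/boxP.
Qed.

Lemma L2_indic (A : set (R * R)) : measurable A -> (leb2 R A < +oo)%E ->
  L2 (leb2 R) \1_A.
Proof.
move=> mA Aoo; split; first exact: measurable_indic.
under eq_integral do rewrite expr2 -[_ * _]/((\1_A \* \1_A) _) -indicI setIid.
by rewrite integral_indic// setIT.
Qed.

Lemma L2_box r : 0 <= r -> L2 (leb2 R) (\1_(box r)).
Proof. by move=> r0; apply: L2_indic; [exact: box_measurable|rewrite leb2_box// ltry]. Qed.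

Lemma L2_bounded_box f (K r : R) : measurable_fun setT f -> 0 <= K -> 0 <= r ->
  (forall x, `|f x| <= K * \1_(box r) x) -> L2 (leb2 R) f.
Proof.
move=> mf K0 r0 hf; apply: (L2_le mf _ (L2Z K (L2_box r0))) => x.
by rewrite [leRHS]ger0_norm// mulr_ge0.
Qed.

End PlaneTopology.

(** * Test functions of two variables *)

Section TestFunctions.
Context (R : realType).
Implicit Types (x h : R * R) (f g p q : R * R -> R).
Local Notation e1 := (e1 R).
Local Notation e2 := (e2 R).

Lemma quotient_e1 f x (t : R) :
  (f \o shift x) (t *: e1) = ((fun s => f (s, x.2)) \o shift x.1) (t *: 1).
Proof.
rewrite /= /shift /= /e1; congr (f _); apply/pair_equal_spec; split => //=.
by rewrite scaler0 add0r.
Qed.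

Lemma quotient_e2 f x (t : R) :
  (f \o shift x) (t *: e2) = ((fun s => f (x.1, s)) \o shift x.2) (t *: 1).
Proof.
rewrite /= /shift /= /e2; congr (f _); apply/pair_equal_spec; split => //=.
by rewrite scaler0 add0r.
Qed.

Lemma derivable_e1 f x :
  derivable f x e1 = derivable (fun s : R => f (s, x.2)) x.1 (1 : R).
Proof.
rewrite /derivable (_ : (fun t => t^-1 *: ((f \o shift x) (t *: e1) - f x)) =
  (fun t => t^-1 *: (((fun s => f (s, x.2)) \o shift x.1) (t *: 1) - f (x.1, x.2))))//.
by apply/funext => t; rewrite quotient_e1 -surjective_pairing.
Qed.

Lemma derivable_e2 f x :
  derivable f x e2 = derivable (fun s : R => f (x.1, s)) x.2 (1 : R).
Proof.
rewrite /derivable (_ : (fun t => t^-1 *: ((f \o shift x) (t *: e2) - f x)) =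
  (fun t => t^-1 *: (((fun s => f (x.1, s)) \o shift x.2) (t *: 1) - f (x.1, x.2))))//.
by apply/funext => t; rewrite quotient_e2 -surjective_pairing.
Qed.

Lemma derive_e1 f x : 'D_e1 f x = 'D_(1 : R) (fun s : R => f (s, x.2)) x.1.
Proof.
rewrite /derive (_ : (fun t => t^-1 *: ((f \o shift x) (t *: e1) - f x)) =
  (fun t => t^-1 *: (((fun s => f (s, x.2)) \o shift x.1) (t *: 1) - f (x.1, x.2))))//.
by apply/funext => t; rewrite quotient_e1 -surjective_pairing.
Qed.

Lemma derive_e2 f x : 'D_e2 f x = 'D_(1 : R) (fun s : R => f (x.1, s)) x.2.
Proof.
rewrite /derive (_ : (fun t => t^-1 *: ((f \o shift x) (t *: e2) - f x)) =
  (fun t => t^-1 *: (((fun s => f (x.1, s)) \o shift x.2) (t *: 1) - f (x.1, x.2))))//.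
by apply/funext => t; rewrite quotient_e2 -surjective_pairing.
Qed.

Lemma Ck_tensor k (f g : R -> R) : smooth f -> smooth g ->
  Ck k (fun x => f x.1 * g x.2).
Proof.
have cts (f0 g0 : R -> R) : continuous f0 -> continuous g0 ->
    continuous (fun x : R * R => f0 x.1 * g0 x.2).
  move=> cf cg x; apply: cvgM.
    by apply: (@continuous_comp _ _ _ fst f0); [exact: cvg_fst|exact: cf].
  by apply: (@continuous_comp _ _ _ snd g0); [exact: cvg_snd|exact: cg].
suff gen : forall f g : R -> R, C1k k f -> C1k k g -> Ck k (fun x => f x.1 * g x.2).
  by move=> sf sg; exact: gen.
elim: k => [|k IH] {}f {}g hf hg; have [cf hf'] := hf; have [cg hg'] := hg.
  by split => //; exact: cts.
have [f' df Cf'] := hf'; have [g' dg Cg'] := hg'.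
have d1 x : is_derive x.1 (1 : R) (fun s : R => f s * g x.2) (f' x.1 * g x.2).
  have /is_derive_eq := is_deriveM (df x.1) (is_derive_cst (g x.2) x.1 (1 : R)); apply.
  by rewrite scaler0 add0r /GRing.scale/= mulrC.
have d2 x : is_derive x.2 (1 : R) (fun s : R => f x.1 * g s) (f x.1 * g' x.2).
  have /is_derive_eq := is_deriveM (is_derive_cst (f x.1) x.2 (1 : R)) (dg x.2); apply.
  by rewrite scaler0 addr0 /GRing.scale/=.
split; first exact: cts.
split; first by move=> x; rewrite derivable_e1 derivable_e2; split; [case: (d1 x)|case: (d2 x)].
split.
  rewrite (_ : (fun x => _) = (fun x => f' x.1 * g x.2)).
    by apply: IH => //; exact: C1kW.
  by apply/funext => x; rewrite derive_e1; case: (d1 x).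
rewrite (_ : (fun x => _) = (fun x => f x.1 * g' x.2)).
  by apply: IH => //; exact: C1kW.
by apply/funext => x; rewrite derive_e2; case: (d2 x).
Qed.

Lemma derive_lin f g (c : R) x v : derivable f x v -> derivable g x v ->
  derivable (fun y => f y + c * g y) x v /\
  'D_v (fun y => f y + c * g y) x = 'D_v f x + c * 'D_v g x.
Proof.
move=> df dg.
have := is_deriveD (derivableP df) (is_deriveZ c (derivableP dg)).
by case => d1 <-; split.
Qed.

Lemma Ck_lin k f g (c : R) : Ck k f -> Ck k g -> Ck k (fun x => f x + c * g x).
Proof.
have cts f0 g0 : continuous f0 -> continuous g0 ->
    continuous (fun x => f0 x + c * g0 x).
  move=> cf cg x; apply: cvgD; first exact: cf.
  by apply: cvgM; [exact: cvg_cst|exact: cg].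
elim: k f g => [|k IH] f g [cf hf] [cg hg]; first by split => //; exact: cts.
split; first exact: cts.
have [df [hf1 hf2]] := hf; have [dg [hg1 hg2]] := hg.
split.
  move=> x; split.
    by have [] := derive_lin c (df x).1 (dg x).1.
  by have [] := derive_lin c (df x).2 (dg x).2.
split.
  rewrite (_ : (fun x => _) = (fun x => 'D_e1 f x + c * 'D_e1 g x)); first exact: IH.
  by apply/funext => x; have [] := derive_lin c (df x).1 (dg x).1.
rewrite (_ : (fun x => _) = (fun x => 'D_e2 f x + c * 'D_e2 g x)); first exact: IH.
by apply/funext => x; have [] := derive_lin c (df x).2 (dg x).2.
Qed.

Lemma derivable_shift f x h v :
  derivable (fun y => f (y + h)) x v = derivable f (x + h) v.
Proof.
rewrite /derivable (_ : (fun t => t^-1 *: (((fun y => f (y + h)) \o shift x) (t *: v) - f (x + h))) =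
  (fun t => t^-1 *: ((f \o shift (x + h)) (t *: v) - f (x + h))))//.
by apply/funext => t /=; rewrite /shift /= addrA.
Qed.

Lemma derive_shift f x h v :
  'D_v (fun y => f (y + h)) x = 'D_v f (x + h).
Proof.
rewrite /derive (_ : (fun t => t^-1 *: (((fun y => f (y + h)) \o shift x) (t *: v) - f (x + h))) =
  (fun t => t^-1 *: ((f \o shift (x + h)) (t *: v) - f (x + h))))//.
by apply/funext => t /=; rewrite /shift /= addrA.
Qed.

Lemma Ck_shift k f h : Ck k f -> Ck k (fun x => f (x + h)).
Proof.
have cts f0 : continuous f0 -> continuous (fun x => f0 (x + h)).
  move=> cf x; apply: (@continuous_comp _ _ _ (fun x => x + h) f0); last exact: cf.
  by apply: cvgD; [exact: cvg_id|exact: cvg_cst].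
elim: k f => [|k IH] f [cf hf]; first by split => //; exact: cts.
split; first exact: cts.
have [df [hf1 hf2]] := hf; split.
  by move=> x; rewrite !derivable_shift.
split.
  rewrite (_ : (fun x => _) = (fun x => 'D_e1 f (x + h))); first exact: (IH (fun x => 'D_e1 f x)).
  by apply/funext => x; rewrite derive_shift.
rewrite (_ : (fun x => _) = (fun x => 'D_e2 f (x + h))); first exact: (IH (fun x => 'D_e2 f x)).
by apply/funext => x; rewrite derive_shift.
Qed.

Lemma test_funS f (r : R) : (forall k, Ck k f) -> (forall x, ~ box r x -> f x = 0) ->
  test_fun f.
Proof.
move=> Cf hr; split => //.
have cb : compact (box r) by apply: compact_setX; exact: segment_compact.
apply: (subclosed_compact _ cb); first exact: closed_closure.
rewrite (_ : box r = closure (box r)).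
  apply: closureS => x /= /eqP fx; apply: contrapT => nb; exact/fx/hr.
by apply/closure_id; exact: compact_closed (@hausdorff2 R) cb.
Qed.

(** Vanishing in a neighbourhood of [x], and not only at [x], is what carries over to the
    derivatives. *)
Lemma test_fun_box f : test_fun f ->
  exists2 r, 0 < r & forall x, ~ box r x -> {near x, f =1 (fun=> 0)}.
Proof.
move=> [Cf /[dup] cS /compact_box[r r0 hr]]; exists r => // x nb.
have : nbhs x (~` closure [set x | f x != 0]).
  apply: open_nbhs_nbhs; split; last by move/hr.
  by apply: closed_openC; exact: closed_closure.
apply: filterS => y ny; apply/eqP; apply: contrapT => /negP fy.
by apply: ny; exact: subset_closure.
Qed.

Lemma test_fun_lin f g (c : R) : test_fun f -> test_fun g ->
  test_fun (fun x => f x + c * g x).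
Proof.
move=> tf tg.
have [r r0 hr] := test_fun_box tf; have [s s0 hs] := test_fun_box tg.
apply: (@test_funS _ (Num.max r s)).
  by move=> k; apply: Ck_lin; [case: tf|case: tg].
move=> x nb.
have h t : t <= Num.max r s -> ~ box t x.
  move=> tm bt; apply: nb; move/boxP : bt => [h1 h2].
  by apply/boxP; split; exact: le_trans tm.
rewrite (nbhs_singleton (hr x (h _ _))) ?le_max ?lexx//.
by rewrite (nbhs_singleton (hs x (h _ _))) ?le_max ?lexx ?orbT// mulr0 addr0.
Qed.

Lemma test_fun0 : test_fun (fun _ : R * R => 0 : R).
Proof.
apply: (@test_funS _ 0) => //; elim => [|k IH]; first by split => // x; exact: cvg_cst.
split; first by move=> x; exact: cvg_cst.
split; first by move=> x; split; exact: derivable_cst.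
split.
  rewrite (_ : (fun x => _) = (fun=> 0)); first exact: IH.
  by apply/funext => x; exact: derive_cst.
rewrite (_ : (fun x => _) = (fun=> 0)); first exact: IH.
by apply/funext => x; exact: derive_cst.
Qed.

Lemma test_fun_shift f h : test_fun f -> test_fun (fun x => f (x + h)).
Proof.
move=> tf; have [r r0 hr] := test_fun_box tf.
apply: (@test_funS _ (r + (`|h.1| + `|h.2|))).
  by move=> k; apply: Ck_shift; case: tf.
move=> x nb; apply: (nbhs_singleton (hr _ _)) => /boxP[/= h1 h2]; apply: nb; apply/boxP.
have a1 := ler_normD (x.1 + h.1) (- h.1); have a2 := ler_normD (x.2 + h.2) (- h.2).
move: a1 a2; rewrite !addrK !normrN.
have := normr_ge0 h.1; have := normr_ge0 h.2; lra.
Qed.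

Lemma test_fun_bump (a b c d : R) n :
  test_fun (fun x : R * R => bump a b n x.1 * bump c d n x.2).
Proof.
apply: (@test_funS _ (`|a| + `|b| + `|c| + `|d|)).
  by move=> k; apply: Ck_tensor; exact: bump_smooth.
move=> x nb; have [h1|/bump_out ->] := boolP (a < x.1 < b); last by rewrite mul0r.
have [h2|/bump_out ->] := boolP (c < x.2 < d); last by rewrite mulr0.
exfalso; apply: nb; apply/boxP; rewrite !ler_norml.
have := ler_norm b; have := ler_norm d; have := ler_norm (- a); have := ler_norm (- c).
rewrite !normrN; move/andP : h1 => [? ?]; move/andP : h2 => [? ?].
have := normr_ge0 a; have := normr_ge0 b; have := normr_ge0 c; have := normr_ge0 d.
by split; apply/andP; split; lra.
Qed.

End TestFunctions.

(** * Taylor expansion of test functions *)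

Section Taylor.
Context (R : realType).
Implicit Types (x h : R * R) (f g p : R * R -> R).
Local Notation e1 := (e1 R).
Local Notation e2 := (e2 R).

Lemma test_fun_continuous p : test_fun p -> continuous p.
Proof. by move=> [/(_ 0%N)[]]. Qed.

Lemma test_fun_measurable p : test_fun p -> measurable_fun setT p.
Proof. by move=> /test_fun_continuous; exact: continuous_measurable2. Qed.

Lemma test_fun_D1 p : test_fun p -> test_fun (fun x => 'D_e1 p x).
Proof.
move=> tp; have [r r0 hr] := test_fun_box tp; apply: (@test_funS _ _ r).
  by move=> k; have [/(_ k.+1)[_ [_ []]]] := tp.
move=> x nb; rewrite (near_eq_derive _ (hr x nb)); exact: derive_cst.
Qed.

Lemma test_fun_D2 p : test_fun p -> test_fun (fun x => 'D_e2 p x).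
Proof.
move=> tp; have [r r0 hr] := test_fun_box tp; apply: (@test_funS _ _ r).
  by move=> k; have [/(_ k.+1)[_ [_ []]]] := tp.
move=> x nb; rewrite (near_eq_derive _ (hr x nb)); exact: derive_cst.
Qed.

Lemma test_fun_bounded p : test_fun p ->
  exists K r, [/\ 0 < K, 0 < r & forall x, `|p x| <= K * \1_(box r) x].
Proof.
move=> tp; have [r r0 hr] := test_fun_box tp.
have cb : compact (box r) by apply: compact_setX; exact: segment_compact.
have : compact (p @` box r).
  apply: continuous_compact => //; apply: continuous_subspaceT.
  exact: test_fun_continuous.
move=> /compact_bounded[M [_ hM]].
exists (`|M| + 1), r; split; [by rewrite ltr_wpDl|by []|].
move=> x; rewrite indicE; have [bx|bx] := boolP (x \in box r).
  rewrite mulr1; have := hM (`|M| + 1); rewrite (le_lt_trans (ler_norm M)) ?ltrDl//.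
  by move=> /(_ isT (p x)); apply; exists x => //; exact: set_mem.
rewrite mulr0 (nbhs_singleton (hr x _)) ?normr0//.
by move=> /mem_set; apply/negP.
Qed.

Lemma test_fun_L2 p : test_fun p -> L2 (leb2 R) p.
Proof.
move=> tp; have [K [r [K0 r0 h]]] := test_fun_bounded tp.
exact: (L2_bounded_box (test_fun_measurable tp) (ltW K0) (ltW r0) h).
Qed.

Lemma mean_value (f df : R -> R) (a b : R) :
  (forall x : R, is_derive x (1 : R) f (df x)) ->
  exists c, `|c - a| <= `|b - a| /\ f b - f a = df c * (b - a).
Proof.
move=> hf.
have cf (i : interval R) : {within [set` i], continuous f}.
  by apply: derivable_within_continuous => t _; case: (hf t).
have [ab|ba] := leP a b.
  have [c cab ->] := MVT_segment ab (fun t _ => hf t) (cf _).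
  exists c; split => //; move: cab; rewrite in_itv/= => /andP[h1 h2].
  by rewrite !ger0_norm ?subr_ge0// lerD2r.
have [c cab e] := MVT_segment (ltW ba) (fun t _ => hf t) (cf _).
exists c; split; last by rewrite -opprB e -mulrN opprB.
move: cab; rewrite in_itv/= => /andP[h1 h2].
by rewrite !ler0_norm ?subr_le0 ?(ltW ba)// lerN2 lerD2r.
Qed.

Lemma is_derive_e1 p x : test_fun p ->
  is_derive x.1 (1 : R) (fun s : R => p (s, x.2)) ('D_e1 p x).
Proof.
move=> [/(_ 1%N)[_ [/(_ x)[dp _] _]] _]; move: (dp).
by rewrite derivable_e1 derive_e1 => d; exact: derivableP.
Qed.

Lemma is_derive_e2 p x : test_fun p ->
  is_derive x.2 (1 : R) (fun s : R => p (x.1, s)) ('D_e2 p x).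
Proof.
move=> [/(_ 1%N)[_ [/(_ x)[_ dp] _]] _]; move: (dp).
by rewrite derivable_e2 derive_e2 => d; exact: derivableP.
Qed.

Lemma mean_value1 p (a b y : R) : test_fun p -> exists c,
  `|c - a| <= `|b - a| /\ p (b, y) - p (a, y) = 'D_e1 p (c, y) * (b - a).
Proof.
move=> tp; apply: (@mean_value (fun s => p (s, y)) (fun s => 'D_e1 p (s, y))).
by move=> x; exact: (is_derive_e1 (x, y)).
Qed.

Lemma mean_value2 p (a b y : R) : test_fun p -> exists c,
  `|c - a| <= `|b - a| /\ p (y, b) - p (y, a) = 'D_e2 p (y, c) * (b - a).
Proof.
move=> tp; apply: (@mean_value (fun s => p (y, s)) (fun s => 'D_e2 p (y, s))).
by move=> x; exact: (is_derive_e2 (y, x)).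
Qed.

Lemma indic_le1 (A : set (R * R)) x : 0 <= (\1_A x : R) <= 1.
Proof. by rewrite indicE ler0n lern1 leq_b1. Qed.

Lemma test_fun_lipschitz p : test_fun p -> exists2 C, 0 < C &
  forall x h, `|p (x + h) - p x| <= C * (`|h.1| + `|h.2|).
Proof.
move=> tp.
have [K1 [r1 [K10 _ h1]]] := test_fun_bounded (test_fun_D1 tp).
have [K2 [r2 [K20 _ h2]]] := test_fun_bounded (test_fun_D2 tp).
exists (K1 + K2); first by rewrite addr_gt0.
move=> x h.
have [c [_ E1]] := mean_value1 x.1 (x.1 + h.1) (x.2 + h.2) tp.
have [c' [_ E2]] := mean_value2 x.2 (x.2 + h.2) x.1 tp.
have -> : p (x + h) - p x = (p (x.1 + h.1, x.2 + h.2) - p (x.1, x.2 + h.2))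
  + (p (x.1, x.2 + h.2) - p (x.1, x.2)) by rewrite -surjective_pairing addrA subrK.
rewrite E1 E2 (addrC x.1) addrK (addrC x.2) addrK.
apply: le_trans (ler_normD _ _) _; rewrite !normrM mulrDr; apply: lerD.
  apply: ler_wpM2r => //; apply: le_trans (h1 _) _.
  have /andP[_ i1] := indic_le1 (box r1) (c, h.2 + x.2).
  by apply: (@le_trans _ _ (K1 * 1)); [rewrite ler_pM2l|lra].
apply: ler_wpM2r => //; apply: le_trans (h2 _) _.
have /andP[_ i1] := indic_le1 (box r2) (x.1, c').
by apply: (@le_trans _ _ (K2 * 1)); [rewrite ler_pM2l|lra].
Qed.

(** The increment is taken along two sides of a rectangle, with one mean value theorem for each; the
    partial derivatives are Lipschitz because they are test functions themselves. *)
Lemma test_fun_taylor p : test_fun p -> exists C r, [/\ 0 < C, 0 < r &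
  forall x h, `|h.1| <= 1 -> `|h.2| <= 1 ->
  `|p (x + h) - p x - h.1 * 'D_e1 p x - h.2 * 'D_e2 p x|
     <= C * (`|h.1| + `|h.2|) ^+ 2 * \1_(box r) x].
Proof.
move=> tp; have [r r0 hr] := test_fun_box tp.
have [C1 C10 L1] := test_fun_lipschitz (test_fun_D1 tp).
have [C2 C20 L2] := test_fun_lipschitz (test_fun_D2 tp).
(* The box grows by 1 because [x + h] may meet the support of [p] although [x] does not. *)
exists (C1 + C2), (r + 1); split; [by rewrite addr_gt0|by rewrite addr_gt0|].
move=> x h b1 b2; rewrite indicE; have [bx|bx] := boolP (x \in box (r + 1)).
  rewrite mulr1.
  have [c [hc E1]] := mean_value1 x.1 (x.1 + h.1) (x.2 + h.2) tp.
  have [c' [hc' E2]] := mean_value2 x.2 (x.2 + h.2) x.1 tp.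
  have -> : p (x + h) - p x - h.1 * 'D_e1 p x - h.2 * 'D_e2 p x =
   (p (x.1 + h.1, x.2 + h.2) - p (x.1, x.2 + h.2) - h.1 * 'D_e1 p x)
   + (p (x.1, x.2 + h.2) - p (x.1, x.2) - h.2 * 'D_e2 p x).
    by rewrite -surjective_pairing; ring.
  move: hc hc'; rewrite E1 E2 (addrC x.1) addrK (addrC x.2) addrK => hc hc'.
  rewrite -!(mulrC h.1) -!(mulrC h.2) -!mulrBr.
  apply: le_trans (ler_normD _ _) _; rewrite !normrM mulrDl; apply: lerD.
    have := L1 x (c - x.1, h.2); rewrite (_ : x + _ = (c, h.2 + x.2)).
      move=> /= l1; apply: (@le_trans _ _ (`|h.1| * (C1 * (`|h.1| + `|h.2|)))).
        apply: ler_wpM2l => //; apply: le_trans l1 _.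
        by apply: ler_wpM2l; [exact: ltW|rewrite lerD2r].
      rewrite -subr_ge0 (_ : _ - _ = C1 * (`|h.1| + `|h.2|) * `|h.2|); last by ring.
      by rewrite !mulr_ge0// ?addr_ge0// ltW.
    by case: x {hr bx E1 E2 hc hc'} => x1 x2 /=; congr pair; rewrite /=; ring.
  have := L2 x (0, c' - x.2); rewrite (_ : x + _ = (x.1, c')).
    move=> /=; rewrite normr0 add0r => l2; apply: (@le_trans _ _ (`|h.2| * (C2 * `|h.2|))).
      apply: ler_wpM2l => //; apply: le_trans l2 _.
      by apply: ler_wpM2l; [exact: ltW|].
    rewrite -subr_ge0 (_ : _ - _ = C2 * (`|h.1| + 2 * `|h.2|) * `|h.1|); last by ring.
    by rewrite !mulr_ge0// ?addr_ge0// ?mulr_ge0// ltW.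
  by case: x {hr bx E1 E2 hc hc'} => x1 x2 /=; congr pair; rewrite /=; ring.
have nb y : `|(y - x).1| <= 1 -> `|(y - x).2| <= 1 -> ~ box r y.
  move=> d1 d2 /boxP[y1 y2]; move/negP: bx; apply; apply/mem_set/boxP.
  have := ler_normB y.1 (y - x).1; have := ler_normB y.2 (y - x).2.
  rewrite (_ : y.1 - (y - x).1 = x.1); last by rewrite /=; ring.
  rewrite (_ : y.2 - (y - x).2 = x.2); last by rewrite /=; ring.
  by split; lra.
have nbx : ~ box r x by apply: nb; rewrite subrr/= normr0.
have nbh : ~ box r (x + h) by apply: nb; rewrite (addrC x) addrK.
rewrite (nbhs_singleton (hr _ nbx)) (nbhs_singleton (hr _ nbh)).
rewrite !(near_eq_derive _ (hr _ nbx)) !derive_cst.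
by rewrite !mulr0 !subr0 normr0.
Qed.

End Taylor.

(** * Functions orthogonal to all test functions *)

Section DynkinIntegral.
Context d (T : measurableType d) (R : realType) (mu : {measure set T -> \bar R}).
Local Open Scope ereal_scope.

(** Sets whose preimage carries integral zero form a Dynkin system. The factor [C] allows one
    coordinate to be extended at a time: [pr] is one projection and [C] a cylinder over the
    other. *)
Lemma dynkin_integral0 d1 (T1 : measurableType d1) (pr : T -> T1)
    (G : set (set T1)) (C : set T) (v : T -> \bar R) :
  measurable_fun setT pr -> @measurable _ T1 = <<s G >> -> setI_closed G ->
  measurable C -> mu.-integrable setT v -> \int[mu]_(x in C) v x = 0 ->
  (forall A, G A -> \int[mu]_(x in pr @^-1` A `&` C) v x = 0) ->
  forall A, measurable A -> \int[mu]_(x in pr @^-1` A `&` C) v x = 0.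
Proof.
move=> mpr GE GI mC iv C0 G0.
have mp A : measurable A -> measurable (pr @^-1` A).
  by move=> mA; rewrite -[X in measurable X]setTI; exact: mpr.
have mpC A : measurable A -> measurable (pr @^-1` A `&` C).
  by move=> mA; apply: measurableI => //; exact: mp.
have ivS E : measurable E -> mu.-integrable E v.
  by move=> mE; apply: (integrableS measurableT) iv.
move=> A mA; have sA : <<s G >> A by rewrite -GE.
pose P (A : set T1) := \int[mu]_(x in pr @^-1` A `&` C) v x = 0.
apply: (@dynkin_induction _ _ G P GE GI) sA.
- by rewrite /P preimage_setT setTI.
- exact: G0.
- move=> S mS PS; rewrite /P.
  have mCS := measurableC mS.
  have e : C = (pr @^-1` S `&` C) `|` (pr @^-1` (~` S) `&` C).
    by rewrite -setIUl preimage_setC setUv setTI.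
  have := C0; rewrite {1}e integral_setU.
  + by rewrite PS add0e.
  + exact: mpC.
  + exact: mpC.
  + by rewrite -e; exact: measurable_int (ivS _ mC).
  + by apply/disj_setPS => x [[/= ? _] [? _]].
- move=> F mF tF PF; rewrite /P preimage_bigcup setI_bigcupl integral_bigcup.
  + by rewrite eseries0// => i _ _; exact: PF.
  + apply/trivIsetP => i j _ _ ij; have /trivIsetP := tF => /(_ i j I I ij) Fij.
    by rewrite setIACA -preimage_setI Fij preimage_set0 set0I.
  + by move=> k; exact: mpC.
  + by apply: ivS; apply: bigcupT_measurable => k; exact: mpC.
Qed.

End DynkinIntegral.

Section Annihilator.
Context (R : realType).
Implicit Types w : R * R -> R.
Local Notation mu := (leb2 R).

Definition rect (a b c d : R) : set (R * R) := `]a, b[ `*` `]c, d[.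

Lemma rect_measurable a b c d : measurable (rect a b c d).
Proof. by apply: measurableX; exact: measurable_itv. Qed.

Lemma rect_box a b c d : rect a b c d `<=` box (`|a| + `|b| + `|c| + `|d|).
Proof.
move=> x [/=]; rewrite !in_itv/= => /andP[h1 h2] /andP[h3 h4]; apply/boxP.
have := ler_norm b; have := ler_norm d; have := ler_norm (- a); have := ler_norm (- c).
have := normr_ge0 a; have := normr_ge0 b; have := normr_ge0 c; have := normr_ge0 d.
by rewrite !normrN !ler_norml => *; split; apply/andP; split; lra.
Qed.

Lemma L2_rect a b c d : L2 mu \1_(rect a b c d).
Proof.
have r0 : 0 <= `|a| + `|b| + `|c| + `|d| by rewrite !addr_ge0.
apply: (L2_bounded_box _ ler01 r0); first by apply: measurable_indic; exact: rect_measurable.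
move=> x; rewrite mul1r ger0_norm// !indicE ler_nat.
have [/set_mem/rect_box/mem_set ->//|//] := boolP (x \in rect a b c d).
Qed.

Lemma rect_indic a b c d (x : R * R) :
  \1_(rect a b c d) x = \1_(`]a, b[%classic) x.1 * \1_(`]c, d[%classic) x.2 :> R.
Proof.
rewrite !indicE -natrM mulnb; congr (nat_of_bool _)%:R.
by apply/idP/andP => [/set_mem[? ?]|[/set_mem ? /set_mem ?]]; [split; apply/mem_set|apply/mem_set].
Qed.

(** Products of bumps are test functions and converge to the indicator of the rectangle while
    dominated by it. *)
Lemma annihilator_rect w a b c d : L2 mu w ->
  (forall p, test_fun p -> ip mu w p = 0) -> ip mu w \1_(rect a b c d) = 0.
Proof.
move=> lw hw.
pose F n (x : R * R) := w x * (bump a b n x.1 * bump c d n x.2).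
have F0 n : (\int[mu]_x (F n x)%:E = 0)%E.
  have tb := test_fun_bump a b c d n.
  by rewrite -(ipE lw (test_fun_L2 tb)) hw.
have mb n : measurable_fun setT (fun x : R * R => bump a b n x.1 * bump c d n x.2).
  exact: test_fun_measurable (test_fun_bump a b c d n).
have mw := L2_meas lw.
have pw n (x : R * R) :
    (`|(F n x)%:E| <= `|(w x * \1_(rect a b c d) x)%:E|)%E.
  rewrite /F lee_fin !(normrM (w x)); apply: ler_wpM2l => //.
  rewrite (ger0_norm (_ : 0 <= \1_(rect a b c d) x))// rect_indic.
  have /andP[b1 b2] := bump_bound a b n x.1.
  have /andP[b3 b4] := bump_bound c d n x.2.
  rewrite (ger0_norm (mulr_ge0 b1 b3)) !indicE.
  have [xa|xa] := boolP (x.1 \in _); last first.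
    rewrite mul0r bump_out ?mul0r//.
    by apply: contra xa => xa; apply/mem_set; rewrite /= in_itv.
  have [xc|xc] := boolP (x.2 \in _); last first.
    rewrite mulr0 (@bump_out _ c) ?mulr0//.
    by apply: contra xc => xc; apply/mem_set; rewrite /= in_itv.
  by rewrite mulr1; exact: mulr_ile1.
suff : (\int[mu]_x (F n x)%:E)%E @[n --> \oo] --> (\int[mu]_x (w x * \1_(rect a b c d) x)%:E)%E.
  under eq_cvg do rewrite F0.
  move=> h; rewrite /ip; have := cvg_lim (@ereal_hausdorff R) h.
  by rewrite lim_cst// => <-.
apply: (@dominated_cvg _ _ _ _ _ _ (fun n x => (F n x)%:E) _
  (fun x => `|(w x * \1_(rect a b c d) x)%:E|%E)) => //.
- by move=> n; apply/measurable_EFinP; apply: measurable_funM.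
- move=> x _; apply: cvg_EFin; first exact: nearW.
  apply: cvgM; first exact: cvg_cst.
  by rewrite rect_indic; apply: cvgM; exact: bump_cvg.
- exact/integrable_abse/L2_integrable/L2_rect.
Qed.

Lemma setI_rect a b c d a' b' c' d' : rect a b c d `&` rect a' b' c' d' =
  rect (Num.max a a') (Num.min b b') (Num.max c c') (Num.min d d').
Proof.
apply/seteqP; split => x; rewrite /rect/= !in_itv/= !gt_max !lt_min.
  by move=> [[/andP[-> ->] /andP[-> ->]] [/andP[-> ->] /andP[-> ->]]].
by move=> [/andP[/andP[-> ->] /andP[-> ->]] /andP[/andP[-> ->] /andP[-> ->]]].
Qed.

(** On a bounded square [w] is integrable, which it need not be on the plane. Zero integrals pass
    from rectangles to all measurable sets by three Dynkin arguments: in the first coordinate, in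
    the second, and on the product sigma-algebra with [pr] the identity. *)
Lemma annihilator_ae w (N : R) : L2 mu w ->
  (forall p, test_fun p -> ip mu w p = 0) ->
  {ae mu, forall x, rect (- N) N (- N) N x -> w x = 0}.
Proof.
move=> lw hw; set B := rect (- N) N (- N) N.
pose v (x : R * R) := (w x * \1_B x)%:E.
have mB : measurable B by exact: rect_measurable.
have iv : mu.-integrable setT v by exact: L2_integrable lw (L2_rect _ _ _ _).
have vS (E : set (R * R)) : measurable E ->
    (\int[mu]_(x in E) v x = \int[mu]_x (w x * (\1_B x * \1_E x))%:E)%E.
  have pt (x : R * R) : (v \_ E) x = (w x * (\1_B x * \1_E x))%:E.
    rewrite patchE /v (indicE _ E); case: ifP => _; first by rewrite mulr1.
    by rewrite !mulr0.
  by move=> mE; rewrite integral_mkcond; apply: eq_integral => x _; exact: pt.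
have ivS E : measurable E -> mu.-integrable E v.
  by move=> mE; apply: (integrableS measurableT) iv.
have r0 a b c d : (\int[mu]_(x in rect a b c d) v x = 0)%E.
  rewrite vS; last exact: rect_measurable.
  under eq_integral do rewrite -[_ * \1_(rect _ _ _ _) _]/((\1_B \* \1_(rect a b c d)) _) -indicI setI_rect.
  by rewrite -ipE//; [rewrite annihilator_rect|exact: L2_rect].
pose G := [set A : set R | exists x y, A = `]x, y[%classic].
have GE : @measurable _ R = <<s G >>.
  exact: RGenOpens.measurableE.
have GI : setI_closed G.
  move=> _ _ [a [b ->]] [c [d ->]]; exists (Num.max a c), (Num.min b d).
  apply/seteqP; split => x; rewrite /= !in_itv/= gt_max lt_min.
    by move=> [/andP[-> ->] /andP[-> ->]].
  by move=> /andP[/andP[-> ->] /andP[-> ->]].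
have BE (E : set (R * R)) : measurable E ->
    (\int[mu]_(x in E) v x = \int[mu]_(x in E `&` B) v x)%E.
  move=> mE; rewrite !vS//; last exact: measurableI.
  have pt (x : R * R) : (\1_B x * \1_E x : R) = \1_B x * \1_(E `&` B) x.
    by rewrite !indicE in_setI; case: (x \in E); case: (x \in B); rewrite /= ?mulr1 ?mulr0.
  by apply: eq_integral => x _; rewrite pt.
have prE a b (A : set R) : fst @^-1` A `&` snd @^-1` `]a, b[ = A `*` `]a, b[%classic.
  by apply/seteqP; split => x [].
have step1 a b (A : set R) : measurable A ->
    (\int[mu]_(x in fst @^-1` A `&` snd @^-1` `]a, b[) v x = 0)%E.
  have ms : measurable (@snd R R @^-1` `]a, b[).
    by rewrite -[X in measurable X]setTI; apply: measurable_snd => //; exact: measurable_itv.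
  move=> mA; apply: (dynkin_integral0 measurable_fst GE GI ms iv _ _ mA).
    rewrite BE// (_ : _ `&` B = rect (- N) N (Num.max a (- N)) (Num.min b N)) ?r0//.
    apply/seteqP; split => x; rewrite /B /rect/= !in_itv/= !gt_max !lt_min.
      by move=> [/andP[-> ->] [-> /andP[-> ->]]].
    by move=> [-> /andP[/andP[-> ->] /andP[-> ->]]].
  by move=> _ [c [d ->]]; rewrite prE; exact: r0.
have step2 (A C : set R) : measurable A -> measurable C ->
    (\int[mu]_(x in snd @^-1` C `&` fst @^-1` A) v x = 0)%E.
  move=> mA mC.
  have ms : measurable (@fst R R @^-1` A).
    by rewrite -[X in measurable X]setTI; apply: measurable_fst.
  apply: (dynkin_integral0 measurable_snd GE GI ms iv _ _ mC).
    rewrite BE// -(step1 (- N) N _ mA) [in RHS]BE; last first.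
      apply: measurableI => //.
      by rewrite -[X in measurable X]setTI; apply: measurable_snd => //; exact: measurable_itv.
    congr (integral mu _ _); apply/seteqP; split => x.
      by move=> [Ax Bx]; split => //; split => //; case: Bx.
    by move=> [[Ax _] Bx].
  by move=> _ [c [d ->]]; rewrite setIC; exact: step1.
have step3 (E : set (R * R)) : measurable E -> (\int[mu]_(x in E) v x = 0)%E.
  move=> mE; rewrite -[E]setIT -[X in X `&` _](_ : id @^-1` E = E)//.
  apply: (@dynkin_integral0 _ _ _ _ _ _ id _ _ _ _ (@measurable_prod_measurableType _ _ R R)) => //.
  - move=> _ _ [A mA [C mC <-]] [A' mA' [C' mC' <-]].
    exists (A `&` A'); first exact: measurableI.
    by exists (C `&` C'); [exact: measurableI|rewrite setXI].
  - by have := step2 _ _ (@measurableT _ R) (@measurableT _ R); rewrite !preimage_setT setTI.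
  - move=> _ [A mA [C mC <-]]; rewrite setIT.
    rewrite -(step2 _ _ mA mC); congr (integral mu _ _).
    by apply/seteqP; split => x [].
have : ae_eq mu setT v (cst 0%E).
  by apply: integral_ae_eq => // E _ mE; rewrite step3// integral0.
apply: filterS => x /(_ I); rewrite /v indicE => h Bx.
by move: h; rewrite mem_set// mulr1 => -[].
Qed.

Lemma L2_annihilator w : L2 mu w ->
  (forall p, test_fun p -> ip mu w p = 0) -> ip mu w w = 0.
Proof.
move=> lw hw.
have : {ae mu, forall x, w x = 0}.
  have := ae_foralln (fun n => annihilator_ae n%:R lw hw).
  apply: filterS => x hx.
  pose n := Num.bound (`|x.1| + `|x.2|).
  apply: (hx n.+1); have := archi_boundP (addr_ge0 (normr_ge0 x.1) (normr_ge0 x.2)).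
  rewrite -/n => hn.
  have b1 : `|x.1| < n.+1%:R by rewrite -natr1; have := normr_ge0 x.2; lra.
  have b2 : `|x.2| < n.+1%:R by rewrite -natr1; have := normr_ge0 x.1; lra.
  by split; rewrite /= in_itv/= -ltr_norml.
move=> w0; rewrite /ip (_ : integral _ _ _ = 0%E)//.
rewrite (@ge0_ae_eq_integral _ _ _ _ _ _ (cst 0%E)) ?integral0//.
- by have mw := L2_meas lw; apply/measurable_EFinP; mfun.
- by move=> x _; rewrite lee_fin -expr2 sqr_ge0.
- by apply: filterS w0 => x -> _; rewrite mul0r.
Qed.

(** Density of test functions in dual form: Riesz represents the functionals [ip mu g1] and
    [ip mu g2] by a pair of norm at most [M], and this pair can differ from the given one only by
    functions orthogonal to all test functions, hence null. *)
Lemma L2_dual_pair (g1 g2 : R * R -> R) (M : R) : L2 mu g1 -> L2 mu g2 -> 0 <= M ->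
  (forall p q, test_fun p -> test_fun q ->
    (ip mu g1 p + ip mu g2 q) ^+ 2 <= M * (ip mu p p + ip mu q q)) ->
  ip mu g1 g1 + ip mu g2 g2 <= M.
Proof.
move=> l1 l2 M0 h.
have [|||||||] := @riesz_pair _ _ R mu (@test_fun R) (ip mu g1) (ip mu g2) M.
- by move=> p /test_fun_L2.
- exact: test_fun0.
- by move=> c p q; exact: test_fun_lin.
- move=> c p q /test_fun_L2 lp /test_fun_L2 lq.
  by rewrite ipDr// ?ipZr//; exact: L2Z.
- move=> c p q /test_fun_L2 lp /test_fun_L2 lq.
  by rewrite ipDr// ?ipZr//; exact: L2Z.
- by [].
- exact: h.
- move=> k1 [k2 [lk1 lk2 kM kE]].
  have eqn (g k : R * R -> R) : L2 mu g -> L2 mu k ->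
      (forall p, test_fun p -> ip mu k p = ip mu g p) -> ip mu g g = ip mu k k.
    move=> lg lk gk; have lgk := L2B lg lk.
    have n0 : ip mu (fun x => g x - k x) (fun x => g x - k x) = 0.
      apply: L2_annihilator => // p tp; have lp := test_fun_L2 tp.
      by rewrite ipBl// gk// subrr.
    have k0 : ip mu k (fun x => g x - k x) = 0.
      have := ip_CS lk lgk; rewrite n0 mulr0 => le0.
      by apply/eqP; rewrite -sqrf_eq0 eq_le le0 sqr_ge0.
    have := ipD_sqr lk lgk; rewrite n0 k0.
    rewrite (_ : (fun x => k x + (g x - k x)) = g); first by move=> ->; ring.
    by apply/funext => x; ring.
  by rewrite (eqn g1 k1)// ?(eqn g2 k2)// => p /kE[].
Qed.

Lemma L2_dual (w : R * R -> R) (M : R) : L2 mu w -> 0 <= M ->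
  (forall p, test_fun p -> ip mu w p ^+ 2 <= M * ip mu p p) -> ip mu w w <= M.
Proof.
move=> lw M0 h; have z p : ip mu (fun=> 0) p = 0.
  by rewrite /ip; under eq_integral do rewrite mul0r; rewrite integral0.
have := @L2_dual_pair w (fun=> 0) M lw (L2_0 _) M0; rewrite z addr0; apply.
move=> p q tp tq; rewrite z addr0; apply: le_trans (h _ tp) _.
by apply: ler_wpM2l => //; rewrite lerDl ip_ge0.
Qed.

End Annihilator.

(** * Translations and weak gradients *)

Section Translations.
Context (R : realType).
Local Notation mu := (leb2 R).
Implicit Types (f g p : R * R -> R) (h x : R * R).

Lemma preserves_measurable s f : preserves s -> measurable_fun setT f ->
  measurable_fun setT (fun x => f (s x)).
Proof. by move=> [ms _] mf; exact: measurableT_comp. Qed.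

Lemma preserves_integral s f : preserves s -> measurable_fun setT f ->
  (\int[mu]_x (f (s x))%:E = \int[mu]_x (f x)%:E)%E.
Proof.
move=> [ms hs] mf; rewrite [LHS]integralE [RHS]integralE.
have mE : measurable_fun setT (EFin \o f) by exact/measurable_EFinP.
congr (_ - _)%E.
  rewrite -[RHS](hs _ (measurable_funepos mE) (funepos_ge0 _)).
  by apply: eq_integral => x _; rewrite !funeposE.
rewrite -[RHS](hs _ (measurable_funeneg mE) (funeneg_ge0 _)).
by apply: eq_integral => x _; rewrite !funenegE.
Qed.

Lemma preserves_ip s f g : preserves s -> measurable_fun setT f ->
  measurable_fun setT g ->
  ip mu (fun x => f (s x)) (fun x => g (s x)) = ip mu f g.
Proof.
move=> ps mf mg; rewrite /ip.
by rewrite (preserves_integral (f := fun x => f x * g x) ps)//; mfun.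
Qed.

Lemma preserves_L2 s f : preserves s -> L2 mu f -> L2 mu (fun x => f (s x)).
Proof.
move=> ps [mf foo]; split; first exact: preserves_measurable.
by rewrite (preserves_integral (f := fun x => f x ^+ 2) ps)//; mfun.
Qed.

Definition tau h f : R * R -> R := fun x => f (x + h).

Lemma tau_L2 h f : L2 mu f -> L2 mu (tau h f).
Proof. exact: preserves_L2 (preserves_shift h). Qed.

Lemma tau_ip h f g : measurable_fun setT f -> measurable_fun setT g ->
  ip mu (tau h f) (tau h g) = ip mu f g.
Proof. exact: preserves_ip (preserves_shift h). Qed.

Lemma tau_ip_adj h f g : measurable_fun setT f -> measurable_fun setT g ->
  ip mu (tau h f) g = ip mu f (tau (- h) g).
Proof.
move=> mf mg.
rewrite -[RHS](tau_ip h)//; last exact: preserves_measurable (preserves_shift (- h)) mg.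
by congr (ip mu); apply/funext => x; rewrite /tau addrK.
Qed.

(** The real, square-integrable form of the weak gradient, written with [ip]; [weakg_partial] and
    [partial_weakg] translate to and from [weak_partial]. *)
Definition weakg f g1 g2 := [/\ L2 mu f, L2 mu g1, L2 mu g2 &
  forall p, test_fun p ->
    ip mu f (fun x => 'D_(e1 R) p x) = - ip mu g1 p /\
    ip mu f (fun x => 'D_(e2 R) p x) = - ip mu g2 p].

Lemma weakg_tau h f g1 g2 : weakg f g1 g2 ->
  weakg (tau h f) (tau h g1) (tau h g2).
Proof.
move=> [lf l1 l2 hw]; split; [exact: tau_L2|exact: tau_L2|exact: tau_L2|].
move=> p tp; have tp' := test_fun_shift (- h) tp; have [h1 h2] := hw _ tp'.
have mf := L2_meas lf; have m1 := L2_meas l1; have m2 := L2_meas l2.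
have mp := test_fun_measurable tp.
rewrite (tau_ip_adj h mf (test_fun_measurable (test_fun_D1 tp))).
rewrite (tau_ip_adj h mf (test_fun_measurable (test_fun_D2 tp))).
rewrite (tau_ip_adj h m1 mp) (tau_ip_adj h m2 mp) -h1 -h2.
by split; congr (ip mu f); apply/funext => x; rewrite derive_shift.
Qed.

Definition dirg h g1 g2 : R * R -> R := fun x => h.1 * g1 x + h.2 * g2 x.

Lemma dirg_L2 h g1 g2 : L2 mu g1 -> L2 mu g2 -> L2 mu (dirg h g1 g2).
Proof. by move=> l1 l2; apply: L2D; exact: L2Z. Qed.

(** The shift is moved onto the test function, where Taylor's formula applies; [f] itself is only
    square integrable, and [C] does not depend on it. *)
Lemma tau_taylor p : test_fun p -> exists2 C, 0 < C & forall f h,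
  L2 mu f -> `|h.1| <= 1 -> `|h.2| <= 1 ->
  `|ip mu (tau h f) p - ip mu f p
    + (h.1 * ip mu f (fun x => 'D_(e1 R) p x) + h.2 * ip mu f (fun x => 'D_(e2 R) p x))|
    <= Num.sqrt (ip mu f f) * (C * (`|h.1| + `|h.2|) ^+ 2).
Proof.
move=> tp; have [C [r [C0 r0 hT]]] := test_fun_taylor tp.
have lb := L2_box (ltW r0).
pose B := Num.sqrt (ip mu \1_(box r) \1_(box r)).
exists (C * (B + 1)); first by rewrite mulr_gt0// ltr_wpDl// sqrtr_ge0.
move=> f h lf b1 b2.
have lp := test_fun_L2 tp.
have ld1 := test_fun_L2 (test_fun_D1 tp); have ld2 := test_fun_L2 (test_fun_D2 tp).
have mf := L2_meas lf; have mp := L2_meas lp.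
have ltp := tau_L2 (- h) lp.
pose e := fun x => tau (- h) p x - p x + h.1 * 'D_(e1 R) p x + h.2 * 'D_(e2 R) p x.
have lB := L2B ltp lp; have lZ1 := L2Z h.1 ld1; have lZ2 := L2Z h.2 ld2.
have lD := L2D lB lZ1; have le : L2 mu e := L2D lD lZ2.
set lhs := (X in `|X|); have {lhs} -> : lhs = ip mu f e.
  rewrite /lhs (tau_ip_adj h mf mp) /e (ipDr lD lZ2 lf) (ipDr lB lZ1 lf).
  rewrite (ipC mu f (fun x => _ - _)) (ipBl ltp lp lf) (ipZr _ ld1 lf) (ipZr _ ld2 lf).
  rewrite (ipC mu p f) (ipC mu (tau (- h) p) f).
  move: (ip mu f (tau (- h) p)) (ip mu f p) (ip mu f (fun x => 'D_(e1 R) p x)).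
  by move: (ip mu f (fun x => 'D_(e2 R) p x)) => d c a b; ring.
have eb x : `|e x| <= C * (`|h.1| + `|h.2|) ^+ 2 * \1_(box r) x.
  have := hT x (- h); rewrite /= !normrN => /(_ b1 b2).
  by rewrite !mulNr !opprK.
set H := `|h.1| + `|h.2| in eb *.
have H0 : 0 <= C * H ^+ 2 by rewrite mulr_ge0// ?(ltW C0)// exprn_ge0// addr_ge0.
have ee : ip mu e e <= (C * H ^+ 2) ^+ 2 * ip mu \1_(box r) \1_(box r).
  rewrite -lee_fin EFinM !ip_sqr// -integralZ_ge0; last 3 first.
  - by apply: measurable_funX; exact: L2_meas lb.
  - exact: sqr_ge0.
  - by move=> x; exact: sqr_ge0.
  have me := L2_meas le; have mb := L2_meas lb.
  apply: le_integral_EFin; [by mfun| |by move=> x; exact: sqr_ge0|].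
    by apply: measurable_funM; [exact: measurable_cst|exact: measurable_funX].
  move=> x; rewrite -exprMn -(real_normK (num_real (e x))).
  by rewrite ler_pXn2r// ?nnegrE// mulr_ge0.
apply: le_trans (ip_le_CS lf le) _; apply: ler_wpM2l; first exact: sqrtr_ge0.
apply: (@le_trans _ _ (C * H ^+ 2 * B)).
  rewrite -[C * H ^+ 2]ger0_norm// -sqrtr_sqr -sqrtrM ?sqr_ge0//.
  by rewrite ler_sqrt// mulr_ge0 ?sqr_ge0 ?ip_ge0.
rewrite -mulrA (mulrC (H ^+ 2)) mulrA; apply: ler_wpM2r; first by rewrite exprn_ge0// addr_ge0.
by apply: ler_wpM2l; [exact: ltW|rewrite lerDl].
Qed.

(* Split h into n small steps; each contributes the directional derivative up to O(1/n^2). *)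
Lemma weakg_shift f g1 g2 h : weakg f g1 g2 ->
  ip mu (fun x => tau h f x - f x) (fun x => tau h f x - f x)
    <= ip mu (dirg h g1 g2) (dirg h g1 g2).
Proof.
move=> wf; have [lf l1 l2 _] := wf.
have lt := tau_L2 h lf; have mf := L2_meas lf.
(* The norm of the increment is computed by testing, so that [f] never has to be smoothed. *)
apply: L2_dual; [exact: L2B|exact: ip_ge0|] => p tp.
have lp := test_fun_L2 tp; have mp := L2_meas lp.
have [C C0 hC] := tau_taylor tp.
set m := Num.sqrt (ip mu (dirg h g1 g2) (dirg h g1 g2)).
pose K := Num.sqrt (ip mu f f) * (C * (`|h.1| + `|h.2|) ^+ 2).
have K0 : 0 <= K by rewrite !mulr_ge0 ?sqrtr_ge0 ?(ltW C0)// exprn_ge0// addr_ge0.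
suff le1 : `|ip mu (fun x => tau h f x - f x) p| <= m * Num.sqrt (ip mu p p).
  rewrite -(real_normK (num_real (ip mu (fun x => tau h f x - f x) p))).
  rewrite -[ip mu (dirg _ _ _) _]sqr_sqrtr ?ip_ge0// -[ip mu p p]sqr_sqrtr ?ip_ge0//.
  by rewrite -exprMn ler_pXn2r// nnegrE ?mulr_ge0 ?sqrtr_ge0.
(* The condition on [n] keeps the small step d = h / (n+1) in the range |d.1|, |d.2| <= 1 of
   [tau_taylor]. *)
have main n : (Num.bound (`|h.1| + `|h.2|) <= n)%N ->
    `|ip mu (fun x => tau h f x - f x) p| <= m * Num.sqrt (ip mu p p) + K * n.+1%:R^-1.
  move=> hn; pose d : R * R := n.+1%:R^-1 *: h.
  have n0 : (0 : R) < n.+1%:R by rewrite ltr0n.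
  have hb : `|h.1| + `|h.2| <= n.+1%:R.
    have := archi_boundP (addr_ge0 (normr_ge0 h.1) (normr_ge0 h.2)) => /ltW/le_trans; apply.
    by rewrite ler_nat; exact: leqW.
  have d1E : `|d.1| = n.+1%:R^-1 * `|h.1| by rewrite normrM gtr0_norm// invr_gt0.
  have d2E : `|d.2| = n.+1%:R^-1 * `|h.2| by rewrite normrM gtr0_norm// invr_gt0.
  have d1 : `|d.1| <= 1.
    by rewrite d1E mulrC ler_pdivrMr// mul1r; have := normr_ge0 h.2; lra.
  have d2 : `|d.2| <= 1.
    by rewrite d2E mulrC ler_pdivrMr// mul1r; have := normr_ge0 h.1; lra.
  have step k : `|ip mu (tau (d *+ k.+1) f) p - ip mu (tau (d *+ k) f) p|
      <= n.+1%:R^-1 * (m * Num.sqrt (ip mu p p)) + K * n.+1%:R^-1 ^+ 2.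
    have wk := weakg_tau (d *+ k) wf.
    have [lk _ _ wkE] := wk; have [wk1 wk2] := wkE _ tp.
    have := hC _ d lk d1 d2.
    have lk1 := tau_L2 (d *+ k) l1; have lk2 := tau_L2 (d *+ k) l2.
    rewrite wk1 wk2 !mulrN -opprD -(ipZl _ lk1 lp) -(ipZl _ lk2 lp).
    rewrite -(ipDl (L2Z _ lk1) (L2Z _ lk2) lp).
    have -> : tau d (tau (d *+ k) f) = tau (d *+ k.+1) f.
      by apply/funext => x; rewrite /tau mulrS -addrA.
    rewrite tau_ip// d1E d2E -mulrDr exprMn.
    have -> : (fun x => d.1 * tau (d *+ k) g1 x + d.2 * tau (d *+ k) g2 x) =
        tau (d *+ k) (fun x => n.+1%:R^-1 * dirg h g1 g2 x).
      by apply/funext => x; rewrite /tau /dirg /= mulrDr !mulrA.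
    have ldi := dirg_L2 h l1 l2; have mdi := L2_meas ldi.
    set D := ip mu (tau _ (fun x => _ * _)) p => h1.
    have Db : `|D| <= n.+1%:R^-1 * (m * Num.sqrt (ip mu p p)).
      have lz := L2Z n.+1%:R^-1 ldi.
      have := ip_le_CS (tau_L2 (d *+ k) lz) lp; rewrite -/D => /le_trans; apply.
      rewrite tau_ip; [|exact: L2_meas lz|exact: L2_meas lz].
      rewrite ipZl// ipZr// mulrA -expr2 sqrtrM ?sqr_ge0// sqrtr_sqr.
      by rewrite gtr0_norm ?invr_gt0// mulrA.
    rewrite -[X in `|X|](subrK D); apply: le_trans (ler_normD _ _) _.
    rewrite addrC; apply: lerD => //; apply: le_trans h1 _.
    by rewrite le_eqVlt; apply/orP; left; apply/eqP; rewrite /K; move: (n.+1%:R^-1) => i; ring.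
  have tele k : `|ip mu (tau (d *+ k) f) p - ip mu f p|
      <= k%:R * (n.+1%:R^-1 * (m * Num.sqrt (ip mu p p)) + K * n.+1%:R^-1 ^+ 2).
    elim: k => [|k IH].
      rewrite mul0r (_ : tau (d *+ 0) f = f) ?subrr ?normr0//.
      by apply/funext => x; rewrite /tau mulr0n addr0.
    rewrite -natr1 mulrDl mul1r.
    rewrite -(subrKA (ip mu (tau (d *+ k) f) p)) addrC.
    by apply: le_trans (ler_normD _ _) _; apply: lerD => //; exact: step.
  have := tele n.+1; rewrite (_ : d *+ n.+1 = h); last first.
    by rewrite /d scalerMnl -mulr_natr mulVf ?scale1r// pnatr_eq0.
  rewrite -ipBl// => /le_trans; apply.
  rewrite le_eqVlt; apply/orP; left; apply/eqP.
  by move: (n.+1%:R) n0 => N N0; field; exact: lt0r_neq0.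
have cK : m * Num.sqrt (ip mu p p) + K * n.+1%:R^-1 @[n --> \oo]
    --> m * Num.sqrt (ip mu p p) + K * 0.
  apply: cvgD; first exact: cvg_cst.
  by apply: cvgM; [exact: cvg_cst|exact: (@cvg_harmonic R)].
rewrite mulr0 addr0 in cK.
by apply: (cvgr_to_ge cK); exists (Num.bound (`|h.1| + `|h.2|)) => // n /= hn.
Qed.

End Translations.

(** * Averages over discs *)

Section DiscAverages.
Context (R : realType).
Local Notation mu := (leb2 R).
Implicit Types (F G : R * R -> R) (h x : R * R) (t : R).

Definition disc t : set (R * R) := [set h | h.1 ^+ 2 + h.2 ^+ 2 < t ^+ 2].

Lemma disc_measurable t : measurable (disc t).
Proof.
have mf : measurable_fun setT (fun h : R * R => h.1 ^+ 2 + h.2 ^+ 2).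
  by mfun.
have := mf measurableT `]-oo, (t ^+ 2)[%classic (measurable_itv _).
by congr measurable; apply/seteqP; split => h; rewrite /= ?in_itv/= => // -[].
Qed.

Lemma disc_box t : 0 <= t -> disc t `<=` box t.
Proof.
move=> t0 h; rewrite /disc /= => ht; apply/boxP.
have aux (a : R) : a ^+ 2 <= t ^+ 2 -> `|a| <= t.
  by rewrite -(@ler_pXn2r _ 2 _ `|a|)// ?nnegrE// real_normK ?num_real.
by have := sqr_ge0 h.1; have := sqr_ge0 h.2; split; apply: aux; lra.
Qed.

Definition disc_bounded t F := measurable_fun setT F /\
  exists2 K, 0 <= K & forall h, disc t h -> `|F h| <= K.

(** The indicator appears in both factors, so that both are in L2 and linearity is inherited from
    [ip]. *)
Definition disc_int t F := ip mu (fun h => \1_(disc t) h * F h) \1_(disc t).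

Lemma disc_indic_le t h : 0 <= t -> (\1_(disc t) h : R) <= \1_(box t) h.
Proof.
move=> t0; rewrite !indicE ler_nat.
by have [/set_mem/(disc_box t0)/mem_set ->|] := boolP (h \in disc t).
Qed.

Lemma disc_bounded_L2 t F : 0 <= t -> disc_bounded t F ->
  L2 mu (fun h => \1_(disc t) h * F h).
Proof.
move=> t0 [mF [K K0 hK]].
apply: (@L2_bounded_box _ _ K t) => //.
  by apply: measurable_funM => //; exact: measurable_indic (disc_measurable t).
move=> h; apply: le_trans (ler_wpM2l K0 (disc_indic_le h t0)).
rewrite indicE; have [hd|_] := boolP (h \in disc t); last by rewrite mul0r mulr0 normr0.
by rewrite mul1r mulr1; exact/hK/set_mem.
Qed.

Lemma L2_disc t : 0 <= t -> L2 mu \1_(disc t).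
Proof.
move=> t0; have := @disc_bounded_L2 t (fun=> 1) t0.
rewrite (_ : (fun h => \1_(disc t) h * 1) = \1_(disc t)); last first.
  by apply/funext => h; rewrite mulr1.
by apply; split => //; exists 1 => // h _; rewrite normr1.
Qed.

Lemma disc_int_lin t F G c : 0 <= t -> disc_bounded t F -> disc_bounded t G ->
  disc_int t (fun h => F h + c * G h) = disc_int t F + c * disc_int t G.
Proof.
move=> t0 bF bG; have lF := disc_bounded_L2 t0 bF; have lG := disc_bounded_L2 t0 bG.
have lt := L2_disc t0.
rewrite /disc_int -(ipZl c lG lt) -(ipDl lF (L2Z c lG) lt).
by congr ip; apply/funext => h; ring.
Qed.

Lemma disc_intE t F : 0 <= t -> disc_bounded t F ->
  ((disc_int t F)%:E = \int[mu]_h (\1_(disc t) h * F h)%:E)%E.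
Proof.
move=> t0 bF; rewrite ipE; [|exact: disc_bounded_L2|exact: L2_disc].
have pt h : \1_(disc t) h * F h * \1_(disc t) h = \1_(disc t) h * F h.
  by rewrite !indicE; case: (h \in disc t); rewrite ?mulr1 ?mul0r.
by apply: eq_integral => h _; rewrite pt.
Qed.

Lemma disc_int_le t F G : 0 <= t -> disc_bounded t F -> disc_bounded t G ->
  (forall h, disc t h -> F h <= G h) -> disc_int t F <= disc_int t G.
Proof.
move=> t0 bF bG FG; have lt := L2_disc t0.
have lF := disc_bounded_L2 t0 bF; have lG := disc_bounded_L2 t0 bG.
rewrite -subr_ge0 -(ipBl lG lF lt); apply: fine_ge0; apply: integral_EFin_ge0.
have pt h : 0 <= (\1_(disc t) h * G h - \1_(disc t) h * F h) * \1_(disc t) h.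
  rewrite indicE; have [/set_mem hd|_] := boolP (h \in disc t); last by rewrite mulr0.
  by rewrite !mul1r mulr1 subr_ge0; exact: FG.
by move=> h; exact: pt.
Qed.

Lemma disc_bounded_monom t i j : 0 <= t ->
  disc_bounded t (fun h => h.1 ^+ i * h.2 ^+ j).
Proof.
move=> t0; split; first by mfun.
exists (t ^+ i * t ^+ j); first by rewrite mulr_ge0 ?exprn_ge0.
move=> h /(disc_box t0)/boxP[h1 h2]; rewrite normrM !normrX.
by apply: ler_pM; rewrite ?exprn_ge0//; apply: lerXn2r; rewrite ?nnegrE.
Qed.

Lemma disc_bounded_lin t F G c : disc_bounded t F -> disc_bounded t G ->
  disc_bounded t (fun h => F h + c * G h).
Proof.
move=> [mF [K K0 hK]] [mG [L L0 hL]]; split; first by mfun.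
exists (K + `|c| * L); first by rewrite addr_ge0 ?mulr_ge0.
move=> h hd; apply: le_trans (ler_normD _ _) _; rewrite normrM.
by apply: lerD; [exact: hK|apply: ler_wpM2l => //; exact: hL].
Qed.

Definition disc_mom t := disc_int t (fun h => h.1 ^+ 2 * h.2 ^+ 0).

Lemma disc_int_swap t F : measurable_fun setT F ->
  disc_int t (fun h => F (h.2, h.1)) = disc_int t F.
Proof.
move=> mF; rewrite /disc_int.
have mi : measurable_fun setT (\1_(disc t) : R * R -> R).
  exact: measurable_indic (disc_measurable t).
rewrite -[RHS](preserves_ip (preserves_swap R))//; last exact: measurable_funM.
congr (ip mu _ _); apply/funext => h; rewrite !indicE.
  by congr (_ %:R * _); congr nat_of_bool; apply/idP/idP => /set_mem; rewrite /disc/= addrC => hd; exact: mem_set.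
by congr (_ %:R); congr nat_of_bool; apply/idP/idP => /set_mem; rewrite /disc/= addrC => hd; exact: mem_set.
Qed.

Lemma disc_int_opp t F : measurable_fun setT F ->
  disc_int t (fun h => F (- h.1, h.2)) = disc_int t F.
Proof.
move=> mF; rewrite /disc_int.
have mi : measurable_fun setT (\1_(disc t) : R * R -> R).
  exact: measurable_indic (disc_measurable t).
rewrite -[RHS](preserves_ip (preserves_opp1 R))//; last exact: measurable_funM.
congr (ip mu _ _); apply/funext => h; rewrite !indicE.
  by congr (_ %:R * _); congr nat_of_bool; apply/idP/idP => /set_mem; rewrite /disc/= ?sqrrN => hd; apply: mem_set; rewrite /disc/= ?sqrrN.
by congr (_ %:R); congr nat_of_bool; apply/idP/idP => /set_mem; rewrite /disc/= ?sqrrN => hd; apply: mem_set; rewrite /disc/= ?sqrrN.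
Qed.

Lemma disc_mom2 t : disc_int t (fun h => h.1 ^+ 0 * h.2 ^+ 2) = disc_mom t.
Proof.
rewrite /disc_mom -disc_int_swap; last by mfun.
by congr disc_int; apply/funext => h /=; rewrite mulrC.
Qed.

Lemma disc_mom11 t : 0 <= t -> disc_int t (fun h => h.1 ^+ 1 * h.2 ^+ 1) = 0.
Proof.
move=> t0; have := @disc_int_opp t (fun h => h.1 ^+ 1 * h.2 ^+ 1).
have b := disc_bounded_monom 1 1 t0; have [mF _] := b => /(_ mF) /=.
have := disc_int_lin (-2) t0 b b.
rewrite (_ : (fun h => h.1 ^+ 1 * h.2 ^+ 1 + _) = (fun h => (- h.1) ^+ 1 * h.2 ^+ 1)).
  by move=> ->; lra.
by apply/funext => h; rewrite !expr1; ring.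
Qed.

(** Exchanging the coordinates equates the two second moments and flipping one of them kills the
    mixed moment. This is the reason for averaging over discs: the Dirichlet integral is such a
    trace. *)
Lemma disc_int_quad t (a b c : R) : 0 <= t ->
  disc_int t (fun h => a * h.1 ^+ 2 + b * (h.1 * h.2) + c * h.2 ^+ 2) =
  (a + c) * disc_mom t.
Proof.
move=> t0.
have b20 := disc_bounded_monom 2 0 t0; have b11 := disc_bounded_monom 1 1 t0.
have b02 := disc_bounded_monom 0 2 t0.
(* The coefficient [a] is written 1 + (a - 1) to fit the shape F + c G of [disc_int_lin]. *)
have c1 := disc_bounded_lin (a - 1) b20 b20.
have c2 := disc_bounded_lin b c1 b11.
transitivity (disc_int t (fun h => h.1 ^+ 2 * h.2 ^+ 0 + (a - 1) * (h.1 ^+ 2 * h.2 ^+ 0)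
   + b * (h.1 ^+ 1 * h.2 ^+ 1) + c * (h.1 ^+ 0 * h.2 ^+ 2))).
  by congr disc_int; apply/funext => h; rewrite !expr0 !expr1; ring.
rewrite (disc_int_lin _ t0 c2 b02) (disc_int_lin _ t0 c1 b11) (disc_int_lin _ t0 b20 b20).
by rewrite disc_mom2 disc_mom11// -/(disc_mom t); ring.
Qed.

Lemma disc_bounded_quad t (a b c : R) : 0 <= t ->
  disc_bounded t (fun h => a * h.1 ^+ 2 + b * (h.1 * h.2) + c * h.2 ^+ 2).
Proof.
move=> t0.
have b20 := disc_bounded_monom 2 0 t0; have b11 := disc_bounded_monom 1 1 t0.
have b02 := disc_bounded_monom 0 2 t0.
have := disc_bounded_lin c (disc_bounded_lin b (disc_bounded_lin (a - 1) b20 b20) b11) b02.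
by congr disc_bounded; apply/funext => h; rewrite !expr0 !expr1; ring.
Qed.

Lemma disc_mom_gt0 t : 0 < t -> 0 < disc_mom t.
Proof.
move=> t0; rewrite -lte_fin disc_intE ?(ltW t0)//; last exact/disc_bounded_monom/ltW.
(* A square inside the disc on which the integrand is at least (t / 4)^2. *)
pose A : set (R * R) := `[t / 4, t / 2] `*` `[t / 4, t / 2].
have mA : measurable A by apply: measurableX; exact: measurable_itv.
have muA : mu A = ((t / 4) * (t / 4))%:E.
  rewrite leb2X ?measurable_itv// leb1_itv; last by lra.
  by rewrite -EFinM; congr EFin; field.
have mi : measurable_fun setT (\1_(disc t) : R * R -> R).
  exact: measurable_indic (disc_measurable t).
apply: (@lt_le_trans _ _ (\int[mu]_h ((t / 4) ^+ 2 * \1_A h)%:E)%E).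
  rewrite integralZ_ge0; [|exact: measurable_indic mA|exact: sqr_ge0|by move=> h].
  rewrite integral_indic// setIT [X in (_ * X)%E](muA : _ = _) -EFinM lte_fin.
  by rewrite !mulr_gt0// ?exprn_gt0// divr_gt0.
apply: le_integral_EFin.
- by apply: measurable_funM; [exact: measurable_cst|exact: measurable_indic mA].
- by apply: measurable_funM => //; mfun.
- by move=> h; rewrite mulr_ge0// sqr_ge0.
have pt h : (t / 4) ^+ 2 * \1_A h <= \1_(disc t) h * (h.1 ^+ 2 * h.2 ^+ 0).
  rewrite indicE; have [/set_mem hA|_] := boolP (h \in A); last first.
    by rewrite mulr0 mulr_ge0 // expr0 mulr1 sqr_ge0.
  move: hA => [/=]; rewrite !in_itv/= => /andP[a1 a2] /andP[b1 b2].
  have h1 : 0 <= h.1 by lra.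
  have h2 : 0 <= h.2 by lra.
  have dh : disc t h by rewrite /disc/=; nra.
  rewrite mulr1 indicE mem_set// mul1r expr0 mulr1.
  by rewrite lerXn2r// nnegrE; lra.
by move=> h; exact: pt.
Qed.

End DiscAverages.

(** * Dirichlet integral and L2 moduli *)

Section DifferenceQuotients.
Context (R : realType).
Local Notation mu := (leb2 R).
Implicit Types (f g p q : R * R -> R) (h x : R * R) (t : R).

Definition dq f h := ip mu (fun x => tau h f x - f x) (fun x => tau h f x - f x).

Lemma measurable_add2 :
  measurable_fun setT (fun z : (R * R) * (R * R) => z.1 + z.2).
Proof.
apply: measurable_fun_pair => /=.
  apply: measurable_funD; apply: measurableT_comp => //; exact: measurable_fst.
apply: measurable_funD; apply: measurableT_comp => //; exact: measurable_snd.
Qed.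

Lemma dq_integral f h : L2 mu f ->
  ((dq f h)%:E = \int[mu]_x ((f (x + h) - f x) ^+ 2)%:E)%E.
Proof. by move=> lf; rewrite /dq ip_sqr//; apply: L2B => //; exact: tau_L2. Qed.

(** Averages over [h] require measurability in [h]; it comes from Tonelli, [dq f h] being a section
    integral of a jointly measurable function. *)
Lemma measurable_dq f : L2 mu f -> measurable_fun setT (dq f).
Proof.
move=> lf; have mf := L2_meas lf.
pose F (z : (R * R) * (R * R)) := ((f (z.1 + z.2) - f z.2) ^+ 2)%:E.
have mF : measurable_fun setT F.
  apply/measurable_EFinP; apply: measurable_funX; apply: measurable_funB.
    by apply: (measurableT_comp mf); exact: measurable_add2.
  by apply: (measurableT_comp mf); exact: measurable_snd.
have F0 z : (0 <= F z)%E by rewrite lee_fin sqr_ge0.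
have := measurable_fun_fubini_tonelli_F (m2 := mu) F mF F0.
move=> mI; have mI2 : measurable_fun setT (fine \o fubini_F mu F).
  by apply: measurableT_comp => //; exact: fine_measurable.
suff -> : dq f = fine \o fubini_F mu F by [].
apply/funext => h; rewrite -[LHS]/(fine (dq f h)%:E) dq_integral//= /fubini_F.
have pt x : ((f (x + h) - f x) ^+ 2)%:E = F (h, x) by rewrite /F/= (addrC h x).
by congr fine; apply: eq_integral => x _; exact: pt.
Qed.

Lemma dq_ge0 f h : 0 <= dq f h.
Proof. exact: ip_ge0. Qed.

Lemma dq_le f h : L2 mu f -> dq f h <= 4 * ip mu f f.
Proof.
move=> lf; have mf := L2_meas lf; rewrite /dq ipB_sqr//; last exact: tau_L2.
have := ip_ge0 mu (fun x => tau h f x + f x).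
rewrite ipD_sqr//; last exact: tau_L2.
by rewrite tau_ip//; lra.
Qed.

Lemma dq_bounded f t : L2 mu f -> disc_bounded t (dq f).
Proof.
move=> lf; split; first exact: measurable_dq.
exists (4 * ip mu f f); first by rewrite mulr_ge0 ?ip_ge0.
by move=> h _; rewrite ger0_norm ?dq_ge0// dq_le.
Qed.

(** The squared norm of the directional derivative is a quadratic form in [h], so its average is a
    multiple of the trace and no constant is lost against the converse [weakg_exists]. *)
Lemma weakg_dq f g1 g2 t : 0 <= t -> weakg f g1 g2 ->
  disc_int t (dq f) <= (ip mu g1 g1 + ip mu g2 g2) * disc_mom t.
Proof.
move=> t0 wf; have [lf l1 l2 _] := wf.
rewrite -(disc_int_quad _ (2 * ip mu g1 g2) _ t0); apply: disc_int_le => //.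
- exact: dq_bounded.
- exact: disc_bounded_quad.
- move=> h _; apply: le_trans (weakg_shift h wf) _.
  rewrite /dirg ipD_sqr; [|exact: L2Z|exact: L2Z].
  rewrite !ipZl//; [|exact: L2Z|exact: L2Z|exact: L2Z].
  rewrite !ipZr// le_eqVlt; apply/orP; left; apply/eqP.
  by move: (ip mu g1 g1) (ip mu g1 g2) (ip mu g2 g2) => a b c; ring.
Qed.

(** Lagrange's identity: the defect in the Cauchy-Schwarz inequality is the squared norm of h.2 g1 -
    h.1 g2. *)
Lemma weakg_dq_le f g1 g2 h : weakg f g1 g2 ->
  dq f h <= (ip mu g1 g1 + ip mu g2 g2) * (h.1 ^+ 2 + h.2 ^+ 2).
Proof.
move=> wf; have [lf l1 l2 _] := wf.
apply: le_trans (weakg_shift h wf) _.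
rewrite /dirg ipD_sqr; [|exact: L2Z|exact: L2Z].
rewrite !ipZl//; [|exact: L2Z|exact: L2Z|exact: L2Z].
rewrite !ipZr//.
have := ip_ge0 mu (fun x => h.2 * g1 x - h.1 * g2 x).
rewrite ipB_sqr; [|exact: L2Z|exact: L2Z].
rewrite !ipZl//; [|exact: L2Z|exact: L2Z|exact: L2Z].
rewrite !ipZr//.
by move: (ip mu g1 g1) (ip mu g1 g2) (ip mu g2 g2) => a b c; lra.
Qed.

Lemma sqrD_le2 (a b : R) : (a + b) ^+ 2 <= 2 * (a ^+ 2 + b ^+ 2).
Proof. by have := sqr_ge0 (a - b); lra. Qed.

Lemma quadratic_discr (l M N : R) : 0 <= N ->
  (forall s, 2 * s * l <= M + s ^+ 2 * N) -> l ^+ 2 <= M * N.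
Proof.
move=> N0 h; have [N00|Nn] := eqVneq N 0.
  rewrite N00 mulr0; have [->|ln] := eqVneq l 0; first by rewrite expr0n.
  have := h ((M + 1) / (2 * l)); rewrite N00 mulr0 addr0.
  rewrite (_ : 2 * _ * l = M + 1); last by field.
  lra.
have Np : 0 < N by rewrite lt_neqAle eq_sym Nn.
have := h (l / N).
rewrite (_ : 2 * _ * l = 2 * (l ^+ 2 / N)); last by field.
rewrite (_ : (l / N) ^+ 2 * N = l ^+ 2 / N); last by field.
move=> h2; have : l ^+ 2 / N <= M by lra.
by rewrite ler_pdivrMr.
Qed.

(** Young's inequality against h.1 p + h.2 q bounds [dq f h] from below. Expanding the shift to
    first order on the test functions leaves a quadratic form in [h]; its disc average is a trace,
    in which only the first derivative of [p] and the second derivative of [q] survive. Letting the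
    radius tend to 0 bounds the divergence functional by [M], and Riesz produces the gradient. *)
Lemma weakg_exists f (M : R) : L2 mu f -> 0 <= M ->
  (forall t, 0 < t -> t <= 1 -> disc_int t (dq f) <= M * disc_mom t) ->
  exists g1 g2, weakg f g1 g2 /\ ip mu g1 g1 + ip mu g2 g2 <= M.
Proof.
move=> lf M0 hQ.
pose l1 p := - ip mu f (fun x => 'D_(e1 R) p x).
pose l2 p := - ip mu f (fun x => 'D_(e2 R) p x).
have key p q : test_fun p -> test_fun q ->
    2 * (l1 p + l2 q) <= M + (ip mu p p + ip mu q q).
  move=> tp tq; have lp := test_fun_L2 tp; have lq := test_fun_L2 tq.
  have [C C0 hC] := tau_taylor tp; have [C' C'0 hC'] := tau_taylor tq.
  pose n := Num.sqrt (ip mu f f); have n0 : 0 <= n by exact: sqrtr_ge0.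
  pose K := n * (C + C'); have K0 : 0 <= K by rewrite mulr_ge0// addr_ge0// ltW.
  rewrite /l1 /l2.
  set a11 := ip mu f (fun x => 'D_(e1 R) p x).
  set a22 := ip mu f (fun x => 'D_(e2 R) q x).
  pose a12 := ip mu f (fun x => 'D_(e2 R) p x).
  pose a21 := ip mu f (fun x => 'D_(e1 R) q x).
  (* The term 8 K t absorbs twice the Taylor remainder 4 K t |h|^2; placed inside the quadratic form
     it is averaged with the rest. *)
  have pw t h : 0 < t -> t <= 1 -> disc t h ->
      (- 2 * a11 - ip mu p p - 8 * K * t) * h.1 ^+ 2
      + (- 2 * (a12 + a21) - 2 * ip mu p q) * (h.1 * h.2)
      + (- 2 * a22 - ip mu q q - 8 * K * t) * h.2 ^+ 2 <= dq f h.
    move=> t0 t1 /(disc_box (ltW t0))/boxP[h1 h2].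
    have b1 : `|h.1| <= 1 by exact: le_trans t1.
    have b2 : `|h.2| <= 1 by exact: le_trans t1.
    have := hC f h lf b1 b2; have := hC' f h lf b1 b2.
    rewrite -/a11 -/a12 -/a21 -/a22 -/n.
    have ltf := tau_L2 h lf.
    set A := ip mu (tau h f) p - ip mu f p; set B := ip mu (tau h f) q - ip mu f q.
    move=> EB EA.
    have ld := L2B ltf lf.
    pose Psi x := h.1 * p x + h.2 * q x.
    have lPsi : L2 mu Psi by apply: L2D; exact: L2Z.
    have young := ip_ge0 mu (fun x => (tau h f x - f x) - Psi x).
    rewrite (ipB_sqr ld lPsi) -/(dq f h) in young.
    have PP : ip mu Psi Psi = h.1 ^+ 2 * ip mu p p + 2 * (h.1 * h.2) * ip mu p q + h.2 ^+ 2 * ip mu q q.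
      rewrite /Psi ipD_sqr; [|exact: L2Z|exact: L2Z].
      rewrite !ipZl//; [|exact: L2Z|exact: L2Z|exact: L2Z].
      rewrite !ipZr//.
      by move: (ip mu p p) (ip mu p q) (ip mu q q) => a b c; ring.
    have dP : ip mu (fun x => tau h f x - f x) Psi = h.1 * A + h.2 * B.
      rewrite /Psi (ipDr (L2Z h.1 lp) (L2Z h.2 lq) ld) (ipZr _ lp ld) (ipZr _ lq ld).
      by rewrite (ipBl ltf lf lp) (ipBl ltf lf lq).
    rewrite PP dP in young.
    set H := `|h.1| + `|h.2| in EA EB.
    have H0 : 0 <= H by rewrite addr_ge0.
    have H2 : H ^+ 2 <= 2 * (h.1 ^+ 2 + h.2 ^+ 2).
      rewrite -(real_normK (num_real h.1)) -(real_normK (num_real h.2)) /H.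
      exact: sqrD_le2.
    have eA : - (h.1 * (A + (h.1 * a11 + h.2 * a12))) <= t * (n * (C * H ^+ 2)).
      apply: le_trans (ler_norm _) _; rewrite normrN normrM.
      by apply: ler_pM.
    have eB : - (h.2 * (B + (h.1 * a21 + h.2 * a22))) <= t * (n * (C' * H ^+ 2)).
      apply: le_trans (ler_norm _) _; rewrite normrN normrM.
      by apply: ler_pM.
    have eAB : t * (n * (C * H ^+ 2)) + t * (n * (C' * H ^+ 2)) <= 4 * K * t * (h.1 ^+ 2 + h.2 ^+ 2).
      rewrite (_ : _ + _ = K * t * H ^+ 2); last by rewrite /K; ring.
      rewrite (_ : 4 * K * t * _ = K * t * (4 * (h.1 ^+ 2 + h.2 ^+ 2))); last by ring.
      apply: ler_wpM2l; first by rewrite mulr_ge0// ltW.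
      apply: le_trans H2 _; apply: ler_wpM2r; first by rewrite addr_ge0 ?sqr_ge0.
      by rewrite ler_nat.
    move: young eA eB eAB; move: (ip mu p p) (ip mu p q) (ip mu q q) (dq f h) => P S Q D.
    move: (t * (n * (C * H ^+ 2))) (t * (n * (C' * H ^+ 2))) => u v.
    by clear; lra.
  have dir t : 0 < t -> t <= 1 -> 2 * (- a11 - a22) <= M + (ip mu p p + ip mu q q) + 16 * K * t.
    move=> t0 t1; have t0' := ltW t0; have c0 := disc_mom_gt0 t0.
    have := disc_int_le t0' (disc_bounded_quad _ _ _ t0') (dq_bounded t lf) (fun h hd => pw t h t0 t1 hd).
    rewrite disc_int_quad// => /le_trans/(_ (hQ t t0 t1)).
    by rewrite ler_pM2r//; clear; lra.
  apply/ler_addgt0Pr => e e0.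
  pose t := Num.min 1 (e / (16 * K + 1)).
  have K1 : 0 < 16 * K + 1 by rewrite ltr_wpDl// mulr_ge0.
  have t0 : 0 < t by rewrite lt_min ltr01 divr_gt0.
  have t1 : t <= 1 by rewrite ge_min lexx.
  apply: le_trans (dir t t0 t1) _; rewrite lerD2l.
  have te : t <= e / (16 * K + 1) by rewrite ge_min lexx orbT.
  apply: (@le_trans _ _ ((16 * K + 1) * t)); first by rewrite ler_pM2r// lerDl.
  by rewrite mulrC -ler_pdivlMr.
have lin1 c p q : test_fun p -> test_fun q -> l1 (fun x => p x + c * q x) = l1 p + c * l1 q.
  move=> tp tq; rewrite /l1.
  have [/(_ 1%N)[_ [dp _]] _] := tp; have [/(_ 1%N)[_ [dq' _]] _] := tq.
  have -> : (fun x => 'D_(e1 R) (fun y => p y + c * q y) x) = (fun x => 'D_(e1 R) p x + c * 'D_(e1 R) q x).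
    by apply/funext => x; have [] := derive_lin c (dp x).1 (dq' x).1.
  have ldp := test_fun_L2 (test_fun_D1 tp); have ldq := test_fun_L2 (test_fun_D1 tq).
  by rewrite (ipDr ldp (L2Z c ldq) lf) (ipZr c ldq lf) opprD mulrN.
have lin2 c p q : test_fun p -> test_fun q -> l2 (fun x => p x + c * q x) = l2 p + c * l2 q.
  move=> tp tq; rewrite /l2.
  have [/(_ 1%N)[_ [dp _]] _] := tp; have [/(_ 1%N)[_ [dq' _]] _] := tq.
  have -> : (fun x => 'D_(e2 R) (fun y => p y + c * q y) x) = (fun x => 'D_(e2 R) p x + c * 'D_(e2 R) q x).
    by apply/funext => x; have [] := derive_lin c (dp x).2 (dq' x).2.
  have ldp := test_fun_L2 (test_fun_D2 tp); have ldq := test_fun_L2 (test_fun_D2 tq).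
  by rewrite (ipDr ldp (L2Z c ldq) lf) (ipZr c ldq lf) opprD mulrN.
have t0 := test_fun0 R.
have sc s p : test_fun p -> test_fun (fun x => 0 + s * p x) /\ (fun x => 0 + s * p x) = (fun x => s * p x).
  move=> tp; split; first exact: (test_fun_lin s t0 tp).
  by apply/funext => x; rewrite add0r.
have l10 : l1 (fun=> 0) = 0.
  have := lin1 (-1) _ _ t0 t0; rewrite (_ : (fun x : R * R => 0 + -1 * 0) = (fun=> 0 : R)).
    by lra.
  by apply/funext => x; ring.
have l20 : l2 (fun=> 0) = 0.
  have := lin2 (-1) _ _ t0 t0; rewrite (_ : (fun x : R * R => 0 + -1 * 0) = (fun=> 0 : R)).
    by lra.
  by apply/funext => x; ring.
have [|||||||] := @riesz_pair _ _ R mu (@test_fun R) l1 l2 M.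
- by move=> p /test_fun_L2.
- exact: t0.
- by move=> c p q; exact: test_fun_lin.
- exact: lin1.
- exact: lin2.
- exact: M0.
- move=> p q tp tq; have lp := test_fun_L2 tp; have lq := test_fun_L2 tq.
  (* The bound [key] is not homogeneous; applied to the multiples s p and s q and optimized in [s],
     it becomes the quadratic bound that Riesz requires. *)
  apply: quadratic_discr; first by rewrite addr_ge0 ?ip_ge0.
  move=> s; have [tsp ep] := sc s p tp; have [tsq eq] := sc s q tq.
  have := key _ _ tsp tsq; rewrite (lin1 _ _ _ t0 tp) (lin2 _ _ _ t0 tq) l10 l20 ep eq.
  rewrite (ipZl _ lp (L2Z s lp)) (ipZr _ lp lp) (ipZl _ lq (L2Z s lq)) (ipZr _ lq lq).
  by move: (ip mu p p) (ip mu q q) (l1 p) (l2 q) => a b c d; clear; lra.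
- move=> g1 [g2 [lg1 lg2 gM gE]]; exists g1, g2; split; last exact: gM.
  split; [exact: lf|exact: lg1|exact: lg2|] => p tp; have [E1 E2] := gE _ tp.
  by split; apply: (canRL opprK); symmetry; [exact: E1|exact: E2].
Qed.

End DifferenceQuotients.

(** * Mass in small boxes *)

Section LocalMass.
Context (R : realType).
Local Notation mu := (leb2 R).
Implicit Types (f g : R * R -> R) (h x y : R * R).

Lemma measurable_sub2 :
  measurable_fun setT (fun z : (R * R) * (R * R) => z.1 - z.2).
Proof.
apply: measurable_fun_pair => /=.
  apply: measurable_funB; apply: measurableT_comp => //; exact: measurable_fst.
apply: measurable_funB; apply: measurableT_comp => //; exact: measurable_snd.
Qed.

Lemma measurable_shift2 h : measurable_fun setT (fun x => x + h).
Proof. by have [] := preserves_shift h. Qed.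

Lemma integral_shift f h : measurable_fun setT f ->
  (\int[mu]_x (f (x + h))%:E = \int[mu]_x (f x)%:E)%E.
Proof. exact: preserves_integral (preserves_shift h). Qed.

Lemma integral_box r h : 0 <= r ->
  (\int[mu]_y (\1_(box r) (y + h))%:E = (4 * r ^+ 2)%:E :> \bar R)%E.
Proof.
move=> r0; have mb : measurable_fun setT (\1_(box r) : R * R -> R).
  exact: measurable_indic (box_measurable r).
rewrite (integral_shift h mb) integral_indic//; last exact: box_measurable.
by rewrite setIT; exact: leb2_box.
Qed.

(** Bound f(y)^2 by 2 f(y + h)^2 + 2 (f(y + h) - f(y))^2 and average over [h] in [box s]: the first
    term spreads the mass over an area 4 s^2, the second costs at most 4 s^2 times the Dirichlet
    integral. The free parameter [s] does the work of a Sobolev inequality. *)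
Lemma local_mass f g1 g2 x (r s : R) : weakg f g1 g2 -> 0 <= r -> 0 < s ->
  (\int[mu]_y (\1_(box r) (y - x) * f y ^+ 2)%:E <=
   (2 * (r ^+ 2 / s ^+ 2) * ip mu f f
    + 4 * s ^+ 2 * (ip mu g1 g1 + ip mu g2 g2))%:E)%E.
Proof.
move=> wf r0 s0; have [lf l1 l2 _] := wf; have mf := L2_meas lf.
set D := ip mu g1 g1 + ip mu g2 g2.
have D0 : 0 <= D by rewrite addr_ge0 ?ip_ge0.
have mbr : measurable_fun setT (\1_(box r) : R * R -> R).
  exact: measurable_indic (box_measurable r).
have mbs : measurable_fun setT (\1_(box s) : R * R -> R).
  exact: measurable_indic (box_measurable s).
have mbx : measurable_fun setT (fun y => \1_(box r) (y - x) : R).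
  by apply: (measurableT_comp mbr); exact: measurable_shift2.
have mfh h : measurable_fun setT (fun y => f (y + h)).
  by apply: (measurableT_comp mf); exact: measurable_shift2.
have b0 (A : set (R * R)) y : 0 <= (\1_A y : R) by case/andP: (indic_le1 A y).
have p0 (A : set (R * R)) y (c : R) : 0 <= \1_A y * c ^+ 2.
  by apply: mulr_ge0; [exact: b0|exact: sqr_ge0].
set m := (\int[mu]_y _)%E.
have m0 : (0 <= m)%E.
  by apply: integral_EFin_ge0 => y; exact: p0.
pose G (z : (R * R) * (R * R)) :=
  (\1_(box s) z.1 * (\1_(box r) (z.2 - x) * f (z.2 + z.1) ^+ 2))%:E.
have mG : measurable_fun setT G.
  apply/measurable_EFinP; apply: measurable_funM.
    by apply: (measurableT_comp mbs); exact: measurable_fst.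
  apply: measurable_funM.
    by apply: (measurableT_comp mbx); exact: measurable_snd.
  apply: measurable_funX; apply: (measurableT_comp mf).
  rewrite (_ : (fun z => _) = (fun z : (R * R) * (R * R) => z.1 + z.2)).
    exact: measurable_add2.
  by apply/funext => z; rewrite addrC.
have G0 z : (0 <= G z)%E by rewrite lee_fin; apply: mulr_ge0; [exact: b0|exact: p0].
pose A h := (\int[mu]_y (\1_(box r) (y - x) * f (y + h) ^+ 2)%:E)%E.
have A0 h : (0 <= A h)%E.
  by apply: integral_EFin_ge0 => y; exact: p0.
have step h : box s h -> (m <= 2%:E * A h + (4 * s ^+ 2 * D)%:E)%E.
  move=> /boxP[h1 h2].
  have e1 : (2%:E * A h = \int[mu]_y (2 * (\1_(box r) (y - x) * f (y + h) ^+ 2))%:E)%E.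
    rewrite integralZ_ge0//.
      by apply: measurable_funM => //; exact: measurable_funX.
  have e2 : (2%:E * (dq f h)%:E = \int[mu]_y (2 * (f (y + h) - f y) ^+ 2)%:E)%E.
    rewrite dq_integral// integralZ_ge0//.
      by apply: measurable_funX; exact: measurable_funB.
    by move=> y; exact: sqr_ge0.
  have e3 : (m <= 2%:E * A h + 2%:E * (dq f h)%:E)%E.
    rewrite e1 e2 -integralD_ge0; last 4 first.
    - by apply: measurable_funM; [exact: measurable_cst|apply: measurable_funM => //; exact: measurable_funX].
    - by apply: measurable_funM; [exact: measurable_cst|apply: measurable_funX; exact: measurable_funB].
    - by move=> y; apply: mulr_ge0 => //; exact: p0.
    - by move=> y; apply: mulr_ge0 => //; exact: sqr_ge0.
    apply: le_integral_EFin.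
    - by apply: measurable_funM => //; exact: measurable_funX.
    - apply: measurable_funD; apply: measurable_funM; try exact: measurable_cst.
        by apply: measurable_funM => //; exact: measurable_funX.
      by apply: measurable_funX; exact: measurable_funB.
    - by move=> y; exact: p0.
    have pt y : \1_(box r) (y - x) * f y ^+ 2 <=
        2 * (\1_(box r) (y - x) * f (y + h) ^+ 2) + 2 * (f (y + h) - f y) ^+ 2.
      have /andP[i0 i1] := indic_le1 (box r) (y - x).
      move: (f y) (f (y + h)) (\1_(box r) (y - x)) i0 i1 => a b i i0 i1.
      have h3 : a ^+ 2 <= 2 * b ^+ 2 + 2 * (b - a) ^+ 2.
        by have := sqr_ge0 (2 * b - a); lra.
      apply: (@le_trans _ _ (i * (2 * b ^+ 2 + 2 * (b - a) ^+ 2))); first exact: ler_wpM2l.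
      rewrite mulrDr mulrCA lerD2l mulrA.
      by apply: ler_wpM2r; [exact: sqr_ge0|lra].
    by move=> y; exact: pt.
  apply: le_trans e3 _; apply: leeD2l; rewrite -EFinM lee_fin.
  have := weakg_dq_le h wf; rewrite -/D.
  have q1 : h.1 ^+ 2 <= s ^+ 2.
    by rewrite -(real_normK (num_real h.1)) lerXn2r// nnegrE// ltW.
  have q2 : h.2 ^+ 2 <= s ^+ 2.
    by rewrite -(real_normK (num_real h.2)) lerXn2r// nnegrE// ltW.
  move=> hd; have : D * (h.1 ^+ 2 + h.2 ^+ 2) <= D * (2 * s ^+ 2).
    by apply: ler_wpM2l => //; lra.
  by move: (D * _) hd => u hd hu; lra.
have s20 : 0 < 4 * s ^+ 2 by rewrite mulr_gt0// exprn_gt0.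
have c0 : 0 <= 4 * s ^+ 2 * D by rewrite mulr_ge0// ltW.
have mA : measurable_fun setT (fun h => ((\1_(box s) h)%:E * A h)%E).
  have := measurable_fun_fubini_tonelli_F (m2 := mu) G mG G0.
  congr measurable_fun; apply/funext => h; rewrite /fubini_F /G /=.
  rewrite integralZ_ge0//.
    by apply: measurable_funM => //; exact: measurable_funX.
(* Tonelli in (h, y): for fixed [y] the integral over [h] of f(y + h)^2 is at most the whole mass,
   and the box in [y] has area 4 r^2. *)
have swap : (\int[mu]_h ((\1_(box s) h)%:E * A h) <= (4 * r ^+ 2 * ip mu f f)%:E)%E.
  have -> : (\int[mu]_h ((\1_(box s) h)%:E * A h) = \int[mu]_h \int[mu]_y G (h, y))%E.
    apply: eq_integral => h _; rewrite /G /=.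
    rewrite integralZ_ge0//.
      by apply: measurable_funM => //; exact: measurable_funX.
  rewrite (fubini_tonelli G)//.
  apply: (@le_trans _ _ (\int[mu]_y (ip mu f f * \1_(box r) (y - x))%:E)%E).
    apply: ge0_le_integral => //.
    - by move=> y _; apply: integral_ge0.
    - exact: (measurable_fun_fubini_tonelli_G G).
    - by apply/measurable_EFinP; apply: measurable_funM => //; exact: measurable_cst.
    - move=> y _; rewrite mulrC EFinM ip_sqr//.
      rewrite -(integral_shift y (f := fun z : R * R => f z ^+ 2)); last exact: measurable_funX.
      rewrite -integralZ_ge0//.
      + apply: le_integral_EFin.
        * apply/measurable_EFinP; apply: (measurableT_comp mG (g := fun z : R * R => (z, y))).
          by apply: measurable_fun_pair; [exact: measurable_id|exact: measurable_cst].
        * by apply: measurable_funM; [exact: measurable_cst|exact: measurable_funX].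
        * by move=> z; apply: mulr_ge0; [exact: b0|exact: p0].
        * move=> z; have /andP[i0 i1] := indic_le1 (box s) z.
          by rewrite (addrC y z); exact: ler_piMl (p0 _ _ _) i1.
      + exact: measurable_funX.
      + by move=> z; exact: sqr_ge0.
  rewrite integralZ_ge0// ?ip_ge0// integral_box//.
  by rewrite -EFinM mulrC.
have total : ((4 * s ^+ 2)%:E * m <=
    2%:E * (4 * r ^+ 2 * ip mu f f)%:E + (4 * s ^+ 2)%:E * (4 * s ^+ 2 * D)%:E)%E.
  have bs0 : (\int[mu]_h (\1_(box s) h)%:E = (4 * s ^+ 2)%:E :> \bar R)%E.
    rewrite integral_indic//; last exact: box_measurable.
    by rewrite setIT; exact/leb2_box/ltW.
  apply: (@le_trans _ _ (\int[mu]_h ((\1_(box s) h)%:E * m))%E).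
    by rewrite ge0_integralZr// ?bs0//; exact/measurable_EFinP.
  apply: (@le_trans _ _ (\int[mu]_h (2%:E * ((\1_(box s) h)%:E * A h) +
     (4 * s ^+ 2 * D)%:E * (\1_(box s) h)%:E))%E).
    apply: ge0_le_integral => //.
    - by move=> h _; rewrite mule_ge0// lee_fin.
    - by apply: emeasurable_funM; [exact/measurable_EFinP|exact: measurable_cst].
    - apply: emeasurable_funD; apply: emeasurable_funM => //; try exact: measurable_cst.
      exact/measurable_EFinP.
    - have pt h : ((\1_(box s) h)%:E * m <= 2%:E * ((\1_(box s) h)%:E * A h) +
         (4 * s ^+ 2 * D)%:E * (\1_(box s) h)%:E)%E.
        rewrite indicE; have [/set_mem hb|_] := boolP (h \in box s).
          by rewrite !mul1e mule1; exact: step.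
        by rewrite !mul0e !mule0 add0e.
      by move=> h _; exact: pt.
  rewrite ge0_integralD//; last 4 first.
  - by move=> h _; rewrite !mule_ge0// lee_fin.
  - by apply: emeasurable_funM => //; exact: measurable_cst.
  - by move=> h _; rewrite mule_ge0.
  - by apply: emeasurable_funM; [exact: measurable_cst|exact/measurable_EFinP].
  have mi : measurable_fun setT (fun h => (\1_(box s) h)%:E : \bar R) by exact/measurable_EFinP.
  rewrite !ge0_integralZl//; last by move=> h _; rewrite mule_ge0// lee_fin.
  rewrite bs0 (muleC (4 * s ^+ 2)%:E); apply: leeD2r.
  by rewrite lee_pmul2l.
move: total; have [->|mfin] := eqVneq m +oo%E; first by rewrite gt0_muley ?lte_fin// leye_eq.
have mf' : m \is a fin_num by rewrite ge0_fin_numE// lt_neqAle mfin leey.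
rewrite -(fineK mf') -!EFinM -EFinD !lee_fin => hh.
rewrite -(ler_pM2l s20); apply: le_trans hh _.
rewrite le_eqVlt; apply/orP; left; apply/eqP.
have sn0 : s != 0 by rewrite gt_eqF.
by rewrite -/D; move: (ip mu f f) (D) sn0; clear; move=> a b sn0; field.
Qed.

End LocalMass.

(** * Logarithmic potentials *)

Section Kernels.
Context (R : realType).
Local Notation mu := (leb2 R).
Implicit Types (f g : R * R -> R) (h x y : R * R) (k : R -> R).

Definition k1 (r : R) : R := ln (1 + r).
(* For r > 0 this is ln (1 + 1/r); since ln 0 = 0, k2 0 = 0 and k2 is monotone
   only away from 0. *)
Definition k2 (r : R) : R := ln (1 + r) - ln r.

Lemma k1_ge0 r : 0 <= r -> 0 <= k1 r.
Proof. by move=> r0; apply: ln_ge0; lra. Qed.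

Lemma k2_ge0 r : 0 <= r -> 0 <= k2 r.
Proof.
rewrite le_eqVlt => /predU1P[<-|r0]; first by rewrite /k2 addr0 ln1 ln0// subr0.
by rewrite /k2 subr_ge0 ler_ln// ?posrE; lra.
Qed.

Lemma k1_le r s : 0 <= r -> r <= s -> k1 r <= k1 s.
Proof. by move=> r0 rs; rewrite /k1 ler_ln// ?posrE; lra. Qed.

Lemma k1_lt r s : 0 <= r -> r < s -> k1 r < k1 s.
Proof. by move=> r0 rs; rewrite /k1 ltr_ln// ?posrE; lra. Qed.

Lemma k2E r : 0 < r -> k2 r = ln (1 + r^-1).
Proof.
move=> r0; rewrite /k2 -ln_div ?posrE; [|lra|lra].
by congr ln; field; lra.
Qed.

Lemma k2_le r s : 0 < r -> r <= s -> k2 s <= k2 r.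
Proof.
move=> r0 rs; have s0 : 0 < s by lra.
have i0 : 0 < s^-1 by rewrite invr_gt0.
have ii : s^-1 <= r^-1 by rewrite lef_pV2 ?posrE.
by rewrite !k2E// ler_ln ?posrE; lra.
Qed.

Lemma lnE r : ln r = k1 r - k2 r.
Proof. by rewrite /k1 /k2; lra. Qed.

Lemma measurable_k1 : measurable_fun setT k1.
Proof.
apply: (measurableT_comp (@measurable_ln R)).
by apply: measurable_funD; [exact: measurable_cst|exact: measurable_id].
Qed.

Lemma measurable_k2 : measurable_fun setT k2.
Proof. by apply: measurable_funB; [exact: measurable_k1|exact: measurable_ln]. Qed.

Lemma enorm_ge0 x : 0 <= enorm x.
Proof. exact: sqrtr_ge0. Qed.

Lemma enorm_sqr x : enorm x ^+ 2 = x.1 ^+ 2 + x.2 ^+ 2.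
Proof. by rewrite /enorm sqr_sqrtr// addr_ge0 ?sqr_ge0. Qed.

Lemma measurable_enorm : measurable_fun setT (@enorm R).
Proof.
apply: (@measurableT_comp _ _ _ _ _ _ (@Num.sqrt R)); last by mfun.
by apply: continuous_measurable_fun; exact: sqrt_continuous.
Qed.

Lemma enormN x : enorm (- x) = enorm x.
Proof. by rewrite /enorm /= !sqrrN. Qed.

Lemma enormB x y : enorm (x - y) = enorm (y - x).
Proof. by rewrite -enormN opprB. Qed.

Lemma enorm_ge1 x : `|x.1| <= enorm x.
Proof.
rewrite -(@ler_pXn2r _ 2)// ?nnegrE ?enorm_ge0// enorm_sqr real_normK ?num_real//.
by rewrite lerDl sqr_ge0.
Qed.

Lemma enorm_ge2 x : `|x.2| <= enorm x.
Proof.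
rewrite -(@ler_pXn2r _ 2)// ?nnegrE ?enorm_ge0// enorm_sqr real_normK ?num_real//.
by rewrite lerDr sqr_ge0.
Qed.

Lemma enormD x y : enorm (x + y) <= enorm x + enorm y.
Proof.
have s0 : 0 <= enorm x + enorm y by rewrite addr_ge0 ?enorm_ge0.
rewrite -(@ler_pXn2r _ 2)// ?nnegrE ?enorm_ge0//.
have cs : x.1 * y.1 + x.2 * y.2 <= enorm x * enorm y.
  apply: le_trans (ler_norm _) _.
  rewrite -(@ler_pXn2r _ 2)// ?nnegrE ?mulr_ge0 ?enorm_ge0// real_normK ?num_real//.
  rewrite exprMn !enorm_sqr; have := sqr_ge0 (x.1 * y.2 - x.2 * y.1).
  by move: x.1 x.2 y.1 y.2 => a b c d; clear; nra.
rewrite enorm_sqr [leRHS]sqrrD !enorm_sqr /=.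
by move: cs; move: (enorm x * enorm y) => e; clear; lra.
Qed.

Lemma k1_enormD x y : k1 (enorm (x + y)) <= k1 (enorm x) + k1 (enorm y).
Proof.
have x0 := enorm_ge0 x; have y0 := enorm_ge0 y; have xy := enormD x y.
rewrite /k1 -lnM ?posrE; [|lra|lra].
rewrite ler_ln ?posrE; [|by have := enorm_ge0 (x + y); lra|by nra].
by nra.
Qed.

Lemma measurable_ker k : measurable_fun setT k ->
  measurable_fun setT (fun z : (R * R) * (R * R) => k (enorm (z.1 - z.2))).
Proof.
move=> mk; apply: (measurableT_comp mk); apply: (measurableT_comp measurable_enorm).
exact: measurable_sub2.
Qed.

Lemma measurable_kerx k x : measurable_fun setT k ->
  measurable_fun setT (fun y => k (enorm (x - y))).
Proof.
move=> mk; apply: (measurableT_comp (measurable_ker mk) (g := fun y => (x, y))).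
by apply: measurable_fun_pair; [exact: measurable_cst|exact: measurable_id].
Qed.

(** If [n] is the first exponent with 2^-n below the max norm rho of [z], then [z] lies in the [n]
    larger dyadic boxes, while ln(1 + 1/rho) <= (n + 1) ln 2 <= n + 1. *)
Lemma k2_dyadic (z : R * R) : ((k2 (enorm z))%:E <=
  1%:E + \sum_(0 <= j <oo) (\1_(box (2^-1 ^+ j)) z)%:E)%E.
Proof.
have b0 j : (0 <= (\1_(box (2^-1 ^+ j)) z : R)%:E)%E.
  by rewrite lee_fin; case/andP: (indic_le1 (box (2^-1 ^+ j : R)) z).
have S0 : (0 <= \sum_(0 <= j <oo) (\1_(box (2^-1 ^+ j)) z : R)%:E)%E.
  by apply: nneseries_ge0 => j _ _; exact: b0.
pose rho : R := Num.max `|z.1| `|z.2|.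
have rz : rho <= enorm z by rewrite ge_max enorm_ge1 enorm_ge2.
have rho0 : 0 <= rho by rewrite le_max normr_ge0.
move: rho0; rewrite le_eqVlt => /predU1P[r0|rp].
  have z0 : enorm z = 0.
    have z1 : `|z.1| <= 0 by rewrite r0 le_max lexx.
    have z2 : `|z.2| <= 0 by rewrite r0 le_max lexx orbT.
    move: z1 z2; rewrite !normr_le0 => /eqP z1 /eqP z2.
    by rewrite /enorm z1 z2 expr0n addr0 sqrtr0.
  rewrite z0 /k2 addr0 ln1 ln0// subr0.
  by rewrite adde_ge0// lee_fin.
have exn : exists n, (2^-1 : R) ^+ n < rho.
  have /cvgrPdist_lt /(_ _ rp) [n _ hn] := @cvg_half_expr R.
  exists n; have := hn n (leqnn n).
  by rewrite sub0r normrN ger0_norm// exprn_ge0// invr_ge0.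
case: (ex_minnP exn) => n nr nmin.
have le1 : k2 (enorm z) <= 1 + n%:R.
  apply: le_trans (k2_le rp rz) _; rewrite k2E//.
  have i1 : rho^-1 <= 2 ^+ n.
    by rewrite invf_ple ?posrE ?exprn_gt0// -exprVn ltW.
  have p1 : (1 : R) <= 2 ^+ n by rewrite exprn_ege1// ler1n.
  apply: (@le_trans _ _ (ln (2 ^+ n.+1 : R))).
    rewrite ler_ln ?posrE ?exprn_gt0//; last by rewrite addr_gt0// invr_gt0.
    by rewrite exprS; lra.
  have l2 : ln (2 : R) <= 1.
    by rewrite (_ : 2 = 1 + 1); [apply: le_ln1Dx; lra|ring].
  by rewrite lnXn// -[ln 2 *+ _]mulr_natr addrC natr1; exact: ler_piMl.
apply: (@le_trans _ _ (1%:E + n%:R%:E)%E); first by rewrite -EFinD lee_fin.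
apply: leeD2l; apply: le_trans (nneseries_lim_ge n _); last by move=> j _ _; exact: b0.
rewrite sumEFin lee_fin big_mkord (eq_bigr (fun=> 1)).
  by rewrite sumr_const card_ord.
move=> [j jn] _ /=; rewrite indicE mem_set//; apply/boxP.
have rj : rho <= 2^-1 ^+ j by rewrite leNgt; apply/negP => /nmin; rewrite leqNgt jn.
by move: rj; rewrite ge_max => /andP[].
Qed.

Definition W k f x := (\int[mu]_y (k (enorm (x - y)) * f y ^+ 2)%:E)%E.
(** In the bound of [W2_bound] the outer [l] comes from the 1 of [k2_dyadic] and the factor 2 from
    the sum of the 2^-j. A small [c] makes the coefficient of [D] as small as desired, at the
    expense of the mass term. *)
Definition Wmax (l c D : R) := l + 2 * (2 * (l / c) + 4 * c * D).

Lemma W2_bound f g1 g2 (c : R) x : weakg f g1 g2 -> 0 < c ->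
  (W k2 f x <= (Wmax (ip mu f f) c (ip mu g1 g1 + ip mu g2 g2))%:E)%E.
Proof.
move=> wf c0; have [lf l1 l2 _] := wf; have mf := L2_meas lf.
set D := ip mu g1 g1 + ip mu g2 g2.
have D0 : 0 <= D by rewrite addr_ge0 ?ip_ge0.
have f20 : 0 <= ip mu f f by exact: ip_ge0.
pose b := 2 * (ip mu f f / c) + 4 * c * D.
have bb : 0 <= b.
  by apply: addr_ge0; rewrite !mulr_ge0// ?invr_ge0// ltW.
pose t j y := (\1_(box (2^-1 ^+ j)) (y - x) * f y ^+ 2 : R).
have mt j : measurable_fun setT (t j).
  apply: measurable_funM; last exact: measurable_funX.
  apply: (measurableT_comp (measurable_indic (box_measurable (2^-1 ^+ j : R)))).
  exact: measurable_shift2.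
have t0 j y : 0 <= t j y.
  by apply: mulr_ge0; [case/andP: (indic_le1 (box (2^-1 ^+ j : R)) (y - x))|exact: sqr_ge0].
have It j : (\int[mu]_y (t j y)%:E <= (b * 2^-1 ^+ j)%:E)%E.
  have r0 : (0 : R) < 2^-1 ^+ j by rewrite exprn_gt0// invr_gt0.
  (* With s^2 = 2^-j c both terms of [local_mass] on the box of half-side 2^-j decay like 2^-j, so
     the series over [j] converges. *)
  have s0 : 0 < Num.sqrt (2^-1 ^+ j * c) by rewrite sqrtr_gt0 mulr_gt0.
  have := local_mass x wf (ltW r0) s0; rewrite sqr_sqrtr ?mulr_ge0 ?(ltW r0) ?(ltW c0)// -/D.
  move=> /le_trans; apply; rewrite lee_fin le_eqVlt; apply/orP; left; apply/eqP.
  rewrite /b; move: (2^-1 ^+ j) r0 c0 (ip mu f f) (D); clear => r r0 c0 a d.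
  by field; rewrite !gt_eqF.
have key y : ((k2 (enorm (x - y)) * f y ^+ 2)%:E <=
    (f y ^+ 2)%:E + \sum_(0 <= j <oo) (t j y)%:E)%E.
  rewrite EFinM enormB.
  apply: le_trans (lee_wpmul2r _ (k2_dyadic (y - x))) _; first by rewrite lee_fin sqr_ge0.
  rewrite ge0_muleDl ?mul1e//; last first.
    apply: nneseries_ge0 => j _ _; rewrite lee_fin.
    by case/andP: (indic_le1 (box (2^-1 ^+ j : R)) (y - x)).
  apply: leeD2l; rewrite muleC -nneseriesZl; last first.
    move=> j _; rewrite lee_fin.
    by case/andP: (indic_le1 (box (2^-1 ^+ j : R)) (y - x)).
  apply: lee_nneseries => [j _ _|j _]; last by rewrite /t mulrC EFinM.
  rewrite -EFinM lee_fin; apply: mulr_ge0; first exact: sqr_ge0.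
  by case/andP: (indic_le1 (box (2^-1 ^+ j : R)) (y - x)).
have mk := measurable_kerx x measurable_k2.
apply: (@le_trans _ _ (\int[mu]_y ((f y ^+ 2)%:E + \sum_(0 <= j <oo) (t j y)%:E))%E).
  apply: ge0_le_integral => //.
  - by move=> y _; rewrite lee_fin mulr_ge0 ?sqr_ge0// k2_ge0// enorm_ge0.
  - by apply/measurable_EFinP; apply: measurable_funM => //; exact: measurable_funX.
  - apply: emeasurable_funD; first by apply/measurable_EFinP; exact: measurable_funX.
    apply: ge0_emeasurable_sum => // [j y _ _|j _]; first by rewrite lee_fin.
    exact/measurable_EFinP.
rewrite ge0_integralD//; last 4 first.
- by move=> y _; rewrite lee_fin sqr_ge0.
- by apply/measurable_EFinP; exact: measurable_funX.
- by move=> y _; apply: nneseries_ge0 => j _ _; rewrite lee_fin.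
- apply: ge0_emeasurable_sum => // [j y _ _|j _]; first by rewrite lee_fin.
  exact/measurable_EFinP.
rewrite -ip_sqr// /Wmax EFinD -/D -/b; apply: leeD2l.
rewrite integral_nneseries//; last 2 first.
- by move=> j; exact/measurable_EFinP.
- by move=> j y _; rewrite lee_fin.
apply: nneseries_le => n; first exact: integral_EFin_ge0.
apply: (@le_trans _ _ (\sum_(0 <= j < n) (b * 2^-1 ^+ j)%:E)%E).
  by apply: lee_sum => j _; exact: It.
rewrite sumEFin lee_fin -mulr_sumr mulrC; apply: ler_wpM2r => //.
have -> : \sum_(0 <= i < n) (2^-1 : R) ^+ i = 2 - 2 * 2^-1 ^+ n.
  elim: n => [|n IH]; first by rewrite big_nil expr0; ring.
  by rewrite big_nat_recr//= IH exprS; field.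
by rewrite gerBl mulr_ge0// exprn_ge0// invr_ge0.
Qed.

End Kernels.

(** * Potentials and interaction energies *)

Section Potentials.
Context (R : realType).
Local Notation mu := (leb2 R).
Implicit Types (f g : R * R -> R) (h x y : R * R) (k : R -> R).

Definition kernel k := measurable_fun setT k /\ forall r, 0 <= r -> 0 <= k r.

Lemma kernel_k1 : kernel (@k1 R).
Proof. by split; [exact: measurable_k1|exact: k1_ge0]. Qed.

Lemma kernel_k2 : kernel (@k2 R).
Proof. by split; [exact: measurable_k2|exact: k2_ge0]. Qed.

Definition Lw f := (\int[mu]_y (k1 (enorm y) * f y ^+ 2)%:E)%E.

Definition V k f :=
  (\int[mu]_x \int[mu]_y (k (enorm (x - y)) * f x ^+ 2 * f y ^+ 2)%:E)%E.

Lemma ker_ge0 k x y : kernel k -> 0 <= k (enorm (x - y)).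
Proof. by move=> [_ k0]; exact/k0/enorm_ge0. Qed.

Lemma W_ge0 k f x : kernel k -> (0 <= W k f x)%E.
Proof.
by move=> kk; apply: integral_EFin_ge0 => y; rewrite mulr_ge0 ?sqr_ge0 ?ker_ge0.
Qed.

Lemma W_measurable k f : kernel k -> measurable_fun setT f ->
  measurable_fun setT (W k f).
Proof.
move=> kk mf; have [mk _] := kk.
apply: (measurable_fun_fubini_tonelli_F (m2 := mu)
  (fun z : (R * R) * (R * R) => (k (enorm (z.1 - z.2)) * f z.2 ^+ 2)%:E)).
  apply/measurable_EFinP; apply: measurable_funM; first exact: measurable_ker.
  by apply: measurable_funX; apply: (measurableT_comp mf); exact: measurable_snd.
by move=> z; rewrite lee_fin mulr_ge0 ?sqr_ge0 ?ker_ge0.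
Qed.

Lemma V_inner k f x : kernel k -> measurable_fun setT f ->
  (\int[mu]_y (k (enorm (x - y)) * f x ^+ 2 * f y ^+ 2)%:E =
   (f x ^+ 2)%:E * W k f x)%E.
Proof.
move=> kk mf; rewrite /W -integralZ_ge0.
- by apply: eq_integral => y _; rewrite mulrA (mulrC (f x ^+ 2)).
- by apply: measurable_funM; [exact: measurable_kerx (proj1 kk)|exact: measurable_funX].
- exact: sqr_ge0.
- by move=> y; rewrite mulr_ge0 ?sqr_ge0 ?ker_ge0.
Qed.

Lemma VE k f : kernel k -> measurable_fun setT f ->
  (V k f = \int[mu]_x ((f x ^+ 2)%:E * W k f x))%E.
Proof. by move=> kk mf; apply: eq_integral => x _; rewrite V_inner. Qed.

Lemma V_ge0 k f : kernel k -> measurable_fun setT f -> (0 <= V k f)%E.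
Proof.
move=> kk mf; rewrite VE//; apply: integral_ge0 => x _.
by rewrite mule_ge0 ?lee_fin ?sqr_ge0 ?W_ge0.
Qed.

Lemma fW_measurable k f : kernel k -> measurable_fun setT f ->
  measurable_fun setT (fun x => ((f x ^+ 2)%:E * W k f x)%E).
Proof.
move=> kk mf; apply: emeasurable_funM; last exact: W_measurable.
by apply/measurable_EFinP; exact: measurable_funX.
Qed.

Lemma Lw_ge0 f : (0 <= Lw f)%E.
Proof.
by apply: integral_EFin_ge0 => y; rewrite mulr_ge0 ?sqr_ge0 ?k1_ge0 ?enorm_ge0.
Qed.

Lemma k1f2_ge0 f y : 0 <= k1 (enorm y) * f y ^+ 2.
Proof. by rewrite mulr_ge0 ?sqr_ge0 ?k1_ge0 ?enorm_ge0. Qed.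

Lemma Lw_measurable f : measurable_fun setT f ->
  measurable_fun setT (fun y => k1 (enorm y) * f y ^+ 2).
Proof.
move=> mf; apply: measurable_funM; last exact: measurable_funX.
by apply: (measurableT_comp (@measurable_k1 R)); exact: measurable_enorm.
Qed.

(** By the subadditivity [k1_enormD]; this turns a finite logarithmic moment into a potential that
    is finite at every point. *)
Lemma W1_le f x : L2 mu f ->
  (W (@k1 R) f x <= (k1 (enorm x) * ip mu f f)%:E + Lw f)%E.
Proof.
move=> lf; have mf := L2_meas lf; have kx : 0 <= k1 (enorm x) by rewrite k1_ge0 ?enorm_ge0.
rewrite EFinM ip_sqr// -integralZ_ge0//; last 2 first.
- exact: measurable_funX.
- by move=> y; exact: sqr_ge0.
rewrite /Lw -integralD_ge0; last 4 first.
- by apply: measurable_funM; [exact: measurable_cst|exact: measurable_funX].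
- exact: Lw_measurable.
- by move=> y; rewrite mulr_ge0 ?sqr_ge0.
- by move=> y; rewrite mulr_ge0 ?sqr_ge0 ?k1_ge0 ?enorm_ge0.
apply: le_integral_EFin.
- by apply: measurable_funM; [exact: measurable_kerx (@measurable_k1 R)|exact: measurable_funX].
- apply: measurable_funD; last exact: Lw_measurable.
  by apply: measurable_funM; [exact: measurable_cst|exact: measurable_funX].
- by move=> y; rewrite mulr_ge0 ?sqr_ge0 ?k1_ge0 ?enorm_ge0.
- move=> y; rewrite -mulrDl; apply: ler_wpM2r; first exact: sqr_ge0.
  by rewrite -(enormN y); exact: k1_enormD.
Qed.

Lemma W1_lty f x : L2 mu f -> (Lw f < +oo)%E -> (W (@k1 R) f x < +oo)%E.
Proof.
by move=> lf Lf; apply: le_lt_trans (W1_le x lf) _; rewrite lte_add_pinfty// ltry.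
Qed.

Lemma V1_le f : L2 mu f -> (V (@k1 R) f <= (2 * ip mu f f)%:E * Lw f)%E.
Proof.
move=> lf; have mf := L2_meas lf; rewrite VE//; last exact: kernel_k1.
apply: (@le_trans _ _ (\int[mu]_x ((ip mu f f)%:E * (k1 (enorm x) * f x ^+ 2)%:E
   + Lw f * (f x ^+ 2)%:E))%E).
  apply: ge0_le_integral => //.
  - by move=> x _; rewrite mule_ge0 ?lee_fin ?sqr_ge0 ?W_ge0//; exact: kernel_k1.
  - exact: fW_measurable kernel_k1 mf.
  - apply: emeasurable_funD; apply: emeasurable_funM; try exact: measurable_cst.
      by apply/measurable_EFinP; exact: Lw_measurable.
    by apply/measurable_EFinP; exact: measurable_funX.
  - move=> x _; apply: le_trans (lee_wpmul2l _ (W1_le x lf)) _; first by rewrite lee_fin sqr_ge0.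
    rewrite ge0_muleDr ?Lw_ge0//; last by rewrite lee_fin mulr_ge0 ?ip_ge0 ?k1_ge0 ?enorm_ge0.
    rewrite (muleC (Lw f)) -!EFinM; apply: leeD2r; rewrite lee_fin.
    by rewrite le_eqVlt; apply/orP; left; apply/eqP; ring.
rewrite ge0_integralD//; last 4 first.
- by move=> x _; rewrite -EFinM lee_fin; apply: mulr_ge0; [exact: ip_ge0|exact: k1f2_ge0].
- apply: emeasurable_funM; first exact: measurable_cst.
  by apply/measurable_EFinP; exact: Lw_measurable.
- by move=> x _; rewrite mule_ge0 ?Lw_ge0 ?lee_fin ?sqr_ge0.
- apply: emeasurable_funM; first exact: measurable_cst.
  by apply/measurable_EFinP; exact: measurable_funX.
rewrite ge0_integralZl//; last 3 first.
- by apply/measurable_EFinP; exact: Lw_measurable.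
- by move=> x _; rewrite lee_fin k1f2_ge0.
- by rewrite lee_fin ip_ge0.
rewrite ge0_integralZl//; last 3 first.
- by apply/measurable_EFinP; exact: measurable_funX.
- by move=> x _; rewrite lee_fin sqr_ge0.
- exact: Lw_ge0.
rewrite -ip_sqr// -/(Lw f) (muleC (Lw f)) -ge0_muleDl ?lee_fin ?ip_ge0//.
by rewrite -EFinD (_ : _ + _ = 2 * ip mu f f)//; ring.
Qed.

Lemma V_le_bounded k f (B : R) : kernel k -> L2 mu f -> 0 <= B ->
  (forall x, W k f x <= B%:E)%E -> (V k f <= (B * ip mu f f)%:E)%E.
Proof.
move=> kk lf B0 hB; have mf := L2_meas lf; rewrite VE//.
rewrite EFinM ip_sqr// -integralZ_ge0//; last 2 first.
- exact: measurable_funX.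
- by move=> y; exact: sqr_ge0.
apply: ge0_le_integral => //.
- by move=> x _; rewrite mule_ge0 ?lee_fin ?sqr_ge0 ?W_ge0.
- exact: fW_measurable.
- by apply/measurable_EFinP; apply: measurable_funM; [exact: measurable_cst|exact: measurable_funX].
- move=> x _; have -> : (B * f x ^+ 2)%:E = ((f x ^+ 2)%:E * B%:E)%E by rewrite mulrC.
  by apply: lee_wpmul2l; rewrite ?lee_fin ?sqr_ge0.
Qed.

(** Each part of the kernel gives an integrable inner integrand at every [x] and then a finite
    double integral, so no difference of infinities arises in either integration. *)
Lemma logV f (B : R) : L2 mu f -> (Lw f < +oo)%E -> 0 <= B ->
  (forall x, W (@k2 R) f x <= B%:E)%E ->
  (\int[mu]_x \int[mu]_y (ln (enorm (x - y)) * f x ^+ 2 * f y ^+ 2)%:E =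
   V (@k1 R) f - V (@k2 R) f)%E.
Proof.
move=> lf Lf B0 hB; have mf := L2_meas lf.
have ik k x : kernel k -> (W k f x < +oo)%E -> mu.-integrable setT
    (EFin \o (fun y => k (enorm (x - y)) * f x ^+ 2 * f y ^+ 2)).
  move=> kk Woo; apply: integrable_EFin_ge0.
  - apply: measurable_funM; last exact: measurable_funX.
    by apply: measurable_funM; [exact: measurable_kerx (proj1 kk)|exact: measurable_cst].
  - by move=> y; rewrite mulr_ge0 ?sqr_ge0// mulr_ge0 ?sqr_ge0// ker_ge0.
  - by rewrite V_inner// lte_mul_pinfty// lee_fin sqr_ge0.
have W2oo x : (W (@k2 R) f x < +oo)%E by apply: le_lt_trans (hB x) _; rewrite ltry.
have inner x : (\int[mu]_y (ln (enorm (x - y)) * f x ^+ 2 * f y ^+ 2)%:E =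
    (f x ^+ 2)%:E * W (@k1 R) f x - (f x ^+ 2)%:E * W (@k2 R) f x)%E.
  have i1 := ik _ x kernel_k1 (W1_lty x lf Lf); have i2 := ik _ x kernel_k2 (W2oo x).
  rewrite -!V_inner//; [|exact: kernel_k2|exact: kernel_k1].
  rewrite -(integralB_EFin measurableT i1 i2).
  by apply: eq_integral => y _ /=; rewrite lnE -EFinB; congr EFin; ring.
under eq_integral do rewrite inner.
have iV k : kernel k -> (V k f < +oo)%E ->
    mu.-integrable setT (fun x => ((f x ^+ 2)%:E * W k f x)%E).
  move=> kk Voo; apply/integrableP; split; first exact: fW_measurable.
  under eq_integral.
    move=> x _; rewrite gee0_abs; last by rewrite mule_ge0 ?lee_fin ?sqr_ge0 ?W_ge0.
    over.
  by rewrite -VE.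
rewrite (integralB measurableT (iV _ kernel_k1 _) (iV _ kernel_k2 _)).
- by rewrite -!VE//; [exact: kernel_k2|exact: kernel_k1].
- apply: le_lt_trans (V1_le lf) _.
  by rewrite lte_mul_pinfty// lee_fin mulr_ge0 ?ip_ge0.
- by apply: le_lt_trans (V_le_bounded kernel_k2 lf B0 hB) _; rewrite ltry.
Qed.

(** [D] is a bound for the Dirichlet integral and not its value, so that the class passes to limits
    without a choice of gradient. Since the energy increases with [D], minimizing over pairs (f, D)
    does not change the infimum. *)
Definition Hcl f (D : R) := [/\ (forall x, 0 <= f x),
  (exists g1 g2, weakg f g1 g2 /\ ip mu g1 g1 + ip mu g2 g2 <= D) &
  (Lw f < +oo)%E].

Lemma Hcl_L2 f D : Hcl f D -> L2 mu f.
Proof. by move=> [_ [g1 [g2 [[]]]]]. Qed.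

Lemma Wmax_ge0 (l c D : R) : 0 <= l -> 0 < c -> 0 <= D -> 0 <= Wmax l c D.
Proof.
move=> l0 c0 D0; rewrite /Wmax addr_ge0// mulr_ge0// addr_ge0//.
  by rewrite mulr_ge0// divr_ge0// ltW.
by rewrite !mulr_ge0// ltW.
Qed.

Lemma Wmax_le (l c D D' : R) : 0 < c -> D <= D' -> Wmax l c D <= Wmax l c D'.
Proof.
move=> c0 DD; rewrite /Wmax lerD2l ler_wpM2l// lerD2l ler_wpM2l//.
by rewrite mulr_ge0// ltW.
Qed.

Lemma Hcl_ge0 f D : Hcl f D -> 0 <= D.
Proof.
by move=> [_ [g1 [g2 [_ gD]]] _]; apply: le_trans gD; rewrite addr_ge0 ?ip_ge0.
Qed.

Lemma Hcl_W2 f D (c : R) x : Hcl f D -> 0 < c ->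
  (W (@k2 R) f x <= (Wmax (ip mu f f) c D)%:E)%E.
Proof.
move=> [_ [g1 [g2 [wg gD]]] _] c0; apply: le_trans (W2_bound x wg c0) _.
by rewrite lee_fin Wmax_le.
Qed.

Definition v1 f := fine (V (@k1 R) f).
Definition v2 f := fine (V (@k2 R) f).

Lemma Hcl_V1 f D : Hcl f D -> ((v1 f)%:E = V (@k1 R) f)%E.
Proof.
move=> hf; have lf := Hcl_L2 hf; have [_ _ Lf] := hf.
rewrite fineK// ge0_fin_numE; last exact: V_ge0 kernel_k1 (L2_meas lf).
apply: le_lt_trans (V1_le lf) _.
by rewrite lte_mul_pinfty// lee_fin mulr_ge0 ?ip_ge0.
Qed.

Lemma Hcl_V2 f D : Hcl f D -> ((v2 f)%:E = V (@k2 R) f)%E.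
Proof.
move=> hf; have lf := Hcl_L2 hf; have D0 := Hcl_ge0 hf.
rewrite fineK// ge0_fin_numE; last exact: V_ge0 kernel_k2 (L2_meas lf).
have W0 : 0 <= Wmax (ip mu f f) 1 D by rewrite Wmax_ge0 ?ip_ge0.
apply: le_lt_trans (V_le_bounded kernel_k2 lf W0 _) _; last by rewrite ltry.
by move=> x; exact: Hcl_W2.
Qed.

Lemma Hcl_v1_le f D g D' : Hcl f D -> Hcl g D' ->
  (V (@k1 R) f <= V (@k1 R) g)%E -> v1 f <= v1 g.
Proof. by move=> Hf Hg; rewrite -(Hcl_V1 Hf) -(Hcl_V1 Hg) lee_fin. Qed.

Lemma Hcl_v2_leD f D g D' (a : R) : Hcl f D -> Hcl g D' ->
  (V (@k2 R) f <= V (@k2 R) g + a%:E)%E -> v2 f <= v2 g + a.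
Proof. by move=> Hf Hg; rewrite -(Hcl_V2 Hf) -(Hcl_V2 Hg) -EFinD lee_fin. Qed.

Lemma v1_ge0 f D : Hcl f D -> 0 <= v1 f.
Proof.
move=> hf; rewrite -lee_fin (Hcl_V1 hf).
exact: V_ge0 kernel_k1 (L2_meas (Hcl_L2 hf)).
Qed.

Lemma v2_ge0 f D : Hcl f D -> 0 <= v2 f.
Proof.
move=> hf; rewrite -lee_fin (Hcl_V2 hf).
exact: V_ge0 kernel_k2 (L2_meas (Hcl_L2 hf)).
Qed.

Lemma v2_le f D (c : R) : Hcl f D -> 0 < c ->
  v2 f <= Wmax (ip mu f f) c D * ip mu f f.
Proof.
move=> hf c0; have lf := Hcl_L2 hf; have D0 := Hcl_ge0 hf.
rewrite -lee_fin (Hcl_V2 hf).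
apply: V_le_bounded kernel_k2 lf _ _; first by rewrite Wmax_ge0 ?ip_ge0.
by move=> x; exact: Hcl_W2.
Qed.

Lemma Hcl_logV f D : Hcl f D ->
  (\int[mu]_x \int[mu]_y (ln (enorm (x - y)) * f x ^+ 2 * f y ^+ 2)%:E =
   (v1 f - v2 f)%:E)%E.
Proof.
move=> hf; have lf := Hcl_L2 hf; have D0 := Hcl_ge0 hf; have [_ _ Lf] := hf.
have W0 : 0 <= Wmax (ip mu f f) 1 D by rewrite Wmax_ge0 ?ip_ge0.
rewrite (logV lf Lf W0); last by move=> x; exact: Hcl_W2.
by rewrite EFinB (Hcl_V1 hf) (Hcl_V2 hf).
Qed.

End Potentials.

(** * Reduction to nonnegative functions *)

Section Reduction.
Context (R : realType).
Local Notation mu := (leb2 R).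
Implicit Types (f g : R * R -> R) (u w : R * R -> R[i]) (h x y : R * R).

Lemma L2_loc_int f : L2 mu f -> loc_int f.
Proof.
move=> lf; split; first exact: L2_meas lf.
move=> K cK; have mK := compact_measurable2 cK.
have [r r0 Kr] := compact_box cK.
have lK : L2 mu \1_K.
  apply: L2_indic => //; apply: (@le_lt_trans _ _ (mu (box r))).
    by apply: le_measure => //; rewrite inE//; exact: box_measurable.
  by have := leb2_box (ltW r0) => /= ->; rewrite ltry.
have iK := L2_integrable lf lK.
have iK' := integrableS measurableT mK (@subsetT _ K) iK.
apply: eq_integrable iK' => //.
have pt x : x \in K -> (f x * \1_K x)%:E = (f x)%:E by move=> xK; rewrite indicE xK mulr1.
by move=> x; exact: pt.
Qed.

Lemma weakg_partial f g1 g2 : weakg f g1 g2 ->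
  weak_partial (e1 R) f g1 /\ weak_partial (e2 R) f g2.
Proof.
move=> [lf l1 l2 hw]; split; split; try exact: L2_loc_int.
  split; first exact: L2_loc_int.
  move=> p tp; have [e _] := hw _ tp.
  rewrite -(ipE lf (test_fun_L2 (test_fun_D1 tp))) -(ipE l1 (test_fun_L2 tp)).
  by rewrite -EFinN; congr EFin.
split; first exact: L2_loc_int.
move=> p tp; have [_ e] := hw _ tp.
rewrite -(ipE lf (test_fun_L2 (test_fun_D2 tp))) -(ipE l2 (test_fun_L2 tp)).
by rewrite -EFinN; congr EFin.
Qed.

Lemma partial_weakg f g1 g2 : L2 mu f -> L2 mu g1 -> L2 mu g2 ->
  weak_partial (e1 R) f g1 -> weak_partial (e2 R) f g2 -> weakg f g1 g2.
Proof.
move=> lf l1 l2 [_ [_ h1]] [_ [_ h2]].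
split; [exact: lf|exact: l1|exact: l2|] => p tp; split.
  apply: EFin_inj; rewrite (ipE lf (test_fun_L2 (test_fun_D1 tp))) EFinN (ipE l1 (test_fun_L2 tp)).
  exact: h1.
apply: EFin_inj; rewrite (ipE lf (test_fun_L2 (test_fun_D2 tp))) EFinN (ipE l2 (test_fun_L2 tp)).
exact: h2.
Qed.

Lemma weakg0 : weakg (fun=> 0 : R) (fun=> 0) (fun=> 0).
Proof.
have z p : ip mu (fun=> 0) p = 0.
  by rewrite /ip; under eq_integral do rewrite mul0r; rewrite integral0.
by split => [|||p _]; [exact: L2_0|exact: L2_0|exact: L2_0|rewrite !z oppr0].
Qed.

Definition cnorm u : R * R -> R := fun x => Num.sqrt (cabs2 (u x)).

Lemma cabs2_ge0 (z : R[i]) : 0 <= cabs2 z.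
Proof. by rewrite addr_ge0 ?sqr_ge0. Qed.

Lemma cnorm_sqr u x : cnorm u x ^+ 2 = cabs2 (u x).
Proof. by rewrite sqr_sqrtr ?cabs2_ge0. Qed.

Lemma cnorm_diff u x y : (cnorm u x - cnorm u y) ^+ 2 <=
  (complex.Re (u x) - complex.Re (u y)) ^+ 2 + (complex.Im (u x) - complex.Im (u y)) ^+ 2.
Proof.
pose p : R * R := (complex.Re (u x), complex.Im (u x)).
pose q : R * R := (complex.Re (u y), complex.Im (u y)).
have -> : cnorm u x = enorm p by [].
have -> : cnorm u y = enorm q by [].
rewrite -[leRHS](enorm_sqr (p - q)) -real_normK ?num_real//.
rewrite lerXn2r// ?nnegrE ?enorm_ge0// ler_norml.
have h1 := enormD (p - q) q; have h2 := enormD (q - p) p.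
rewrite subrK in h1; rewrite subrK enormB in h2.
by apply/andP; split; lra.
Qed.

Definition Dir (g1 g2 : R * R -> R[i]) := (\int[mu]_x ((cabs2 (g1 x) + cabs2 (g2 x))%:E))%E.

Lemma X_grad_L2 u (g1 g2 : R * R -> R[i]) : X_grad u g1 g2 ->
  [/\ L2 mu (fun x => complex.Re (u x)), L2 mu (fun x => complex.Im (u x)),
      L2 mu (fun x => complex.Re (g1 x)) & L2 mu (fun x => complex.Im (g1 x))] /\
  [/\ L2 mu (fun x => complex.Re (g2 x)), L2 mu (fun x => complex.Im (g2 x)) &
      (Lw (cnorm u) < +oo)%E].
Proof.
move=> [[w1 [w2 [w3 w4]]] oo].
have mR : measurable_fun setT (fun x => complex.Re (u x)) by have [[]] := w1.
have mI : measurable_fun setT (fun x => complex.Im (u x)) by have [[]] := w2.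
have mR1 : measurable_fun setT (fun x => complex.Re (g1 x)) by have [_ [[]]] := w1.
have mI1 : measurable_fun setT (fun x => complex.Im (g1 x)) by have [_ [[]]] := w2.
have mR2 : measurable_fun setT (fun x => complex.Re (g2 x)) by have [_ [[]]] := w3.
have mI2 : measurable_fun setT (fun x => complex.Im (g2 x)) by have [_ [[]]] := w4.
have mc (z : R * R -> R[i]) : measurable_fun setT (fun x => complex.Re (z x)) ->
    measurable_fun setT (fun x => complex.Im (z x)) ->
    measurable_fun setT (fun x : R * R => cabs2 (z x) : R).
  by move=> m1 m2; apply: measurable_funD; exact: measurable_funX.
have mu' := mc _ mR mI; have mg1 := mc _ mR1 mI1; have mg2 := mc _ mR2 mI2.
have mcn : measurable_fun setT (cnorm u).
  apply: (@measurableT_comp _ _ _ _ _ _ (@Num.sqrt R)) => //.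
  by apply: continuous_measurable_fun; exact: sqrt_continuous.
have mk : measurable_fun setT (fun x : R * R => ln (1 + enorm x) : R).
  by apply: (measurableT_comp (@measurable_k1 R)); exact: measurable_enorm.
have mtot : measurable_fun setT (fun x => cabs2 (g1 x) + cabs2 (g2 x) + cabs2 (u x)
   + ln (1 + enorm x) * cabs2 (u x)).
  apply: measurable_funD; last exact: measurable_funM.
  by apply: measurable_funD => //; exact: measurable_funD.
have k0 x : 0 <= ln (1 + enorm x) * cabs2 (u x).
  by rewrite mulr_ge0 ?cabs2_ge0//; apply: k1_ge0; exact: enorm_ge0.
have dom f : measurable_fun setT f -> (forall x, 0 <= f x) -> (forall x, f x <=
    cabs2 (g1 x) + cabs2 (g2 x) + cabs2 (u x) + ln (1 + enorm x) * cabs2 (u x)) ->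
    (\int[mu]_x (f x)%:E < +oo)%E.
  by move=> mf f0 hf; apply: le_lt_trans oo; apply: le_integral_EFin.
have aux x : [/\ 0 <= cabs2 (g1 x), 0 <= cabs2 (g2 x), 0 <= cabs2 (u x) &
    0 <= ln (1 + enorm x) * cabs2 (u x)] by split; rewrite ?cabs2_ge0.
have sq (z : R[i]) : complex.Re z ^+ 2 <= cabs2 z /\ complex.Im z ^+ 2 <= cabs2 z.
  by rewrite /cabs2 lerDl lerDr !sqr_ge0.
split; split => //; try (split => //; apply: dom; [exact: measurable_funX|by move=> x; exact: sqr_ge0|]).
- by move=> x; have [] := aux x; have [] := sq (u x); lra.
- by move=> x; have [] := aux x; have [] := sq (u x); lra.
- by move=> x; have [] := aux x; have [] := sq (g1 x); lra.
- by move=> x; have [] := aux x; have [] := sq (g1 x); lra.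
- by move=> x; have [] := aux x; have [] := sq (g2 x); lra.
- by move=> x; have [] := aux x; have [] := sq (g2 x); lra.
- apply: dom; first exact: Lw_measurable.
    by move=> x; exact: k1f2_ge0.
  by move=> x; rewrite cnorm_sqr /k1; have [] := aux x; lra.
Qed.

Lemma X_grad_Dir u (g1 g2 : R * R -> R[i]) : X_grad u g1 g2 -> Dir g1 g2 =
  ((ip mu (fun x => complex.Re (g1 x)) (fun x => complex.Re (g1 x))
   + ip mu (fun x => complex.Im (g1 x)) (fun x => complex.Im (g1 x)))
   + (ip mu (fun x => complex.Re (g2 x)) (fun x => complex.Re (g2 x))
   + ip mu (fun x => complex.Im (g2 x)) (fun x => complex.Im (g2 x))))%:E.
Proof.
move=> /X_grad_L2[[_ _ l1 l2] [l3 l4 _]].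
have m1 := L2_meas l1; have m2 := L2_meas l2; have m3 := L2_meas l3; have m4 := L2_meas l4.
rewrite !EFinD !ip_sqr// /Dir /cabs2 integralD_ge0.
- by rewrite !integralD_ge0//; try exact: measurable_funX; by move=> x; exact: sqr_ge0.
- by apply: measurable_funD; exact: measurable_funX.
- by apply: measurable_funD; exact: measurable_funX.
- by move=> x; rewrite addr_ge0 ?sqr_ge0.
- by move=> x; rewrite addr_ge0 ?sqr_ge0.
Qed.

(** The triangle inequality in the complex plane bounds the modulus [dq] of |u| by the sum of those
    of its real and imaginary parts, and [weakg_exists] converts the bound back into a gradient. No
    chain rule for the square root is used. *)
Lemma X_grad_Hcl u (g1 g2 : R * R -> R[i]) : X_grad u g1 g2 -> Hcl (cnorm u) (fine (Dir g1 g2)).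
Proof.
move=> Xu; have [[l1 l2 l3 l4] [l5 l6 Lu]] := X_grad_L2 Xu.
have [[w1 [w2 [w3 w4]]] _] := Xu.
have wR := partial_weakg l1 l3 l5 w1 w3; have wI := partial_weakg l2 l4 l6 w2 w4.
have lc : L2 mu (cnorm u).
  split.
    apply: (@measurableT_comp _ _ _ _ _ _ (@Num.sqrt R)).
      by apply: continuous_measurable_fun; exact: sqrt_continuous.
    by apply: measurable_funD; apply: measurable_funX; [exact: L2_meas l1|exact: L2_meas l2].
  under eq_integral do rewrite cnorm_sqr.
  rewrite /cabs2 integralD_ge0; [|exact: measurable_funX (L2_meas l1)|exact: measurable_funX (L2_meas l2)|by move=> x; exact: sqr_ge0|by move=> x; exact: sqr_ge0].
  by case: l1 l2 => _ ? [_ ?]; rewrite lte_add_pinfty.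
split => //; first by move=> x; exact: sqrtr_ge0.
rewrite (X_grad_Dir Xu) /=; apply: weakg_exists => //.
  by rewrite !addr_ge0 ?ip_ge0.
move=> t t0 t1; have t0' := ltW t0.
have bR := dq_bounded t l1; have bI := dq_bounded t l2.
apply: (@le_trans _ _ (disc_int t (fun h => dq (fun x => complex.Re (u x)) h
    + 1 * dq (fun x => complex.Im (u x)) h))).
  apply: disc_int_le => //; [exact: dq_bounded|exact: disc_bounded_lin|].
  move=> h _; rewrite mul1r -lee_fin EFinD !dq_integral// -integralD_ge0.
  - apply: le_integral_EFin.
    + apply: measurable_funX; apply: measurable_funB; last exact: L2_meas lc.
      exact: L2_meas (tau_L2 h lc).
    + apply: measurable_funD; apply: measurable_funX; apply: measurable_funB.
      * exact: L2_meas (tau_L2 h l1).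
      * exact: L2_meas l1.
      * exact: L2_meas (tau_L2 h l2).
      * exact: L2_meas l2.
    + by move=> x; exact: sqr_ge0.
    + by move=> x; exact: cnorm_diff.
  - by apply: measurable_funX; apply: measurable_funB; [exact: L2_meas (tau_L2 h l1)|exact: L2_meas l1].
  - by apply: measurable_funX; apply: measurable_funB; [exact: L2_meas (tau_L2 h l2)|exact: L2_meas l2].
  - by move=> x; exact: sqr_ge0.
  - by move=> x; exact: sqr_ge0.
rewrite disc_int_lin// mul1r.
have h1 := weakg_dq t0' wR; have h2 := weakg_dq t0' wI.
apply: le_trans (lerD h1 h2) _; rewrite -mulrDl; apply: ler_wpM2r.
  exact/ltW/disc_mom_gt0.
by rewrite le_eqVlt addrACA eqxx.
Qed.

Definition cplx f : R * R -> R[i] := fun x => Complex (f x) 0.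

Lemma Hcl_X_grad f g1 g2 : weakg f g1 g2 -> (Lw f < +oo)%E ->
  X_grad (cplx f) (cplx g1) (cplx g2) /\
  Dir (cplx g1) (cplx g2) = (ip mu g1 g1 + ip mu g2 g2)%:E.
Proof.
move=> wf Lf; have [lf l1 l2 _] := wf.
have [p1 p2] := weakg_partial wf; have [z1 z2] := weakg_partial weakg0.
have mf := L2_meas lf; have m1 := L2_meas l1; have m2 := L2_meas l2.
have cE g x : cabs2 (cplx g x) = g x ^+ 2 by rewrite /cabs2 /cplx /= expr0n addr0.
have DE : Dir (cplx g1) (cplx g2) = (ip mu g1 g1 + ip mu g2 g2)%:E.
  rewrite /Dir; under eq_integral do rewrite !cE.
  rewrite integralD_ge0; [|exact: measurable_funX|exact: measurable_funX|by move=> x; exact: sqr_ge0|by move=> x; exact: sqr_ge0].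
  by rewrite EFinD !ip_sqr.
split; last exact: DE.
split; first by split; [exact: p1|split; [exact: z1|split; [exact: p2|exact: z2]]].
under eq_integral do rewrite !cE.
rewrite integralD_ge0.
- rewrite integralD_ge0.
  + rewrite lte_add_pinfty// lte_add_pinfty//; last by case: lf.
    rewrite integralD_ge0; [|exact: measurable_funX|exact: measurable_funX|by move=> x; exact: sqr_ge0|by move=> x; exact: sqr_ge0].
    by rewrite -!ip_sqr// -EFinD ltry.
  + by apply: measurable_funD; exact: measurable_funX.
  + exact: measurable_funX.
  + by move=> x; rewrite addr_ge0 ?sqr_ge0.
  + by move=> x; exact: sqr_ge0.
- apply: measurable_funD; last exact: measurable_funX.
  by apply: measurable_funD; exact: measurable_funX.
- exact: Lw_measurable.
- by move=> x; rewrite !addr_ge0 ?sqr_ge0.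
- by move=> x; exact: k1f2_ge0.
Qed.

(** The theorem ranges over all weak gradients of [u], so some uniqueness is required. Two gradients
    have the same products with test functions, which duality turns into a comparison of norms; the
    imaginary parts of the gradient are orthogonal to all test functions. *)
Lemma X_grad_Dir_le f (g1 g2 : R * R -> R[i]) G1 G2 : X_grad (cplx f) g1 g2 -> weakg f G1 G2 ->
  (Dir g1 g2 <= (ip mu G1 G1 + ip mu G2 G2)%:E)%E.
Proof.
move=> Xu [lf L1 L2' hG]; have [[l1 l2 l3 l4] [l5 l6 _]] := X_grad_L2 Xu.
have [[w1 [w2 [w3 w4]]] _] := Xu.
have [_ _ _ hR] := partial_weakg l1 l3 l5 w1 w3.
have [_ _ _ hI] := partial_weakg l2 l4 l6 w2 w4.
rewrite (X_grad_Dir Xu) lee_fin.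
have G0 : 0 <= ip mu G1 G1 + ip mu G2 G2 by rewrite addr_ge0 ?ip_ge0.
have i0 p : ip mu (fun x => complex.Im (cplx f x)) p = 0.
  by rewrite /ip /=; under eq_integral do rewrite mul0r; rewrite integral0.
have bR : ip mu (fun x => complex.Re (g1 x)) (fun x => complex.Re (g1 x)) +
    ip mu (fun x => complex.Re (g2 x)) (fun x => complex.Re (g2 x)) <= ip mu G1 G1 + ip mu G2 G2.
  apply: L2_dual_pair => // p q tp tq.
  have lp := test_fun_L2 tp; have lq := test_fun_L2 tq.
  have r1 : ip mu (fun x => complex.Re (g1 x)) p = ip mu G1 p.
    apply: oppr_inj; have [<- _] := hR _ tp; have [<- _] := hG _ tp; reflexivity.
  have r2 : ip mu (fun x => complex.Re (g2 x)) q = ip mu G2 q.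
    apply: oppr_inj; have [_ <-] := hR _ tq; have [_ <-] := hG _ tq; reflexivity.
  rewrite r1 r2; have c1 := ip_CS L1 lp; have c2 := ip_CS L2' lq.
  have := ip_ge0 mu G1; have := ip_ge0 mu G2; have := ip_ge0 mu p; have := ip_ge0 mu q.
  move: c1 c2; move: (ip mu G1 p) (ip mu G2 q) (ip mu G1 G1) (ip mu G2 G2) (ip mu p p) (ip mu q q).
  clear; move=> a b A B P Q aAP bBQ Q0 P0 B0 A0.
  (* Squaring reduces this to 4 (A P) (B Q) <= (A Q + B P)^2. *)
  have ab : (2 * (a * b)) <= A * Q + B * P.
    apply: le_trans (ler_norm _) _; rewrite -(@ler_pXn2r _ 2)// ?nnegrE ?addr_ge0 ?mulr_ge0//.
    rewrite real_normK ?num_real//.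
    apply: (@le_trans _ _ (4 * ((A * P) * (B * Q)))).
      rewrite (_ : (2 * (a * b)) ^+ 2 = 4 * (a ^+ 2 * b ^+ 2)); last by ring.
      by apply: ler_wpM2l => //; apply: ler_pM; rewrite ?sqr_ge0.
    by have := sqr_ge0 (A * Q - B * P); lra.
  by lra.
have zI g : L2 mu g -> (forall p, test_fun p -> ip mu g p = 0) -> ip mu g g = 0.
  by move=> lg hg; exact: L2_annihilator.
have I1 : ip mu (fun x => complex.Im (g1 x)) (fun x => complex.Im (g1 x)) = 0.
  by apply: zI => // p tp; have [] := hI _ tp; rewrite i0 => /eqP; rewrite eq_sym oppr_eq0 => /eqP.
have I2 : ip mu (fun x => complex.Im (g2 x)) (fun x => complex.Im (g2 x)) = 0.
  by apply: zI => // p tp; have [_] := hI _ tp; rewrite i0 => /eqP; rewrite eq_sym oppr_eq0 => /eqP.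
by rewrite I1 I2 !addr0.
Qed.

End Reduction.

(** * Compactness *)

Section Cells.
Context (R : realType).
Local Notation mu := (leb2 R).
Implicit Types (f g w : R * R -> R) (h x y : R * R).

(** The substitution y = x + h at fixed [x], followed by Tonelli in (x, h). *)
Lemma integral_dq_indic (A : set (R * R)) w : measurable A -> L2 mu w ->
  (\int[mu]_x \int[mu]_y (\1_A (y - x) * (w y - w x) ^+ 2)%:E =
   \int[mu]_h (\1_A h * dq w h)%:E)%E.
Proof.
move=> mA lw; have mw := L2_meas lw.
have mb : measurable_fun setT (\1_A : R * R -> R).
  exact: measurable_indic (mA).
have b0 h : 0 <= (\1_A h : R) by case/andP: (indic_le1 A h).
pose G (z : (R * R) * (R * R)) := (\1_A z.2 * (w (z.1 + z.2) - w z.1) ^+ 2)%:E.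
have mG : measurable_fun setT G.
  apply/measurable_EFinP; apply: measurable_funM.
    by apply: (measurableT_comp mb); exact: measurable_snd.
  apply: measurable_funX; apply: measurable_funB.
    by apply: (measurableT_comp mw); exact: measurable_add2.
  by apply: (measurableT_comp mw); exact: measurable_fst.
have G0 z : (0 <= G z)%E by rewrite lee_fin mulr_ge0 ?sqr_ge0.
transitivity (\int[mu]_x \int[mu]_h G (x, h))%E.
  apply: eq_integral => x _.
  have mf : measurable_fun setT (fun y => \1_A (y - x) * (w y - w x) ^+ 2).
    apply: measurable_funM.
      by apply: (measurableT_comp mb); exact: measurable_shift2.
    by apply: measurable_funX; apply: measurable_funB => //; exact: measurable_cst.
  rewrite -(integral_shift x mf); apply: eq_integral => h _.
  by rewrite /G/= addrK (addrC x h).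
rewrite (fubini_tonelli G)//; apply: eq_integral => h _.
rewrite /G /= EFinM dq_integral// -integralZ_ge0//.
  apply: measurable_funX; apply: measurable_funB => //.
  by apply: (measurableT_comp mw); exact: measurable_shift2.
by move=> x; exact: sqr_ge0.
Qed.

Section Grid.
Variables (a s : R) (N : nat).
Hypothesis s0 : 0 < s.

(** Half-open, so that the cells tile the grid box without overlap and their indicators sum to one
    at every point of it. *)
Definition gridI (i : nat) : set R := `[a + s * i%:R, a + s * i.+1%:R[.

Lemma gridI_sum (n : nat) (t : R) :
  \sum_(i < n) (\1_(gridI i) t : R) = \1_(`[a, a + s * n%:R[%classic) t.
Proof.
elim: n => [|n IH]; first by rewrite big_ord0 mulr0 addr0 set_itv_ge ?bnd_simp ?ltxx// indic0.
rewrite big_ord_recr /= IH !indicE !mem_setE !in_itv/=.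
have h1 : a + s * n%:R < a + s * n.+1%:R by rewrite ltrD2l ltr_pM2l// ltr_nat.
have h2 : a <= a + s * n%:R by rewrite lerDl mulr_ge0// ltW.
case: (leP a t) => at_ /=; last first.
  by rewrite leNgt (lt_le_trans at_ h2)/= addr0.
case: (ltP t (a + s * n%:R)) => tn /=; last by rewrite add0r.
by rewrite (lt_trans tn h1) addr0.
Qed.

Definition cell (c : 'I_N * 'I_N) x : R := \1_(gridI c.1) x.1 * \1_(gridI c.2) x.2.
Definition gridbox : set (R * R) := `[a, a + s * N%:R[ `*` `[a, a + s * N%:R[.

Lemma cell_sum x : \sum_(c : 'I_N * 'I_N) cell c x = \1_gridbox x.
Proof.
transitivity (\sum_(i < N) \sum_(j < N) \1_(gridI i) x.1 * \1_(gridI j) x.2 : R).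
  by rewrite pair_big.
under eq_bigr do rewrite -mulr_sumr gridI_sum.
rewrite -mulr_suml gridI_sum !indicE -natrM mulnb; congr (nat_of_bool _)%:R.
apply/andP/idP => [[/set_mem h1 /set_mem h2]|/set_mem[h1 h2]]; first exact/mem_set.
by split; exact/mem_set.
Qed.

Lemma cellE c x : cell c x = \1_(gridI c.1 `*` gridI c.2) x.
Proof.
rewrite /cell !indicE -natrM mulnb; congr (nat_of_bool _)%:R.
apply/andP/idP => [[/set_mem h1 /set_mem h2]|/set_mem[h1 h2]]; first exact/mem_set.
by split; exact/mem_set.
Qed.

Lemma cell_ge0 c x : 0 <= cell c x.
Proof. by rewrite cellE; case/andP: (indic_le1 (gridI c.1 `*` gridI c.2) x). Qed.

Lemma cell_sqr c x : cell c x * cell c x = cell c x.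
Proof. by rewrite cellE indicE; case: (x \in _); rewrite ?mulr1 ?mulr0. Qed.

Lemma gridIX_measurable (c : 'I_N * 'I_N) : measurable (gridI c.1 `*` gridI c.2).
Proof. by apply: measurableX; exact: measurable_itv. Qed.

Lemma leb1_gridI i : leb1 R (gridI i) = s%:E.
Proof.
rewrite /leb1 /gridI lebesgue_measure_itv/= lte_fin ltrD2l ltr_pM2l// ltr_nat ltnSn.
by rewrite -EFinB; congr EFin; rewrite -natr1; ring.
Qed.

Lemma leb2_cell (c : 'I_N * 'I_N) : mu (gridI c.1 `*` gridI c.2) = (s ^+ 2)%:E.
Proof.
rewrite leb2X; [|exact: measurable_itv|exact: measurable_itv].
by rewrite !leb1_gridI -EFinM.
Qed.

Lemma cell_L2 c : L2 mu (cell c).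
Proof.
rewrite (_ : cell c = \1_(gridI c.1 `*` gridI c.2)); last first.
  by apply/funext => x; rewrite cellE.
apply: L2_indic; first exact: gridIX_measurable.
by have := leb2_cell c => /= ->; rewrite ltry.
Qed.

Lemma cell_ip c : ip mu (cell c) (cell c) = s ^+ 2.
Proof.
apply: EFin_inj; rewrite ipE; [|exact: cell_L2|exact: cell_L2].
under eq_integral do rewrite cell_sqr cellE.
rewrite integral_indic ?setIT; first exact: leb2_cell.
  exact: measurableT.
exact: gridIX_measurable.
Qed.

Lemma cell_prod_sum x y :
  \sum_(c : 'I_N * 'I_N) cell c x * cell c y <= \1_(box s) (y - x).
Proof.
have near1 i (t u : R) : \1_(gridI i) t * \1_(gridI i) u != 0 :> R -> `|u - t| <= s.
  rewrite !indicE !mem_setE !in_itv/= -natrM mulnb pnatr_eq0 eqb0 negbK.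
  move=> /andP[/andP[t1 t2] /andP[u1 u2]].
  move: t2 u2; rewrite -natr1 mulrDr mulr1 ler_norml => t2 u2.
  by apply/andP; split; lra.
rewrite indicE; have [bx|bx] := boolP (y - x \in box s).
  apply: (@le_trans _ _ (\sum_(c : 'I_N * 'I_N) cell c x)); last first.
    by rewrite cell_sum; case/andP: (indic_le1 gridbox x).
  apply: ler_sum => c _; rewrite -[leRHS]mulr1; apply: ler_wpM2l; first exact: cell_ge0.
  by rewrite cellE; case/andP: (indic_le1 (gridI c.1 `*` gridI c.2) y).
rewrite big1// => c _; apply/eqP; apply: contraNT bx => cxy.
apply/mem_set/boxP; rewrite /=.
have e : cell c x * cell c y = (\1_(gridI c.1) x.1 * \1_(gridI c.1) y.1) *
  (\1_(gridI c.2) x.2 * \1_(gridI c.2) y.2) by rewrite /cell mulrACA.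
move: cxy; rewrite e mulf_eq0 negb_or => /andP[h1 h2].
by split; [exact: near1 h1|exact: near1 h2].
Qed.

(** Jensen on the cell: the squared distance from w(x) to the mean [q] is at most the mean squared
    distance from w(x) to w(y). Integration in [x] bounds the variance by a double integral of
    differences. *)
Lemma cell_poincare w c : L2 mu w ->
  ((ip mu (fun x => cell c x * w x) (fun x => cell c x * w x))%:E <=
   (ip mu w (cell c) ^+ 2 / s ^+ 2)%:E + (s ^- 2)%:E *
   \int[mu]_x \int[mu]_y (cell c x * cell c y * (w y - w x) ^+ 2)%:E)%E.
Proof.
move=> lw; have mw := L2_meas lw; have lc := cell_L2 c; have mc := L2_meas lc.
have lcw : L2 mu (fun x => cell c x * w x).
  apply: (L2_le _ _ lw); first exact: measurable_funM.
  move=> x; rewrite normrM; apply: ler_piMl => //.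
  by rewrite ger0_norm ?cell_ge0// cellE; case/andP: (indic_le1 (gridI c.1 `*` gridI c.2) x).
set B := ip mu (fun x => cell c x * w x) (fun x => cell c x * w x).
set A := ip mu w (cell c).
have s2 : 0 < s ^+ 2 by rewrite exprn_gt0.
have Acw : ip mu (fun x => cell c x * w x) (cell c) = A.
  rewrite /A /ip; congr fine; apply: eq_integral => x _.
  by rewrite mulrAC cell_sqr mulrC.
have AB : A ^+ 2 <= B * s ^+ 2 by rewrite -Acw -(cell_ip c); exact: ip_CS.
pose q := A / s ^+ 2.
have e1 : B - A ^+ 2 / s ^+ 2 =
   ip mu (fun x => cell c x * w x + (- q) * cell c x) (fun x => cell c x * w x + (- q) * cell c x).
  by rewrite ip_lin// Acw cell_ip -/B /q; field; rewrite gt_eqF.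
have inner x : (((w x - q) ^+ 2)%:E <=
    (s ^- 2)%:E * \int[mu]_y (cell c y * (w y - w x) ^+ 2)%:E)%E.
  have -> : (\int[mu]_y (cell c y * (w y - w x) ^+ 2)%:E =
     (ip mu (fun y => cell c y * w y + (- w x) * cell c y)
            (fun y => cell c y * w y + (- w x) * cell c y))%:E)%E.
    have l3 := L2D lcw (L2Z (- w x) lc).
    rewrite ipE//; apply: eq_integral => y _; congr EFin.
    rewrite -{1}cell_sqr; ring.
  rewrite ip_lin// Acw cell_ip -/B -EFinM lee_fin.
  rewrite -ler_pdivrMl ?invr_gt0// invrK.
  apply: (@le_trans _ _ (A ^+ 2 / s ^+ 2 + 2 * - w x * A + (- w x) ^+ 2 * s ^+ 2)).
    rewrite le_eqVlt; apply/orP; left; apply/eqP.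
    by rewrite /q; field; rewrite gt_eqF.
  by rewrite !lerD2r ler_pdivrMr.
have l4 := L2D lcw (L2Z (- q) lc).
rewrite -leeBlDl// -EFinB e1 ip_sqr//.
have mG : measurable_fun setT (fun z : (R * R) * (R * R) =>
    (cell c z.1 * cell c z.2 * (w z.2 - w z.1) ^+ 2)%:E).
  apply/measurable_EFinP; apply: measurable_funM.
    by apply: measurable_funM; apply: (measurableT_comp mc); [exact: measurable_fst|exact: measurable_snd].
  by apply: measurable_funX; apply: measurable_funB; apply: (measurableT_comp mw); [exact: measurable_snd|exact: measurable_fst].
have G0 z : (0 <= (cell c z.1 * cell c z.2 * (w z.2 - w z.1) ^+ 2)%:E)%E.
  by rewrite lee_fin mulr_ge0 ?sqr_ge0// mulr_ge0 ?cell_ge0.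
have mI := measurable_fun_fubini_tonelli_F (m2 := mu) _ mG G0.
have is0 : 0 <= s ^- 2 by rewrite invr_ge0 ltW.
rewrite -ge0_integralZl//; last first.
  by move=> x _; apply: integral_ge0 => y _; exact: (G0 (x, y)).
apply: ge0_le_integral => //.
- by move=> x _; rewrite lee_fin sqr_ge0.
- by apply/measurable_EFinP; apply: measurable_funX; exact: L2_meas l4.
- by apply: emeasurable_funM => //; exact: measurable_cst.
- move=> x _.
  have -> : (\int[mu]_y (cell c x * cell c y * (w y - w x) ^+ 2)%:E =
      (cell c x)%:E * \int[mu]_y (cell c y * (w y - w x) ^+ 2)%:E)%E.
    rewrite -integralZ_ge0.
    + by apply: eq_integral => y _; rewrite mulrA.
    + apply: measurable_funM => //; apply: measurable_funX.
      by apply: measurable_funB => //; exact: measurable_cst.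
    + exact: cell_ge0.
    + by move=> y; rewrite mulr_ge0 ?sqr_ge0 ?cell_ge0.
  rewrite muleCA; have -> : (cell c x * w x + - q * cell c x) ^+ 2 = cell c x * (w x - q) ^+ 2.
    by rewrite -[in RHS]cell_sqr; ring.
  by rewrite EFinM; apply: lee_wpmul2l; rewrite ?lee_fin ?cell_ge0.
Qed.

(** Points of a common cell differ by an element of [box s], so the double integrals of all cells
    together are dominated by one integral of [dq w] over that box, of area 4 s^2; division by s^2
    leaves 4 K. *)
Lemma cells_bound w (K : R) : L2 mu w -> 0 <= K ->
  (forall h, box s h -> dq w h <= K) ->
  (\int[mu]_x (\1_gridbox x * w x ^+ 2)%:E <=
   (\sum_(c : 'I_N * 'I_N) (ip mu w (cell c) ^+ 2 / s ^+ 2) + 4 * K)%:E)%E.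
Proof.
move=> lw K0 hK; have mw := L2_meas lw.
have mc c := L2_meas (cell_L2 c).
have lcw c : L2 mu (fun x => cell c x * w x).
  apply: (L2_le _ _ lw); first exact: measurable_funM.
  move=> x; rewrite normrM; apply: ler_piMl => //.
  by rewrite ger0_norm ?cell_ge0// cellE; case/andP: (indic_le1 (gridI c.1 `*` gridI c.2) x).
have s2 : 0 < s ^+ 2 by rewrite exprn_gt0.
have is0 : 0 <= s ^- 2 by rewrite invr_ge0 ltW.
have -> : (\int[mu]_x (\1_gridbox x * w x ^+ 2)%:E =
   \sum_(c : 'I_N * 'I_N) (ip mu (fun x => cell c x * w x) (fun x => cell c x * w x))%:E)%E.
  under [RHS]eq_bigr do rewrite ip_sqr//.
  rewrite -ge0_integral_sum//.
  - apply: eq_integral => x _; rewrite sumEFin -cell_sum mulr_suml; congr EFin.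
    by apply: eq_bigr => c _; rewrite exprMn (expr2 (cell c x)) cell_sqr.
  - by move=> c; apply/measurable_EFinP; apply: measurable_funX; exact: L2_meas (lcw c).
  - by move=> c x _; rewrite lee_fin sqr_ge0.
apply: (@le_trans _ _ (\sum_(c : 'I_N * 'I_N) ((ip mu w (cell c) ^+ 2 / s ^+ 2)%:E + (s ^- 2)%:E *
   \int[mu]_x \int[mu]_y (cell c x * cell c y * (w y - w x) ^+ 2)%:E))%E).
  by apply: lee_sum => c _; exact: cell_poincare.
rewrite big_split /= EFinD -sumEFin; apply: leeD2l.
have mG c : measurable_fun setT (fun z : (R * R) * (R * R) =>
    (cell c z.1 * cell c z.2 * (w z.2 - w z.1) ^+ 2)%:E).
  apply/measurable_EFinP; apply: measurable_funM.
    by apply: measurable_funM; apply: (measurableT_comp (mc c)); [exact: measurable_fst|exact: measurable_snd].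
  by apply: measurable_funX; apply: measurable_funB; apply: (measurableT_comp mw); [exact: measurable_snd|exact: measurable_fst].
have G0 c z : (0 <= (cell c z.1 * cell c z.2 * (w z.2 - w z.1) ^+ 2)%:E)%E.
  by rewrite lee_fin mulr_ge0 ?sqr_ge0// mulr_ge0 ?cell_ge0.
have mI c := measurable_fun_fubini_tonelli_F (m2 := mu) _ (mG c) (G0 c).
have I0 c x : (0 <= \int[mu]_y (cell c x * cell c y * (w y - w x) ^+ 2)%:E)%E.
  by apply: integral_ge0 => y _; exact: (G0 c (x, y)).
have mb : measurable_fun setT (\1_(box s) : R * R -> R).
  exact: measurable_indic (box_measurable s).
have b0 h : 0 <= (\1_(box s) h : R) by case/andP: (indic_le1 (box s) h).
rewrite -ge0_sume_distrr; last by move=> c _; apply: integral_ge0 => x _; exact: I0.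
rewrite -ge0_integral_sum//.
apply: (@le_trans _ _ ((s ^- 2)%:E * \int[mu]_x \int[mu]_y (\1_(box s) (y - x) * (w y - w x) ^+ 2)%:E)%E).
  apply: lee_wpmul2l; first by rewrite lee_fin.
  have mG2 : measurable_fun setT (fun z : (R * R) * (R * R) =>
      (\1_(box s) (z.2 - z.1) * (w z.2 - w z.1) ^+ 2)%:E).
    apply/measurable_EFinP; apply: measurable_funM.
      apply: (measurableT_comp mb (g := fun z : (R * R) * (R * R) => z.2 - z.1)).
      apply: measurable_fun_pair => /=; apply: measurable_funB; apply: measurableT_comp => //;
        by [exact: measurable_fst|exact: measurable_snd].
    by apply: measurable_funX; apply: measurable_funB; apply: (measurableT_comp mw); [exact: measurable_snd|exact: measurable_fst].
  have G20 z : (0 <= (\1_(box s) (z.2 - z.1) * (w z.2 - w z.1) ^+ 2)%:E)%E.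
    by rewrite lee_fin mulr_ge0 ?sqr_ge0.
  have mI2 := measurable_fun_fubini_tonelli_F (m2 := mu) _ mG2 G20.
  apply: ge0_le_integral => //.
  - by move=> x _; apply: sume_ge0 => c _; exact: I0.
  - by apply: emeasurable_sum => c; exact: mI.
  - move=> x _; rewrite -ge0_integral_sum//.
    + apply: ge0_le_integral => //.
      * by move=> y _; apply: sume_ge0 => c _; exact: (G0 c (x, y)).
      * apply: emeasurable_sum => c; apply: (measurableT_comp (mG c) (g := fun y => (x, y))).
        by apply: measurable_fun_pair; [exact: measurable_cst|exact: measurable_id].
      * apply: (measurableT_comp mG2 (g := fun y => (x, y))).
        by apply: measurable_fun_pair; [exact: measurable_cst|exact: measurable_id].
      * move=> y _; rewrite sumEFin lee_fin -mulr_suml.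
        by apply: ler_wpM2r; [exact: sqr_ge0|exact: cell_prod_sum].
    + move=> c; apply: (measurableT_comp (mG c) (g := fun y => (x, y))).
      by apply: measurable_fun_pair; [exact: measurable_cst|exact: measurable_id].
    + by move=> c y _; exact: (G0 c (x, y)).
rewrite (integral_dq_indic (box_measurable s) lw).
apply: (@le_trans _ _ ((s ^- 2)%:E * \int[mu]_h (K * \1_(box s) h)%:E)%E).
  apply: lee_wpmul2l; first by rewrite lee_fin.
  apply: le_integral_EFin.
  - by apply: measurable_funM => //; exact: measurable_dq.
  - by apply: measurable_funM => //; exact: measurable_cst.
  - by move=> h; rewrite mulr_ge0 ?dq_ge0.
  - have pt h : \1_(box s) h * dq w h <= K * \1_(box s) h.
      rewrite indicE; have [/set_mem bh|_] := boolP (h \in box s); last by rewrite mul0r mulr0.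
      by rewrite mul1r mulr1 hK.
    by move=> h; exact: pt.
rewrite integralZ_ge0//.
have -> : (\int[mu]_h (\1_(box s) h)%:E = (4 * s ^+ 2)%:E :> \bar R)%E.
  rewrite -(integral_box 0 (ltW s0)).
  by apply: eq_integral => h _; rewrite addr0.
rewrite -!EFinM lee_fin le_eqVlt; apply/orP; left; apply/eqP.
by field; rewrite gt_eqF.
Qed.

End Grid.
End Cells.

(** * Compactness in L2 from the logarithmic moment *)

Section Rellich.
Context (R : realType).
Local Notation mu := (leb2 R).
Implicit Types (f g w : R * R -> R) (h x y : R * R).

Lemma dqB f g h : L2 mu f -> L2 mu g ->
  dq (fun x => f x - g x) h <= 2 * dq f h + 2 * dq g h.
Proof.
move=> lf lg.
have l1 := L2B (tau_L2 h lf) lf; have l2 := L2N (L2B (tau_L2 h lg) lg).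
have := ipD_sqr_le l1 l2.
have -> : ip mu (fun x => - (tau h g x - g x)) (fun x => - (tau h g x - g x)) = dq g h.
  by rewrite /dq /ip; congr fine; apply: eq_integral => x _; rewrite mulrNN.
suff -> : ip mu (fun x => tau h f x - f x - (tau h g x - g x))
   (fun x => tau h f x - f x - (tau h g x - g x)) = dq (fun x => f x - g x) h by [].
by rewrite /dq /ip; congr fine; apply: eq_integral => x _; rewrite /tau; congr EFin; congr (_ * _); ring.
Qed.

Lemma gridbox_compl (r s : R) (N : nat) x : 0 <= r -> 2 * r <= s * N%:R ->
  ~ gridbox (- r) s N x -> r <= enorm x.
Proof.
move=> r0 rN nx.
have [h1|h1] := ltP (enorm x) r; last by [].
case: nx; split => /=; rewrite in_itv /=.
  have := le_lt_trans (enorm_ge1 x) h1; rewrite ltr_norml => /andP[a1 a2].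
  by rewrite ltW//= (lt_le_trans a2)//; lra.
have := le_lt_trans (enorm_ge2 x) h1; rewrite ltr_norml => /andP[a1 a2].
by rewrite ltW//= (lt_le_trans a2)//; lra.
Qed.

Lemma gridbox_measurable (a s : R) (N : nat) : measurable (gridbox a s N).
Proof. by apply: measurableX; exact: measurable_itv. Qed.

(** Outside the grid box the norm is at least [r], so the logarithmic weight is at least [k1 r] and
    the moments of [f] and [g] control what remains. *)
Lemma tail_bound (r s : R) (N : nat) w f g (C : R) : 0 < r -> 2 * r <= s * N%:R ->
  L2 mu f -> L2 mu g -> (forall x, w x = f x - g x) ->
  (Lw f <= C%:E)%E -> (Lw g <= C%:E)%E ->
  (\int[mu]_x (w x ^+ 2)%:E <= \int[mu]_x (\1_(gridbox (- r) s N) x * w x ^+ 2)%:E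
     + (4 * C / k1 r)%:E)%E.
Proof.
move=> r0 rN lf lg wE Cf Cg.
have k0 : 0 < k1 r by have := k1_lt (lexx 0) r0; rewrite /k1 addr0 ln1.
have mw : measurable_fun setT w.
  by rewrite (_ : w = fun x => f x - g x); [exact: L2_meas (L2B lf lg)|apply/funext].
have mG : measurable_fun setT (\1_(gridbox (- r) s N) : R * R -> R).
  exact: measurable_indic (gridbox_measurable _ _ _).
have mf := Lw_measurable (L2_meas lf); have mg := Lw_measurable (L2_meas lg).
have c0 : 0 <= 2 / k1 r by rewrite divr_ge0 ?ltW.
pose B (x : R * R) := k1 (enorm x) * f x ^+ 2 + k1 (enorm x) * g x ^+ 2.
have mB : measurable_fun setT B by exact: measurable_funD.
have B0 (x : R * R) : 0 <= B x by rewrite addr_ge0 ?k1f2_ge0.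
have I0 (x : R * R) : 0 <= \1_(gridbox (- r) s N) x * w x ^+ 2.
  by rewrite mulr_ge0 ?sqr_ge0//; case/andP: (indic_le1 (gridbox (- r) s N) x).
have m1 : measurable_fun setT (fun x => \1_(gridbox (- r) s N) x * w x ^+ 2).
  by apply: measurable_funM => //; exact: measurable_funX.
have m2 : measurable_fun setT (fun x => 2 / k1 r * B x).
  by apply: measurable_funM => //; exact: measurable_cst.
apply: (@le_trans _ _ (\int[mu]_x (\1_(gridbox (- r) s N) x * w x ^+ 2 + 2 / k1 r * B x)%:E)%E).
  apply: le_integral_EFin.
  - exact: measurable_funX.
  - exact: measurable_funD.
  - by move=> x; exact: sqr_ge0.
  - have pt (x : R * R) : w x ^+ 2 <= \1_(gridbox (- r) s N) x * w x ^+ 2 + 2 / k1 r * B x.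
      rewrite indicE; have [_|/negP nx] := boolP (x \in _).
        by rewrite mul1r lerDl mulr_ge0.
      rewrite mul0r add0r.
      have rx : r <= enorm x.
        by apply: (gridbox_compl (ltW r0) rN) => gx; apply: nx; exact/mem_set.
      have kx := k1_le (ltW r0) rx.
      rewrite mulrAC ler_pdivlMr// wE.
      have h1 : (f x - g x) ^+ 2 <= 2 * (f x ^+ 2 + g x ^+ 2).
        by have := sqrD_le2 (f x) (- g x); rewrite sqrrN.
      apply: (le_trans (ler_wpM2r (ltW k0) h1)).
      rewrite /B -mulrDr -mulrA ler_pM2l// mulrC; apply: ler_wpM2r => //.
      by rewrite addr_ge0 ?sqr_ge0.
    by move=> x; exact: pt.
rewrite integralD_ge0//; last by move=> x; rewrite mulr_ge0.
apply: leeD2l; rewrite integralZ_ge0// /B integralD_ge0//; try by move=> x; exact: k1f2_ge0.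
apply: (@le_trans _ _ ((2 / k1 r)%:E * (C + C)%:E)%E).
  by apply: lee_wpmul2l; rewrite ?lee_fin// EFinD; exact: leeD.
by rewrite -EFinM lee_fin le_eqVlt; apply/orP; left; apply/eqP; field; rewrite gt_eqF.
Qed.

(** Total boundedness: the oscillation inside cells is controlled by the Dirichlet integral and the
    tail by the logarithmic moment, so up to [e] finitely many cell means determine the function. *)
Lemma cells_separate (D C e : R) : 0 <= D -> 0 <= C -> 0 < e ->
  exists (a s : R) (N : nat) (d : R), [/\ 0 < s, 0 < d & forall f g,
    (exists g1 g2, weakg f g1 g2 /\ ip mu g1 g1 + ip mu g2 g2 <= D) ->
    (exists g1 g2, weakg g g1 g2 /\ ip mu g1 g1 + ip mu g2 g2 <= D) ->
    (Lw f <= C%:E)%E -> (Lw g <= C%:E)%E ->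
    (forall c, `|ip mu f (@cell R a s N c) - ip mu g (@cell R a s N c)| <= d) ->
    ip mu (fun x => f x - g x) (fun x => f x - g x) <= e].
Proof.
move=> D0 C0 e0.
(* Makes [k1 r] exceed 16 C / e, so that the tail 4 C / k1 r is at most e / 4. *)
pose r := expR (16 * C / e).
have r0 : 0 < r by exact: expR_gt0.
have k1r : 4 * C / k1 r <= e / 4.
  have h1 : 16 * C / e < k1 r.
    rewrite /k1 -[X in X < _]expRK ltr_ln ?posrE//; first by rewrite ltrDr ltr01.
    by rewrite addr_gt0.
  have k0 : 0 < k1 r by apply: le_lt_trans h1; rewrite divr_ge0 ?(ltW e0)// mulr_ge0.
  rewrite ler_pdivrMr//; have := ltW h1; rewrite ler_pdivrMr//.
  move: (k1 r) => K h2; have -> : e / 4 * K = (K * e) / 4 by ring.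
  by rewrite ler_pdivlMr//; apply: le_trans h2; rewrite le_eqVlt; apply/orP; left; apply/eqP; ring.
(* Makes the oscillation term 4 (8 D s^2) at most e / 4; D + 1 keeps the quotient meaningful for D =
   0. *)
pose s := Num.sqrt (e / (128 * (D + 1))).
have Dp : 0 < 128 * (D + 1) by rewrite mulr_gt0// ltr_wpDl.
have s0 : 0 < s by rewrite sqrtr_gt0 divr_gt0.
have s2 : s ^+ 2 * (128 * (D + 1)) = e.
  by rewrite sqr_sqrtr ?divfK ?gt_eqF// divr_ge0 ?ltW.
pose N := (Num.trunc (2 * r / s)).+1.
have rN : 2 * r <= s * N%:R.
  by rewrite [s * _]mulrC -ler_pdivrMr// ltW//; exact: truncnS_gt.
have N0 : 0 < N%:R :> R by rewrite ltr0n.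
(* The N^2 cells contribute d^2 / s^2 each, together e / 4. *)
pose d := s / N%:R * (Num.sqrt e / 2).
have d0 : 0 < d by apply: mulr_gt0; apply: divr_gt0 => //; rewrite sqrtr_gt0.
exists (- r), s, N, d; split=> // f g [f1 [f2 [wf Df]]] [g1 [g2 [wg Dg]]] Cf Cg hd.
have lf : L2 mu f by case: wf.
have lg : L2 mu g by case: wg.
have lw := L2B lf lg.
pose w x := f x - g x.
rewrite -lee_fin ip_sqr//.
apply: (le_trans (tail_bound r0 rN lf lg (w := w) _ Cf Cg)); first by [].
have hK h : box s h -> dq w h <= 8 * D * s ^+ 2.
  move=> /boxP[b1 b2]; apply: (le_trans (dqB h lf lg)).
  have h1 : h.1 ^+ 2 <= s ^+ 2 by rewrite -real_normK ?num_real// ler_sqr ?nnegrE// ltW.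
  have h2 : h.2 ^+ 2 <= s ^+ 2 by rewrite -real_normK ?num_real// ler_sqr ?nnegrE// ltW.
  have u1 : dq f h <= D * (2 * s ^+ 2).
    apply: (le_trans (weakg_dq_le h wf)); apply: ler_pM => //.
    - by rewrite addr_ge0 ?ip_ge0.
    - by rewrite addr_ge0 ?sqr_ge0.
    - by move: h1 h2; clear; lra.
  have u2 : dq g h <= D * (2 * s ^+ 2).
    apply: (le_trans (weakg_dq_le h wg)); apply: ler_pM => //.
    - by rewrite addr_ge0 ?ip_ge0.
    - by rewrite addr_ge0 ?sqr_ge0.
    - by move: h1 h2; clear; lra.
  by move: u1 u2; clear; lra.
have K0 : 0 <= 8 * D * s ^+ 2 by rewrite mulr_ge0 ?sqr_ge0// mulr_ge0.
apply: (le_trans (leeD (cells_bound (- r) N s0 lw K0 hK) (lexx _))).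
rewrite -EFinD lee_fin.
have S : \sum_(c : 'I_N * 'I_N) (ip mu w (@cell R (- r) s N c) ^+ 2 / s ^+ 2) <= e / 4.
  apply: (@le_trans _ _ (\sum_(c : 'I_N * 'I_N) (e / 4 / N%:R ^+ 2))).
    apply: ler_sum => c _.
    rewrite (ipBl lf lg (cell_L2 (- r) s0 c)).
    rewrite ler_pdivrMr ?exprn_gt0//.
    have -> : e / 4 / N%:R ^+ 2 * s ^+ 2 = d ^+ 2.
      have q : Num.sqrt e ^+ 2 = e by rewrite sqr_sqrtr ?ltW.
      by rewrite /d; move: (Num.sqrt e) q => z <-; field; rewrite gt_eqF.
    by rewrite -real_normK ?num_real// ler_sqr ?nnegrE ?hd// ltW.
  rewrite sumr_const card_prod card_ord -[_ *+ _]mulr_natr natrM.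
  by rewrite le_eqVlt; apply/orP; left; apply/eqP; field; rewrite gt_eqF.
have e2 : 4 * (8 * D * s ^+ 2) <= e / 4.
  rewrite -s2; have q0 := sqr_ge0 s; move: (s ^+ 2) q0 => q q0.
  rewrite -subr_ge0; have -> : q * (128 * (D + 1)) / 4 - 4 * (8 * D * q) = q * 32 by field.
  exact: mulr_ge0.
apply: (le_trans (lerD (lerD S e2) k1r)).
by move: e0; clear; lra.
Qed.

(** A cluster point in the compact interval is a limit, because an ultrafilter contains each set or
    its complement. *)
Lemma ultra_cvg_bounded (U : set_system nat) (u : nat -> R) (B : R) :
  UltraFilter U -> (forall n, `|u n| <= B) ->
  exists l, forall e, 0 < e -> U [set n | `|u n - l| <= e].
Proof.
move=> uU uB; have pU : ProperFilter U by case: uU.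
have pf : ProperFilter (u @ U) by exact: fmap_proper_filter.
have [|l [_ cl]] := @segment_compact R (- B) B (u @ U) pf.
  rewrite /= nbhs_filterE; apply: (filterS _ (@filterT _ U _)) => n _ /=.
  by rewrite in_itv /= -ler_norml.
exists l => e e0; have [//|UC] := in_ultra_setVsetC [set n | `|u n - l| <= e] uU.
have [||x [x1 x2]] := cl [set x | e < `|x - l|] (ball l e).
- by rewrite /= nbhs_filterE; apply: filterS UC => n /= /negP; rewrite -ltNge.
- exact: nbhsx_ballx.
by move: x1 x2; rewrite /ball /= distrC => h1 /(lt_trans h1); rewrite ltxx.
Qed.

(* Along an ultrafilter all cell means converge, which replaces the extraction of
   a diagonal subsequence. *)
Lemma rellich (F : nat -> R * R -> R) (D C l : R) : 0 <= D -> 0 <= C ->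
  (forall n, exists g1 g2, weakg (F n) g1 g2 /\ ip mu g1 g1 + ip mu g2 g2 <= D) ->
  (forall n, Lw (F n) <= C%:E)%E -> (forall n, ip mu (F n) (F n) <= l) ->
  exists phi : nat -> nat, (forall k, (k <= phi k)%N) /\
    forall k, ip mu (fun x => F (phi k.+1) x - F (phi k) x)
      (fun x => F (phi k.+1) x - F (phi k) x) <= 8^-1 ^+ k.
Proof.
move=> D0 C0 hD hC hl.
have lF n : L2 mu (F n) by have [g1 [g2 [[]]]] := hD n.
have [U [uU ooU]] := ultraFilterLemma (@eventually_filter).
have fU : Filter U by case: uU => -[].
have close e : 0 < e -> exists2 A, U A & forall n m, A n -> A m ->
    ip mu (fun x => F n x - F m x) (fun x => F n x - F m x) <= e.
  move=> e0; have [a [s [N [d [s0 d0 sep]]]]] := cells_separate D0 C0 e0.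
  have lim (c : 'I_N * 'I_N) : exists b, forall e, 0 < e ->
      U [set n | `|ip mu (F n) (@cell R a s N c) - b| <= e].
    apply: (ultra_cvg_bounded (B := Num.sqrt l * s) uU) => n.
    apply: (le_trans (ip_le_CS (lF n) (cell_L2 a s0 c))).
    rewrite cell_ip// sqrtr_sqr gtr0_norm//; apply: ler_wpM2r; first exact: ltW.
    by apply: ler_wsqrtr.
  have [b hb] := choice lim.
  exists [set n | forall c, `|ip mu (F n) (@cell R a s N c) - b c| <= d / 2].
    by apply: filter_forall => c; apply: hb; rewrite divr_gt0.
  move=> n m /= An Am; apply: sep => // c.
  have -> : ip mu (F n) (@cell R a s N c) - ip mu (F m) (@cell R a s N c) =
    (ip mu (F n) (@cell R a s N c) - b c) - (ip mu (F m) (@cell R a s N c) - b c) by ring.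
  by apply: (le_trans (ler_normB _ _)); have := lerD (An c) (Am c); rewrite -splitr.
have e0 k : 0 < (8^-1 : R) ^+ k by rewrite exprn_gt0// invr_gt0.
have close' k : exists A, U A /\ forall n m, A n -> A m ->
    ip mu (fun x => F n x - F m x) (fun x => F n x - F m x) <= 8^-1 ^+ k.
  by have [A UA hA] := close _ (e0 k); exists A.
have [A hA] := choice close'.
(* The index lies in all of A 0, ..., A k, so that two consecutive choices share the set A k; beyond
   that only k <= phi k is secured, not monotonicity. *)
have ex k : exists n, (k <= n)%N /\ forall j, (j <= k)%N -> A j n.
  have U1 : U [set n | forall j : 'I_k.+1, A j n].
    by apply: filter_forall => j; case: (hA j).
  have U2 : U [set n | (k <= n)%N] by apply: ooU; exists k.
  have [n [n1 n2]] : exists n, (forall j : 'I_k.+1, A j n) /\ (k <= n)%N.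
    by apply: filter_ex (filterI U1 U2).
  exists n; split => // j jk.
  by have := n1 (Ordinal (jk : (j < k.+1)%N)).
have [phi hphi] := choice ex.
exists phi; split => [k|k]; first by case: (hphi k).
have [_ h1] := hphi k.+1; have [_ h2] := hphi k; have [_ h3] := hA k.
by apply: h3; [exact: h1 (leqnSn k)|exact: h2].
Qed.

End Rellich.

Section Limits.
Context (R : realType).

Lemma half_expr_le (e : R) : 0 < e -> exists n : nat, (2^-1 : R) ^+ n <= e.
Proof.
move=> e0; have /cvgrPdist_le/(_ e e0)[n _ hn] := @cvg_half_expr R.
exists n; have := hn n (leqnn n); rewrite /= sub0r normrN ger0_norm// exprn_ge0// invr_ge0.
Qed.

Lemma le_half_expr (a b K : R) : (forall n : nat, a <= b + K * 2^-1 ^+ n) -> a <= b.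
Proof.
move=> h; apply/ler_addgt0Pr => e e0.
have K1 : 0 < `|K| + 1 by rewrite ltr_wpDl.
have [n hn] := half_expr_le (divr_gt0 e0 K1).
apply: (le_trans (h n)); rewrite lerD2l.
have p0 : 0 <= (2^-1 : R) ^+ n by rewrite exprn_ge0// invr_ge0.
apply: (@le_trans _ _ ((`|K| + 1) * 2^-1 ^+ n)).
  by apply: ler_wpM2r => //; apply: (le_trans (ler_norm K)); rewrite lerDl.
by rewrite mulrC -ler_pdivlMr.
Qed.

(** The infima in the limit inferior run over all large indices, where the error K 2^-n falls below
    any given bound. *)
Lemma fatou_le d (T : measurableType d) (nu : {measure set T -> \bar R})
    (g_ : nat -> T -> R) (g : T -> R) (a K : R) :
  (forall n, measurable_fun setT (g_ n)) -> (forall n x, 0 <= g_ n x) ->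
  (forall x, g_ n x @[n --> \oo] --> g x) ->
  (forall n, \int[nu]_x (g_ n x)%:E <= (a + K * 2^-1 ^+ n)%:E)%E ->
  (\int[nu]_x (g x)%:E <= a%:E)%E.
Proof.
move=> mg g0 cg bg.
have mg' n : measurable_fun setT (fun x => (g_ n x)%:E) by exact/measurable_EFinP.
have g0' n x : setT x -> (0 <= (g_ n x)%:E)%E by move=> _; rewrite lee_fin.
have := @fatou _ T R nu setT measurableT (fun n x => (g_ n x)%:E) mg' g0'.
rewrite (_ : (\int[nu]_x limn_einf (fun n => (g_ n x)%:E) = \int[nu]_x (g x)%:E)%E); last first.
  apply: eq_integral => x _; apply: (cvg_limn_einf_sup _).1.
  by apply: cvg_EFin; [exact: nearW|exact: cg].
move=> /le_trans; apply; rewrite limn_einf_lim.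
apply: lime_le; first exact: is_cvg_einfs.
apply: nearW => N; apply/lee_addgt0Pr => e e0.
have K1 : 0 < `|K| + 1 by rewrite ltr_wpDl.
have [n hn] := half_expr_le (divr_gt0 e0 K1).
apply: (@le_trans _ _ (\int[nu]_x (g_ (N + n)%N x)%:E)%E).
  by apply: ereal_inf_lbound; exists (N + n)%N => //=; exact: leq_addr.
apply: (le_trans (bg _)); rewrite -EFinD lee_fin lerD2l.
have p0 j : 0 <= (2^-1 : R) ^+ j by rewrite exprn_ge0// invr_ge0.
apply: (@le_trans _ _ ((`|K| + 1) * 2^-1 ^+ (N + n))).
  by apply: ler_wpM2r => //; apply: (le_trans (ler_norm K)); rewrite lerDl.
rewrite mulrC -ler_pdivlMr//; apply: le_trans hn.
by rewrite exprD; apply: ler_piMl => //; apply: exprn_ile1; rewrite ?invr_ge0// invf_le1// ler1n.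
Qed.

End Limits.

(** * Potentials under comparison, translation, scaling and limits *)

Section PotentialCalculus.
Context (R : realType).
Local Notation mu := (leb2 R).
Implicit Types (f g : R * R -> R) (h x y : R * R) (k : R -> R).

Lemma V_integrand_measurable k f : kernel k -> measurable_fun setT f ->
  measurable_fun setT (fun z : (R * R) * (R * R) =>
    k (enorm (z.1 - z.2)) * f z.1 ^+ 2 * f z.2 ^+ 2).
Proof.
move=> [mk _] mf; apply: measurable_funM; last first.
  by apply: measurable_funX; apply: (measurableT_comp mf); exact: measurable_snd.
apply: measurable_funM; first exact: measurable_ker.
by apply: measurable_funX; apply: (measurableT_comp mf); exact: measurable_fst.
Qed.

Lemma V_prod k f : kernel k -> measurable_fun setT f ->
  (V k f = \int[(mu \x mu)%E]_z (k (enorm (z.1 - z.2)) * f z.1 ^+ 2 * f z.2 ^+ 2)%:E)%E.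
Proof.
move=> kk mf.
rewrite (fubini_tonelli1 (fun z : (R * R) * (R * R) => (k (enorm (z.1 - z.2)) * f z.1 ^+ 2 * f z.2 ^+ 2)%:E))//.
  by apply/measurable_EFinP; exact: V_integrand_measurable.
by move=> z; rewrite lee_fin mulr_ge0 ?sqr_ge0// mulr_ge0 ?sqr_ge0 ?ker_ge0.
Qed.

Lemma V_le k f g : kernel k -> measurable_fun setT f -> measurable_fun setT g ->
  (forall x, 0 <= f x) -> (forall x, f x <= g x) -> (V k f <= V k g)%E.
Proof.
move=> kk mf mg f0 fg; rewrite !V_prod//.
have f2 x : f x ^+ 2 <= g x ^+ 2 by rewrite ler_sqr ?nnegrE// (le_trans (f0 x)).
apply: le_integral_EFin.
- exact: V_integrand_measurable.
- exact: V_integrand_measurable.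
- by move=> z; rewrite mulr_ge0 ?sqr_ge0// mulr_ge0 ?sqr_ge0 ?ker_ge0.
- move=> z; apply: ler_pM; rewrite ?sqr_ge0 ?mulr_ge0 ?sqr_ge0 ?ker_ge0//.
  by apply: ler_wpM2l => //; exact: ker_ge0.
Qed.

Lemma W_le k f g x : kernel k -> measurable_fun setT f -> measurable_fun setT g ->
  (forall x, 0 <= f x) -> (forall x, f x <= g x) -> (W k f x <= W k g x)%E.
Proof.
move=> kk mf mg f0 fg.
have m (u : R * R -> R) : measurable_fun setT u -> measurable_fun setT (fun y => k (enorm (x - y)) * u y ^+ 2).
  by move=> mu; apply: measurable_funM; [exact: measurable_kerx (proj1 kk)|exact: measurable_funX].
apply: le_integral_EFin; [exact: m|exact: m| |].
- by move=> y; rewrite mulr_ge0 ?sqr_ge0 ?ker_ge0.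
- move=> y; apply: ler_wpM2l; first exact: ker_ge0.
  by rewrite ler_sqr ?nnegrE// (le_trans (f0 y)).
Qed.

Lemma V_scale k f (a : R) : kernel k -> measurable_fun setT f ->
  (V k (fun x => (a * f x)%R) = (a ^+ 4)%:E * V k f)%E.
Proof.
move=> kk mf; have mf' : measurable_fun setT (fun x => a * f x).
  by apply: measurable_funM => //; exact: measurable_cst.
rewrite !V_prod// -integralZ_ge0.
- by apply: eq_integral => z _; congr EFin; ring.
- exact: V_integrand_measurable.
- by rewrite (_ : 4 = 2 * 2)%N// exprM sqr_ge0.
- by move=> z; rewrite mulr_ge0 ?sqr_ge0// mulr_ge0 ?sqr_ge0 ?ker_ge0.
Qed.

Lemma W_tau k f h x : kernel k -> measurable_fun setT f ->
  W k (tau h f) x = W k f (x + h).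
Proof.
move=> kk mf.
have m : measurable_fun setT (fun y => k (enorm (x + h - y)) * f y ^+ 2).
  by apply: measurable_funM; [exact: measurable_kerx (proj1 kk)|exact: measurable_funX].
rewrite /W -(integral_shift h m); apply: eq_integral => y _.
by rewrite /tau; congr (k (enorm _) * _)%:E; rewrite opprD addrACA subrr addr0.
Qed.

Lemma V_tau k f h : kernel k -> measurable_fun setT f ->
  V k (tau h f) = V k f.
Proof.
move=> kk mf; have [ms ish] := preserves_shift h.
have mt : measurable_fun setT (tau h f) by exact: measurableT_comp.
rewrite (VE kk mt) (VE kk mf).
transitivity (\int[mu]_x ((f (x + h)%R ^+ 2)%:E * W k f (x + h)%R))%E.
  by apply: eq_integral => x _; rewrite W_tau.
apply: (ish (fun x => (f x ^+ 2)%:E * W k f x)%E); first exact: fW_measurable.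
by move=> x; rewrite mule_ge0 ?lee_fin ?sqr_ge0 ?W_ge0.
Qed.

Lemma Lw_tau f h : measurable_fun setT f -> Lw (tau h f) = W (@k1 R) f h.
Proof.
move=> mf; rewrite -[h in RHS]add0r -(W_tau _ _ (@kernel_k1 R) mf) /Lw /W.
by apply: eq_integral => y _; rewrite sub0r enormN.
Qed.

Lemma V_fatou k (F : nat -> R * R -> R) f (a K : R) : kernel k ->
  (forall n, measurable_fun setT (F n)) -> measurable_fun setT f ->
  (forall x, F n x @[n --> \oo] --> f x) ->
  (forall n, V k (F n) <= (a + K * 2^-1 ^+ n)%:E)%E -> (V k f <= a%:E)%E.
Proof.
move=> kk mF mf cF bF; rewrite V_prod//.
apply: (@fatou_le R _ _ (mu \x mu)%E
  (fun n z => k (enorm (z.1 - z.2)) * F n z.1 ^+ 2 * F n z.2 ^+ 2)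
  (fun z => k (enorm (z.1 - z.2)) * f z.1 ^+ 2 * f z.2 ^+ 2) a K).
- by move=> n; exact: V_integrand_measurable.
- by move=> n z; rewrite mulr_ge0 ?sqr_ge0// mulr_ge0 ?sqr_ge0 ?ker_ge0.
- have c2 x : F n x ^+ 2 @[n --> \oo] --> f x ^+ 2.
    by rewrite expr2; under eq_fun do rewrite expr2; apply: cvgM; exact: cF.
  move=> z; apply: (cvgM _ (c2 z.2)); apply: (cvgM _ (c2 z.1)); exact: cvg_cst.
- by move=> n; rewrite -V_prod.
Qed.

Lemma Lw_fatou (F : nat -> R * R -> R) f (a K : R) :
  (forall n, measurable_fun setT (F n)) -> measurable_fun setT f ->
  (forall x, F n x @[n --> \oo] --> f x) ->
  (forall n, Lw (F n) <= (a + K * 2^-1 ^+ n)%:E)%E -> (Lw f <= a%:E)%E.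
Proof.
move=> mF mf cF bF.
apply: (@fatou_le R _ _ mu (fun n y => k1 (enorm y) * F n y ^+ 2)
  (fun y => k1 (enorm y) * f y ^+ 2) a K).
- by move=> n; exact: Lw_measurable.
- by move=> n y; exact: k1f2_ge0.
- move=> y; apply: cvgM; first exact: cvg_cst.
  by rewrite expr2; under eq_fun do rewrite expr2; apply: cvgM; exact: cF.
- exact: bF.
Qed.

Let lip_pt (K a b c e p q : R) : 0 <= K -> 0 <= b -> 0 <= c ->
  a - c <= p -> b - e <= q -> K * a * b <= K * c * e + (K * p * b + K * c * q).
Proof.
move=> K0 b0 c0 h1 h2; rewrite -!mulrA -!mulrDr; apply: ler_wpM2l => //.
by have := ler_wpM2r b0 h1; have := ler_wpM2l c0 h2; rewrite mulrBl mulrBr; lra.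
Qed.

(** The difference f(x)^2 f(y)^2 - g(x)^2 g(y)^2 telescopes into a change in [x] and a change in
    [y]. Each is integrated against a potential bounded by [B], which gives a Lipschitz bound in the
    L1 distance of the squares even for a singular kernel. *)
Lemma V_lip k f g (B d : R) : kernel k -> measurable_fun setT f ->
  measurable_fun setT g -> 0 <= B ->
  (forall x, W k f x <= B%:E)%E -> (forall x, W k g x <= B%:E)%E ->
  (\int[mu]_x (`|f x ^+ 2 - g x ^+ 2|)%:E <= d%:E)%E ->
  (V k f <= V k g + (2 * B * d)%:E)%E.
Proof.
move=> kk mf mg B0 Bf Bg hd; have [mk k0] := kk.
pose w x := `|f x ^+ 2 - g x ^+ 2|.
have mw : measurable_fun setT w.
  by apply: measurableT_comp => //; apply: measurable_funB; exact: measurable_funX.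
have w0 x : 0 <= w x by exact: normr_ge0.
have mK := measurable_ker mk.
have comp1 (u : R * R -> R) : measurable_fun setT u -> measurable_fun setT (fun z : (R * R) * (R * R) => u z.1 : R).
  by move=> mu; apply: (measurableT_comp mu); exact: measurable_fst.
have comp2 (u : R * R -> R) : measurable_fun setT u -> measurable_fun setT (fun z : (R * R) * (R * R) => u z.2 : R).
  by move=> mu; apply: (measurableT_comp mu); exact: measurable_snd.
pose A (z : (R * R) * (R * R)) := k (enorm (z.1 - z.2)) * w z.1 * f z.2 ^+ 2.
pose C (z : (R * R) * (R * R)) := k (enorm (z.1 - z.2)) * g z.1 ^+ 2 * w z.2.
have mA : measurable_fun setT A.
  apply: measurable_funM; first by apply: measurable_funM => //; exact: comp1.
  exact: measurable_funX (comp2 _ mf).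
have mC : measurable_fun setT C.
  apply: measurable_funM; last exact: comp2.
  by apply: measurable_funM => //; exact: measurable_funX (comp1 _ mg).
have A0 z : 0 <= A z by rewrite mulr_ge0 ?sqr_ge0// mulr_ge0 ?sqr_ge0 ?ker_ge0.
have C0 z : 0 <= C z by rewrite mulr_ge0 ?sqr_ge0// mulr_ge0 ?sqr_ge0 ?ker_ge0.
have mVg := V_integrand_measurable kk mg.
have Vg0 (z : (R * R) * (R * R)) : 0 <= k (enorm (z.1 - z.2)) * g z.1 ^+ 2 * g z.2 ^+ 2.
  by rewrite mulr_ge0 ?sqr_ge0// mulr_ge0 ?sqr_ge0 ?ker_ge0.
have mww (u : R * R -> R) : measurable_fun setT u -> measurable_fun setT (fun x => ((w x)%:E * W k u x)%E).
  move=> mu; apply: emeasurable_funM; last exact: W_measurable.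
  exact/measurable_EFinP.
have bw (u : R * R -> R) : measurable_fun setT u -> (forall x, W k u x <= B%:E)%E ->
    (\int[mu]_x ((w x)%:E * W k u x) <= (B * d)%:E)%E.
  move=> mu' Bu; apply: (@le_trans _ _ (\int[mu]_x (B * w x)%:E)%E).
    apply: ge0_le_integral => //.
    - by move=> x _; rewrite mule_ge0 ?lee_fin ?W_ge0.
    - exact: mww.
    - by apply/measurable_EFinP; apply: measurable_funM => //; exact: measurable_cst.
    - by move=> x _; rewrite mulrC EFinM; apply: lee_wpmul2l; rewrite ?lee_fin.
  rewrite integralZ_ge0// EFinM; apply: lee_wpmul2l => //.
have IA : (\int[(mu \x mu)%E]_z (A z)%:E <= (B * d)%:E)%E.
  rewrite (fubini_tonelli1 (fun z => (A z)%:E)); last 2 first.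
  - exact/measurable_EFinP.
  - by move=> z; rewrite lee_fin.
  apply: le_trans (bw f mf Bf); rewrite /fubini_F.
  apply: ge0_le_integral => //.
  - by move=> x _; apply: integral_EFin_ge0 => y; exact: (A0 (x, y)).
  - apply: (measurable_fun_fubini_tonelli_F (m2 := mu) (fun z => (A z)%:E)).
      exact/measurable_EFinP.
    by move=> z; rewrite lee_fin.
  - exact: mww.
  - move=> x _; rewrite /W -integralZ_ge0//.
    + rewrite le_eqVlt; apply/orP; left; apply/eqP; apply: eq_integral => y _.
      by rewrite /A/= mulrA (mulrC (w x)).
    + by apply: measurable_funM; [exact: measurable_kerx|exact: measurable_funX].
    + by move=> y; rewrite mulr_ge0 ?sqr_ge0 ?ker_ge0.
have IC : (\int[(mu \x mu)%E]_z (C z)%:E <= (B * d)%:E)%E.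
  rewrite (fubini_tonelli2 (fun z => (C z)%:E)); last 2 first.
  - exact/measurable_EFinP.
  - by move=> z; rewrite lee_fin.
  apply: le_trans (bw g mg Bg); rewrite /fubini_G.
  apply: ge0_le_integral => //.
  - by move=> x _; apply: integral_EFin_ge0 => y; exact: (C0 (y, x)).
  - apply: (measurable_fun_fubini_tonelli_G (m1 := mu) (fun z => (C z)%:E)).
      exact/measurable_EFinP.
    by move=> z; rewrite lee_fin.
  - exact: mww.
  - move=> x _; rewrite /W -integralZ_ge0//.
    + rewrite le_eqVlt; apply/orP; left; apply/eqP; apply: eq_integral => y _.
      by rewrite /C/= enormB mulrC.
    + by apply: measurable_funM; [exact: measurable_kerx|exact: measurable_funX].
    + by move=> y; rewrite mulr_ge0 ?sqr_ge0 ?ker_ge0.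
rewrite !V_prod//.
apply: (@le_trans _ _ (\int[(mu \x mu)%E]_z
  (k (enorm (z.1 - z.2)) * g z.1 ^+ 2 * g z.2 ^+ 2 + (A z + C z))%:E)%E).
  apply: le_integral_EFin.
  - exact: V_integrand_measurable.
  - by apply: measurable_funD => //; exact: measurable_funD.
  - by move=> z; rewrite mulr_ge0 ?sqr_ge0// mulr_ge0 ?sqr_ge0 ?ker_ge0.
  - have pt (z : (R * R) * (R * R)) : k (enorm (z.1 - z.2)) * f z.1 ^+ 2 * f z.2 ^+ 2 <=
       k (enorm (z.1 - z.2)) * g z.1 ^+ 2 * g z.2 ^+ 2 + (A z + C z).
      by apply: lip_pt; rewrite ?sqr_ge0 ?ker_ge0 ?ler_norm.
    by move=> z; exact: pt.
rewrite integralD_ge0//; [|exact: measurable_funD|by move=> z; exact: addr_ge0].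
apply: leeD2l; rewrite integralD_ge0//.
apply: (le_trans (leeD IA IC)); rewrite -EFinD lee_fin.
by rewrite le_eqVlt; apply/orP; left; apply/eqP; ring.
Qed.

Lemma L2_diff_sqr f g : L2 mu f -> L2 mu g ->
  (\int[mu]_x (`|f x ^+ 2 - g x ^+ 2|)%:E <=
   (Num.sqrt (ip mu (fun x => f x - g x) (fun x => f x - g x))
    * Num.sqrt (2 * ip mu f f + 2 * ip mu g g))%:E)%E.
Proof.
move=> lf lg; have l1 := L2B lf lg; have l2 := L2D lf lg.
have ln (u : R * R -> R) : L2 mu u -> L2 mu (fun x => `|u x|).
  move=> lu; apply: (L2_le _ _ lu); first by apply: measurableT_comp => //; exact: L2_meas lu.
  by move=> x; rewrite normr_id.
have ipn (u : R * R -> R) : ip mu (fun x => `|u x|) (fun x => `|u x|) = ip mu u u.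
  by rewrite /ip; congr fine; apply: eq_integral => x _; rewrite -!expr2 real_normK ?num_real.
rewrite (_ : (\int[mu]_x (`|f x ^+ 2 - g x ^+ 2|)%:E =
  (ip mu (fun x => `|f x - g x|) (fun x => `|f x + g x|))%:E)%E); last first.
  rewrite ipE; [|exact: ln|exact: ln].
  by apply: eq_integral => x _; rewrite subr_sqr normrM.
rewrite lee_fin; apply: (le_trans (ler_norm _)).
apply: (le_trans (ip_le_CS (ln _ l1) (ln _ l2))); rewrite !ipn.
by apply: ler_wpM2l; [exact: sqrtr_ge0|apply: ler_wsqrtr; exact: ipD_sqr_le].
Qed.

End PotentialCalculus.

(** * Existence of a minimizer *)

Section Existence.
Context (R : realType).
Local Notation mu := (leb2 R).
Implicit Types (f g : R * R -> R) (h x y : R * R) (k : R -> R).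

Lemma weakg_lin f (f1 f2 : R * R -> R) g (g1 g2 : R * R -> R) (c : R) :
  weakg f f1 f2 -> weakg g g1 g2 ->
  weakg (fun x => f x + c * g x) (fun x => f1 x + c * g1 x) (fun x => f2 x + c * g2 x).
Proof.
move=> [lf lf1 lf2 hf] [lg lg1 lg2 hg].
split; [exact: L2D lf (L2Z c lg)|exact: L2D lf1 (L2Z c lg1)|exact: L2D lf2 (L2Z c lg2)|].
move=> p tp; have lp := test_fun_L2 tp.
have lp1 := test_fun_L2 (test_fun_D1 tp); have lp2 := test_fun_L2 (test_fun_D2 tp).
have [e1 e2] := hf p tp; have [e3 e4] := hg p tp.
rewrite (ipDl lf (L2Z c lg) lp1) (ipDl lf (L2Z c lg) lp2) (ipZl c lg lp1) (ipZl c lg lp2).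
rewrite (ipDl lf1 (L2Z c lg1) lp) (ipDl lf2 (L2Z c lg2) lp) (ipZl c lg1 lp) (ipZl c lg2 lp).
by rewrite e1 e2 e3 e4; split; ring.
Qed.

Lemma Hcl_scale f (D a : R) : 0 <= a -> Hcl f D -> Hcl (fun x => a * f x) (a ^+ 2 * D).
Proof.
move=> a0 Hf; have lf := Hcl_L2 Hf; case: Hf => f0 [g1 [g2 [wg hD]]] lw.
have [_ l1 l2 _] := wg.
split; first by move=> x; rewrite mulr_ge0.
  exists (fun x => a * g1 x), (fun x => a * g2 x); split.
    have := weakg_lin a (@weakg0 R) wg.
    have e (u : R * R -> R) : (fun x => 0 + a * u x) = (fun x => a * u x).
      by apply/funext => x; rewrite add0r.
    by rewrite !e.
  rewrite (ipZl _ l1 (L2Z a l1)) (ipZr _ l1 l1) (ipZl _ l2 (L2Z a l2)) (ipZr _ l2 l2).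
  rewrite !mulrA -!expr2 -mulrDr; apply: ler_wpM2l => //; exact: sqr_ge0.
rewrite /Lw (_ : (fun y => _) = (fun y => (a ^+ 2 * (k1 (enorm y) * f y ^+ 2))%:E)); last first.
  by apply/funext => y; congr EFin; ring.
rewrite integralZ_ge0.
- by apply: lte_mul_pinfty; rewrite ?lee_fin ?sqr_ge0.
- by apply: Lw_measurable; exact: L2_meas lf.
- exact: sqr_ge0.
- by move=> y; exact: k1f2_ge0.
Qed.

Lemma ip_scale f (a : R) : L2 mu f ->
  ip mu (fun x => a * f x) (fun x => a * f x) = a ^+ 2 * ip mu f f.
Proof. by move=> lf; rewrite (ipZl a lf (L2Z a lf)) (ipZr a lf lf) mulrA. Qed.

(** An explicit competitor, so that the infimum runs over a nonempty set. *)
Definition tent x : R := Num.max 0 (1 - enorm x).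

Lemma tent_lip x y : (tent x - tent y) ^+ 2 <= (x - y).1 ^+ 2 + (x - y).2 ^+ 2.
Proof.
have h1 : enorm x <= enorm y + enorm (x - y).
  by have := enormD y (x - y); rewrite addrCA subrr addr0.
have h2 : enorm y <= enorm x + enorm (x - y).
  by have := enormD x (y - x); rewrite addrCA subrr addr0 (enormB y x).
rewrite -enorm_sqr -real_normK ?num_real// ler_sqr ?nnegrE ?enorm_ge0//.
have := enorm_ge0 (x - y); move: h1 h2; rewrite /tent ler_norml.
move: (enorm x) (enorm y) (enorm (x - y)) => a b c h1 h2 c0.
by case: (leP 0 (1 - a)) => p; case: (leP 0 (1 - b)) => q; apply/andP; split; lra.
Qed.

Lemma tent_ge0 x : 0 <= tent x.
Proof. by rewrite /tent le_max lexx. Qed.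

Lemma tent_le_box x : tent x <= \1_(box 1) x.
Proof.
rewrite indicE; have [_|/negP nx] := boolP (x \in box 1).
  rewrite /tent ge_max ler01 /= -subr_ge0.
  by rewrite (_ : _ - _ = enorm x) ?enorm_ge0//=; ring.
rewrite /tent ge_max lexx /= subr_le0; apply/negPn/negP => h; apply: nx.
rewrite -ltNge in h; apply/mem_set/boxP.
by rewrite (le_trans (enorm_ge1 x)) ?(le_trans (enorm_ge2 x))// ltW.
Qed.

Lemma measurable_tent : measurable_fun setT tent.
Proof.
apply: measurable_maxr; first exact: measurable_cst.
by apply: measurable_funB; [exact: measurable_cst|exact: measurable_enorm].
Qed.

Lemma tent_L2 : L2 mu tent.
Proof.
apply: (L2_le measurable_tent _ (L2_box ler01)) => x.
by rewrite !ger0_norm ?tent_ge0 ?tent_le_box.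
Qed.

(** The constant 16 is the area of [box 2], outside which [tent] and its shift vanish; the term with
    factor 0 provides the shape of [disc_int_quad]. *)
Lemma tent_dq h : `|h.1| <= 1 -> `|h.2| <= 1 ->
  dq tent h <= 16 * h.1 ^+ 2 + 0 * (h.1 * h.2) + 16 * h.2 ^+ 2.
Proof.
move=> h1 h2; rewrite -lee_fin dq_integral; last exact: tent_L2.
have h0 : 0 <= h.1 ^+ 2 + h.2 ^+ 2 by rewrite addr_ge0 ?sqr_ge0.
have mb : measurable_fun setT (\1_(box 2) : R * R -> R).
  exact: measurable_indic (box_measurable 2).
apply: (@le_trans _ _ (\int[mu]_x ((h.1 ^+ 2 + h.2 ^+ 2) * \1_(box 2) x)%:E)%E).
  apply: le_integral_EFin.
  - apply: measurable_funX; apply: measurable_funB; last exact: measurable_tent.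
    by apply: (measurableT_comp measurable_tent); exact: measurable_shift2.
  - by apply: measurable_funM => //; exact: measurable_cst.
  - by move=> x; exact: sqr_ge0.
  - have pt x : (tent (x + h) - tent x) ^+ 2 <= (h.1 ^+ 2 + h.2 ^+ 2) * \1_(box 2) x.
      rewrite indicE; have [_|/negP nx] := boolP (x \in box 2).
        by rewrite mulr1; have := tent_lip (x + h) x; rewrite addrAC subrr add0r.
      have z1 y : ~ box 1 y -> tent y = 0.
        move=> ny; apply/eqP; rewrite eq_le tent_ge0 andbT.
        by have := tent_le_box y; rewrite indicE memNset.
      rewrite (z1 x) ?(z1 (x + h)).
      + by rewrite subrr expr0n mulr0.
      + move=> /boxP[b1 b2]; apply: nx; apply/mem_set/boxP; split.
          rewrite (_ : x.1 = (x + h).1 - h.1); last by rewrite /= addrK.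
          apply: (le_trans (ler_normB _ _)); apply: (le_trans (lerD b1 h1)); lra.
        rewrite (_ : x.2 = (x + h).2 - h.2); last by rewrite /= addrK.
        apply: (le_trans (ler_normB _ _)); apply: (le_trans (lerD b2 h2)); lra.
      + move=> /boxP[b1 b2]; apply: nx; apply/mem_set/boxP.
        by split; [apply: (le_trans b1)|apply: (le_trans b2)]; lra.
    by move=> x; exact: pt.
rewrite integralZ_ge0//.
have -> : (\int[mu]_x (\1_(box 2) x)%:E = 16%:E :> \bar R)%E.
  rewrite (_ : 16 = 4 * 2 ^+ 2); last by rewrite -natrX -natrM.
  rewrite -(integral_box 0 (ler0n _ 2)).
  by apply: eq_integral => y _; rewrite addr0.
by rewrite -EFinM lee_fin; lra.
Qed.

Lemma tent_ip_gt0 : 0 < ip mu tent tent.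
Proof.
rewrite -lte_fin ip_sqr; last exact: tent_L2.
have mb : measurable_fun setT (\1_(box 4^-1) : R * R -> R).
  exact: measurable_indic (box_measurable _).
apply: (@lt_le_trans _ _ (\int[mu]_x (4^-1 * \1_(box 4^-1) x)%:E)%E).
  have -> : (\int[mu]_x (4^-1 * \1_(box 4^-1) x)%:E = (4^-1 * (4 * 4^-1 ^+ 2))%:E :> \bar R)%E.
    rewrite integralZ_ge0//.
    rewrite EFinM -(integral_box 0); last by rewrite invr_ge0.
    by congr (_ * _)%E; apply: eq_integral => y _; rewrite addr0.
  by rewrite lte_fin !mulr_gt0// ?exprn_gt0 ?invr_gt0.
apply: le_integral_EFin.
- by apply: measurable_funM => //; exact: measurable_cst.
- by apply: measurable_funX; exact: measurable_tent.
- by move=> x; rewrite mulr_ge0 ?invr_ge0//; case/andP: (indic_le1 (box 4^-1) x).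
- have pt x : 4^-1 * \1_(box 4^-1) x <= tent x ^+ 2.
    rewrite indicE; have [/set_mem/boxP[b1 b2]|_] := boolP (x \in box 4^-1); last by rewrite mulr0 sqr_ge0.
    have e2 : enorm x <= 2^-1.
      rewrite -(@ler_sqr _ (enorm x)) ?nnegrE ?enorm_ge0 ?invr_ge0// enorm_sqr.
      rewrite -(real_normK (num_real x.1)) -(real_normK (num_real x.2)).
      have s1 : `|x.1| ^+ 2 <= 4^-1 ^+ 2 by rewrite ler_sqr ?nnegrE ?invr_ge0.
      have s2 : `|x.2| ^+ 2 <= 4^-1 ^+ 2 by rewrite ler_sqr ?nnegrE ?invr_ge0.
      by apply: (le_trans (lerD s1 s2)); lra.
    have t2 : 2^-1 <= tent x by rewrite /tent le_max; apply/orP; right; lra.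
    rewrite mulr1 (_ : 4^-1 = 2^-1 ^+ 2); last by field.
    by rewrite ler_sqr ?nnegrE ?invr_ge0 ?tent_ge0.
  by move=> x; exact: pt.
Qed.

Lemma Hcl_tent : Hcl tent 32.
Proof.
split; first exact: tent_ge0.
  apply: weakg_exists; [exact: tent_L2|by []|] => t t0 t1.
  apply: (@le_trans _ _ (disc_int t (fun h => 16 * h.1 ^+ 2 + 0 * (h.1 * h.2) + 16 * h.2 ^+ 2))).
    apply: disc_int_le; [exact: ltW|exact: dq_bounded tent_L2|exact/disc_bounded_quad/ltW|].
    move=> h /(disc_box (ltW t0))/boxP[b1 b2].
    by apply: tent_dq; apply: le_trans t1.
  rewrite disc_int_quad; last exact: ltW.
  by rewrite (_ : 16 + 16 = 32)// -natrD.
apply: (@le_lt_trans _ _ ((k1 2)%:E * \int[mu]_x (tent x ^+ 2)%:E)%E); last first.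
  by rewrite -ip_sqr; [rewrite -EFinM ltry|exact: tent_L2].
have mt2 : measurable_fun setT (fun x => tent x ^+ 2) by apply: measurable_funX; exact: measurable_tent.
have k20 : 0 <= k1 2 :> R by exact: k1_ge0.
rewrite -integralZ_ge0//; last by move=> x; exact: sqr_ge0.
apply: le_integral_EFin.
- by apply: Lw_measurable; exact: measurable_tent.
- by apply: measurable_funM => //; exact: measurable_cst.
- by move=> y; exact: k1f2_ge0.
- have pt y : k1 (enorm y) * tent y ^+ 2 <= k1 2 * tent y ^+ 2.
    have [h|h] := leP (enorm y) 2.
      by apply: ler_wpM2r; [exact: sqr_ge0|apply: k1_le => //; exact: enorm_ge0].
    rewrite (_ : tent y = 0) ?expr0n ?mulr0//.
    by rewrite /tent; apply: max_l; lra.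
  by move=> y; exact: pt.
Qed.

Lemma Hcl_exists (l : R) : 0 < l -> exists f D, Hcl f D /\ ip mu f f = l.
Proof.
move=> l0; have t0 := tent_ip_gt0.
pose a := Num.sqrt (l / ip mu tent tent).
exists (fun x => a * tent x), (a ^+ 2 * 32); split.
  exact: Hcl_scale (sqrtr_ge0 _) Hcl_tent.
rewrite (ip_scale a tent_L2) sqr_sqrtr ?divfK ?gt_eqF//.
by rewrite divr_ge0 ?ltW.
Qed.

Lemma Hcl_tau f (D : R) h : Hcl f D -> Hcl (tau h f) D.
Proof.
move=> Hf; have lf := Hcl_L2 Hf; case: Hf => f0 [g1 [g2 [wg hD]]] lw.
have [_ l1 l2 _] := wg.
split; first by move=> x; exact: f0.
  exists (tau h g1), (tau h g2); split; first exact: weakg_tau.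
  by rewrite !tau_ip//; [exact: L2_meas l2|exact: L2_meas l2|exact: L2_meas l1|exact: L2_meas l1].
by rewrite Lw_tau; [exact: W1_lty|exact: L2_meas lf].
Qed.

(** The logarithmic moment of the translate by [h] is the [k1] potential of [f] at [h], and the mean
    of this potential with respect to f^2 / l is v1 f / l; it cannot exceed (v1 f + 1) / l
    everywhere. *)
Lemma Hcl_center f (D l : R) : Hcl f D -> ip mu f f = l -> 0 < l ->
  exists h, (Lw (tau h f) <= ((v1 f + 1) / l)%:E)%E.
Proof.
move=> Hf fl l0; have lf := Hcl_L2 Hf; have mf := L2_meas lf.
have kk := @kernel_k1 R.
apply: contrapT => /forallNP nh.
have w0 : 0 <= (v1 f + 1) / l by rewrite divr_ge0 ?ltW// ltr_wpDl// (v1_ge0 Hf).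
suff : (((v1 f + 1))%:E <= V (@k1 R) f)%E.
  by rewrite -(Hcl_V1 Hf) lee_fin gerDl ler10.
rewrite (VE kk mf) (_ : v1 f + 1 = (v1 f + 1) / l * ip mu f f); last first.
  by rewrite fl divfK// gt_eqF.
rewrite EFinM ip_sqr// -integralZ_ge0//; [|exact: measurable_funX|by move=> x; exact: sqr_ge0].
apply: ge0_le_integral => //.
- by move=> x _; rewrite lee_fin mulr_ge0 ?sqr_ge0.
- by apply/measurable_EFinP; apply: measurable_funM; [exact: measurable_cst|exact: measurable_funX].
- exact: fW_measurable.
- move=> x _; rewrite mulrC EFinM; apply: lee_wpmul2l; first by rewrite lee_fin sqr_ge0.
  by have /negP := nh x; rewrite -ltNge (Lw_tau _ mf) => /ltW.
Qed.

Lemma ip_young f g (r : R) : L2 mu f -> L2 mu g -> 0 < r ->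
  ip mu (fun x => f x + g x) (fun x => f x + g x) <=
  (1 + r) * ip mu f f + (1 + r^-1) * ip mu g g.
Proof.
move=> lf lg r0; rewrite (ipD_sqr lf lg).
have := ip_ge0 mu (fun x => f x + - r^-1 * g x); rewrite (ip_lin _ lf lg).
move: (ip mu f f) (ip mu f g) (ip mu g g) => a b c h.
have := mulr_ge0 (ltW r0) h.
have -> : r * (a + 2 * - r^-1 * b + (- r^-1) ^+ 2 * c) = r * a - 2 * b + r^-1 * c.
  by field; rewrite gt_eqF.
by clear; lra.
Qed.

(** Write f = g - (g - f); the modulus of the second term is at most four times its squared norm,
    whatever the shift. *)
Lemma dq_young f g h (r : R) : L2 mu f -> L2 mu g -> 0 < r ->
  dq f h <= (1 + r) * dq g h + (1 + r^-1) * (4 * ip mu (fun x => g x - f x) (fun x => g x - f x)).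
Proof.
move=> lf lg r0; have l1 := L2B lg lf; have l2 := L2N l1.
have l3 := L2B (tau_L2 h lg) lg; have l4 := L2B (tau_L2 h l2) l2.
have e1 : dq f h = ip mu (fun x => (tau h g x - g x) + (tau h (fun y => - (g y - f y)) x - (- (g x - f x))))
  (fun x => (tau h g x - g x) + (tau h (fun y => - (g y - f y)) x - (- (g x - f x)))).
  by rewrite /dq /ip; congr fine; apply: eq_integral => x _; rewrite /tau; congr EFin; congr (_ * _); ring.
rewrite e1; apply: (le_trans (ip_young l3 l4 r0)); rewrite lerD2l.
apply: ler_wpM2l; first by rewrite addr_ge0// invr_ge0 ltW.
apply: (le_trans (dq_le h l2)); rewrite le_eqVlt; apply/orP; left; apply/eqP; congr (_ * _).
by rewrite /ip; congr fine; apply: eq_integral => x _; rewrite mulrNN.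
Qed.

Lemma disc_bounded_cst (t c : R) : disc_bounded t (fun=> c).
Proof. by split; [exact: measurable_cst|exists `|c|]. Qed.

Lemma half_expr_ge0 n : 0 <= (2^-1 : R) ^+ n.
Proof. by rewrite exprn_ge0// invr_ge0. Qed.

Lemma half_expr_le1 n : (2^-1 : R) ^+ n <= 1.
Proof. by apply: exprn_ile1; rewrite ?invr_ge0// invf_le1// ler1n. Qed.

Lemma quarter_expr n : (4^-1 : R) ^+ n = (2^-1 ^+ n) ^+ 2.
Proof. by rewrite -exprM mulnC exprM; congr (_ ^+ n); field. Qed.

(** Lower semicontinuity at the level of moduli: Young's inequality with r = 2^-n loses a factor 1 +
    r on [dq (F n)] and costs 1 + 1/r times a squared distance of order r^2. *)
Lemma weakg_limit (F : nat -> R * R -> R) f (D : R) : L2 mu f -> 0 <= D ->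
  (forall n, exists g1 g2, weakg (F n) g1 g2 /\ ip mu g1 g1 + ip mu g2 g2 <= D + 2^-1 ^+ n) ->
  (forall n, ip mu (fun x => F n x - f x) (fun x => F n x - f x) <= 8 * 4^-1 ^+ n) ->
  exists g1 g2, weakg f g1 g2 /\ ip mu g1 g1 + ip mu g2 g2 <= D.
Proof.
move=> lf D0 hF cF; apply: weakg_exists => // t t0 t1.
have lF n : L2 mu (F n) by have [g1 [g2 [[]]]] := hF n.
have m0 := disc_mom_gt0 t0.
pose l := ip mu f f.
have bl n : ip mu (F n) (F n) <= 2 * l + 16.
  have e1 : ip mu (F n) (F n) = ip mu (fun x => (F n x - f x) + f x) (fun x => (F n x - f x) + f x).
    by rewrite /ip; congr fine; apply: eq_integral => x _; rewrite subrK.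
  rewrite e1; apply: (le_trans (ipD_sqr_le (L2B (lF n) lf) lf)).
  have c1 : 4^-1 ^+ n <= 1 :> R by apply: exprn_ile1; rewrite ?invr_ge0// invf_le1// ler1n.
  have := cF n; move: (ip mu _ _) c1 => a; rewrite -/l; move: (4^-1 ^+ n : R) => b.
  by clear; lra.
(* Here 64 r bounds the distance term, and 4 (2 l + 16) bounds [dq (F n) h] uniformly in [n] and
   [h]. *)
pose K := disc_int t (fun=> 64 + 4 * (2 * l + 16)).
apply: (@le_half_expr _ _ _ (disc_mom t + K)) => n.
set r := (2^-1 : R) ^+ n; have r0 : 0 < r by rewrite exprn_gt0// invr_gt0.
have r1 : r <= 1 by exact: half_expr_le1.
have lb := disc_bounded_lin 1 (disc_bounded_cst t 64) (dq_bounded t (lF n)).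
apply: (@le_trans _ _ (disc_int t (fun h => dq (F n) h + r * (64 + 1 * dq (F n) h)))).
  apply: disc_int_le; [exact: ltW|exact: dq_bounded|exact: disc_bounded_lin (dq_bounded t (lF n)) lb|].
  move=> h _; apply: (le_trans (dq_young h lf (lF n) r0)).
  have := cF n; rewrite quarter_expr -/r; move: (ip mu _ _) (ip_ge0 mu (fun x => F n x - f x)) => a a0 ha.
  have : (1 + r^-1) * (4 * a) <= 64 * r.
    apply: (@le_trans _ _ ((1 + r^-1) * (4 * (8 * r ^+ 2)))).
      apply: ler_wpM2l; first by rewrite addr_ge0// invr_ge0 ltW.
      by rewrite ler_pM2l.
    have -> : (1 + r^-1) * (4 * (8 * r ^+ 2)) = 32 * (r * r) + 32 * r by field; rewrite gt_eqF.
    by have := ler_wpM2l (ltW r0) r1; rewrite mulr1; clear; lra.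
  by move: (dq (F n) h) => b; clear; lra.
rewrite (disc_int_lin _ (ltW t0) (dq_bounded t (lF n)) lb).
have h1 : disc_int t (dq (F n)) <= (D + r) * disc_mom t.
  have [g1 [g2 [wg gD]]] := hF n.
  by apply: (le_trans (weakg_dq (ltW t0) wg)); rewrite ler_pM2r.
have h2 : disc_int t (fun h => 64 + 1 * dq (F n) h) <= K.
  apply: disc_int_le; [exact: ltW|exact: lb|exact: disc_bounded_cst|] => h _.
  rewrite mul1r lerD2l; apply: (le_trans (dq_le h (lF n))).
  by rewrite ler_pM2l.
have := ler_wpM2l (ltW r0) h2; move: h1.
move: (disc_int t _) (disc_int t _) (disc_mom t) => a b c; clear.
by rewrite mulrDl; lra.
Qed.

(** The signs in the energy dictate two modes of passage: [v1] needs only lower semicontinuity,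
    hence Fatou, while [v2] enters with a minus sign and must be estimated from the other side,
    hence [V_lip]. *)
Lemma Hcl_limit (F : nat -> R * R -> R) (Dn : nat -> R) (l C D a : R) :
  0 < l -> (forall n, Hcl (F n) (Dn n)) -> (forall n, ip mu (F n) (F n) = l) ->
  (forall n, Lw (F n) <= C%:E)%E -> (forall n, Dn n <= D + 2^-1 ^+ n) ->
  (forall n, v1 (F n) <= a + 2^-1 ^+ n) ->
  (forall n, ip mu (fun x => F n.+1 x - F n x) (fun x => F n.+1 x - F n x) <= 8^-1 ^+ n) ->
  exists f, [/\ Hcl f D, ip mu f f = l, v1 f <= a &
    exists K, forall n, v2 (F n) <= v2 f + K * 2^-1 ^+ n].
Proof.
move=> l0 HF Fl FC FD Fa cF.
have lF n := Hcl_L2 (HF n); have mF n := L2_meas (lF n).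
have D0 : 0 <= D.
  apply: (@le_half_expr _ _ _ 1) => n; rewrite mul1r.
  exact: le_trans (Hcl_ge0 (HF n)) (FD n).
have [A [f [[mA _] lf cf cF']]] := L2_complete lF cF.
have mf := L2_meas lf.
(* The cut-off sequence converges at every point and lies below [F n], so its moments and potentials
   are no larger. *)
pose G n x := F n x * \1_A x.
have mG n : measurable_fun setT (G n).
  by apply: measurable_funM => //; exact: measurable_indic.
have i01 x : 0 <= (\1_A x : R) <= 1 := indic_le1 A x.
have F0 n x : 0 <= F n x by case: (HF n).
have G0 n x : 0 <= G n x by case/andP: (i01 x) => ? _; exact: mulr_ge0.
have GF n x : G n x <= F n x by case/andP: (i01 x) => _ ?; exact: ler_piMr.
have f0 x : 0 <= f x.
  by apply: (cvgr_to_ge (cf x)); apply: nearW => n; exact: G0.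
have Lwf : (Lw f <= C%:E)%E.
  apply: (Lw_fatou (F := G) (K := 0)) => // n; rewrite mul0r addr0.
  apply: le_trans (FC n); apply: le_integral_EFin.
  - exact: Lw_measurable.
  - exact: Lw_measurable.
  - by move=> y; exact: k1f2_ge0.
  - move=> y; apply: ler_wpM2l; first by rewrite k1_ge0 ?enorm_ge0.
    by rewrite ler_sqr ?nnegrE.
have wf : exists g1 g2, weakg f g1 g2 /\ ip mu g1 g1 + ip mu g2 g2 <= D.
  apply: (weakg_limit (F := F)) => // n.
  have [_ [g1 [g2 [wg hg]]] _] := HF n.
  by exists g1, g2; split => //; exact: le_trans hg (FD n).
have Hf : Hcl f D by split => //; exact: le_lt_trans Lwf (ltry _).
have cvg0 : ip mu (fun x => F n x - f x) (fun x => F n x - f x) @[n --> \oo] --> (0 : R).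
  apply/cvgrPdist_le => e e0.
  have e8 : 0 < e / 8 by rewrite divr_gt0.
  have [N hN] := half_expr_le e8.
  exists N => // n Nn; rewrite /= sub0r normrN ger0_norm ?ip_ge0//.
  apply: (le_trans (cF' n)); rewrite mulrC -ler_pdivlMr//; apply: le_trans hN.
  rewrite quarter_expr expr2; apply: (@le_trans _ _ (2^-1 ^+ n)).
    by apply: ler_piMl; [exact: half_expr_ge0|exact: half_expr_le1].
  by apply: ler_wiXn2l; rewrite ?invr_ge0// invf_le1// ler1n.
have fl : ip mu f f = l.
  have := ip_sqr_cvg lF lf cvg0; under eq_fun do rewrite Fl.
  by move=> /(cvg_unique (@Rhausdorff R))/(_ (cvg_cst l)).
exists f; split => //.
  rewrite -lee_fin (Hcl_V1 Hf).
  apply: (V_fatou (F := G) (K := 1) (@kernel_k1 R)) => // n.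
  apply: (@le_trans _ _ (V (@k1 R) (F n))); first exact: V_le (@kernel_k1 R) (mG n) (mF n) (G0 n) (GF n).
  by rewrite -(Hcl_V1 (HF n)) lee_fin mul1r.
pose B := Wmax l 1 (D + 1).
have B0 : 0 <= B by apply: Wmax_ge0; rewrite ?addr_ge0// ltW.
exists (2 * B * (Num.sqrt 8 * Num.sqrt (4 * l))) => n.
rewrite (_ : 2 * B * _ * _ = 2 * B * (Num.sqrt 8 * Num.sqrt (4 * l) * 2^-1 ^+ n)); last by ring.
apply: (Hcl_v2_leD (HF n) Hf); apply: (V_lip (@kernel_k2 R) (mF n) mf B0).
- move=> x; apply: (le_trans (Hcl_W2 x (HF n) ltr01)); rewrite Fl lee_fin.
  by apply: Wmax_le => //; apply: (le_trans (FD n)); rewrite lerD2l half_expr_le1.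
- move=> x; apply: (le_trans (Hcl_W2 x Hf ltr01)); rewrite fl lee_fin.
  by apply: Wmax_le => //; rewrite lerDl.
- apply: (le_trans (L2_diff_sqr (lF n) lf)); rewrite Fl fl lee_fin.
  rewrite (_ : 2 * l + 2 * l = 4 * l); last by ring.
  rewrite mulrAC; apply: ler_wpM2r; first exact: sqrtr_ge0.
  rewrite (_ : 2^-1 ^+ n = Num.sqrt (4^-1 ^+ n)); last first.
    by rewrite quarter_expr sqrtr_sqr ger0_norm ?half_expr_ge0.
  by rewrite -sqrtrM// ler_wsqrtr.
Qed.

(** Both sequences converge along the same ultrafilter, so every tolerance is met by a common
    index. *)
Lemma bounded_extract (u v : nat -> R) (B : R) :
  (forall n, `|u n| <= B) -> (forall n, `|v n| <= B) ->
  exists a b (phi : nat -> nat), forall n, [/\ (n <= phi n)%N,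
    `|u (phi n) - a| <= 2^-1 ^+ n & `|v (phi n) - b| <= 2^-1 ^+ n].
Proof.
move=> hu hv; have [U [uU ooU]] := ultraFilterLemma (@eventually_filter).
have pU : ProperFilter U by case: uU.
have [a ha] := ultra_cvg_bounded uU hu; have [b hb] := ultra_cvg_bounded uU hv.
have e0 (j : nat) : 0 < (2^-1 : R) ^+ j by rewrite exprn_gt0// invr_gt0.
have ex n : exists m, [/\ (n <= m)%N,
    `|u m - a| <= 2^-1 ^+ n & `|v m - b| <= 2^-1 ^+ n].
  have U2 : U [set m | (n <= m)%N] by apply: ooU; exists n.
  have [m [[m1 m2] m3]] := filter_ex (filterI (filterI U2 (ha _ (e0 n))) (hb _ (e0 n))).
  by exists m.
by have [phi hphi] := choice ex; exists a, b, phi.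
Qed.

(** [D] stands in for the Dirichlet integral and [c] for gamma / (4 pi). *)
Definition En (c : R) f (D : R) := D + c * (v1 f - v2 f).

Definition minimizer (c l : R) f (D : R) := [/\ Hcl f D, ip mu f f = l &
  forall g D', Hcl g D' -> ip mu g g = l -> En c f D <= En c g D'].

Lemma En_coercive (c l : R) : 0 < c -> 0 < l -> exists C0, forall f D,
  Hcl f D -> ip mu f f = l -> D / 2 + c * v1 f <= En c f D + C0.
Proof.
(* With this [k] the part of the bound on [c * v2 f] that carries [D], namely 8 c l k D, equals D /
   2. *)
move=> c0 l0; pose k : R := (16 * c * l)^-1.
have k0 : 0 < k by rewrite invr_gt0 !mulr_gt0.
exists (c * (l * (l + 4 * (l / k)))) => f D Hf fl.
have := ler_wpM2l (ltW c0) (v2_le Hf k0); rewrite fl /Wmax /En.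
have -> : c * ((l + 2 * (2 * (l / k) + 4 * k * D)) * l) =
    c * (l * (l + 4 * (l / k))) + (16 * c * l) * k * (D / 2).
  by move: (k) k0 => q q0; field; rewrite gt_eqF.
rewrite mulfV ?gt_eqF ?mulr_gt0// mul1r.
move: (c * (l * (l + 4 * (l / k)))) (v1 f) (v2 f) => q a b.
by rewrite mulrBr; clear; lra.
Qed.

Lemma minimizer_exists (c l : R) : 0 < c -> 0 < l -> exists f D, minimizer c l f D.
Proof.
move=> c0 l0; have [C0 coer] := En_coercive c0 l0.
pose S := [set e | exists f D, [/\ Hcl f D, ip mu f f = l & e = En c f D]].
have lbS : has_lbound S.
  exists (- C0) => _ [f [D [Hf fl ->]]].
  have := coer f D Hf fl; have := mulr_ge0 (ltW c0) (v1_ge0 Hf); have := Hcl_ge0 Hf.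
  by move: (En c f D) (c * v1 f) => p q; clear; lra.
have iS : has_inf S.
  by split => //; have [f [D [Hf fl]]] := Hcl_exists l0; exists (En c f D), f, D.
set m := inf S.
have mS f D : Hcl f D -> ip mu f f = l -> m <= En c f D.
  by move=> Hf fl; apply: ge_inf => //; exists f, D.
(* The bounds that coercivity gives at energies up to m + 1. *)
pose Dm := 2 * (m + 1 + C0); pose Vm := (m + 1 + C0) / c.
have seq n : exists fD : (R * R -> R) * R, [/\ Hcl fD.1 fD.2, ip mu fD.1 fD.1 = l,
    (Lw fD.1 <= ((Vm + 1) / l)%:E)%E, fD.2 <= Dm & v1 fD.1 <= Vm] /\ En c fD.1 fD.2 <= m + 2^-1 ^+ n.
  have e0 : 0 < (2^-1 : R) ^+ n by rewrite exprn_gt0// invr_gt0.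
  have [_ [f [D [Hf fl ->]]] lt] := inf_adherent e0 iS.
  have [h Lh] := Hcl_center Hf fl l0.
  have mf := L2_meas (Hcl_L2 Hf).
  have e1 : v1 (tau h f) = v1 f by rewrite /v1 (V_tau _ (@kernel_k1 R) mf).
  have e2 : v2 (tau h f) = v2 f by rewrite /v2 (V_tau _ (@kernel_k2 R) mf).
  have b := coer f D Hf fl; have D0 := Hcl_ge0 Hf; have q0 := mulr_ge0 (ltW c0) (v1_ge0 Hf).
  have p1 := half_expr_le1 n.
  have vV : v1 f <= Vm.
    rewrite /Vm (ler_pdivlMr _ _ c0) mulrC; move: b q0 lt p1 D0; rewrite -/m.
    by move: (En c f D) (c * v1 f) ((2^-1) ^+ n : R) => p q r; clear; lra.
  exists (tau h f, D); split; last by rewrite /= /En e1 e2 ltW.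
  split => /=; [exact: Hcl_tau|by rewrite (tau_ip h mf mf)| | |by rewrite e1].
    apply: (le_trans Lh); rewrite lee_fin; apply: ler_wpM2r; last by rewrite lerD2r.
    by rewrite invr_ge0; exact: ltW.
  rewrite /Dm; move: b q0 lt p1 D0; rewrite -/m.
  by move: (En c f D) (c * v1 f) ((2^-1) ^+ n : R) => p q r; clear; lra.
have [fD hfD] := choice seq.
pose B := `|Dm| + `|Vm|.
have bD n : `|(fD n).2| <= B.
  have [[Hf _ _ b _] _] := hfD n; rewrite ger0_norm ?(Hcl_ge0 Hf)//.
  by apply: (le_trans b); apply: (le_trans (ler_norm _)); rewrite lerDl.
have bV n : `|v1 (fD n).1| <= B.
  have [[Hf _ _ _ b] _] := hfD n; rewrite ger0_norm ?(v1_ge0 Hf)//.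
  by apply: (le_trans b); apply: (le_trans (ler_norm _)); rewrite lerDr.
(* The bounds on the Dirichlet integral and the values of [v1] converge separately, before the
   functions do: each is only lower semicontinuous, and this [D] becomes the bound paired with the
   limit function. *)
have [D [a [psi hpsi]]] := bounded_extract bD bV.
pose f_ n := (fD (psi n)).1; pose D_ n := (fD (psi n)).2.
have C0' : 0 <= (Vm + 1) / l.
  have [[Hf _ _ _ b] _] := hfD 0%N.
  by rewrite divr_ge0 ?ltW// ltr_wpDl// (le_trans (v1_ge0 Hf)).
have Dm0 : 0 <= Dm by have [[Hf _ _ b _] _] := hfD 0%N; exact: le_trans (Hcl_ge0 Hf) b.
have [phi [phik cphi]] : exists phi : nat -> nat, (forall k : nat, (k <= phi k)%N) /\
    forall k : nat, ip mu (fun x => f_ (phi k.+1) x - f_ (phi k) x)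
      (fun x => f_ (phi k.+1) x - f_ (phi k) x) <= 8^-1 ^+ k.
  apply: (rellich (l := l) Dm0 C0').
  - move=> n; have [[[_ [g1 [g2 [wg hg]]] _] _ _ b _] _] := hfD (psi n).
    by exists g1, g2; split => //; exact: le_trans hg b.
  - by move=> n; have [[]] := hfD (psi n).
  - by move=> n; have [[_ -> ]] := hfD (psi n).
have mono j n : (n <= j)%N -> (2^-1 : R) ^+ j <= 2^-1 ^+ n.
  by move=> nj; apply: ler_wiXn2l; rewrite ?invr_ge0// invf_le1// ler1n.
have DD n : `|D_ (phi n) - D| <= 2^-1 ^+ n.
  by have [_ h _] := hpsi (phi n); apply: (le_trans h); exact: mono.
have aa n : `|v1 (f_ (phi n)) - a| <= 2^-1 ^+ n.
  by have [_ _ h] := hpsi (phi n); apply: (le_trans h); exact: mono.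
have [f [Hf fl fa [K hK]]] : exists f, [/\ Hcl f D, ip mu f f = l, v1 f <= a &
    exists K, forall n, v2 (f_ (phi n)) <= v2 f + K * 2^-1 ^+ n].
  apply: (Hcl_limit (F := fun n => f_ (phi n)) (Dn := fun n => D_ (phi n)) (C := (Vm + 1) / l)) => //.
  - by move=> n; have [[]] := hfD (psi (phi n)).
  - by move=> n; have [[]] := hfD (psi (phi n)).
  - by move=> n; have [[]] := hfD (psi (phi n)).
  - by move=> n; have := le_trans (ler_norm _) (DD n); rewrite lerBlDl.
  - by move=> n; have := le_trans (ler_norm _) (aa n); rewrite lerBlDl.
exists f, D; split; [exact: Hf|exact: fl|move=> g D' Hg gl; apply: le_trans (mS g D' Hg gl)].
(* The errors in units of 2^-n: one each from near-minimality and from [D], [c] from [v1], and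
   [c * K] from [v2]. *)
apply: (@le_half_expr _ _ _ (2 + c + c * K)) => n; rewrite -/m.
have En_ : En c (f_ (phi n)) (D_ (phi n)) <= m + 2^-1 ^+ n.
  have [_ h] := hfD (psi (phi n)); apply: (le_trans h); rewrite lerD2l; apply: mono.
  by apply: (leq_trans (phik n)); case: (hpsi (phi n)).
have := DD n; have := aa n; rewrite !ler_norml => /andP[a1 _] /andP[d1 _].
have ca := ler_wpM2l (ltW c0) a1; have cf := ler_wpM2l (ltW c0) fa.
have cK := ler_wpM2l (ltW c0) (hK n).
move: En_ ca cf cK d1; rewrite /En.
move: (2^-1 ^+ n : R) (v1 f) (v2 f) (v1 _) (v2 _) (D_ _) => r p q s t d; clear.
by rewrite !mulrBr !mulrDr mulrN mulrA; lra.
Qed.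

End Existence.

(** * Boundedness of minimizers *)

Section Boundedness.
Context (R : realType).
Local Notation mu := (leb2 R).
Implicit Types (f g w : R * R -> R) (h x y : R * R).

Definition wbound f (D : R) := exists g1 g2, weakg f g1 g2 /\ ip mu g1 g1 + ip mu g2 g2 <= D.

Lemma wbound_L2 f D : wbound f D -> L2 mu f.
Proof. by move=> [g1 [g2 [[]]]]. Qed.

Lemma wbound_ge0 f D : wbound f D -> 0 <= D.
Proof. by move=> [g1 [g2 [_ h]]]; apply: le_trans h; rewrite addr_ge0 ?ip_ge0. Qed.

(** A normal contraction has a smaller modulus [dq] at every shift, and moduli determine the
    Dirichlet bound. *)
Lemma wbound_contraction f g D : L2 mu g ->
  (forall x y, (g x - g y) ^+ 2 <= (f x - f y) ^+ 2) -> wbound f D -> wbound g D.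
Proof.
move=> lg gf fD; have D0 := wbound_ge0 fD; have lf := wbound_L2 fD.
case: fD => f1 [f2 [wf hD]]; apply: weakg_exists => // t t0 t1.
apply: (@le_trans _ _ (disc_int t (dq f))).
  apply: disc_int_le; [exact: ltW|exact: dq_bounded|exact: dq_bounded|] => h _.
  rewrite -lee_fin (dq_integral h lg) (dq_integral h lf).
  have m u : L2 mu u -> measurable_fun setT (fun x => (u (x + h) - u x) ^+ 2).
    move=> /L2_meas mu'; apply: measurable_funX; apply: measurable_funB => //.
    by apply: (measurableT_comp mu'); exact: measurable_shift2.
  apply: le_integral_EFin; [exact: m|exact: m|by move=> x; exact: sqr_ge0|by move=> x; exact: gf].
apply: (le_trans (weakg_dq (ltW t0) wf)).
by rewrite ler_pM2r ?disc_mom_gt0.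
Qed.

(* The two pieces are (f + u) / 2 and (f - u) / 2 with u = M - |f - M|, whose
   increments are bounded by those of f; conclude by the parallelogram law. *)
Lemma trunc_split f D (M : R) : 0 <= M -> (forall x, 0 <= f x) -> wbound f D ->
  exists Dg Dw, [/\ wbound (fun x => Num.min (f x) M) Dg,
    wbound (fun x => f x - Num.min (f x) M) Dw & Dg + Dw <= D].
Proof.
move=> M0 f0 fD; have lf := wbound_L2 fD; have mf := L2_meas lf.
pose u x := M - `|f x - M|.
have lu : L2 mu u.
  apply: (L2_le _ _ lf).
    apply: measurable_funB; first exact: measurable_cst.
    by apply: measurableT_comp => //; apply: measurable_funB => //; exact: measurable_cst.
  move=> x; rewrite (ger0_norm (f0 x)) /u ler_norml.
  have := f0 x; move: (f x) => a a0; have [h|h] := leP 0 (a - M).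
    by rewrite (ger0_norm h); apply/andP; split; lra.
  by rewrite (ltr0_norm h); apply/andP; split; lra.
have uD : wbound u D.
  apply: (wbound_contraction lu _ fD) => x y.
  rewrite -(real_normK (num_real (u x - u y))) -(real_normK (num_real (f x - f y))).
  rewrite ler_sqr ?nnegrE// (_ : u x - u y = `|f y - M| - `|f x - M|); last by rewrite /u; ring.
  apply: (le_trans (ler_dist_dist _ _)).
  have -> : f y - M - (f x - M) = f y - f x by ring.
  by rewrite distrC lexx.
case: fD => f1 [f2 [wf hf]]; case: uD => u1 [u2 [wu hu]].
have w2 := weakg_lin (-1) wf wu.
have ww := weakg_lin 2^-1 (@weakg0 R) w2.
have wg := weakg_lin 2^-1 wu w2.
have ew : (fun x => 0 + 2^-1 * (f x + -1 * u x)) = (fun x => f x - Num.min (f x) M).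
  apply/funext => x; rewrite /u; move: (f x) => a.
  have [h|h] := leP a M; first by rewrite ler0_norm ?subr_le0//; field.
  by rewrite ger0_norm ?subr_ge0 ?ltW//; field.
have eg : (fun x => u x + 2^-1 * (f x + -1 * u x)) = (fun x => Num.min (f x) M).
  apply/funext => x; rewrite /u; move: (f x) => a.
  have [h|h] := leP a M; first by rewrite ler0_norm ?subr_le0//; field.
  by rewrite ger0_norm ?subr_ge0 ?ltW//; field.
rewrite ew in ww; rewrite eg in wg.
have [_ lf1 lf2 _] := wf; have [_ lu1 lu2 _] := wu; have [_ l1 l2 _] := w2.
have [_ lw1 lw2 _] := ww; have [_ lg1 lg2 _] := wg.
have par (p q : R * R -> R) : L2 mu p -> L2 mu q ->
  ip mu (fun x => q x + 2^-1 * (p x + -1 * q x)) (fun x => q x + 2^-1 * (p x + -1 * q x))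
  + ip mu (fun x => 0 + 2^-1 * (p x + -1 * q x)) (fun x => 0 + 2^-1 * (p x + -1 * q x))
  = 2^-1 * (ip mu p p + ip mu q q).
  move=> lp lq; have ld := L2D lp (L2Z (-1) lq).
  rewrite (ip_lin _ lq ld) (ip_lin _ (L2_0 mu) ld) (ip_lin _ lp lq).
  rewrite (ipDr lp (L2Z (-1) lq) lq) (ipZr (-1) lq lq) (ipC _ q p).
  have z (v : R * R -> R) : ip mu (fun=> 0) v = 0.
    by rewrite /ip (_ : (fun x => _) = (fun=> 0%:E)) ?integral0//; apply/funext => x; rewrite mul0r.
  by rewrite !z; move: (ip mu p p) (ip mu p q) (ip mu q q) => a b e; field.
exists (ip mu (fun x => u1 x + 2^-1 * (f1 x + -1 * u1 x)) (fun x => u1 x + 2^-1 * (f1 x + -1 * u1 x))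
  + ip mu (fun x => u2 x + 2^-1 * (f2 x + -1 * u2 x)) (fun x => u2 x + 2^-1 * (f2 x + -1 * u2 x))).
exists (ip mu (fun x => 0 + 2^-1 * (f1 x + -1 * u1 x)) (fun x => 0 + 2^-1 * (f1 x + -1 * u1 x))
  + ip mu (fun x => 0 + 2^-1 * (f2 x + -1 * u2 x)) (fun x => 0 + 2^-1 * (f2 x + -1 * u2 x))).
split; [by exists (fun x => u1 x + 2^-1 * (f1 x + -1 * u1 x)), (fun x => u2 x + 2^-1 * (f2 x + -1 * u2 x))
  |by exists (fun x => 0 + 2^-1 * (f1 x + -1 * u1 x)), (fun x => 0 + 2^-1 * (f2 x + -1 * u2 x))|].
rewrite addrACA (par _ _ lf1 lu1) (par _ _ lf2 lu2).
move: hf hu; move: (ip mu f1 f1) (ip mu f2 f2) (ip mu u1 u1) (ip mu u2 u2) => a b d e.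
by clear; lra.
Qed.

(* At least half of every square of area 2a lies outside the support of w. *)
Lemma faber_krahn w D (a : R) : wbound w D -> 0 < a ->
  (mu [set x | w x != 0%R] <= a%:E)%E -> ip mu w w <= 2 * a * D.
Proof.
move=> wD a0 ha; have lw := wbound_L2 wD; have mw := L2_meas lw; have D0 := wbound_ge0 wD.
pose s := Num.sqrt (a / 2).
have s0 : 0 < s by rewrite sqrtr_gt0 divr_gt0.
have s2 : s ^+ 2 = a / 2 by rewrite sqr_sqrtr ?divr_ge0 ?ltW.
pose Z := [set x | w x != 0].
have mZ : measurable Z.
  rewrite (_ : Z = w @^-1` [set~ 0]).
    by rewrite -[X in measurable X]setTI; apply: mw => //; apply: measurableC; exact: measurable_set1.
  by apply/seteqP; split => x /= /eqP.
have mIZ : measurable_fun setT (\1_Z : R * R -> R) by exact: measurable_indic.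
have mb : measurable_fun setT (\1_(box s) : R * R -> R) by exact: measurable_indic (box_measurable s).
have b01 h : 0 <= (\1_(box s) h : R) <= 1 := indic_le1 (box s) h.
have Z01 x : 0 <= (\1_Z x : R) <= 1 := indic_le1 Z x.
have mbx x : measurable_fun setT (fun y => \1_(box s) (y - x) : R).
  by apply: (measurableT_comp mb); exact: measurable_shift2.
have IZ : (\int[mu]_y (\1_Z y)%:E <= a%:E)%E by rewrite integral_indic// setIT.
have mwx x : measurable_fun setT (fun y => \1_(box s) (y - x) * (w y - w x) ^+ 2).
  apply: measurable_funM => //; apply: measurable_funX.
  by apply: measurable_funB => //; exact: measurable_cst.
have inner x : ((a * w x ^+ 2)%:E <= \int[mu]_y (\1_(box s) (y - x) * (w y - w x) ^+ 2)%:E)%E.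
  have h1 : ((2 * a * w x ^+ 2)%:E <= \int[mu]_y (\1_(box s) (y - x) * (w y - w x) ^+ 2)%:E
      + (w x ^+ 2)%:E * \int[mu]_y (\1_Z y)%:E)%E.
    rewrite -integralZ_ge0//; [|exact: sqr_ge0].
    rewrite -integralD_ge0//; last 3 first.
    - by apply: measurable_funM => //; exact: measurable_cst.
    - by move=> y; case/andP: (b01 (y - x)) => ? _; rewrite mulr_ge0 ?sqr_ge0.
    - by move=> y; case/andP: (Z01 y) => ? _; rewrite mulr_ge0 ?sqr_ge0.
    have -> : ((2 * a * w x ^+ 2)%:E = \int[mu]_y (w x ^+ 2 * \1_(box s) (y - x))%:E)%E.
      rewrite integralZ_ge0//; last exact: sqr_ge0.
      rewrite (integral_box (- x) (ltW s0)) s2 -EFinM; congr EFin; by field.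
    apply: le_integral_EFin.
    - by apply: measurable_funM => //; exact: measurable_cst.
    - by apply: measurable_funD => //; apply: measurable_funM => //; exact: measurable_cst.
    - by move=> y; case/andP: (b01 (y - x)) => ? _; rewrite mulr_ge0 ?sqr_ge0.
    - have pt y : w x ^+ 2 * \1_(box s) (y - x) <=
          \1_(box s) (y - x) * (w y - w x) ^+ 2 + w x ^+ 2 * \1_Z y.
        case/andP: (b01 (y - x)) => i0 i1.
        rewrite [in X in _ <= _ + X]indicE; have [_|/negP nz] := boolP (y \in Z).
          rewrite mulr1; apply: ler_wpDl; first by rewrite mulr_ge0 ?sqr_ge0.
          by apply: ler_piMr => //; exact: sqr_ge0.
        have -> : w y = 0 by apply/eqP/negPn/negP => h; apply: nz; exact/mem_set.
        by rewrite sub0r sqrrN mulr0 addr0 mulrC.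
      by move=> y; exact: pt.
  have h2 : ((w x ^+ 2)%:E * \int[mu]_y (\1_Z y)%:E <= (a * w x ^+ 2)%:E)%E.
    by rewrite (mulrC a) (EFinM _ a); apply: lee_wpmul2l; rewrite ?lee_fin ?sqr_ge0.
  have h3 := le_trans h1 (leeD (lexx _) h2).
  have : ((2 * a * w x ^+ 2)%:E - (a * w x ^+ 2)%:E <=
     \int[mu]_y (\1_(box s) (y - x) * (w y - w x) ^+ 2)%:E)%E by rewrite leeBlDr.
  by rewrite -EFinB (_ : _ - _ = a * w x ^+ 2)//; ring.
have tot : ((a * ip mu w w)%:E <= (2 * a ^+ 2 * D)%:E)%E.
  rewrite EFinM ip_sqr// -integralZ_ge0//; last 3 first.
  - exact: measurable_funX.
  - exact: ltW.
  - by move=> x; exact: sqr_ge0.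
  apply: (@le_trans _ _ (\int[mu]_x \int[mu]_y (\1_(box s) (y - x) * (w y - w x) ^+ 2)%:E)%E).
    apply: ge0_le_integral => //.
    - by move=> x _; rewrite lee_fin mulr_ge0 ?sqr_ge0 ?ltW.
    - by apply/measurable_EFinP; apply: measurable_funM; [exact: measurable_cst|exact: measurable_funX].
    - apply: (measurable_fun_fubini_tonelli_F (m2 := mu)
        (fun z : (R * R) * (R * R) => (\1_(box s) (z.2 - z.1) * (w z.2 - w z.1) ^+ 2)%:E)).
        apply/measurable_EFinP; apply: measurable_funM.
          apply: (measurableT_comp mb (g := fun z : (R * R) * (R * R) => z.2 - z.1)).
          apply: measurable_fun_pair => /=; apply: measurable_funB; apply: measurableT_comp => //;
            by [exact: measurable_fst|exact: measurable_snd].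
        by apply: measurable_funX; apply: measurable_funB; apply: (measurableT_comp mw); [exact: measurable_snd|exact: measurable_fst].
      by move=> z; case/andP: (b01 (z.2 - z.1)) => ? _; rewrite lee_fin mulr_ge0 ?sqr_ge0.
  rewrite (integral_dq_indic (box_measurable s) lw).
  apply: (@le_trans _ _ (\int[mu]_h (D * a * \1_(box s) (h + 0))%:E)%E).
    have Da : 0 <= D * a by exact: mulr_ge0 (ltW a0).
    apply: le_integral_EFin.
    - by apply: measurable_funM => //; exact: measurable_dq.
    - by under eq_fun do rewrite addr0; apply: measurable_funM => //; exact: measurable_cst.
    - by move=> h; case/andP: (b01 h) => ? _; rewrite mulr_ge0 ?dq_ge0.
    - have pt h : \1_(box s) h * dq w h <= D * a * \1_(box s) (h + 0).
        rewrite addr0 indicE; have [/set_mem/boxP[b1 b2]|_] := boolP (h \in box s); last by rewrite mul0r mulr0.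
        rewrite mul1r mulr1; case: wD => g1 [g2 [wg hg]].
        apply: (le_trans (weakg_dq_le h wg)); apply: ler_pM => //.
        + by rewrite addr_ge0 ?ip_ge0.
        + by rewrite addr_ge0 ?sqr_ge0.
        + rewrite -(real_normK (num_real h.1)) -(real_normK (num_real h.2)).
          have q1 : `|h.1| ^+ 2 <= s ^+ 2 by rewrite ler_sqr ?nnegrE// ltW.
          have q2 : `|h.2| ^+ 2 <= s ^+ 2 by rewrite ler_sqr ?nnegrE// ltW.
          by apply: (le_trans (lerD q1 q2)); rewrite s2 -splitr.
      by move=> h; exact: pt.
  rewrite integralZ_ge0//; last 2 first.
  - by under eq_fun do rewrite addr0.
  - exact: mulr_ge0 (ltW a0).
  rewrite (integral_box 0 (ltW s0)) s2 -EFinM lee_fin le_eqVlt; apply/orP; left; apply/eqP.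
  by field.
move: tot; rewrite lee_fin (_ : 2 * a ^+ 2 * D = a * (2 * a * D)); last by ring.
by rewrite ler_pM2l.
Qed.

Lemma Lw_le f g : measurable_fun setT f -> measurable_fun setT g ->
  (forall x, 0 <= f x) -> (forall x, f x <= g x) -> (Lw f <= Lw g)%E.
Proof.
move=> mf mg f0 fg; apply: le_integral_EFin; [exact: Lw_measurable|exact: Lw_measurable| |].
  by move=> y; exact: k1f2_ge0.
have pt y : k1 (enorm y) * f y ^+ 2 <= k1 (enorm y) * g y ^+ 2.
  apply: ler_wpM2l; first by rewrite k1_ge0 ?enorm_ge0.
  by rewrite ler_sqr ?nnegrE// (le_trans (f0 y)).
by move=> y; exact: pt.
Qed.

Lemma trunc_Hcl f D (M Dg : R) : 0 <= M -> Hcl f D ->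
  wbound (fun x => Num.min (f x) M) Dg -> Hcl (fun x => Num.min (f x) M) Dg.
Proof.
move=> M0 Hf gD; have mf := L2_meas (Hcl_L2 Hf); have mg := L2_meas (wbound_L2 gD).
have [f0 _ Lf] := Hf.
split => //; first by move=> x; rewrite le_min f0 M0.
by apply: le_lt_trans Lf; apply: Lw_le => // x; rewrite ?le_min ?f0 ?M0// ge_min lexx.
Qed.

(** The kernels are nonnegative, so truncation lowers both energies. For [v2] this is a loss, which
    the Lipschitz bound measures by the mass removed. *)
Lemma trunc_potentials f D (M Dg B : R) : 0 <= M -> Hcl f D ->
  wbound (fun x => Num.min (f x) M) Dg -> 0 <= B ->
  (forall x, W (@k2 R) f x <= B%:E)%E ->
  v1 (fun x => Num.min (f x) M) <= v1 f /\
  v2 f <= v2 (fun x => Num.min (f x) M) + 2 * B * (ip mu f f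
    - ip mu (fun x => Num.min (f x) M) (fun x => Num.min (f x) M)).
Proof.
move=> M0 Hf gD B0 Bf; have Hg := trunc_Hcl M0 Hf gD.
set g := (fun x => Num.min (f x) M) in gD Hg *.
have lf := Hcl_L2 Hf; have lg := Hcl_L2 Hg; have mf := L2_meas lf; have mg := L2_meas lg.
have f0 x : 0 <= f x by case: Hf.
have g0 x : 0 <= g x by case: Hg.
have gf x : g x <= f x by rewrite ge_min lexx.
split.
  apply: (Hcl_v1_le Hg Hf); exact: V_le (@kernel_k1 R) mg mf g0 gf.
apply: (Hcl_v2_leD Hf Hg).
apply: (V_lip (@kernel_k2 R) mf mg B0 Bf).
  by move=> x; apply: le_trans (Bf x); exact: W_le (@kernel_k2 R) mg mf g0 gf.
have fn : (\int[mu]_x (g x ^+ 2)%:E \is a fin_num)%E by rewrite -ip_sqr.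
rewrite EFinB ip_sqr// ip_sqr// leeBrDr// -integralD_ge0.
- rewrite le_eqVlt; apply/orP; left; apply/eqP; apply: eq_integral => x _; congr EFin.
  by rewrite ger0_norm ?subrK// subr_ge0 ler_sqr ?nnegrE.
- by apply: measurableT_comp => //; apply: measurable_funB; exact: measurable_funX.
- exact: measurable_funX.
- by move=> x; exact: normr_ge0.
- by move=> x; exact: sqr_ge0.
Qed.

(** Here [d] is the mass removed and q = l / (l - d) the factor that restores it; d <= l / 2 keeps
    [q] in [1, 2] and q - 1 below 2 d / l, so that every loss is linear in [d]. *)
Let trunc_arith (c D Dg Dw v1f v1g v2f v2g B d q l : R) : 0 < c -> 0 < l -> 0 <= d ->
  d <= l / 2 -> q * (l - d) = l -> 0 <= D -> 0 <= Dw -> Dg + Dw <= D ->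
  0 <= v1f -> v1g <= v1f -> 0 <= v2g -> v2f <= v2g + 2 * B * d ->
  D + c * (v1f - v2f) <= q * Dg + c * (q ^+ 2 * v1g - q ^+ 2 * v2g) ->
  Dw <= (2 / l * (D + 3 * c * v1f) + 2 * c * B) * d.
Proof.
move=> c0 l0 d0 dl ql D0 Dw0 hD v0 hv v20 hv2 hE.
have ld : l / 2 <= l - d by lra.
have ld0 : 0 < l - d by apply: lt_le_trans ld; rewrite divr_gt0.
have q1 : 1 <= q by rewrite -(ler_pM2r ld0) ql mul1r; lra.
have q2 : q <= 2 by rewrite -(ler_pM2r ld0) ql; lra.
have qd : q - 1 <= 2 / l * d.
  rewrite mulrAC ler_pdivlMr//; have -> : (q - 1) * l = q * d by rewrite mulrBl -[in 1 * l]ql; ring.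
  by apply: ler_wpM2r.
have qq : 1 <= q ^+ 2 by rewrite expr_ge1// (le_trans ler01).
have e1 : v2g <= q ^+ 2 * v2g by rewrite ler_peMl.
have e2 : q ^+ 2 * v1g <= q ^+ 2 * v1f by rewrite ler_wpM2l ?sqr_ge0.
have e3 : q * Dg <= q * (D - Dw) by apply: ler_wpM2l; lra.
have e4 : (q ^+ 2 - 1) * v1f <= 3 * (2 / l * d) * v1f.
  apply: ler_wpM2r => //; have -> : q ^+ 2 - 1 = (q + 1) * (q - 1) by ring.
  by apply: ler_pM; lra.
have e5 : (q - 1) * D <= 2 / l * d * D by exact: ler_wpM2r.
have e6 : Dw <= q * Dw by rewrite ler_peMl.
have c1 := ler_wpM2l (ltW c0) e1; have c2 := ler_wpM2l (ltW c0) e2.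
have c4 := ler_wpM2l (ltW c0) e4; have c3 := ler_wpM2l (ltW c0) hv2.
move: hE e3 e5 e6 c1 c2 c3 c4; move: (q ^+ 2) (2 / l) => s r; clear.
rewrite !mulrBr !mulrDr !mulrBl !mulrDl !mulrA; lra.
Qed.

(** Minimality is tested against the truncation rescaled to mass [l]. The outcome, that the part cut
    off has Dirichlet integral of the order of the mass removed, plays the role of the Caccioppoli
    inequality in the iteration. *)
Lemma trunc_energy (c l : R) f D : 0 < c -> 0 < l -> minimizer c l f D ->
  exists2 C, 0 <= C & forall M, 0 <= M ->
    l / 2 <= ip mu (fun x => Num.min (f x) M) (fun x => Num.min (f x) M) ->
    exists2 Dw, wbound (fun x => f x - Num.min (f x) M) Dw &
      Dw <= C * (l - ip mu (fun x => Num.min (f x) M) (fun x => Num.min (f x) M)).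
Proof.
move=> c0 l0 [Hf fl fmin]; have D0 := Hcl_ge0 Hf.
pose B := Wmax l 1 D.
have B0 : 0 <= B by apply: Wmax_ge0 => //; exact: ltW.
have Bf x : (W (@k2 R) f x <= B%:E)%E by rewrite /B -fl; exact: Hcl_W2.
exists (2 / l * (D + 3 * c * v1 f) + 2 * c * B).
  rewrite addr_ge0// mulr_ge0//; first by rewrite divr_ge0// ltW.
    by rewrite addr_ge0// mulr_ge0 ?(v1_ge0 Hf)// mulr_ge0// ltW.
  by rewrite mulr_ge0// ltW.
move=> M M0 half; have [f0 wf _] := Hf.
have [Dg [Dw [gD wD hD]]] := trunc_split M0 f0 wf.
exists Dw => //; have Hg := trunc_Hcl M0 Hf gD.
have [hv1 hv2] := trunc_potentials M0 Hf gD B0 Bf.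
set g := (fun x => Num.min (f x) M) in half gD Hg hv1 hv2 *.
have lg := Hcl_L2 Hg; have mg := L2_meas lg.
have gl : ip mu g g <= l.
  rewrite -fl -lee_fin ip_sqr// ip_sqr; last exact: Hcl_L2 Hf.
  apply: le_integral_EFin; [exact: measurable_funX|apply: measurable_funX; exact: L2_meas (Hcl_L2 Hf)| |].
    by move=> x; exact: sqr_ge0.
  have pt x : g x ^+ 2 <= f x ^+ 2.
    by rewrite ler_sqr ?nnegrE ?f0// /g ?le_min ?f0// ge_min lexx.
  by move=> x; exact: pt.
have gp : 0 < ip mu g g by apply: lt_le_trans half; rewrite divr_gt0.
pose q := l / ip mu g g; have q0 : 0 <= q by rewrite divr_ge0 ?ltW.
have sq : Num.sqrt q ^+ 2 = q by rewrite sqr_sqrtr.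
have Hs := Hcl_scale (sqrtr_ge0 q) Hg.
have sl : ip mu (fun x => Num.sqrt q * g x) (fun x => Num.sqrt q * g x) = l.
  by rewrite (ip_scale _ lg) sq /q divfK// gt_eqF.
have := fmin _ _ Hs sl; rewrite /En sq.
have s4 : Num.sqrt q ^+ 4 = q ^+ 2 by rewrite -[in RHS]sq -exprM.
have -> : v1 (fun x => Num.sqrt q * g x) = q ^+ 2 * v1 g.
  by rewrite /v1 (V_scale _ (@kernel_k1 R) mg) s4 -(Hcl_V1 Hg).
have -> : v2 (fun x => Num.sqrt q * g x) = q ^+ 2 * v2 g.
  by rewrite /v2 (V_scale _ (@kernel_k2 R) mg) s4 -(Hcl_V2 Hg).
rewrite fl in hv2.
apply: (trunc_arith c0 l0 _ _ _ D0 (wbound_ge0 wD) hD (v1_ge0 Hf) hv1 (v2_ge0 Hg) hv2).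
- by rewrite subr_ge0.
- by move: half; clear; lra.
- by rewrite subKr /q divfK// gt_eqF.
Qed.

End Boundedness.

(** * De Giorgi iteration *)

Section DeGiorgi.
Context (R : realType).
Local Notation mu := (leb2 R).
Implicit Types (f g w : R * R -> R) (h x y : R * R).

(** From z <= 2 a C (2 M t + z), the condition 4 a C <= 1 absorbs the last term and leaves z <= 8 a
    C M t; squaring and inserting t^2 <= z a gives the cubic bound. *)
Let level_arith (z t a C M Dw d : R) : 0 <= z -> 0 <= t -> 0 < a -> 0 <= C -> 0 <= M ->
  z <= 2 * a * Dw -> Dw <= C * d -> d = 2 * M * t + z -> 4 * a * C <= 1 -> t ^+ 2 <= z * a ->
  z <= 64 * C ^+ 2 * M ^+ 2 * a ^+ 3.
Proof.
move=> z0 t0 a0 C0 M0 h1 h2 hd h3 h4.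
have [->|zn0] := eqVneq z 0.
  by rewrite mulr_ge0 ?exprn_ge0 ?(ltW a0)// mulr_ge0 ?sqr_ge0// mulr_ge0 ?sqr_ge0.
have zp : 0 < z by rewrite lt0r zn0.
have e1 : z <= 8 * a * C * M * t.
  have q1 : 2 * a * Dw <= 2 * a * (C * d) by rewrite ler_wpM2l// mulr_ge0// ltW.
  have q2 : 4 * a * C * z <= 1 * z by exact: ler_wpM2r.
  have := le_trans h1 q1; rewrite hd; move: q2; clear.
  by rewrite !mulrDr !mulrA; lra.
have e2 : z ^+ 2 <= (8 * a * C * M * t) ^+ 2.
  by rewrite ler_sqr ?nnegrE// (le_trans z0).
have e3 : (8 * a * C * M * t) ^+ 2 <= 64 * a ^+ 2 * C ^+ 2 * M ^+ 2 * (z * a).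
  rewrite (_ : (8 * a * C * M * t) ^+ 2 = 64 * a ^+ 2 * C ^+ 2 * M ^+ 2 * t ^+ 2); last by ring.
  apply: ler_wpM2l => //.
  by rewrite mulr_ge0 ?sqr_ge0// mulr_ge0 ?sqr_ge0// mulr_ge0 ?sqr_ge0.
have := le_trans e2 e3.
rewrite (_ : 64 * a ^+ 2 * C ^+ 2 * M ^+ 2 * (z * a) = 64 * C ^+ 2 * M ^+ 2 * a ^+ 3 * z); last by ring.
by rewrite expr2 ler_pM2r.
Qed.

Lemma superlevel_measurable f (M : R) : measurable_fun setT f -> measurable [set x | M < f x].
Proof.
move=> mf; rewrite (_ : [set x | _] = f @^-1` `]M, +oo[).
  by rewrite -[X in measurable X]setTI; apply: mf => //; exact: measurable_itv.
by apply/seteqP; split => x /=; rewrite in_itv /= andbT.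
Qed.

(** Where the truncation acts it equals [M], so f^2 - g^2 = 2 M w + w^2. The number [t] is the
    integral of [w], estimated by Cauchy-Schwarz on the superlevel set. *)
Lemma trunc_excess f (M a : R) : 0 <= M -> (forall x, 0 <= f x) -> L2 mu f ->
  (mu [set x | (M < f x)%R] <= a%:E)%E ->
  let g x := Num.min (f x) M in let w x := f x - g x in
  exists2 t, 0 <= t & ip mu f f - ip mu g g = 2 * M * t + ip mu w w /\
    t ^+ 2 <= ip mu w w * a.
Proof.
move=> M0 f0 lf ha g w; have mf := L2_meas lf.
have mZ := superlevel_measurable M mf.
set Z := [set x | M < f x] in mZ ha.
have lZ : L2 mu (\1_Z : R * R -> R) by apply: L2_indic => //; exact: le_lt_trans ha (ltry a).
have mg : measurable_fun setT g by apply: measurable_minr => //; exact: measurable_cst.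
have g0 x : 0 <= g x by rewrite le_min f0.
have gf x : g x <= f x by rewrite ge_min lexx.
have lg : L2 mu g by apply: (L2_le mg _ lf) => x; rewrite !ger0_norm ?f0.
have lw : L2 mu w := L2B lf lg.
have w0 x : 0 <= w x by rewrite subr_ge0.
exists (ip mu (\1_Z : R * R -> R) w).
  rewrite -lee_fin ipE//; apply: integral_EFin_ge0 => x; rewrite mulr_ge0//.
split; last first.
  apply: (le_trans (ip_CS lZ lw)); rewrite mulrC; apply: ler_wpM2l; first exact: ip_ge0.
  rewrite -lee_fin ip_sqr//; apply: le_trans ha.
  rewrite le_eqVlt; apply/orP; left; apply/eqP.
  transitivity (\int[mu]_x (\1_Z x)%:E)%E; last by rewrite integral_indic// setIT.
  apply: eq_integral => x _; rewrite indicE.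
  by case: (x \in Z); rewrite ?expr1n ?expr0n.
have -> : ip mu f f = ip mu (fun x => g x + w x) (fun x => g x + w x).
  by rewrite /ip; congr fine; apply: eq_integral => x _; rewrite /w addrC subrK.
rewrite (ipD_sqr lg lw).
have -> : ip mu g w = ip mu (fun x => M * \1_Z x) w.
  rewrite /ip; congr fine; apply: eq_integral => x _; congr EFin.
  rewrite /w /g indicE; have [/set_mem /= h|/negP nz] := boolP (x \in Z).
    by rewrite mulr1 (min_r (ltW h)).
  have h : f x <= M by rewrite leNgt; apply/negP => h; apply: nz; exact/mem_set.
  by rewrite (min_l h) subrr !mulr0.
rewrite (ipZl M lZ lw).
by move: (ip mu g g) (ip mu _ w) (ip mu w w) => p q r; ring.
Qed.

Lemma chebyshev_excess f (M M' z : R) : L2 mu f -> (forall x, 0 <= f x) -> 0 <= M -> M < M' ->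
  ip mu (fun x => f x - Num.min (f x) M) (fun x => f x - Num.min (f x) M) <= z ->
  (mu [set x | (M' < f x)%R] <= (z / (M' - M) ^+ 2)%:E)%E.
Proof.
move=> lf f0 M0 MM hz; have mf := L2_meas lf.
have mZ := superlevel_measurable M' mf.
set g := (fun x => Num.min (f x) M).
have mg : measurable_fun setT g by apply: measurable_minr => //; exact: measurable_cst.
have lg : L2 mu g.
  by apply: (L2_le mg _ lf) => x; rewrite !ger0_norm ?f0 ?le_min ?f0// ge_min lexx.
have lw := L2B lf lg.
have d0 : 0 < (M' - M) ^+ 2 by rewrite exprn_gt0// subr_gt0.
have i0 : 0 <= (M' - M) ^- 2 by rewrite invr_ge0 ltW.
have mw2 : measurable_fun setT (fun x => (f x - g x) ^+ 2) by apply: measurable_funX; exact: L2_meas lw.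
apply: (@le_trans _ _ ((M' - M) ^- 2 * ip mu (fun x => f x - g x) (fun x => f x - g x))%:E); last first.
  by rewrite lee_fin mulrC; apply: ler_wpM2r.
rewrite EFinM ip_sqr// -integralZ_ge0//; last by move=> x; exact: sqr_ge0.
rewrite -[X in (mu X <= _)%E]setIT -integral_indic//.
apply: le_integral_EFin => //.
- by apply: measurable_funM => //; exact: measurable_cst.
- have pt x : (\1_[set x | M' < f x] x : R) <= (M' - M) ^- 2 * (f x - g x) ^+ 2.
    rewrite indicE; have [/set_mem /= h|_] := boolP (x \in _); last by rewrite mulr_ge0 ?sqr_ge0.
    rewrite mulrC ler_pdivlMr// mul1r ler_sqr ?nnegrE.
    + by rewrite /g min_r ?(ltW (lt_trans MM h))// lerD2r ltW.
    + by rewrite subr_ge0 ltW.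
    + by rewrite subr_ge0 /g ge_min lexx.
  by move=> x; exact: pt.
Qed.

(** If all truncations had mass at most l / 2, Fatou would give the same for [f]; their masses
    increase with the level. *)
Lemma trunc_mass f (l : R) : 0 < l -> L2 mu f -> (forall x, 0 <= f x) -> ip mu f f = l ->
  exists2 M1, 0 < M1 & forall M, M1 <= M ->
    l / 2 <= ip mu (fun x => Num.min (f x) M) (fun x => Num.min (f x) M).
Proof.
move=> l0 lf f0 fl; have mf := L2_meas lf.
have mg (M : R) : measurable_fun setT (fun x => Num.min (f x) M).
  by apply: measurable_minr => //; exact: measurable_cst.
have lg M : 0 <= M -> L2 mu (fun x => Num.min (f x) M).
  move=> M0; apply: (L2_le (mg M) _ lf) => x.
  by rewrite !ger0_norm ?f0 ?le_min ?f0// ge_min lexx.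
have mono (M M' : R) : 0 <= M -> M <= M' ->
    ip mu (fun x => Num.min (f x) M) (fun x => Num.min (f x) M) <=
    ip mu (fun x => Num.min (f x) M') (fun x => Num.min (f x) M').
  move=> M0 MM; have M'0 := le_trans M0 MM.
  rewrite -lee_fin (ip_sqr (lg _ M0)) (ip_sqr (lg _ M'0)); apply: le_integral_EFin; [exact: measurable_funX|exact: measurable_funX| |].
    by move=> x; exact: sqr_ge0.
  have pt x : Num.min (f x) M ^+ 2 <= Num.min (f x) M' ^+ 2.
    by rewrite ler_sqr ?nnegrE ?le_min ?f0// ge_min lexx /= ge_min MM orbT.
  by move=> x; exact: pt.
apply: contrapT => nh.
have small n : ip mu (fun x => Num.min (f x) n.+1%:R) (fun x => Num.min (f x) n.+1%:R) <= l / 2.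
  rewrite leNgt; apply/negP => h; apply: nh; exists n.+1%:R => [|M hM]; first by rewrite ltr0n.
  by apply: (le_trans (ltW h)); exact: mono.
have : (\int[mu]_x (f x ^+ 2)%:E <= (l / 2)%:E)%E.
  apply: (@fatou_le R _ _ mu (fun n x => Num.min (f x) n.+1%:R ^+ 2) _ _ 0).
  - by move=> n; exact: measurable_funX.
  - by move=> n x; exact: sqr_ge0.
  - move=> x; apply: cvg_near_cst; exists (Num.trunc (f x)).+1 => // n /= hn.
    have h : f x <= n.+1%:R.
      by apply: (le_trans (ltW (truncnS_gt (f x)))); rewrite ler_nat (leq_trans hn).
    by rewrite (min_l h).
  - by move=> n; rewrite mul0r addr0 -(ip_sqr (lg _ (ler0n _ _))) lee_fin.
by rewrite -ip_sqr// fl lee_fin; move: l0; clear; lra.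
Qed.

(** The exponent 3 of [a] exceeds 1, which drives the iteration: the power of [a] from [faber_krahn]
    is squared in [level_arith], and Cauchy-Schwarz adds one more. *)
Lemma level_step (c l : R) f D : 0 < c -> 0 < l -> minimizer c l f D ->
  exists C M1, [/\ 0 <= C, 0 < M1 & forall M M' a, M1 <= M -> M < M' -> 0 < a ->
    4 * a * C <= 1 -> (mu [set x | (M < f x)%R] <= a%:E)%E ->
    (mu [set x | (M' < f x)%R] <= (64 * C ^+ 2 * M ^+ 2 * a ^+ 3 / (M' - M) ^+ 2)%:E)%E].
Proof.
move=> c0 l0 fm; have [C C0 hC] := trunc_energy c0 l0 fm.
have [Hf fl _] := fm; have lf := Hcl_L2 Hf; have [f0 _ _] := Hf.
have [M1 M10 hM1] := trunc_mass l0 lf f0 fl.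
exists C, M1; split => // M M' a MM MM' a0 aC ha.
have M0 : 0 <= M by exact: le_trans (ltW M10) MM.
have [Dw wD hDw] := hC M M0 (hM1 M MM).
have [t t0 [et tt]] := trunc_excess M0 f0 lf ha.
apply: (chebyshev_excess lf f0 M0 MM').
rewrite -fl et in hDw.
apply: (level_arith (ip_ge0 _ _) t0 a0 C0 M0 _ hDw erefl aC tt).
apply: (faber_krahn wD a0); apply: le_trans ha.
apply: le_measure; rewrite ?inE.
- rewrite (_ : [set x | _] = [set x | M < f x]); first exact: superlevel_measurable (L2_meas lf).
  apply/seteqP; split => x /=.
    by have [h|h] := leP (f x) M; rewrite ?subrr ?eqxx.
  by move=> h; rewrite (min_r (ltW h)) subr_eq0 gt_eqF.
- exact: superlevel_measurable (L2_meas lf).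
- by move=> x /=; have [h|h] := leP (f x) M; rewrite ?subrr ?eqxx.
Qed.

Lemma minimizer_ae_bounded (c l : R) f D : 0 < c -> 0 < l -> minimizer c l f D ->
  exists2 B, 0 <= B & mu [set x | (B < f x)%R] = 0%E.
Proof.
move=> c0 l0 fm; have [C [M1 [C0 M10 step]]] := level_step c0 l0 fm.
have [Hf fl _] := fm; have lf := Hcl_L2 Hf; have [f0 _ _] := Hf.
(* Small enough that 256 (al C)^2 <= 1 / 8, the factor needed to pass from one level to the next; it
   also secures the condition 4 a C <= 1 of [level_step]. *)
pose al : R := (64 * (C + 1))^-1.
have C1 : 0 < C + 1 by rewrite ltr_wpDl.
have al0 : 0 < al by rewrite invr_gt0 mulr_gt0.
have alC : al * C <= 64^-1.
  rewrite /al invfM -mulrA; apply: ler_piMr; first by rewrite invr_ge0.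
  by rewrite mulrC ler_pdivrMr// mul1r lerDl.
(* From this level on Chebyshev's inequality bounds the superlevel set by [al], which starts the
   induction. *)
pose M0 := Num.max M1 (Num.sqrt (l / al) + 1).
have M0p : 0 < M0 by rewrite lt_max M10.
have M02 : l / M0 ^+ 2 <= al.
  rewrite ler_pdivrMr ?exprn_gt0// -ler_pdivrMl// mulrC.
  rewrite -[X in X <= _](@sqr_sqrtr _ (l / al)); last by rewrite divr_ge0 ?ltW.
  rewrite ler_sqr ?nnegrE ?sqrtr_ge0 ?(ltW M0p)//.
  by rewrite le_max; apply/orP; right; rewrite lerDl.
(* The levels increase to 2 M0; both the gaps and the bounds on the superlevel sets halve at each
   step. *)
pose Mk (k : nat) := M0 * (2 - 2^-1 ^+ k).
have r01 (k : nat) : 0 < (2^-1 : R) ^+ k by rewrite exprn_gt0// invr_gt0.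
have MkM0 k : M0 <= Mk k.
  by rewrite /Mk ler_peMr ?(ltW M0p)//; have := @half_expr_le1 R k; move: (2^-1 ^+ k : R) => r; clear; lra.
have Mk2 k : Mk k <= M0 * 2 by rewrite /Mk ler_pM2l// lerBlDr lerDl ltW.
have lev k : (mu [set x | (Mk k < f x)%R] <= (al * 2^-1 ^+ k)%:E)%E.
  elim: k => [|k IH].
    rewrite expr0 mulr1 /Mk expr0 (_ : M0 * (2 - 1) = M0); last by ring.
    have hz : ip mu (fun x => f x - Num.min (f x) 0) (fun x => f x - Num.min (f x) 0) <= l.
      rewrite -fl le_eqVlt; apply/orP; left; apply/eqP; rewrite /ip; congr fine.
      by apply: eq_integral => x _; rewrite min_r// subr0.
    apply: (le_trans (chebyshev_excess lf f0 (lexx 0) M0p hz)).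
    by rewrite lee_fin subr0.
  have ak0 : 0 < al * 2^-1 ^+ k by rewrite mulr_gt0.
  have MM : Mk k < Mk k.+1.
    rewrite /Mk ltr_pM2l// ltrD2l ltrN2 exprS; have := r01 k.
    by move: (2^-1 ^+ k : R) => r; clear; lra.
  have aC : 4 * (al * 2^-1 ^+ k) * C <= 1.
    have -> : 4 * (al * 2^-1 ^+ k) * C = 4 * (al * C) * 2^-1 ^+ k by ring.
    apply: mulr_ile1; rewrite ?(ltW (r01 k))// ?half_expr_le1//.
      by rewrite mulr_ge0// mulr_ge0// ltW.
    by move: alC; clear; lra.
  have M1k : M1 <= Mk k by apply: le_trans (MkM0 k); rewrite le_max lexx.
  apply: (le_trans (step _ _ _ M1k MM ak0 aC IH)); rewrite lee_fin.
  have d0 : 0 < (Mk k.+1 - Mk k) ^+ 2 by rewrite exprn_gt0// subr_gt0.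
  rewrite ler_pdivrMr//.
  have -> : Mk k.+1 - Mk k = M0 * (2^-1 * 2^-1 ^+ k) by rewrite /Mk exprS; field.
  have b : Mk k ^+ 2 <= (M0 * 2) ^+ 2.
    rewrite ler_sqr; first exact: Mk2.
      by rewrite nnegrE (le_trans (ltW M0p) (MkM0 k)).
    by rewrite nnegrE mulr_ge0 ?(ltW M0p).
  apply: (@le_trans _ _ (64 * C ^+ 2 * (M0 * 2) ^+ 2 * (al * 2^-1 ^+ k) ^+ 3)).
    apply: ler_wpM2r; first by rewrite exprn_ge0// ltW.
    by apply: ler_wpM2l => //; rewrite mulr_ge0 ?sqr_ge0.
  have -> : 2^-1 ^+ k.+1 = 2^-1 * 2^-1 ^+ k :> R by rewrite exprS.
  have rk := r01 k; move: (2^-1 ^+ k : R) rk => r rk.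
  have -> : 64 * C ^+ 2 * (M0 * 2) ^+ 2 * (al * r) ^+ 3 = (al * C) ^+ 2 * (256 * (M0 ^+ 2 * al * r ^+ 3)) by ring.
  have -> : al * (2^-1 * r) * (M0 * (2^-1 * r)) ^+ 2 = 8^-1 * (M0 ^+ 2 * al * r ^+ 3) by field.
  rewrite (mulrA ((al * C) ^+ 2)); apply: ler_wpM2r.
    by rewrite mulr_ge0 ?exprn_ge0 ?(ltW rk)// mulr_ge0 ?sqr_ge0// ltW.
  have : (al * C) ^+ 2 <= 64^-1 ^+ 2.
    by rewrite ler_sqr ?nnegrE ?invr_ge0// mulr_ge0// ltW.
  by move: ((al * C) ^+ 2) => z; clear; lra.
exists (M0 * 2); first by rewrite mulr_ge0 ?(ltW M0p).
have mB := superlevel_measurable (M0 * 2) (L2_meas lf).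
have le k : (mu [set x | (M0 * 2 < f x)%R] <= (al * 2^-1 ^+ k)%:E)%E.
  apply: le_trans (lev k); apply: le_measure; rewrite ?inE //.
    exact: superlevel_measurable (L2_meas lf).
  by move=> x /=; apply: le_lt_trans; exact: Mk2.
have fin : (mu [set x | (M0 * 2 < f x)%R] \is a fin_num)%E.
  by rewrite ge0_fin_numE//; apply: le_lt_trans (le 0%N) (ltry _).
apply/eqP; rewrite eq_le measure_ge0 andbT -(fineK fin) lee_fin.
apply: (@le_half_expr _ _ _ al) => k; rewrite add0r.
by rewrite -lee_fin fineK.
Qed.

(** Truncation at the almost everywhere bound keeps the mass and makes neither the Dirichlet bound
    nor the potentials worse, so the result is still a minimizer, now bounded at every point. *)
Lemma bounded_minimizer (c l : R) : 0 < c -> 0 < l ->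
  exists f D B, minimizer c l f D /\ forall x, f x <= B.
Proof.
move=> c0 l0; have [f [D fm]] := minimizer_exists c0 l0.
have [B B0 fB] := minimizer_ae_bounded c0 l0 fm.
have [Hf fl fmin] := fm; have lf := Hcl_L2 Hf; have [f0 wf _] := Hf.
have le0 : (mu [set x | (B < f x)%R] <= 0%:E)%E by rewrite fB.
have [Dg [Dw [gD wD hD]]] := trunc_split B0 f0 wf.
have Hg := trunc_Hcl B0 Hf gD.
pose W2 := Wmax l 1 D.
have W20 : 0 <= W2 by apply: Wmax_ge0; rewrite ?(Hcl_ge0 Hf)// ltW.
have W2f x : (W (@k2 R) f x <= W2%:E)%E by rewrite /W2 -fl; exact: Hcl_W2.
have [hv1 hv2] := trunc_potentials B0 Hf gD W20 W2f.
have [t t0 [et tt]] := trunc_excess B0 f0 lf le0.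
have lw := wbound_L2 wD.
set g := (fun x => Num.min (f x) B) in et tt hv1 hv2 Hg gD.
have t00 : t = 0.
  by apply/eqP; rewrite -sqrf_eq0 eq_le sqr_ge0 andbT; apply: (le_trans tt); rewrite mulr0.
have w00 : ip mu (fun x => f x - g x) (fun x => f x - g x) = 0.
  apply/eqP; rewrite eq_le ip_ge0 andbT.
  (* The support of [f - g] is null, so [faber_krahn] applies with every positive area. *)
  apply: (@le_half_expr _ _ _ (2 * Dw)) => k; rewrite add0r mulrAC -mulrA mulrA.
  have r0 : 0 < (2^-1 : R) ^+ k by rewrite exprn_gt0// invr_gt0.
  apply: (le_trans (faber_krahn wD r0 _)); last by rewrite mulrAC.
  rewrite (_ : [set x | _] = [set x | B < f x]) ?fB ?lee_fin ?(ltW r0)//.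
  apply/seteqP; split => x /=.
    by have [h|h] := leP (f x) B; rewrite ?subrr ?eqxx.
  by move=> h; rewrite (min_r (ltW h)) subr_eq0 gt_eqF.
have gl : ip mu g g = l.
  move: et; rewrite t00 w00 mulr0 addr0 => /eqP; rewrite subr_eq0 => /eqP <-.
  exact: fl.
rewrite gl fl subrr mulr0 addr0 in hv2.
have Dw0 := wbound_ge0 wD.
exists g, Dg, B; split; last by move=> x; rewrite ge_min lexx orbT.
split; [exact: Hg|exact: gl|move=> g' D' Hg' gl'; apply: le_trans (fmin g' D' Hg' gl')].
rewrite /En; have := ler_wpM2l (ltW c0) hv1; have := ler_wpM2l (ltW c0) hv2.
move: hD Dw0; move: (v1 f) (v1 g) (v2 f) (v2 g) => p q r s; clear.
by rewrite !mulrBr; lra.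
Qed.

End DeGiorgi.

(** * Polarization *)

Section Polarization.
Context (R : realType).
Local Notation mu := (leb2 R).
Implicit Types (f g w : R * R -> R) (h x y : R * R) (k : R -> R).

(** The last clause carries the geometry: with [s] the signed distance to the mirror, a point is
    closer to a point of its own side than to the mirror image of that point. The four-point
    comparison uses nothing more about the mirror line. *)
Definition reflection (sg : R * R -> R * R) (s : R * R -> R) :=
  [/\ preserves sg, (forall x, sg (sg x) = x), measurable_fun setT s,
      (forall x, s (sg x) = - s x) &
      forall x y, enorm (x - sg y) ^+ 2 = enorm (x - y) ^+ 2 + 4 * (s x * s y)].

Section Fixed.
Variables (sg : R * R -> R * R) (s : R * R -> R).
Hypothesis rs : reflection sg s.

Lemma refl_enormC x y : enorm (sg x - y) = enorm (x - sg y).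
Proof.
have [_ _ _ _ h] := rs.
apply/eqP; rewrite -(@eqrXn2 _ 2) ?enorm_ge0// enormB !h.
by rewrite (enormB y x) (mulrC (s y)).
Qed.

Lemma refl_enorm x y : enorm (sg x - sg y) = enorm (x - y).
Proof. by rewrite refl_enormC; have [_ -> _ _ _] := rs. Qed.

(** The strict inequality leaves the points of the mirror and the pairs with equal values untouched;
    elsewhere [pol] puts the larger value on the side s > 0. *)
Definition swap f x := s x * (f x - f (sg x)) < 0.

Definition pol f x := if swap f x then f (sg x) else f x.

Lemma swap_refl f x : swap f (sg x) = swap f x.
Proof.
have [_ inv _ sN _] := rs; rewrite /swap inv sN.
by congr (_ < 0); ring.
Qed.

Lemma pol_refl f x : pol f (sg x) = if swap f x then f x else f (sg x).
Proof. by rewrite /pol swap_refl; have [_ -> _ _ _] := rs. Qed.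

Lemma sg_measurable f : measurable_fun setT f -> measurable_fun setT (fun x => f (sg x)).
Proof. by move=> mf; have [[ms _] _ _ _ _] := rs; exact: measurableT_comp. Qed.

Lemma pol_measurable f : measurable_fun setT f -> measurable_fun setT (pol f).
Proof.
move=> mf; have [_ _ ms _ _] := rs; have mfs := sg_measurable mf.
have mq : measurable_fun setT (fun x => s x * (f x - f (sg x))).
  by apply: measurable_funM => //; exact: measurable_funB.
apply: measurable_fun_ifT => //.
exact: measurable_fun_ltr mq (measurable_cst _).
Qed.

Lemma pol_ge0 f x : (forall x, 0 <= f x) -> 0 <= pol f x.
Proof. by move=> f0; rewrite /pol; case: ifP. Qed.

Lemma pol_L2 f : L2 mu f -> L2 mu (pol f).
Proof.
move=> lf; have mf := L2_meas lf; have [ps _ _ _ _] := rs.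
have ls := preserves_L2 ps lf.
have ln (u : R * R -> R) : L2 mu u -> L2 mu (fun x => `|u x|).
  move=> lu; apply: (L2_le _ _ lu); first by apply: measurableT_comp => //; exact: L2_meas lu.
  by move=> x; rewrite normr_id.
apply: (L2_le (pol_measurable mf) _ (L2D (ln _ lf) (ln _ ls))) => x.
rewrite [X in _ <= X]ger0_norm ?addr_ge0// /pol.
by case: ifP => _; rewrite ?lerDl ?lerDr.
Qed.

(** Doubling symmetrizes the integrand over the pair formed by [x] and [sg x], whose two values are
    merely permuted. *)
Lemma pol_ip f : L2 mu f -> ip mu (pol f) (pol f) = ip mu f f.
Proof.
move=> lf; have [ps _ _ _ _] := rs; have lp := pol_L2 lf.
have half (u : R * R -> R) : L2 mu u ->
    (2 * ip mu u u)%:E = (\int[mu]_x (u x ^+ 2 + u (sg x) ^+ 2)%:E)%E.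
  move=> lu; have mu' := L2_meas lu.
  rewrite integralD_ge0; last 4 first.
  - exact: measurable_funX.
  - by apply: measurable_funX; exact: sg_measurable.
  - by move=> x; exact: sqr_ge0.
  - by move=> x; exact: sqr_ge0.
  rewrite -(ip_sqr lu) -(ip_sqr (preserves_L2 ps lu)) (preserves_ip ps mu' mu').
  by rewrite -EFinD; congr EFin; ring.
have : (2 * ip mu (pol f) (pol f))%:E = (2 * ip mu f f)%:E.
  rewrite !half//; apply: eq_integral => x _; congr EFin.
  by rewrite pol_refl /pol; case: ifP => _ //; exact: addrC.
by move=> [] /mulfI; apply; rewrite pnatr_eq0.
Qed.

(** The moment of the reflected function is the [k1] potential of [f] at the image of the origin,
    which is finite. *)
Lemma pol_Lw f : (forall x, 0 <= f x) -> L2 mu f -> (Lw f < +oo)%E -> (Lw (pol f) < +oo)%E.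
Proof.
move=> f0 lf Lf; have mf := L2_meas lf; have mfs := sg_measurable mf.
have [ps inv _ _ _] := rs; have [msg isg] := ps.
have mLs : measurable_fun setT (fun x => k1 (enorm x) * f (sg x) ^+ 2) by exact: (Lw_measurable mfs).
apply: (@le_lt_trans _ _ (Lw f + Lw (fun x => f (sg x)))%E).
  rewrite /Lw -integralD_ge0//; [|exact: Lw_measurable|by move=> x; exact: k1f2_ge0
    |by move=> x; exact: (k1f2_ge0 (fun x => f (sg x)))].
  apply: le_integral_EFin.
  - exact: Lw_measurable (pol_measurable mf).
  - by apply: measurable_funD => //; exact: Lw_measurable.
  - by move=> x; exact: k1f2_ge0.
  - have pt x : k1 (enorm x) * pol f x ^+ 2 <= k1 (enorm x) * f x ^+ 2 + k1 (enorm x) * f (sg x) ^+ 2.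
      rewrite -mulrDr; apply: ler_wpM2l; first by rewrite k1_ge0 ?enorm_ge0.
      by rewrite /pol; case: ifP => _; rewrite ?lerDl ?lerDr ?sqr_ge0.
    by move=> x; exact: pt.
apply: lte_add_pinfty => //.
rewrite (_ : Lw _ = W (@k1 R) f (sg 0)); first exact: W1_lty.
have mW : measurable_fun setT (fun y => (k1 (enorm (sg 0 - y)) * f y ^+ 2)%:E).
  apply/measurable_EFinP; apply: measurable_funM; last exact: measurable_funX.
  exact: measurable_kerx (@measurable_k1 R).
rewrite /W -(isg _ mW).
  by apply: eq_integral => x _; rewrite refl_enorm sub0r enormN.
by move=> y; rewrite lee_fin mulr_ge0 ?sqr_ge0// k1_ge0 ?enorm_ge0.
Qed.

Section FourPoint.
Variables (k : R -> R) (Phi : R -> R -> R).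
Hypothesis kk : kernel k.
Hypothesis mPhi : measurable_fun setT (fun p : R * R => Phi p.1 p.2).
Hypothesis Phi0 : forall a b, 0 <= Phi a b.

(** A general [Phi] serves both terms of the energy: f(x)^2 f(y)^2 with a logarithmic kernel, and
    (f(x) - f(y))^2 with the indicator of a disc. *)
Definition pairing f := (\int[(mu \x mu)%E]_z (k (enorm (z.1 - z.2)) * Phi (f z.1) (f z.2))%:E)%E.

Definition aligned f (z : (R * R) * (R * R)) := Phi (f z.1) (f z.2) + Phi (f (sg z.1)) (f (sg z.2)).
Definition crossed f (z : (R * R) * (R * R)) := Phi (f z.1) (f (sg z.2)) + Phi (f (sg z.1)) (f z.2).
Definition four f (z : (R * R) * (R * R)) :=
  k (enorm (z.1 - z.2)) * aligned f z + k (enorm (z.1 - sg z.2)) * crossed f z.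

Lemma pairing_measurable f g : measurable_fun setT f -> measurable_fun setT g ->
  measurable_fun setT (fun z : (R * R) * (R * R) => Phi (f z.1) (g z.2)).
Proof.
move=> mf mg; apply: (measurableT_comp mPhi (g := fun z : (R * R) * (R * R) => (f z.1, g z.2))).
apply: measurable_fun_pair.
  by apply: (measurableT_comp mf); exact: measurable_fst.
by apply: (measurableT_comp mg); exact: measurable_snd.
Qed.

Lemma sg2_measurable : measurable_fun setT (fun z : (R * R) * (R * R) => (z.1, sg z.2)).
Proof.
have [[ms _] _ _ _ _] := rs; apply: measurable_fun_pair; first exact: measurable_fst.
by apply: (measurableT_comp ms); exact: measurable_snd.
Qed.

Lemma sg1_measurable : measurable_fun setT (fun z : (R * R) * (R * R) => (sg z.1, z.2)).
Proof.
have [[ms _] _ _ _ _] := rs; apply: measurable_fun_pair; last exact: measurable_snd.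
by apply: (measurableT_comp ms); exact: measurable_fst.
Qed.

Lemma integral_sg2 (G : (R * R) * (R * R) -> \bar R) : measurable_fun setT G ->
  (forall z, 0 <= G z)%E ->
  (\int[(mu \x mu)%E]_z G (z.1, sg z.2) = \int[(mu \x mu)%E]_z G z)%E.
Proof.
move=> mG G0; have [[_ isg] _ _ _ _] := rs.
rewrite (fubini_tonelli1 (fun z => G (z.1, sg z.2)))//; last exact: (measurableT_comp mG sg2_measurable).
rewrite (fubini_tonelli1 G mG G0); apply: eq_integral => x _; rewrite /fubini_F /=.
apply: (isg (fun y => G (x, y))) => //.
by apply: (measurableT_comp mG); apply: measurable_fun_pair; [exact: measurable_cst|exact: measurable_id].
Qed.

Lemma integral_sg1 (G : (R * R) * (R * R) -> \bar R) : measurable_fun setT G ->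
  (forall z, 0 <= G z)%E ->
  (\int[(mu \x mu)%E]_z G (sg z.1, z.2) = \int[(mu \x mu)%E]_z G z)%E.
Proof.
move=> mG G0; have [[_ isg] _ _ _ _] := rs.
rewrite (fubini_tonelli2 (fun z => G (sg z.1, z.2)))//; last exact: (measurableT_comp mG sg1_measurable).
rewrite (fubini_tonelli2 G mG G0); apply: eq_integral => y _; rewrite /fubini_G /=.
apply: (isg (fun x => G (x, y))) => //.
by apply: (measurableT_comp mG); apply: measurable_fun_pair; [exact: measurable_id|exact: measurable_cst].
Qed.

(* Average over the four images of (x, y) under the mirror in each variable; on
   such a quadruple an exchange at one point only swaps aligned and crossed. *)
Lemma pairing4 f : measurable_fun setT f ->
  (4%:E * pairing f = \int[(mu \x mu)%E]_z (four f z)%:E)%E.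
Proof.
move=> mf; have [mk k0] := kk; have mfs := sg_measurable mf.
pose G (z : (R * R) * (R * R)) := k (enorm (z.1 - z.2)) * Phi (f z.1) (f z.2).
have mG : measurable_fun setT G.
  by apply: measurable_funM; [exact: measurable_ker|exact: pairing_measurable].
have G0 z : 0 <= G z by rewrite mulr_ge0 ?ker_ge0.
have mG2 := measurableT_comp mG sg2_measurable; have mG1 := measurableT_comp mG sg1_measurable.
have mG12 := measurableT_comp mG1 sg2_measurable.
have mGE : measurable_fun setT (fun z => (G z)%:E) by exact/measurable_EFinP.
have GE0 z : (0 <= (G z)%:E)%E by rewrite lee_fin.
have mG1E : measurable_fun setT (fun z : (R * R) * (R * R) => (G (sg z.1, z.2))%:E) by exact/measurable_EFinP.
have i2 := integral_sg2 mGE GE0; have i1 := integral_sg1 mGE GE0.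
have i12 := integral_sg2 mG1E (fun z => GE0 (sg z.1, z.2)).
have -> : (\int[(mu \x mu)%E]_z (four f z)%:E =
  \int[(mu \x mu)%E]_z ((G z + G (sg z.1, sg z.2)) + (G (z.1, sg z.2) + G (sg z.1, z.2)))%:E)%E.
  apply: eq_integral => z _; rewrite /four /aligned /crossed /G /= refl_enorm refl_enormC.
  by congr EFin; rewrite !mulrDr.
rewrite integralD_ge0; [|exact: measurable_funD mG mG12|exact: measurable_funD mG2 mG1
  |by move=> z; exact: addr_ge0|by move=> z; exact: addr_ge0].
rewrite integralD_ge0; [|exact: mG|exact: mG12|exact: G0|by move=> z; exact: G0].
rewrite integralD_ge0; [|exact: mG2|exact: mG1|by move=> z; exact: G0|by move=> z; exact: G0].
rewrite i2 i1 i12 i1 /pairing -/G.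
have I0 : (0 <= \int[(mu \x mu)%E]_z (G z)%:E)%E by exact: integral_EFin_ge0.
move: I0; case: (\int[_]_z _)%E => [r| |] //= _.
  by rewrite -!EFinD -EFinM; congr EFin; ring.
by rewrite gt0_muley ?lte_fin.
Qed.

Lemma four_ge0 f z : 0 <= four f z.
Proof. by rewrite addr_ge0// mulr_ge0 ?ker_ge0 ?addr_ge0. Qed.

Lemma four_measurable f : measurable_fun setT f -> measurable_fun setT (four f).
Proof.
move=> mf; have [mk _] := kk; have mfs := sg_measurable mf.
apply: measurable_funD; apply: measurable_funM.
- exact: measurable_ker.
- exact: measurable_funD (pairing_measurable mf mf) (pairing_measurable mfs mfs).
- exact: (measurableT_comp (measurable_ker mk) sg2_measurable).
- exact: measurable_funD (pairing_measurable mf mfs) (pairing_measurable mfs mf).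
Qed.

Lemma four_pol f z : four (pol f) z = if swap f z.1 (+) swap f z.2
  then k (enorm (z.1 - z.2)) * crossed f z + k (enorm (z.1 - sg z.2)) * aligned f z
  else four f z.
Proof.
rewrite /four /aligned /crossed !pol_refl /pol.
by case: ifP => _; case: ifP => _ //=; congr (_ * _ + _ * _); exact: addrC.
Qed.

(** The change of the four-point sum when exactly one of the two points is exchanged with its mirror
    image; with none or both exchanged the sum stays the same. *)
Definition exchange f z := (k (enorm (z.1 - z.2)) - k (enorm (z.1 - sg z.2))) * (crossed f z - aligned f z).

Lemma four_polB f z : four (pol f) z - four f z = if swap f z.1 (+) swap f z.2 then exchange f z else 0.
Proof.
rewrite four_pol; case: ifP => _; last by rewrite subrr.
by rewrite /four /exchange; ring.
Qed.

Lemma pairing_pol_le f : measurable_fun setT f ->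
  (forall z, swap f z.1 (+) swap f z.2 -> exchange f z <= 0) ->
  (pairing (pol f) <= pairing f)%E.
Proof.
move=> mf hx; rewrite -(@lee_pmul2l _ 4%:E)// !pairing4//; last exact: pol_measurable.
apply: le_integral_EFin.
- exact: four_measurable (pol_measurable mf).
- exact: four_measurable.
- by move=> z; exact: four_ge0.
- have pt z : four (pol f) z <= four f z by rewrite -subr_le0 four_polB; case: ifP => // /hx.
  by move=> z; exact: pt.
Qed.

Lemma pairing_pol_ge f : measurable_fun setT f ->
  (forall z, swap f z.1 (+) swap f z.2 -> 0 <= exchange f z) ->
  (pairing f <= pairing (pol f))%E.
Proof.
move=> mf hx; rewrite -(@lee_pmul2l _ 4%:E)// !pairing4//; last exact: pol_measurable.
apply: le_integral_EFin.
- exact: four_measurable.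
- exact: four_measurable (pol_measurable mf).
- by move=> z; exact: four_ge0.
- have pt z : four f z <= four (pol f) z by rewrite -subr_ge0 four_polB; case: ifP => // /hx.
  by move=> z; exact: pt.
Qed.

(** Finiteness of the pairing permits subtraction, so equality of the integrals forces a nonnegative
    defect to vanish. *)
Lemma pairing_pol_eq f : measurable_fun setT f ->
  (forall z, swap f z.1 (+) swap f z.2 -> exchange f z <= 0) ->
  (pairing f < +oo)%E -> pairing (pol f) = pairing f ->
  {ae (mu \x mu)%E, forall z, four f z - four (pol f) z = 0}.
Proof.
move=> mf hx foo e; have mp := pol_measurable mf.
have le z : 0 <= four f z - four (pol f) z.
  by rewrite subr_ge0 -subr_le0 four_polB; case: ifP => // /hx.
have m1 := four_measurable mf; have m2 := four_measurable mp.
apply: integral_eq0_ae => //; first exact: measurable_funB.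
have fin : (\int[(mu \x mu)%E]_z (four (pol f) z)%:E)%E \is a fin_num.
  rewrite -pairing4// e ge0_fin_numE; last first.
    by rewrite mule_ge0 ?lee_fin// integral_EFin_ge0// => z; rewrite mulr_ge0 ?ker_ge0.
  by rewrite lte_mul_pinfty ?lee_fin.
have : (\int[(mu \x mu)%E]_z (four f z - four (pol f) z)%:E
    + \int[(mu \x mu)%E]_z (four (pol f) z)%:E = \int[(mu \x mu)%E]_z (four f z)%:E)%E.
  rewrite -integralD_ge0//; [|exact: measurable_funB|exact: four_ge0].
  by apply: eq_integral => z _; rewrite subrK.
rewrite -(pairing4 mf) -[in RHS]e (pairing4 mp) => /eqP.
rewrite eq_sym -sube_eq//; first by rewrite subee// => /eqP <-.
by rewrite fin_num_adde_defl.
Qed.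

End FourPoint.
End Fixed.
End Polarization.

(** * Polarization of minimizers and its equality case *)

Section Rigidity.
Context (R : realType).
Local Notation mu := (leb2 R).
Implicit Types (f g w : R * R -> R) (h x y : R * R) (k : R -> R).

Definition Phip (a b : R) : R := a ^+ 2 * b ^+ 2.
Definition Phid (a b : R) : R := (a - b) ^+ 2.
(** The comparison of squares matches the definition of [disc]. *)
Definition kd (t r : R) : R := if r ^+ 2 < t ^+ 2 then 1 else 0.

Lemma measurable_Phip : measurable_fun setT (fun p : R * R => Phip p.1 p.2).
Proof.
by apply: measurable_funM; apply: measurable_funX; [exact: measurable_fst|exact: measurable_snd].
Qed.

Lemma measurable_Phid : measurable_fun setT (fun p : R * R => Phid p.1 p.2).
Proof.
by apply: measurable_funX; apply: measurable_funB; [exact: measurable_fst|exact: measurable_snd].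
Qed.

Lemma Phip_ge0 a b : 0 <= Phip a b. Proof. by rewrite mulr_ge0 ?sqr_ge0. Qed.
Lemma Phid_ge0 a b : 0 <= Phid a b. Proof. exact: sqr_ge0. Qed.

Lemma kernel_kd t : kernel (kd t).
Proof.
split; last by move=> r _; rewrite /kd; case: ifP.
apply: measurable_fun_ifT; [|exact: measurable_cst|exact: measurable_cst].
by apply: measurable_fun_ltr; [apply: measurable_funX; exact: measurable_id|exact: measurable_cst].
Qed.

Lemma V_pairing k f : kernel k -> measurable_fun setT f -> V k f = pairing k Phip f.
Proof.
move=> kk mf; rewrite V_prod//; apply: eq_integral => z _.
by rewrite /Phip mulrA.
Qed.

Lemma V_pairing_le k f g : kernel k -> measurable_fun setT f -> measurable_fun setT g ->
  (pairing k Phip f <= pairing k Phip g)%E -> (V k f <= V k g)%E.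
Proof. by move=> kk mf mg; rewrite -(V_pairing kk mf) -(V_pairing kk mg). Qed.

Lemma dq_pairing t f : 0 <= t -> L2 mu f ->
  ((disc_int t (dq f))%:E = pairing (kd t) Phid f)%E.
Proof.
move=> t0 lf; have mf := L2_meas lf.
rewrite (disc_intE t0 (dq_bounded t lf)) -(integral_dq_indic (disc_measurable t) lf).
rewrite /pairing (fubini_tonelli1
  (fun z : (R * R) * (R * R) => (kd t (enorm (z.1 - z.2)) * Phid (f z.1) (f z.2))%:E)).
- apply: eq_integral => x _; rewrite /fubini_F; apply: eq_integral => y _ /=.
  congr EFin; congr (_ * _); last by rewrite /Phid -sqrrN opprB.
  rewrite /kd enormB enorm_sqr indicE; case: ifP => h; first by rewrite mem_set.
  by rewrite memNset// /disc /= h.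
- apply/measurable_EFinP; apply: measurable_funM.
    by apply: measurable_ker; case: (kernel_kd t).
  exact: (pairing_measurable measurable_Phid).
- by move=> z; rewrite lee_fin mulr_ge0 ?Phid_ge0// ker_ge0//; exact: kernel_kd.
Qed.

Lemma dq_pairing_le t f g : 0 <= t -> L2 mu f -> L2 mu g ->
  (pairing (kd t) Phid f <= pairing (kd t) Phid g)%E ->
  disc_int t (dq f) <= disc_int t (dq g).
Proof. by move=> t0 lf lg; rewrite -(dq_pairing t0 lf) -(dq_pairing t0 lg) lee_fin. Qed.

Lemma enorm_gt0 x y : x <> y -> 0 < enorm (x - y).
Proof.
move=> xy; rewrite lt0r enorm_ge0 andbT; apply/eqP => h; apply: xy.
have := enorm_sqr (x - y); rewrite h expr0n /= => /eqP.
rewrite eq_sym paddr_eq0 ?sqr_ge0// !sqrf_eq0 !subr_eq0 => /andP[/eqP h1 /eqP h2].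
by case: x y h1 h2 {h} => [a b] [c d] /= -> ->.
Qed.

(** In use [p] is a product of signed distances, [u] a difference of kernels of the same sign, and
    [d] a product of differences of values; multiplying by p^2 transfers the sign of p d to u d. *)
Let sign_comb (u p d : R) : 0 <= u * p -> (p = 0 -> u = 0) -> p * d <= 0 -> u * d <= 0.
Proof.
move=> up p0 pd; have [/p0 ->|pn] := eqVneq p 0; first by rewrite mul0r.
have p2 : 0 < p ^+ 2 by rewrite exprn_even_gt0.
rewrite -(pmulr_rle0 _ p2) (_ : p ^+ 2 * (u * d) = (u * p) * (p * d)); last by ring.
by apply: mulr_ge0_le0.
Qed.

Section Fixed.
Variables (sg : R * R -> R * R) (s : R * R -> R).
Hypothesis rs : reflection sg s.

Lemma xor_sign f (z : (R * R) * (R * R)) : swap sg s f z.1 (+) swap sg s f z.2 ->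
  s z.1 * s z.2 * ((f z.1 - f (sg z.1)) * (f z.2 - f (sg z.2))) <= 0.
Proof.
move=> h; rewrite (_ : _ * _ = (s z.1 * (f z.1 - f (sg z.1))) * (s z.2 * (f z.2 - f (sg z.2)))); last by ring.
move: h; rewrite /swap; case: ltP => h1; case: ltP => h2 //= _.
  by rewrite mulr_le0_ge0// ltW.
by rewrite mulr_ge0_le0// ltW.
Qed.

(* Exchange at exactly one of two points excludes that they are equal or mirror
   images, so the value of k2 at 0 never matters. *)
Lemma xor_neq f (z : (R * R) * (R * R)) : swap sg s f z.1 (+) swap sg s f z.2 ->
  0 < enorm (z.1 - z.2) /\ 0 < enorm (z.1 - sg z.2).
Proof.
move=> h; split; apply: enorm_gt0 => e; move: h; rewrite e ?(swap_refl rs) addbb//.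
Qed.

Lemma kernel_decr_sign k f z : (forall r r', 0 < r -> r <= r' -> k r' <= k r) ->
  0 < enorm (z.1 - z.2) -> 0 < enorm (z.1 - sg z.2) ->
  0 <= (k (enorm (z.1 - z.2)) - k (enorm (z.1 - sg z.2))) * (s z.1 * s z.2) /\
  (s z.1 * s z.2 = 0 -> k (enorm (z.1 - z.2)) - k (enorm (z.1 - sg z.2)) = 0).
Proof.
move=> kd h1 h2; have [_ _ _ _ h] := rs; have e := h z.1 z.2; split; last first.
  move=> p0; move: e; rewrite p0 mulr0 addr0 => /eqP.
  by rewrite eqrXn2 ?enorm_ge0// => /eqP ->; rewrite subrr.
have [p0|p0] := leP 0 (s z.1 * s z.2).
  apply: mulr_ge0 => //; rewrite subr_ge0; apply: kd => //.
  by rewrite -ler_sqr ?nnegrE ?enorm_ge0// e lerDl mulr_ge0.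
apply: mulr_le0; last exact: ltW.
rewrite subr_le0; apply: kd => //.
by rewrite -ler_sqr ?nnegrE ?enorm_ge0// e gerDl mulr_ge0_le0// ltW.
Qed.

Lemma crossedB_Phip f z : crossed sg Phip f z - aligned sg Phip f z =
  - ((f z.1 + f (sg z.1)) * (f z.2 + f (sg z.2))) * ((f z.1 - f (sg z.1)) * (f z.2 - f (sg z.2))).
Proof. by rewrite /crossed /aligned /Phip; ring. Qed.

Lemma crossedB_Phid f z : crossed sg Phid f z - aligned sg Phid f z =
  2 * ((f z.1 - f (sg z.1)) * (f z.2 - f (sg z.2))).
Proof. by rewrite /crossed /aligned /Phid; ring. Qed.

(** The average over the disc is essential: the exchange is compared through a kernel that depends
    on the distance only, and a single shift [h] provides no such kernel. *)
Lemma pol_dq t f : 0 < t -> L2 mu f ->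
  disc_int t (dq (pol sg s f)) <= disc_int t (dq f).
Proof.
move=> t0 lf; have lp := pol_L2 rs lf.
apply: (dq_pairing_le (ltW t0) lp lf).
apply: (pairing_pol_le rs (kernel_kd t) measurable_Phid Phid_ge0 (L2_meas lf)) => z hz.
have [n1 n2] := xor_neq hz; have xs := xor_sign hz.
have kdd r r' : 0 < r -> r <= r' -> kd t r' <= kd t r.
  move=> r0 rr; rewrite /kd; case: ifP => h1; case: ifP => h2 //.
  by move: h2; rewrite (le_lt_trans _ h1)// ler_sqr ?nnegrE ?(ltW r0)// (le_trans (ltW r0)).
have [k1' k2'] := kernel_decr_sign f kdd n1 n2.
rewrite /exchange crossedB_Phid mulrCA pmulr_rle0//.
exact: sign_comb k1' k2' xs.
Qed.

Lemma pol_Hcl f D : Hcl f D -> Hcl (pol sg s f) D.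
Proof.
move=> Hf; have lf := Hcl_L2 Hf; have D0 := Hcl_ge0 Hf; have [f0 [g1 [g2 [wg hg]]] Lf] := Hf.
split; [by move=> x; exact: pol_ge0| |exact: pol_Lw].
apply: weakg_exists => //; first exact: pol_L2.
move=> t t0 t1; apply: (le_trans (pol_dq t0 lf)).
apply: (le_trans (weakg_dq (ltW t0) wg)).
by rewrite ler_pM2r ?disc_mom_gt0.
Qed.

Lemma exchange_k1 f z : (forall x, 0 <= f x) -> swap sg s f z.1 (+) swap sg s f z.2 ->
  exchange sg (@k1 R) Phip f z <= 0.
Proof.
move=> f0 hz; have [n1 n2] := xor_neq hz; have xs := xor_sign hz.
have kdd (r r' : R) : 0 < r -> r <= r' -> - k1 r' <= - k1 r.
  by move=> r0 rr; rewrite lerN2; apply: k1_le => //; exact: ltW.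
have [k1' k2'] := kernel_decr_sign f kdd n1 n2.
rewrite /exchange crossedB_Phip.
have q0 : 0 <= (f z.1 + f (sg z.1)) * (f z.2 + f (sg z.2)) by rewrite mulr_ge0// addr_ge0.
have := sign_comb k1' k2' xs; move: q0.
move: ((f z.1 + _) * _) ((f z.1 - _) * _) (k1 (enorm (z.1 - z.2))) (k1 (enorm (z.1 - sg z.2))) => q d a b q0 h.
rewrite (_ : _ * _ = q * ((- a - - b) * d)); last by ring.
exact: mulr_ge0_le0.
Qed.

Lemma exchange_k2 f z : (forall x, 0 <= f x) -> swap sg s f z.1 (+) swap sg s f z.2 ->
  0 <= exchange sg (@k2 R) Phip f z.
Proof.
move=> f0 hz; have [n1 n2] := xor_neq hz; have xs := xor_sign hz.
have [k1' k2'] := kernel_decr_sign f (@k2_le R) n1 n2.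
rewrite /exchange crossedB_Phip.
have q0 : 0 <= (f z.1 + f (sg z.1)) * (f z.2 + f (sg z.2)) by rewrite mulr_ge0// addr_ge0.
have := sign_comb k1' k2' xs; move: q0.
move: ((f z.1 + _) * _) ((f z.1 - _) * _) (k2 (enorm (z.1 - z.2))) (k2 (enorm (z.1 - sg z.2))) => q d a b q0 h.
rewrite (_ : (a - b) * (- q * d) = - (q * ((a - b) * d))); last by ring.
by rewrite oppr_ge0; exact: mulr_ge0_le0.
Qed.

(** Strictness combines [k1_lt] with the positivity of f(x) + f(sg x) at both points, forced by f >=
    0 and a nonzero difference of values. *)
Lemma exchange_k1_lt f z : (forall x, 0 <= f x) ->
  0 < s z.1 * (f z.1 - f (sg z.1)) -> s z.2 * (f z.2 - f (sg z.2)) < 0 ->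
  exchange sg (@k1 R) Phip f z < 0.
Proof.
move=> f0 p1 p2; have [_ _ _ _ h] := rs; have e := h z.1 z.2.
rewrite /exchange crossedB_Phip.
have pos x : s x * (f x - f (sg x)) != 0 -> 0 < f x + f (sg x).
  move=> n0; rewrite lt0r addr_ge0// andbT; apply/eqP => h0.
  have := paddr_eq0 (f0 x) (f0 (sg x)); rewrite h0 eqxx => /esym/andP[/eqP a0 /eqP b0].
  by move: n0; rewrite a0 b0 subrr mulr0 eqxx.
have q1 : 0 < f z.1 + f (sg z.1) by apply: pos; rewrite gt_eqF.
have q2 : 0 < f z.2 + f (sg z.2) by apply: pos; rewrite lt_eqF.
have q0 := mulr_gt0 q1 q2.
have pd : s z.1 * s z.2 * ((f z.1 - f (sg z.1)) * (f z.2 - f (sg z.2))) < 0.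
  rewrite (_ : _ * _ = (s z.1 * (f z.1 - f (sg z.1))) * (s z.2 * (f z.2 - f (sg z.2)))); last by ring.
  by rewrite pmulr_rlt0.
move: q0 pd; move: ((f z.1 + _) * _) ((f z.1 - _) * _) => q d q0 pd.
have [p0|p0|p0] := ltgtP 0 (s z.1 * s z.2).
- have d0 : d < 0 by rewrite -(pmulr_rlt0 _ p0).
  have lt : enorm (z.1 - z.2) < enorm (z.1 - sg z.2).
    by rewrite -ltr_sqr ?nnegrE ?enorm_ge0// e ltrDl mulr_gt0.
  have := k1_lt (enorm_ge0 _) lt; rewrite -subr_lt0 => h1.
  rewrite mulNr mulrN oppr_lt0 nmulr_rgt0// pmulr_rlt0//.
- have d0 : 0 < d by rewrite -(nmulr_rlt0 _ p0).
  have lt : enorm (z.1 - sg z.2) < enorm (z.1 - z.2).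
    by rewrite -ltr_sqr ?nnegrE ?enorm_ge0// e gtrDl pmulr_rlt0.
  have := k1_lt (enorm_ge0 _) lt; rewrite -subr_gt0 => h1.
  rewrite mulNr mulrN oppr_lt0 mulr_gt0// mulr_gt0//.
- by move: pd; rewrite -p0 mul0r ltxx.
Qed.

(** The polarized function competes with the same mass and the same [D], a [v1] that is no larger
    and a [v2] that is no smaller, so [v1] is unchanged. The exchange is strictly favourable on
    every pair drawn from the two sets, so their product is null and one factor is null. *)
Lemma minimizer_rigid (c l : R) f D : 0 < c -> minimizer c l f D ->
  mu [set x | 0 < s x * (f x - f (sg x))] = 0%E \/
  mu [set x | s x * (f x - f (sg x)) < 0] = 0%E.
Proof.
move=> c0 [Hf fl fmin]; have lf := Hcl_L2 Hf; have mf := L2_meas lf.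
have f0 x : 0 <= f x by case: Hf.
have Hp := pol_Hcl Hf; have mp := L2_meas (Hcl_L2 Hp).
have pl : ip mu (pol sg s f) (pol sg s f) = l by rewrite (pol_ip rs lf).
have := fmin _ _ Hp pl; rewrite /En lerD2l ler_pM2l// => hmin.
have K1 := @kernel_k1 R; have K2 := @kernel_k2 R.
have h1 : v1 (pol sg s f) <= v1 f.
  apply: (Hcl_v1_le Hp Hf); apply: (V_pairing_le K1 mp mf).
  apply: (pairing_pol_le rs K1 measurable_Phip Phip_ge0 mf) => z; exact: exchange_k1.
have h2 : v2 f <= v2 (pol sg s f).
  rewrite -[X in _ <= X]addr0; apply: (Hcl_v2_leD Hf Hp); rewrite adde0.
  apply: (V_pairing_le K2 mf mp).
  apply: (pairing_pol_ge rs K2 measurable_Phip Phip_ge0 mf) => z; exact: exchange_k2.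
have squeeze (a b p q : R) : a - b <= p - q -> p <= a -> b <= q -> p = a by clear; lra.
have e1 : v1 (pol sg s f) = v1 f := squeeze _ _ _ _ hmin h1 h2.
have ep : pairing (@k1 R) Phip (pol sg s f) = pairing (@k1 R) Phip f.
  by rewrite -(V_pairing K1 mp) -(V_pairing K1 mf) -(Hcl_V1 Hp) -(Hcl_V1 Hf) e1.
have foo : (pairing (@k1 R) Phip f < +oo)%E by rewrite -V_pairing// -(Hcl_V1 Hf) ltry.
have ae := pairing_pol_eq rs K1 measurable_Phip Phip_ge0 mf (fun z => exchange_k1 (z := z) f0) foo ep.
have [_ _ ms _ _] := rs.
have mq : measurable_fun setT (fun x => s x * (f x - f (sg x))).
  by apply: measurable_funM; [exact: ms|exact: measurable_funB mf (sg_measurable rs mf)].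
set Qp := [set x | _ < _ * _]; set Qm := [set x | _ < 0].
have mQp : measurable Qp by exact: superlevel_measurable mq.
have mQm : measurable Qm.
  rewrite (_ : Qm = (fun x => s x * (f x - f (sg x))) @^-1` `]-oo, 0[).
    by rewrite -[X in measurable X]setTI; apply: mq => //; exact: measurable_itv.
  by apply/seteqP; split => x /=; rewrite in_itv.
have null : ((mu \x mu) (Qp `*` Qm) = 0)%E.
  apply: (measure_negligible (measurableX mQp mQm)).
  apply: negligibleS ae => z [/= z1 z2] /= e.
  have sx : swap sg s f z.1 (+) swap sg s f z.2.
    by rewrite /swap z2 ltNge (ltW z1).
  have := exchange_k1_lt f0 z1 z2.
  have := four_polB rs (@k1 R) Phip f z; rewrite sx => <-.
  by rewrite -opprB e oppr0 ltxx.
have /eqP := etrans (esym (product_measure1E mu mu mQp mQm)) null.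
by rewrite mule_eq0 => /orP[/eqP ?|/eqP ?]; [left|right].
Qed.

End Fixed.
End Rigidity.

(** * Radial symmetry *)

Section Reflections.
Context (R : realType).
Local Notation mu := (leb2 R).
Implicit Types (f g w : R * R -> R) (h x y e : R * R) (k : R -> R).

Definition lin e x : R := e.1 * x.1 + e.2 * x.2.
Definition mirror e (t : R) x : R * R :=
  (x.1 - 2 * (lin e x - t) * e.1, x.2 - 2 * (lin e x - t) * e.2).
Definition unit_vec e := e.1 ^+ 2 + e.2 ^+ 2 = 1.

Lemma measurable_lin e : measurable_fun setT (lin e).
Proof.
by apply: measurable_funD; apply: measurable_funM; try exact: measurable_cst;
  [exact: measurable_fst|exact: measurable_snd].
Qed.

(** The linear part is the orthogonal reflection with c = 1 - 2 e.1^2 and s = -2 e.1 e.2; it is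
    followed by the translation by 2 t e. *)
Lemma mirror_preserves e t : unit_vec e -> preserves (mirror e t).
Proof.
move=> u; have cs : (1 - 2 * e.1 ^+ 2) ^+ 2 + (- (2 * e.1 * e.2)) ^+ 2 = 1.
  have u1 : e.1 ^+ 2 = 1 - e.2 ^+ 2 by rewrite -u addrK.
  by rewrite sqrrN !exprMn u1; ring.
have := preserves_comp (preserves_shift (2 * t * e.1, 2 * t * e.2)) (preserves_orthogonal_reflection cs).
apply: eq_preserves => x; rewrite /mirror /lin /=.
congr pair; first by rewrite /=; ring.
have u2 : e.1 ^+ 2 = 1 - e.2 ^+ 2 by rewrite -u addrK.
have -> : - (2 * e.1 * e.2) * x.1 - (1 - 2 * e.1 ^+ 2) * x.2 = - (2 * e.1 * e.2) * x.1 + (1 - 2 * e.2 ^+ 2) * x.2.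
  by rewrite u2; ring.
by rewrite /=; ring.
Qed.

Lemma mirror_reflection e t : unit_vec e -> reflection (mirror e t) (fun x => lin e x - t).
Proof.
move=> u; have u1 : e.1 ^+ 2 = 1 - e.2 ^+ 2 by rewrite -u addrK.
have lN x : lin e (mirror e t x) - t = - (lin e x - t).
  have lsh (a : R) : lin e (x.1 - a * e.1, x.2 - a * e.2) = lin e x - a * (e.1 ^+ 2 + e.2 ^+ 2).
    by rewrite /lin /=; ring.
  by rewrite /mirror lsh u; ring.
split => //.
- exact: mirror_preserves.
- move=> x; rewrite {1}/mirror lN /mirror /=; case: x => a b /=; congr pair; ring.
- by apply: measurable_funB; [exact: measurable_lin|exact: measurable_cst].
- move=> x y; rewrite !enorm_sqr /mirror /=.
  set p := lin e x - t; set q := lin e y - t.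
  have -> : (x.1 - (y.1 - 2 * q * e.1)) ^+ 2 + (x.2 - (y.2 - 2 * q * e.2)) ^+ 2 =
    ((x.1 - y.1) ^+ 2 + (x.2 - y.2) ^+ 2) + 4 * q * (p - q) + 4 * q ^+ 2 * (e.1 ^+ 2 + e.2 ^+ 2).
    by rewrite (_ : p - q = e.1 * (x.1 - y.1) + e.2 * (x.2 - y.2)); [|rewrite /p /q /lin]; ring.
  by rewrite u; ring.
Qed.

Lemma leb1_set1 (a : R) : leb1 R [set a] = 0%E.
Proof. exact: lebesgue_measure_set1. Qed.

Lemma line1_null (t : R) : mu [set x | x.1 = t] = 0%E.
Proof.
rewrite (_ : [set x | _] = [set t] `*` setT); last by apply/seteqP; split => x /=; [move=> ->|case].
by rewrite (leb2X (measurable_set1 t) measurableT) leb1_set1 mul0e.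
Qed.

Lemma line2_null (t : R) : mu [set x | x.2 = t] = 0%E.
Proof.
rewrite (_ : [set x | _] = setT `*` [set t]); last by apply/seteqP; split => x /=; [move=> ->|case].
by rewrite (leb2X measurableT (measurable_set1 t)) leb1_set1 mule0.
Qed.

End Reflections.

(** * Half-plane masses and medians *)

Section Masses.
Context (R : realType).
Local Notation mu := (leb2 R).
Implicit Types (f g w : R * R -> R) (h x y e : R * R).

Definition massp f (s : R * R -> R) := ip mu (fun x => \1_[set x | 0 < s x] x * f x) f.

Lemma indic_pos_measurable (s : R * R -> R) : measurable_fun setT s ->
  measurable_fun setT (\1_[set x | 0 < s x] : R * R -> R).
Proof. by move=> ms; apply: measurable_indic; exact: superlevel_measurable. Qed.

Lemma massp_L2 f (s : R * R -> R) : measurable_fun setT s -> L2 mu f ->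
  L2 mu (fun x => \1_[set x | 0 < s x] x * f x).
Proof.
move=> ms lf; apply: (L2_le _ _ lf).
  by apply: measurable_funM; [exact: indic_pos_measurable|exact: L2_meas lf].
move=> x; rewrite normrM; apply: ler_piMl => //.
have /andP[a b] := indic_le1 [set x | 0 < s x] x.
by rewrite ger0_norm.
Qed.

Lemma masspE f (s : R * R -> R) : measurable_fun setT s -> L2 mu f ->
  ((massp f s)%:E = \int[mu]_x (\1_[set x | 0 < s x] x * f x ^+ 2)%:E)%E.
Proof.
move=> ms lf; rewrite ipE//; last exact: massp_L2.
by apply: eq_integral => x _; rewrite expr2 mulrA.
Qed.

Lemma massp_le f (s s' : R * R -> R) : measurable_fun setT s -> measurable_fun setT s' ->
  L2 mu f -> (forall x, 0 < s x -> 0 < s' x) -> massp f s <= massp f s'.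
Proof.
move=> ms ms' lf ss; rewrite -lee_fin !masspE//.
have m (u : R * R -> R) : measurable_fun setT u -> measurable_fun setT (fun x => \1_[set x | 0 < u x] x * f x ^+ 2).
  move=> mu'; apply: measurable_funM; first exact: indic_pos_measurable.
  by apply: measurable_funX; exact: L2_meas lf.
apply: le_integral_EFin; [exact: m|exact: m| |].
  by move=> x; rewrite mulr_ge0 ?sqr_ge0//; case/andP: (indic_le1 [set x | 0 < s x] x).
have pt x : \1_[set x | 0 < s x] x * f x ^+ 2 <= \1_[set x | 0 < s' x] x * f x ^+ 2.
  apply: ler_wpM2r; first exact: sqr_ge0.
  rewrite !indicE; have [/set_mem /= h|_] := boolP (x \in [set x | 0 < s x]); last by rewrite ler0n.
  by rewrite mem_set//=; exact: ss.
by move=> x; exact: pt.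
Qed.

Lemma massp_total f (s : R * R -> R) : measurable_fun setT s -> L2 mu f ->
  mu [set x | s x = 0%R] = 0%E -> massp f s + massp f (fun x => - s x) = ip mu f f.
Proof.
move=> ms lf null; have mf := L2_meas lf.
have msN : measurable_fun setT (fun x => - s x) by exact: measurableT_comp.
have l1 := massp_L2 ms lf; have l2 := massp_L2 msN lf.
rewrite /massp -(ipDl l1 l2 lf) /ip; congr fine.
have m1 : measurable_fun setT (fun x => (\1_[set x | 0 < s x] x * f x
   + \1_[set x | 0 < - s x] x * f x) * f x).
  by apply: measurable_funM; [exact: measurable_funD (L2_meas l1) (L2_meas l2)|exact: mf].
apply: ae_eq_integral => //.
- exact/measurable_EFinP.
- by apply/measurable_EFinP; exact: measurable_funM.
- have mz : measurable [set x | s x = 0].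
    rewrite (_ : [set x | _] = s @^-1` [set 0])//.
    by rewrite -[X in measurable X]setTI; apply: ms => //; exact: measurable_set1.
  exists [set x | s x = 0]; split => //.
  move=> x /= /not_implyP[_ h]; apply: contrapT => s0; apply: h; congr EFin.
  congr (_ * _); rewrite -mulrDl -[RHS]mul1r; congr (_ * _).
  have [p|p|p] := ltgtP 0 (s x).
  + by rewrite !indicE mem_set// memNset ?addr0//= oppr_gt0 ltNge ltW.
  + by rewrite !indicE memNset ?mem_set ?add0r//= ?oppr_gt0// ltNge ltW.
  + by case: s0.
Qed.

(** Along increasing sets the indicators are eventually constant at each point, so Fatou applies
    without any rate. *)
Lemma massp_fatou f (s_ : nat -> R * R -> R) (s : R * R -> R) (a : R) : L2 mu f ->
  (forall n, measurable_fun setT (s_ n)) -> measurable_fun setT s ->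
  (forall n m x, (n <= m)%N -> 0 < s_ n x -> 0 < s_ m x) ->
  (forall x, 0 < s x -> exists n, 0 < s_ n x) -> (forall n x, 0 < s_ n x -> 0 < s x) ->
  (forall n, massp f (s_ n) <= a) -> massp f s <= a.
Proof.
move=> lf ms_ ms mono ex le ha; rewrite -lee_fin masspE//.
apply: (@fatou_le R _ _ mu (fun n x => \1_[set x | 0 < s_ n x] x * f x ^+ 2) _ _ 0).
- move=> n; apply: measurable_funM; first exact: indic_pos_measurable.
  by apply: measurable_funX; exact: L2_meas lf.
- by move=> n x; rewrite mulr_ge0 ?sqr_ge0//; case/andP: (indic_le1 [set x | 0 < s_ n x] x).
- move=> x; apply: cvg_near_cst; have [p|p] := ltP 0 (s x).
    have [n sn] := ex x p; exists n => // m /= nm; rewrite !indicE !mem_set//=.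
    exact: mono nm sn.
  exists 0%N => // m _; rewrite !indicE !memNset//=; first by rewrite ltNge p.
  by move=> /le; rewrite ltNge p.
- by move=> n; rewrite mul0r addr0 -masspE// lee_fin.
Qed.

(** The median is the supremum of the [t] with at least half of the mass beyond them. Continuity
    from either side is [massp_fatou] along half-planes with offsets t + 2^-n and t - 2^-n, and
    since level sets of [L] are null the two sides share the whole mass. *)
Lemma median f (L : R * R -> R) : measurable_fun setT L -> L2 mu f -> 0 < ip mu f f ->
  (forall t, mu [set x | L x = t] = 0%E) ->
  exists t, massp f (fun x => L x - t) = massp f (fun x => - (L x - t)).
Proof.
move=> mL lf l0 null; set l := ip mu f f in l0.
have ms t : measurable_fun setT (fun x => L x - t).
  by apply: measurable_funB => //; exact: measurable_cst.
have msN t : measurable_fun setT (fun x => - (L x - t)) by exact: measurableT_comp.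
have tot t : massp f (fun x => L x - t) + massp f (fun x => - (L x - t)) = l.
  apply: massp_total => //; rewrite -[RHS](null t); congr (mu _).
  by apply/seteqP; split => x /= => [/eqP|->]; [rewrite subr_eq0 => /eqP|rewrite subrr].
have all1 : massp f (fun=> 1) = l.
  rewrite /massp /ip /l; congr fine; apply: eq_integral => x _; congr EFin.
  by rewrite indicE mem_set ?mul1r//= ltr01.
have l2 : ~ (l <= l / 2) by move: l0; clear => l0 ?; lra.
pose T := [set t | l / 2 <= massp f (fun x => L x - t)].
have T0 : T !=set0.
  apply: contrapT => /forallNP nT; apply: l2; rewrite -{1}all1.
  apply: (massp_fatou (s_ := fun n x => L x - - n%:R)) => //.
  - move=> n m x nm; rewrite !opprK => /lt_le_trans; apply.
    by rewrite lerD2l ler_nat.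
  - move=> x _; exists (Num.trunc (- L x)).+1; rewrite opprK -ltrBlDl sub0r.
    exact: truncnS_gt.
  - by move=> n; have /negP := nT (- n%:R); rewrite -ltNge => /ltW.
have ubT : has_ubound T.
  apply: contrapT => nub; apply: l2; rewrite -{1}all1.
  apply: (massp_fatou (s_ := fun n x => - (L x - n%:R))) => //.
  - move=> n m x nm; rewrite !opprB => /lt_le_trans; apply.
    by rewrite lerD2r ler_nat.
  - move=> x _; exists (Num.trunc (L x)).+1; rewrite opprB subr_gt0.
    exact: truncnS_gt.
  - move=> n; have [t [Tt nt]] : exists t, T t /\ n%:R < t.
      apply: contrapT => /forallNP h; apply: nub; exists n%:R => t Tt.
      by rewrite leNgt; apply/negP => nt; apply: (h t).
    apply: (@le_trans _ _ (massp f (fun x => - (L x - t)))).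
      apply: massp_le => // x; rewrite !opprB => /lt_trans; apply.
      by rewrite ltrD2r.
    by have := tot t; move: Tt; rewrite /T /=; move: (massp _ _) (massp _ _) => p q; clear; lra.
pose t := sup T; exists t.
have r0 n : 0 < (2^-1 : R) ^+ n by rewrite exprn_gt0// invr_gt0.
have rm n m : (n <= m)%N -> (2^-1 : R) ^+ m <= 2^-1 ^+ n.
  by move=> nm; apply: ler_wiXn2l; rewrite ?invr_ge0// invf_le1// ler1n.
have h1 : massp f (fun x => L x - t) <= l / 2.
  apply: (massp_fatou (s_ := fun n x => L x - (t + 2^-1 ^+ n))) => //.
  - move=> n m x nm /lt_le_trans; apply.
    by rewrite lerD2l lerN2 lerD2l rm.
  - move=> x p; have p2 : 0 < (L x - t) / 2 by rewrite divr_gt0.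
    have [n hn] := half_expr_le p2.
    by exists n; move: hn p; move: (2^-1 ^+ n : R) => r; clear; lra.
  - by move=> n x; have := r0 n; move: (2^-1 ^+ n : R) => r; clear; lra.
  - move=> n; rewrite leNgt; apply/negP => h.
    have : t + 2^-1 ^+ n <= t by apply: ub_le_sup => //; exact: ltW.
    by rewrite gerDl leNgt r0.
have h2 : massp f (fun x => - (L x - t)) <= l / 2.
  apply: (massp_fatou (s_ := fun n x => - (L x - (t - 2^-1 ^+ n)))) => //.
  - move=> n m x nm /lt_le_trans; apply.
    by rewrite lerN2 lerD2l lerN2 lerD2l lerN2 rm.
  - move=> x p; have p2 : 0 < - (L x - t) / 2 by rewrite divr_gt0.
    have [n hn] := half_expr_le p2.
    by exists n; move: hn p; move: (2^-1 ^+ n : R) => r; clear; lra.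
  - by move=> n x; have := r0 n; move: (2^-1 ^+ n : R) => r; clear; lra.
  - move=> n; have [t' Tt' tt'] := sup_adherent (r0 n) (conj T0 ubT).
    apply: (@le_trans _ _ (massp f (fun x => - (L x - t')))).
      apply: massp_le => // x; rewrite -/t in tt'; move: tt'; move: (2^-1 ^+ n : R) => r; clear; lra.
    by have := tot t'; move: Tt'; rewrite /T /=; move: (massp _ _) (massp _ _) => p q; clear; lra.
have := tot t; move: h1 h2; move: (massp _ _) (massp _ _) => p q; clear; lra.
Qed.

Lemma null_negligible (A : set (R * R)) : measurable A -> mu A = 0%E -> mu.-negligible A.
Proof. by move=> mA A0; exists A; split => // x. Qed.

Lemma preserves_null (sg : R * R -> R * R) (A : set (R * R)) : preserves sg ->
  measurable A -> mu A = 0%E -> mu (sg @^-1` A) = 0%E.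
Proof.
move=> [ms is_] mA A0.
have mP : measurable (sg @^-1` A) by rewrite -[X in measurable X]setTI; exact: ms.
have ind (B : set (R * R)) : measurable B -> (mu B = \int[mu]_x (\1_B x)%:E)%E.
  by move=> mB; rewrite integral_indic// setIT.
rewrite (ind _ mP) -A0 (ind _ mA).
apply: (is_ (fun x => (\1_A x)%:E)).
  by apply/measurable_EFinP; exact: measurable_indic.
by move=> x; rewrite lee_fin.
Qed.

Lemma preserves_ae (sg : R * R -> R * R) (P : R * R -> Prop) : preserves sg ->
  {ae mu, forall x, P x} -> {ae mu, forall x, P (sg x)}.
Proof.
move=> ps [N [mN N0 sN]]; exists (sg @^-1` N); split.
- by rewrite -[X in measurable X]setTI; apply: (proj1 ps).
- exact: preserves_null.
- by move=> x nP; apply: sN.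
Qed.

Section Fixed.
Variables (sg : R * R -> R * R) (s : R * R -> R).
Hypothesis rs : reflection sg s.

Lemma reflectionN : reflection sg (fun x => - s x).
Proof.
have [h1 h2 h3 h4 h5] := rs; split => //.
- exact: measurableT_comp.
- by move=> x; rewrite h4.
- by move=> x y; rewrite h5 mulrNN.
Qed.

Lemma refl_mass f : L2 mu f -> massp f (fun x => - s x) = massp (fun x => f (sg x)) s.
Proof.
move=> lf; have [ps _ ms sN _] := rs; have mf := L2_meas lf.
have msN : measurable_fun setT (fun x => - s x) by exact: measurableT_comp.
apply: EFin_inj; rewrite masspE// masspE//; last exact: preserves_L2.
rewrite -(preserves_integral (f := fun x => \1_[set x | 0 < - s x] x * f x ^+ 2) ps).
  apply: eq_integral => x _; congr EFin; congr (_ * _); rewrite !indicE; congr (_%:R).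
  by congr nat_of_bool; apply/idP/idP => /set_mem /= h; apply/mem_set => /=; rewrite sN opprK in h *.
by apply: measurable_funM; [exact: indic_pos_measurable|exact: measurable_funX].
Qed.

(** If [f] is larger on the side s > 0 and yet carries no more mass there, the masses agree and the
    nonnegative difference of squares integrates to zero. *)
Lemma refl_null f : (forall x, 0 <= f x) -> L2 mu f ->
  massp f s <= massp f (fun x => - s x) ->
  mu [set x | s x * (f x - f (sg x)) < 0] = 0%E ->
  mu [set x | 0 < s x * (f x - f (sg x))] = 0%E.
Proof.
move=> f0 lf hm q0; have [ps inv ms sN _] := rs; have mf := L2_meas lf.
have lfs := preserves_L2 ps lf; have mfs := L2_meas lfs.
have mi := indic_pos_measurable ms.
have i0 x : 0 <= (\1_[set x | 0 < s x] x : R) by case/andP: (indic_le1 [set x | 0 < s x] x).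
pose p x := \1_[set x | 0 < s x] x * `|f x ^+ 2 - f (sg x) ^+ 2|.
have p0 x : 0 <= p x by rewrite mulr_ge0.
have mp : measurable_fun setT p.
  apply: measurable_funM => //; apply: measurableT_comp => //.
  by apply: measurable_funB; exact: measurable_funX.
have mq : measurable_fun setT (fun x => s x * (f x - f (sg x))).
  by apply: measurable_funM => //; exact: measurable_funB.
have mQm : measurable [set x | s x * (f x - f (sg x)) < 0].
  rewrite (_ : [set x | _] = (fun x => s x * (f x - f (sg x))) @^-1` `]-oo, 0[).
    by rewrite -[X in measurable X]setTI; apply: mq => //; exact: measurable_itv.
  by apply/seteqP; split => x /=; rewrite in_itv.
have mfs1 : measurable_fun setT (fun x => \1_[set x | 0 < s x] x * f (sg x) ^+ 2).
  by apply: measurable_funM => //; exact: measurable_funX.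
have e1 : ((massp f s)%:E = (massp (fun x => f (sg x)) s)%:E + \int[mu]_x (p x)%:E)%E.
  rewrite masspE// masspE// -integralD_ge0//; last by move=> x; rewrite mulr_ge0 ?sqr_ge0.
  apply: ae_eq_integral => //.
  - by apply/measurable_EFinP; apply: measurable_funM => //; exact: measurable_funX.
  - by apply/measurable_EFinP; exact: measurable_funD.
  - exists [set x | s x * (f x - f (sg x)) < 0]; split => //.
    move=> x /= /not_implyP[_ h]; apply: contrapT => nq; apply: h; congr EFin.
    rewrite /p -mulrDr indicE; have [/set_mem /= sx|_] := boolP (x \in _); last by rewrite !mul0r.
    have fx : f (sg x) <= f x.
      by rewrite -subr_ge0 leNgt; apply/negP => h; apply: nq; rewrite pmulr_rlt0.
    by congr (_ * _); rewrite ger0_norm ?subr_ge0 ?ler_sqr ?nnegrE// addrC subrK.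
have Ip : (\int[mu]_x (p x)%:E)%E = 0%E.
  apply/eqP; rewrite eq_le integral_EFin_ge0// andbT.
  have : ((massp (fun x => f (sg x)) s)%:E + \int[mu]_x (p x)%:E <= (massp (fun x => f (sg x)) s)%:E)%E.
    by rewrite -e1 lee_fin -(refl_mass lf).
  by rewrite -leeBrDl// -EFinB subrr.
have mN : measurable [set x | 0 < p x] by exact: superlevel_measurable.
have N0 : mu [set x | 0 < p x] = 0%E.
  apply: (measure_negligible mN); apply: negligibleS (integral_eq0_ae mp p0 Ip) => x /= px.
  by move=> e; move: px; rewrite e ltxx.
have S0 := preserves_null ps mN N0.
apply: (measure_negligible (superlevel_measurable 0 mq)).
apply: (@negligibleS _ _ _ mu ([set x | 0 < p x] `|` sg @^-1` [set x | 0 < p x])); last first.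
  apply: negligibleU; first exact: null_negligible mN N0.
  apply: null_negligible S0.
  by rewrite -[X in measurable X]setTI; apply: (proj1 ps).
have key x : 0 < s x -> 0 < s x * (f x - f (sg x)) -> 0 < p x.
  move=> sx; rewrite pmulr_rgt0// subr_gt0 => h.
  rewrite /p indicE mem_set//= mul1r normr_gt0 subr_eq0.
  by rewrite eqrXn2// gt_eqF.
move=> x /= qx; have [sx|sx|sx] := ltgtP 0 (s x); first by left; exact: key.
  right => /=; apply: key; first by rewrite sN oppr_gt0.
  by rewrite sN inv mulNr -mulrN opprB.
by move: qx; rewrite -sx mul0r ltxx.
Qed.

(** The comparison of masses settles the alternative left open by [minimizer_rigid]: its
    unfavourable case falls under [refl_null]. *)
Lemma minimizer_halfspace (c l : R) f D : 0 < c -> minimizer c l f D ->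
  massp f s <= massp f (fun x => - s x) ->
  mu [set x | 0 < s x * (f x - f (sg x))] = 0%E.
Proof.
move=> c0 fm hm; have [//|h] := minimizer_rigid rs c0 fm.
have [Hf _ _] := fm; have [f0 _ _] := Hf.
exact: refl_null (Hcl_L2 Hf) hm h.
Qed.

End Fixed.

Lemma minimizer_symmetric (sg : R * R -> R * R) (s : R * R -> R) (c l : R) f D :
  reflection sg s -> 0 < c -> minimizer c l f D ->
  massp f s = massp f (fun x => - s x) -> {ae mu, forall x, f (sg x) = f x}.
Proof.
move=> rs c0 fm hm; have rsN := reflectionN rs.
have h1 := minimizer_halfspace rs c0 fm (ltac:(by rewrite hm)).
have h2 : mu [set x | 0 < - s x * (f x - f (sg x))] = 0%E.
  apply: (minimizer_halfspace rsN c0 fm).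
  by rewrite -hm; have -> : (fun x => - - s x) = s by apply/funext => x; rewrite opprK.
have [Hf _ _] := fm; have mf := L2_meas (Hcl_L2 Hf).
have [ps inv ms sN dist] := rs.
have mq : measurable_fun setT (fun x => s x * (f x - f (sg x))).
  by apply: measurable_funM; [exact: ms|exact: measurable_funB mf (sg_measurable rs mf)].
have mqN : measurable_fun setT (fun x => - s x * (f x - f (sg x))).
  rewrite (_ : (fun x => _) = (fun x => - (s x * (f x - f (sg x))))); first exact: measurableT_comp.
  by apply/funext => x; rewrite mulNr.
apply: (@negligibleS _ _ _ mu ([set x | 0 < s x * (f x - f (sg x))] `|`
  [set x | 0 < - s x * (f x - f (sg x))])); last first.
  apply: negligibleU.
    exact: null_negligible (superlevel_measurable 0 mq) h1.
  exact: null_negligible (superlevel_measurable 0 mqN) h2.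
move=> x /= nf; have [q|q|q] := ltgtP 0 (s x * (f x - f (sg x))); [by left|by right; rewrite mulNr oppr_gt0|].
case: nf; move/esym/eqP: q; rewrite mulf_eq0 => /orP[/eqP s0|]; last by rewrite subr_eq0 => /eqP.
(* A point with s x = 0 is its own mirror image, since [dist] then gives |x - sg x| = |x - x|. *)
have := dist x x; rewrite s0 mul0r mulr0 addr0 => /eqP; rewrite eqrXn2 ?enorm_ge0// => /eqP e.
apply: contrapT => nf; have : x <> sg x by move=> e'; apply: nf; rewrite -e'.
by move=> /enorm_gt0; rewrite e subrr /enorm /= expr0n addr0 sqrtr0 ltxx.
Qed.

End Masses.

(** * Centering at the medians *)

Section Centering.
Context (R : realType).
Local Notation mu := (leb2 R).
Implicit Types (f g w : R * R -> R) (h x y e : R * R).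

Lemma minimizer_tau (c l : R) f D h : minimizer c l f D -> minimizer c l (tau h f) D.
Proof.
move=> [Hf fl fmin]; have mf := L2_meas (Hcl_L2 Hf).
split; [exact: Hcl_tau|by rewrite (tau_ip h mf mf)|].
move=> g D' Hg gl; rewrite /En /v1 /v2 (V_tau h (@kernel_k1 R) mf) (V_tau h (@kernel_k2 R) mf).
exact: fmin.
Qed.

Lemma massp_tau f (s : R * R -> R) h : measurable_fun setT s -> L2 mu f ->
  massp (tau h f) (fun x => s (x + h)) = massp f s.
Proof.
move=> ms lf; have mf := L2_meas lf.
have msh : measurable_fun setT (fun x => s (x + h)).
  exact: (measurableT_comp ms (measurable_shift2 h)).
apply: EFin_inj; rewrite (masspE msh (tau_L2 h lf)) (masspE ms lf).
have m : measurable_fun setT (fun x => \1_[set x | 0 < s x] x * f x ^+ 2).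
  by apply: measurable_funM; [exact: indic_pos_measurable|exact: measurable_funX].
by rewrite -(integral_shift h m).
Qed.

Lemma unit_vec1 : unit_vec ((1, 0) : R * R).
Proof. by rewrite /unit_vec /= expr1n expr0n addr0. Qed.

Lemma unit_vec2 : unit_vec ((0, 1) : R * R).
Proof. by rewrite /unit_vec /= expr1n expr0n add0r. Qed.

(** The mirrors in the two axes compose to the central reflection. *)
Lemma minimizer_even (c l : R) f D : 0 < c -> minimizer c l f D ->
  massp f (fun x => lin (1, 0) x - 0) = massp f (fun x => - (lin (1, 0) x - 0)) ->
  massp f (fun x => lin (0, 1) x - 0) = massp f (fun x => - (lin (0, 1) x - 0)) ->
  {ae mu, forall x, f (- x) = f x}.
Proof.
move=> c0 fm m1 m2.
have a1 := minimizer_symmetric (mirror_reflection 0 unit_vec1) c0 fm m1.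
have a2 := minimizer_symmetric (mirror_reflection 0 unit_vec2) c0 fm m2.
have a3 := preserves_ae (mirror_preserves 0 unit_vec2) a1.
apply: filterS2 a2 a3 => x h2 h3.
rewrite -h2 -h3; congr f; case: x {h2 h3} => a b.
by rewrite /mirror /lin /=; congr pair; rewrite /=; ring.
Qed.

(** Evenness moves the half-plane {lin e > t} to {lin e < -t}, which lies in {lin e < t} because t
    >= 0. *)
Lemma massp_even f e (t : R) : L2 mu f -> {ae mu, forall x, f (- x) = f x} -> 0 <= t ->
  massp f (fun x => lin e x - t) <= massp f (fun x => - (lin e x - t)).
Proof.
move=> lf ev t0; have mf := L2_meas lf.
have ms : measurable_fun setT (fun x => lin e x - t).
  by apply: measurable_funB; [exact: measurable_lin|exact: measurable_cst].
have msN : measurable_fun setT (fun x => - (lin e x - t)) by exact: measurableT_comp.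
have ms2 : measurable_fun setT (fun x => - lin e x - t).
  by apply: measurable_funB; [apply: measurableT_comp => //; exact: measurable_lin|exact: measurable_cst].
have mm (s : R * R -> R) : measurable_fun setT s ->
    measurable_fun setT (fun x => \1_[set x | 0 < s x] x * f x ^+ 2).
  by move=> ms'; apply: measurable_funM; [exact: indic_pos_measurable|exact: measurable_funX].
have -> : massp f (fun x => lin e x - t) = massp f (fun x => - lin e x - t).
  apply: EFin_inj; rewrite (masspE ms lf) (masspE ms2 lf).
  rewrite -(preserves_integral (@preserves_opp R) (mm _ ms)).
  have po := @preserves_opp R.
  apply: ae_eq_integral; [exact: measurableT| | |].
  - by apply/measurable_EFinP; exact: (preserves_measurable po (mm _ ms)).
  - by apply/measurable_EFinP; exact: mm.
  - apply: filterS ev => x fx _; congr EFin; rewrite fx; congr (_ * _).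
    rewrite !indicE; congr (_%:R); congr nat_of_bool.
    have lN : lin e (- x) = - lin e x by rewrite /lin /=; ring.
    by apply/idP/idP => /set_mem /= h; apply/mem_set; rewrite /= ?lN// -lN.
apply: massp_le => // x; move: (lin e x) => a; move: t0; clear; lra.
Qed.

(** Two medians provide equal masses for two mirrors only. Evenness then settles all the others: the
    half-plane beyond a mirror, seen from the origin, never has the larger mass. *)
Lemma centered_minimizer (c l : R) : 0 < c -> 0 < l ->
  exists f D B, [/\ minimizer c l f D, (forall x, f x <= B) &
    forall e (t : R), unit_vec e -> 0 <= t ->
      {ae mu, forall x, (lin e x - t) * (f x - f (mirror e t x)) <= 0}].
Proof.
move=> c0 l0; have [f0 [D [B [fm fB]]]] := bounded_minimizer c0 l0.
have [Hf fl _] := fm; have lf0 := Hcl_L2 Hf.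
have fp : 0 < ip mu f0 f0 by rewrite fl.
have [t1 h1] := median (@measurable_fst _ _ _ _) lf0 fp (@line1_null R).
have [t2 h2] := median (@measurable_snd _ _ _ _) lf0 fp (@line2_null R).
have fm' := minimizer_tau (t1, t2) fm.
have ms1 : measurable_fun setT (fun x : R * R => x.1 - t1).
  by apply: measurable_funB; [exact: measurable_fst|exact: measurable_cst].
have ms2 : measurable_fun setT (fun x : R * R => x.2 - t2).
  by apply: measurable_funB; [exact: measurable_snd|exact: measurable_cst].
have ms1N : measurable_fun setT (fun x : R * R => - (x.1 - t1)) by exact: measurableT_comp.
have ms2N : measurable_fun setT (fun x : R * R => - (x.2 - t2)) by exact: measurableT_comp.
exists (tau (t1, t2) f0), D, B; split; [exact: fm'|by move=> x; exact: fB|].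
have ev : {ae mu, forall x, tau (t1, t2) f0 (- x) = tau (t1, t2) f0 x}.
  apply: (minimizer_even c0 fm').
  - have e1 : (fun x => lin (1, 0) x - 0) = (fun x : R * R => (x + (t1, t2)).1 - t1).
      by apply/funext => x; rewrite /lin /=; ring.
    have e2 : (fun x => - (lin (1, 0) x - 0)) = (fun x : R * R => - ((x + (t1, t2)).1 - t1)).
      by apply/funext => x; rewrite /lin /=; ring.
    by rewrite e1 e2 (massp_tau _ ms1 lf0) (massp_tau _ ms1N lf0).
  - have e1 : (fun x => lin (0, 1) x - 0) = (fun x : R * R => (x + (t1, t2)).2 - t2).
      by apply/funext => x; rewrite /lin /=; ring.
    have e2 : (fun x => - (lin (0, 1) x - 0)) = (fun x : R * R => - ((x + (t1, t2)).2 - t2)).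
      by apply/funext => x; rewrite /lin /=; ring.
    by rewrite e1 e2 (massp_tau _ ms2 lf0) (massp_tau _ ms2N lf0).
move=> e t ue t0; have rs := mirror_reflection t ue.
have lf := tau_L2 (t1, t2) lf0; have mf := L2_meas lf.
have null := minimizer_halfspace rs c0 fm' (massp_even e lf ev t0).
have [_ _ ms _ _] := rs.
have mq : measurable_fun setT (fun x => (lin e x - t) *
    (tau (t1, t2) f0 x - tau (t1, t2) f0 (mirror e t x))).
  by apply: measurable_funM; [exact: ms|exact: measurable_funB mf (sg_measurable rs mf)].
apply: negligibleS (null_negligible (superlevel_measurable 0 mq) null) => x /= /negP.
by rewrite -ltNge.
Qed.

End Centering.

(** * Disc means and the radial profile *)

Section Averages.
Context (R : realType).
Local Notation mu := (leb2 R).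
Implicit Types (f g w : R * R -> R) (h x y z e : R * R) (t : R).

Definition dind t x y : R := \1_(disc t) (y - x).
(** The integral over the disc, not divided by the area [darea t]; monotonicity is insensitive to
    that factor. *)
Definition davg t f x := ip mu (dind t x) f.
Definition darea t := ip mu (dind t 0) (dind t 0).

Lemma dind_L2 t x : 0 <= t -> L2 mu (dind t x).
Proof. by move=> t0; exact: (preserves_L2 (preserves_shift (- x)) (L2_disc t0)). Qed.

Lemma dind_ge0 t x y : 0 <= dind t x y.
Proof. by case/andP: (indic_le1 (disc t) (y - x)). Qed.

Lemma dind_sqr t x y : dind t x y * dind t x y = dind t x y.
Proof. by rewrite /dind indicE; case: (_ \in _); rewrite ?mulr1 ?mulr0. Qed.

Lemma dindE t x y : dind t x y = if enorm (x - y) ^+ 2 < t ^+ 2 then 1 else 0.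
Proof.
rewrite /dind enormB enorm_sqr indicE; case: ifP => h; first by rewrite mem_set.
by rewrite memNset// /disc /= h.
Qed.

Lemma darea_shift t x : 0 <= t -> ip mu (dind t x) (dind t x) = darea t.
Proof.
move=> t0; have m := L2_meas (dind_L2 0 t0).
rewrite /darea -(preserves_ip (preserves_shift (- x)) m m).
by rewrite /ip; congr fine; apply: eq_integral => y _; rewrite /dind !subr0.
Qed.

(** If the area vanished, Cauchy-Schwarz would annihilate the second moment [disc_mom t]. *)
Lemma darea_gt0 t : 0 < t -> 0 < darea t.
Proof.
move=> t0; have m := disc_mom_gt0 t0.
rewrite lt0r ip_ge0 andbT; apply/eqP => a0.
have := ip_CS (disc_bounded_L2 (ltW t0) (disc_bounded_monom 2 0 (ltW t0))) (L2_disc (ltW t0)).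
rewrite -/(disc_int t _) -/(disc_mom t).
have -> : ip mu \1_(disc t) \1_(disc t) = darea t.
  by rewrite /darea /ip; congr fine; apply: eq_integral => y _; rewrite /dind subr0.
rewrite a0 mulr0 => h; have := lt_le_trans (exprn_gt0 2 m) h; by rewrite ltxx.
Qed.

Lemma davgE t f x : 0 <= t -> L2 mu f ->
  ((davg t f x)%:E = \int[mu]_y (dind t x y * f y)%:E)%E.
Proof. by move=> t0 lf; rewrite ipE//; exact: dind_L2. Qed.

Lemma measurable_dind2 t : measurable_fun setT (fun z : (R * R) * (R * R) => dind t z.1 z.2).
Proof.
have -> : (fun z : (R * R) * (R * R) => dind t z.1 z.2) =
    (fun z : (R * R) * (R * R) => kd t (enorm (z.1 - z.2))).
  by apply/funext => z; rewrite dindE.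
by apply: measurable_ker; case: (kernel_kd t).
Qed.

Lemma davg_measurable t f : 0 <= t -> L2 mu f -> (forall x, 0 <= f x) ->
  measurable_fun setT (davg t f).
Proof.
move=> t0 lf f0; apply/measurable_EFinP.
rewrite (_ : EFin \o _ = (fun x => \int[mu]_y (dind t x y * f y)%:E)%E); last first.
  by apply/funext => x /=; rewrite davgE.
apply: (measurable_fun_fubini_tonelli_F (m2 := mu)
  (fun z : (R * R) * (R * R) => (dind t z.1 z.2 * f z.2)%:E)).
  apply/measurable_EFinP; apply: measurable_funM; first exact: measurable_dind2.
  by apply: (measurableT_comp (L2_meas lf)); exact: measurable_snd.
by move=> z; rewrite lee_fin mulr_ge0 ?dind_ge0.
Qed.

Lemma davg_bounds t f x (B : R) : 0 <= t -> L2 mu f -> (forall x, 0 <= f x) ->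
  (forall x, f x <= B) -> 0 <= davg t f x <= B * darea t.
Proof.
move=> t0 lf f0 fB; have ld := dind_L2 x t0; have B0 : 0 <= B by exact: le_trans (f0 0) (fB 0).
apply/andP; split; rewrite -lee_fin davgE//.
  by apply: integral_EFin_ge0 => y; rewrite mulr_ge0 ?dind_ge0.
rewrite EFinM -(darea_shift x t0) ipE// -integralZ_ge0//; last 2 first.
- by apply: measurable_funM; exact: L2_meas ld.
- by move=> y; rewrite mulr_ge0 ?dind_ge0.
apply: le_integral_EFin.
- by apply: measurable_funM; [exact: L2_meas ld|exact: L2_meas lf].
- by apply: measurable_funM; [exact: measurable_cst|apply: measurable_funM; exact: L2_meas ld].
- by move=> y; rewrite mulr_ge0 ?dind_ge0.
- by move=> y; rewrite dind_sqr mulrC; apply: ler_wpM2r; [exact: dind_ge0|exact: fB].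
Qed.

(* The pointwise error of the mean over a disc is a mean of differences, so by
   Cauchy-Schwarz its square integrates to a mean of [dq f]. *)
Lemma davg_error t f (D : R) : 0 < t -> (forall x, 0 <= f x) -> wbound f D ->
  L2 mu (fun x => davg t f x / darea t) /\
  ip mu (fun x => davg t f x / darea t - f x) (fun x => davg t f x / darea t - f x) <= D * t ^+ 2.
Proof.
move=> t0 f0 fD; have lf := wbound_L2 fD; have mf := L2_meas lf; have c0 := darea_gt0 t0.
have t0' := ltW t0; have D0 := wbound_ge0 fD.
have mA : measurable_fun setT (fun x => davg t f x / darea t).
  by apply: measurable_funM; [exact: davg_measurable|exact: measurable_cst].
have mAf : measurable_fun setT (fun x => davg t f x / darea t - f x) by exact: measurable_funB.
have pw x : (((davg t f x / darea t - f x) ^+ 2)%:E <=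
    ((darea t)^-1)%:E * \int[mu]_y (\1_(disc t) (y - x) * (f y - f x) ^+ 2)%:E)%E.
  have ld := dind_L2 x t0'; have md := L2_meas ld.
  have lid : L2 mu (fun y => dind t x y * f y).
    apply: (L2_le _ _ lf); first exact: measurable_funM.
    move=> y; rewrite normrM; apply: ler_piMl => //.
    by rewrite ger0_norm ?dind_ge0//; case/andP: (indic_le1 (disc t) (y - x)).
  have lw : L2 mu (fun y => dind t x y * f y + - f x * dind t x y) by exact: L2D lid (L2Z _ ld).
  have e1 : ip mu (dind t x) (fun y => dind t x y * f y + - f x * dind t x y) =
      davg t f x - f x * darea t.
    rewrite (ipDr lid (L2Z _ ld) ld) (ipZr _ ld ld) (darea_shift x t0') mulNr; congr (_ - _).
    by rewrite /davg /ip; congr fine; apply: eq_integral => y _; rewrite mulrA dind_sqr.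
  have := ip_CS ld lw; rewrite e1 (darea_shift x t0') => h.
  have e2 : davg t f x / darea t - f x = (davg t f x - f x * darea t) / darea t.
    by rewrite mulrBl mulfK// gt_eqF.
  have e3 : (\int[mu]_y (\1_(disc t) (y - x) * (f y - f x) ^+ 2)%:E =
     (ip mu (fun y => dind t x y * f y + - f x * dind t x y)
            (fun y => dind t x y * f y + - f x * dind t x y))%:E)%E.
    rewrite (ip_sqr lw); apply: eq_integral => y _; congr EFin.
    rewrite -/(dind t x y) -[in LHS]dind_sqr; ring.
  rewrite e3 -EFinM lee_fin e2 expr_div_n ler_pdivrMr ?exprn_gt0//.
  apply: (le_trans h); rewrite le_eqVlt; apply/orP; left; apply/eqP.
  move: (ip mu _ _) => q; by field; rewrite gt_eqF.
have bound : (\int[mu]_x ((davg t f x / darea t - f x) ^+ 2)%:E <= (D * t ^+ 2)%:E)%E.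
  have mG : measurable_fun setT (fun z : (R * R) * (R * R) => (\1_(disc t) (z.2 - z.1) * (f z.2 - f z.1) ^+ 2)%:E).
    apply/measurable_EFinP; apply: measurable_funM; first exact: measurable_dind2.
    by apply: measurable_funX; apply: measurable_funB; apply: (measurableT_comp mf); [exact: measurable_snd|exact: measurable_fst].
  have G0 (z : (R * R) * (R * R)) : (0 <= (\1_(disc t) (z.2 - z.1) * (f z.2 - f z.1) ^+ 2)%:E)%E.
    by rewrite lee_fin mulr_ge0 ?sqr_ge0.
  have mI := measurable_fun_fubini_tonelli_F (m2 := mu) _ mG G0.
  apply: (@le_trans _ _ (((darea t)^-1)%:E * \int[mu]_x \int[mu]_y (\1_(disc t) (y - x) * (f y - f x) ^+ 2)%:E)%E).
    rewrite -ge0_integralZl_EFin//; last 2 first.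
    - by move=> x _; apply: integral_ge0 => y _; exact: (G0 (x, y)).
    - by rewrite invr_ge0 ltW.
    apply: ge0_le_integral => //.
    - by move=> x _; rewrite lee_fin sqr_ge0.
    - by apply/measurable_EFinP; exact: measurable_funX.
    - by apply: emeasurable_funM => //; exact: measurable_cst.
  rewrite (integral_dq_indic (disc_measurable t) lf) -(disc_intE t0' (dq_bounded t lf)) -EFinM lee_fin.
  rewrite mulrC ler_pdivrMr//; case: fD => g1 [g2 [wg hg]].
  apply: (le_trans (weakg_dq t0' wg)).
  apply: (@le_trans _ _ (D * disc_mom t)); first by rewrite ler_pM2r ?disc_mom_gt0.
  rewrite -mulrA; apply: ler_wpM2l => //.
  have -> : t ^+ 2 * darea t = disc_int t (fun=> t ^+ 2).
    rewrite /disc_int (_ : (fun h => _) = (fun h => t ^+ 2 * \1_(disc t) h)); last first.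
      by apply/funext => h; rewrite mulrC.
    rewrite (ipZl _ (L2_disc t0') (L2_disc t0')); congr (_ * _).
    by rewrite /darea /ip; congr fine; apply: eq_integral => y _; rewrite /dind subr0.
  apply: disc_int_le => //; [exact: disc_bounded_monom|exact: disc_bounded_cst|] => h.
  rewrite /disc /= expr0 mulr1 => /ltW/(le_trans _); apply.
  by rewrite lerDl sqr_ge0.
have lAf : L2 mu (fun x => davg t f x / darea t - f x).
  by split => //; apply: le_lt_trans bound (ltry _).
split; last by rewrite -lee_fin ip_sqr.
by have := L2D lAf lf; congr L2; apply/funext => x; rewrite subrK.
Qed.

Definition radial_decr f := forall e t, unit_vec e -> 0 <= t ->
  {ae mu, forall x, (lin e x - t) * (f x - f (mirror e t x)) <= 0}.

(** The mirror that exchanges [x] and [z] has offset [a] >= 0 because |z| <= |x|, so [radial_decr]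
    covers it. Adding to each integrand its mirror image makes the comparison pointwise. The
    conclusion holds for every pair, although the hypothesis is almost everywhere for each
    mirror. *)
Lemma davg_decr t f x z : 0 < t -> L2 mu f -> (forall x, 0 <= f x) -> radial_decr f ->
  enorm z <= enorm x -> davg t f x <= davg t f z.
Proof.
move=> t0 lf f0 rf zx; have t0' := ltW t0; have mf := L2_meas lf.
have [->//|xz] := pselect (x = z).
have n0 := enorm_gt0 xz; set n := enorm (x - z) in n0.
pose e : R * R := ((x.1 - z.1) / n, (x.2 - z.2) / n).
pose a := lin e (2^-1 * (x.1 + z.1), 2^-1 * (x.2 + z.2)).
have n2 : (x.1 - z.1) ^+ 2 + (x.2 - z.2) ^+ 2 = n ^+ 2 by rewrite enorm_sqr.
have ue : unit_vec e.
  rewrite /unit_vec /= !exprMn -mulrDl n2 exprVn mulfV// expf_neq0// gt_eqF//.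
have a0 : 0 <= a.
  have -> : a = (enorm x ^+ 2 - enorm z ^+ 2) / (2 * n).
    by rewrite !enorm_sqr /a /lin /=; field; rewrite gt_eqF.
  by rewrite divr_ge0 ?mulr_ge0 ?(ltW n0)// subr_ge0 ler_sqr ?nnegrE ?enorm_ge0.
have lx : lin e x - a = n / 2.
  have -> : lin e x - a = ((x.1 - z.1) ^+ 2 + (x.2 - z.2) ^+ 2) / (2 * n).
    by rewrite /a /lin /=; field; rewrite gt_eqF.
  by rewrite n2; field; rewrite gt_eqF.
have sx : mirror e a x = z.
  rewrite /mirror lx /e /= [RHS]surjective_pairing.
  by congr pair; field; rewrite gt_eqF.
have [ps inv _ _ dist] := mirror_reflection a ue.
have re := refl_enormC (mirror_reflection a ue).
have dz y : dind t z y = dind t x (mirror e a y).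
  by rewrite !dindE -sx re.
have dx y : dind t z (mirror e a y) = dind t x y by rewrite dz inv.
have ldx := dind_L2 x t0'; have ldz := dind_L2 z t0'.
have m1 : measurable_fun setT (fun y => dind t x y * f y).
  by apply: measurable_funM; [exact: L2_meas ldx|exact: mf].
have m2 : measurable_fun setT (fun y => dind t z y * f y).
  by apply: measurable_funM; [exact: L2_meas ldz|exact: mf].
have m3 := preserves_measurable ps m1; have m4 := preserves_measurable ps m2.
have g0 (y p : R * R) : 0 <= dind t p y * f y by rewrite mulr_ge0 ?dind_ge0.
suff : ((2 * davg t f x)%:E <= (2 * davg t f z)%:E)%E by rewrite lee_fin ler_pM2l.
have dbl p : 0 <= t -> measurable_fun setT (fun y => dind t p y * f y) ->
    ((2 * davg t f p)%:E = \int[mu]_y (dind t p y * f y + dind t p (mirror e a y) * f (mirror e a y))%:E)%E.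
  move=> _ mp; rewrite integralD_ge0//; [|exact: (preserves_measurable ps mp)].
  by rewrite (preserves_integral ps mp) -davgE// -EFinD; congr EFin; ring.
rewrite (dbl x t0' m1) (dbl z t0' m2).
apply: ae_ge0_le_integral => //.
- by move=> y _; rewrite lee_fin addr_ge0.
- by apply/measurable_EFinP; exact: measurable_funD.
- by move=> y _; rewrite lee_fin addr_ge0.
- by apply/measurable_EFinP; exact: measurable_funD.
apply: filterS (rf e a ue a0) => y hy _; rewrite lee_fin dx -dz.
have dd := dist y x; rewrite sx (enormB y z) (enormB y x) in dd.
move: hy; rewrite !dindE dd lx.
move: (f y) (f (mirror e a y)) (lin e y - a) (enorm (x - y) ^+ 2) => u v p q hy.
have np : 0 < n / 2 by rewrite divr_gt0.
have [p0|p0|p0] := ltgtP 0 p.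
(* On the side of [x] the reflected value is the larger one, and if the disc about [z] contains the
   point then so does the disc about [x]. *)
- have uv : u <= v by rewrite -subr_le0 -(pmulr_rle0 _ p0).
  have q0 : q <= q + 4 * (p * (n / 2)) by rewrite lerDl mulr_ge0// mulr_ge0 ?ltW.
  case: ifP => h1; case: ifP => h2; rewrite ?mul1r ?mul0r ?addr0 ?add0r//.
  by move: h1; rewrite (le_lt_trans q0 h2).
- have uv : v <= u by rewrite -subr_ge0 -(nmulr_rle0 _ p0).
  have q0 : q + 4 * (p * (n / 2)) <= q.
    by rewrite gerDl mulr_ge0_le0// mulr_le0_ge0 ?ltW.
  case: ifP => h1; case: ifP => h2; rewrite ?mul1r ?mul0r ?addr0 ?add0r//.
  by move: h2; rewrite (le_lt_trans q0 h1).
- by rewrite -p0 mul0r mulr0 addr0; case: ifP => _; rewrite ?mul1r ?mul0r ?addr0.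
Qed.

(** The disc means are monotone in |x| at every point, hence functions of |x| alone, and they
    converge to [f] almost everywhere. An ultrafilter limit along the first axis defines [F] at
    every radius, even one where the means might fail to converge; the bound [B] keeps it finite. *)
Lemma radial_profile f (D B : R) : wbound f D -> (forall x, 0 <= f x) ->
  (forall x, f x <= B) -> radial_decr f ->
  exists F : R -> R, [/\ (forall r s, 0 <= r -> r <= s -> F s <= F r),
    (forall r, 0 <= F r) & {ae mu, forall x, f x = F (enorm x)}].
Proof.
move=> fD f0 fB rf; have lf := wbound_L2 fD; have D0 := wbound_ge0 fD.
have B0 : 0 <= B by exact: le_trans (f0 0) (fB 0).
have D1 : 0 < 4 * (D + 1) by rewrite mulr_gt0// ltr_wpDl.
have e80 n : 0 < (8^-1 : R) ^+ n by rewrite exprn_gt0// invr_gt0.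
(* Chosen so that D ep^2 <= 8^-n / 4, which makes consecutive means differ by at most 8^-n in
   squared norm, the rate of [L2_complete]. *)
pose ep n := Num.sqrt (8^-1 ^+ n / (4 * (D + 1))).
have ep0 n : 0 < ep n by rewrite sqrtr_gt0 divr_gt0.
have ep2 n : 4 * (D * ep n ^+ 2) <= 8^-1 ^+ n.
  rewrite sqr_sqrtr ?divr_ge0 ?(ltW D1) ?(ltW (e80 n))//.
  rewrite (_ : 4 * _ = (4 * D) / (4 * (D + 1)) * 8^-1 ^+ n); last by ring.
  apply: ler_piMl; first exact: ltW.
  by rewrite ler_pdivrMr// mul1r ler_pM2l// lerDl.
pose A n x := davg (ep n) f x / darea (ep n).
have lA n : L2 mu (A n) by have [] := davg_error (ep0 n) f0 fD.
have eA n : ip mu (fun x => A n x - f x) (fun x => A n x - f x) <= 8^-1 ^+ n / 4.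
  have [_ h] := davg_error (ep0 n) f0 fD; apply: (le_trans h).
  by rewrite ler_pdivlMr// mulrC.
have cA n : ip mu (fun x => A n.+1 x - A n x) (fun x => A n.+1 x - A n x) <= 8^-1 ^+ n.
  have l1 := L2B (lA n.+1) lf; have l2 := L2N (L2B (lA n) lf).
  have := ipD_sqr_le l1 l2.
  have -> : ip mu (fun x => - (A n x - f x)) (fun x => - (A n x - f x)) =
    ip mu (fun x => A n x - f x) (fun x => A n x - f x).
    by rewrite /ip; congr fine; apply: eq_integral => x _; rewrite mulrNN.
  have -> : ip mu (fun x => A n.+1 x - f x - (A n x - f x)) (fun x => A n.+1 x - f x - (A n x - f x)) =
    ip mu (fun x => A n.+1 x - A n x) (fun x => A n.+1 x - A n x).
    by rewrite /ip; congr fine; apply: eq_integral => x _; congr EFin; congr (_ * _); ring.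
  move=> h; apply: (le_trans h).
  have := eA n; have := eA n.+1; have := e80 n; rewrite exprS.
  move: (ip mu _ _) (ip mu _ _) (8^-1 ^+ n : R) => p q r; clear; lra.
have [S [g [[mS aeS] lg cg eg]]] := L2_complete lA cA.
have fg : ip mu (fun x => f x - g x) (fun x => f x - g x) = 0.
  apply/eqP; rewrite eq_le ip_ge0 andbT.
  (* The two errors give 2 (8^-n / 4) + 2 (8 * 4^-n), at most 17 * 2^-n. *)
  apply: (@le_half_expr _ _ _ 17) => n; rewrite add0r.
  have l1 := L2N (L2B (lA n) lf); have l2 := L2B (lA n) lg.
  have := ipD_sqr_le l1 l2.
  have -> : ip mu (fun x => - (A n x - f x)) (fun x => - (A n x - f x)) =
    ip mu (fun x => A n x - f x) (fun x => A n x - f x).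
    by rewrite /ip; congr fine; apply: eq_integral => x _; rewrite mulrNN.
  have -> : ip mu (fun x => - (A n x - f x) + (A n x - g x)) (fun x => - (A n x - f x) + (A n x - g x)) =
    ip mu (fun x => f x - g x) (fun x => f x - g x).
    by rewrite /ip; congr fine; apply: eq_integral => x _; congr EFin; congr (_ * _); ring.
  move=> h; apply: (le_trans h).
  have r4 : (4^-1 : R) ^+ n <= 2^-1 ^+ n.
    by apply: lerXn2r; rewrite ?nnegrE ?invr_ge0// lef_pV2 ?posrE// ler_nat.
  have r8 : (8^-1 : R) ^+ n <= 2^-1 ^+ n.
    by apply: lerXn2r; rewrite ?nnegrE ?invr_ge0// lef_pV2 ?posrE// ler_nat.
  have := eA n; have := eg n; have := half_expr_ge0 R n; move: r4 r8.
  move: (ip mu _ _) (ip mu _ _) (8^-1 ^+ n : R) (4^-1 ^+ n : R) (2^-1 ^+ n : R) => p q r s u; clear; lra.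
have lfg := L2B lf lg.
have aefg : {ae mu, forall x, f x = g x}.
  have := @integral_eq0_ae _ _ _ mu (fun x => (f x - g x) ^+ 2) (measurable_funX 2 (L2_meas lfg)).
  move=> /(_ (fun x => sqr_ge0 _)); rewrite -(ip_sqr lfg) fg => /(_ erefl).
  apply: filterS => x /eqP.
  by rewrite sqrf_eq0 subr_eq0 => /eqP.
have aeA : {ae mu, forall x, A n x @[n --> \oo] --> f x}.
  apply: filterS2 aeS aefg => x Sx ->; have := cg x.
  rewrite (_ : (fun n => A n x * \1_S x) = (fun n => A n x))//.
  by apply/funext => n; rewrite indicE mem_set// mulr1.
have Ar n (x z : R * R) : enorm z <= enorm x -> A n x <= A n z.
  by move=> zx; rewrite ler_pM2r ?invr_gt0 ?darea_gt0//; exact: davg_decr.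
have Ab n x : 0 <= A n x <= B.
  have /andP[h1 h2] := davg_bounds x (ltW (ep0 n)) lf f0 fB; have c0 := darea_gt0 (ep0 n).
  by rewrite divr_ge0 ?(ltW c0)// ler_pdivrMr.
have [U [uU ooU]] := ultraFilterLemma (@eventually_filter).
have pU : ProperFilter U by case: uU.
have lim (r : R) : exists b : R, forall d : R, 0 < d -> U [set n | `|A n (r, 0) - b| <= d].
  apply: (ultra_cvg_bounded (B := B) uU) => n.
  by have /andP[h1 h2] := Ab n (r, 0); rewrite ger0_norm.
have [F hF] := choice lim.
have enr (r : R) : 0 <= r -> enorm (r, 0) = r.
  by move=> r0; rewrite /enorm /= expr0n addr0 sqrtr_sqr ger0_norm.
exists F; split.
- move=> r s r0 rs; apply/ler_addgt0Pr => e e0.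
  have e20 : 0 < e / 2 by rewrite divr_gt0.
  have [n [n1 n2]] := filter_ex (filterI (hF r _ e20) (hF s _ e20)).
  have := Ar n (s, 0) (r, 0); rewrite !enr//; last exact: le_trans r0 rs.
  move=> /(_ rs); move: n1 n2; rewrite /= !ler_norml => /andP[p1 p2] /andP[p3 p4].
  move: p1 p2 p3 p4; move: (A n (s, 0)) (A n (r, 0)) (F r) (F s) => p q u v; clear; lra.
- move=> r; rewrite -[F r]addr0; apply/ler_addgt0Pr => e e0.
  have [n n1] := filter_ex (hF r _ e0).
  have /andP[h1 _] := Ab n (r, 0).
  move: n1 h1; rewrite /= ler_norml => /andP[p1 p2]; move: p1 p2.
  by move: (A n (r, 0)) (F r) => p q; clear; lra.
- apply: filterS aeA => x cx.
  have Ax n : A n x = A n (enorm x, 0).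
    by apply/eqP; rewrite eq_le !Ar// enr// enorm_ge0.
  apply/eqP; rewrite -subr_eq0 -normr_eq0 eq_le normr_ge0 andbT.
  apply/ler_addgt0Pr => e e0; rewrite add0r; have e20 : 0 < e / 2 by rewrite divr_gt0.
  have h1 : U [set n | `|f x - A n x| <= e / 2].
    by apply: ooU; move/cvgrPdist_le : cx => /(_ _ e20).
  have [n [n1 n2]] := filter_ex (filterI h1 (hF (enorm x) _ e20)).
  rewrite (_ : f x - F (enorm x) = (f x - A n x) + (A n x - F (enorm x))); last by ring.
  apply: (le_trans (ler_normD _ _)); rewrite (splitr e); apply: lerD => //.
  by rewrite Ax.
Qed.

End Averages.

(** * Null-set changes and return to the complex energy *)

Section Conclusion.
Context (R : realType).
Local Notation mu := (leb2 R).
Implicit Types (f g w : R * R -> R) (h x y z : R * R) (k : R -> R).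

Lemma integral_ae f g : measurable_fun setT f -> measurable_fun setT g ->
  {ae mu, forall x, f x = g x} -> (\int[mu]_x (f x)%:E = \int[mu]_x (g x)%:E)%E.
Proof.
move=> mf mg fg; apply: ae_eq_integral; [exact: measurableT| | |].
- exact/measurable_EFinP.
- exact/measurable_EFinP.
- by apply: filterS fg => x -> _.
Qed.

Section Transfer.
Variables f g : R * R -> R.
Hypothesis mg : measurable_fun setT g.
Hypothesis fg : {ae mu, forall x, f x = g x}.

Lemma ae_L2 : L2 mu f -> L2 mu g.
Proof.
move=> [mf fo]; split => //; rewrite -(@integral_ae (fun x => f x ^+ 2) (fun x => g x ^+ 2))//.
- exact: measurable_funX.
- exact: measurable_funX.
- by apply: filterS fg => x ->.
Qed.

Lemma ae_ip w : L2 mu f -> L2 mu w -> ip mu f w = ip mu g w.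
Proof.
move=> [mf _] [mw _]; rewrite /ip; congr fine; apply: integral_ae.
- exact: measurable_funM.
- exact: measurable_funM.
- by apply: filterS fg => x ->.
Qed.

Lemma ae_W k x : kernel k -> L2 mu f -> W k f x = W k g x.
Proof.
move=> [mk _] [mf _]; apply: integral_ae.
- by apply: measurable_funM; [exact: measurable_kerx|exact: measurable_funX].
- by apply: measurable_funM; [exact: measurable_kerx|exact: measurable_funX].
- by apply: filterS fg => y ->.
Qed.

Lemma ae_V k : kernel k -> L2 mu f -> V k f = V k g.
Proof.
move=> kk lf; have mf := L2_meas lf; rewrite (VE kk mf) (VE kk mg).
apply: ae_eq_integral; [exact: measurableT|exact: fW_measurable|exact: fW_measurable|].
by apply: filterS fg => x -> _; rewrite (ae_W x kk lf).
Qed.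

Lemma ae_Lw : L2 mu f -> Lw f = Lw g.
Proof.
move=> lf; apply: integral_ae.
- exact: Lw_measurable (L2_meas lf).
- exact: Lw_measurable.
- by apply: filterS fg => x ->.
Qed.

Lemma ae_minimizer (c l D : R) : (forall x, 0 <= g x) -> minimizer c l f D ->
  minimizer c l g D.
Proof.
move=> g0 [Hf fl fmin]; have lf := Hcl_L2 Hf; have lg := ae_L2 lf.
have [_ [g1 [g2 [[_ l1 l2 wf] hD]]] Lf] := Hf.
split.
- split => //; last by rewrite -(ae_Lw lf).
  exists g1, g2; split => //; split => // p tp; have [e1 e2] := wf p tp.
  rewrite -(ae_ip lf (test_fun_L2 (test_fun_D1 tp))) -(ae_ip lf (test_fun_L2 (test_fun_D2 tp))).
  by rewrite e1 e2.
- by rewrite -fl (ae_ip lf lf) ipC [RHS]ipC -(ae_ip lf lg) [RHS]ipC.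
- move=> w D' Hw wl; rewrite /En /v1 /v2 -(ae_V (@kernel_k1 R) lf) -(ae_V (@kernel_k2 R) lf).
  exact: fmin.
Qed.

End Transfer.

Lemma energy_En (gamma : R) (u g1 g2 : R * R -> R[i]) : X_grad u g1 g2 ->
  energy gamma u g1 g2 = (En (gamma / (4 * pi)) (cnorm u) (fine (Dir g1 g2)))%:E.
Proof.
move=> ug; have Hu := X_grad_Hcl ug; rewrite /energy -/(Dir g1 g2).
have -> : (\int[mu]_x \int[mu]_y (ln (enorm (x - y)) * cabs2 (u x) * cabs2 (u y))%:E =
    (v1 (cnorm u) - v2 (cnorm u))%:E)%E.
  rewrite -(Hcl_logV Hu); apply: eq_integral => x _; apply: eq_integral => y _.
  by rewrite !cnorm_sqr.
by rewrite (X_grad_Dir ug) /= -EFinM -EFinD.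
Qed.

Lemma Nmass_cnorm (u g1 g2 : R * R -> R[i]) : X_grad u g1 g2 ->
  Nmass u = (ip mu (cnorm u) (cnorm u))%:E.
Proof.
move=> ug; rewrite ip_sqr; last exact: Hcl_L2 (X_grad_Hcl ug).
by apply: eq_integral => x _; rewrite cnorm_sqr.
Qed.

Lemma cnorm_cplx f : (forall x, 0 <= f x) -> cnorm (cplx f) = f.
Proof.
move=> f0; apply/funext => x; rewrite /cnorm /cabs2 /= expr0n addr0.
by rewrite sqrtr_sqr ger0_norm.
Qed.

Lemma e0_En (gamma l : R) f D : minimizer (gamma / (4 * pi)) l f D ->
  ((En (gamma / (4 * pi)) f D)%:E <= e0 gamma l)%E.
Proof.
move=> [_ _ fmin]; apply: le_ereal_inf_tmp => _ [u [g1 [g2 [ug ul ->]]]].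
rewrite (energy_En _ ug) lee_fin; apply: fmin; first exact: X_grad_Hcl.
by apply: EFin_inj; rewrite -(Nmass_cnorm ug).
Qed.

End Conclusion.

Theorem theorem3p1 (R : realType) (gamma : R) (hgamma : 0 < gamma)
  (lambda : R) (hlambda : 0 < lambda) :
  exists u : R * R -> R[i],
    sym_decreasing u /\ in_X u /\ Nmass u = lambda%:E /\
    (forall g1 g2, X_grad u g1 g2 -> energy gamma u g1 g2 = e0 gamma lambda).
Proof.
have c0 : 0 < gamma / (4 * pi) by rewrite divr_gt0// mulr_gt0// pi_gt0.
have [f0 [D [B [fm fB rf]]]] := centered_minimizer c0 hlambda.
have [[p0 wf _] _ _] := fm.
have [F [Fd F0 aeF]] := radial_profile wf p0 fB rf.
pose f (x : R * R) := F (enorm x).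
have mf : measurable_fun setT f.
  (* A monotone function is measurable; the argument is cut at 0 because [F] is known to be monotone
     on nonnegative radii only. *)
  have mG : measurable_fun setT (fun r : R => F (Num.max r 0)).
    apply: nonincreasing_measurable => // r s rs; apply: Fd; first by rewrite le_max lexx orbT.
    by rewrite ge_max !le_max rs lexx orbT.
  rewrite (_ : f = (fun r : R => F (Num.max r 0)) \o @enorm R).
    exact: measurableT_comp mG (@measurable_enorm R).
  by apply/funext => x /=; rewrite max_l// enorm_ge0.
have fpos (x : R * R) : 0 <= f x by exact: F0.
have fmin := ae_minimizer mf aeF fpos fm.
have [Hf fl _] := fmin; have [_ [G1 [G2 [wG hD]]] Lf] := Hf.
have [uX uD] := Hcl_X_grad wG Lf.
have Nl : Nmass (cplx f) = lambda%:E by rewrite (Nmass_cnorm uX) (cnorm_cplx fpos) fl.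
exists (cplx f); split; first by exists F.
split; first by exists (cplx G1), (cplx G2).
split => // g1 g2 ug; apply/eqP; rewrite eq_le; apply/andP; split; last first.
  by apply: ereal_inf_lbound; exists (cplx f), g1, g2.
(* The energy is computed with an arbitrary weak gradient, whose norm [X_grad_Dir_le] bounds by that
   of (G1, G2), hence by [D]. *)
apply: le_trans (e0_En fmin); rewrite (energy_En _ ug) (cnorm_cplx fpos) lee_fin.
rewrite /En lerD2r -lee_fin fineK; last by rewrite (X_grad_Dir ug).
by apply: (le_trans (X_grad_Dir_le ug wG)); rewrite lee_fin.
Qed.
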